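(* Let $N_1,N_2$ be compact, oriented, simply-connected topological $4$-manifolds with boundary $S^3$, let $x_i\in H_2(N_i,\partial N_i)$ ($i=1,2$) be nonzero classes both of divisibility $d$, and let $K_1,K_2$ be knots with $K_i\subset S^3=\partial N_i$. Suppose that $H_1(\Sigma_d(K_1\#K_2);\mathbb{Z})=0$. Then $$g^{\mathrm{simple}}_{x_1\oplus x_2,\,N_1\natural N_2}(K_1\#K_2)\;\leq\; g^{\mathrm{simple}}_{x_1,N_1}(K_1)+g^{\mathrm{simple}}_{x_2,N_2}(K_2).$$
   Context: All embeddings are locally flat. $N_1\natural N_2$ is the boundary connected sum (again simply connected with boundary $S^3$), $K_1\#K_2$ the connected sum of knots, and $x_1\oplus x_2\in H_2(N_1,\partial N_1)\oplus H_2(N_2,\partial N_2)\cong H_2(N_1\natural N_2,\partial(N_1\natural N_2))$. The divisibility of a nonzero class $x$ is the largest positive integer $d$ with $x=dy$. $\Sigma_d(K)$ is the $d$-fold cyclic cover of $S^3$ branched along $K$. For a compact, oriented, simply-connected $4$-manifold $N$ with boundary $S^3$, a class $x\in H_2(N,\partial N)$ and a knot $K\subset\partial N$, the simple $(x,N)$-genus is $$g^{\mathrm{simple}}_{x,N}(K):=\min\{g\geq 0 : K\text{ bounds a simple surface of genus } g\text{ in }N\text{ representing }x\},$$ where a simple surface is a compact, connected, oriented, properly and locally flatly embedded surface whose complement has abelian fundamental group. *)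

(* Defs.v *)
From HB Require Import structures.
From mathcomp Require Import all_boot all_order all_algebra.
From mathcomp Require Import generic_quotient ring_quotient complex freeg.
From mathcomp Require Import all_classical all_reals topology ereal normedtype.
Import Order.TTheory GRing.Theory Num.Theory numFieldNormedType.Exports.

Set Implicit Arguments.
Unset Strict Implicit.
Unset Printing Implicit Defensive.

Local Open Scope classical_set_scope.
Local Open Scope ring_scope.
Local Open Scope quotient_scope.

Section SingularHomology.
Variable R : realType.

Definition std_simplex (n : nat) : set 'rV[R]_n.+1 :=
  [set v | (forall i, 0 <= v 0 i) /\ \sum_i v 0 i = 1].
Arguments std_simplex n : clear implicits.

(* The i-th coface map inserts a zero coordinate at position i. *)
Definition coface_row n (i : 'I_n.+2) (v : 'rV[R]_n.+1) : 'rV[R]_n.+2 :=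
  \row_j (if unlift i j is Some k then v 0 k else 0).

Lemma coface_subproof n (i : 'I_n.+2) (v : std_simplex n) :
  coface_row i (\val v) \in std_simplex n.+1.
Proof.
case: v => v /= /set_mem [v0 v1]; apply/mem_set; split.
  by move=> j; rewrite mxE; case: unliftP.
rewrite (bigD1_ord i) //= mxE unlift_none add0r -[RHS]v1.
by apply: eq_bigr => k _; rewrite mxE liftK.
Qed.

Definition coface n (i : 'I_n.+2) (v : std_simplex n) : std_simplex n.+1 :=
  exist (fun w => w \in std_simplex n.+1) _ (coface_subproof i v).

Section Chains.
Variable X : topologicalType.

(* Formal sums of arbitrary functions from the simplex; the continuous ones,
   with image in a given subset, are selected by [chain_in]. *)
Definition chain n := {freeg (std_simplex n -> X) / int}.

Definition bd n : chain n -> chain n.-1 :=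
  match n with
  | 0 => fun=> 0
  | m.+1 => fglift (fun s : std_simplex m.+1 -> X =>
      \sum_(i < m.+2) << (-1) ^+ i *g (s \o @coface m i) >>)
  end.

Lemma bd_is_zmod n : zmod_morphism (@bd n).
Proof.
case: n => [|n] /= c1 c2; first by rewrite subr0.
exact: lift_is_additive.
Qed.
HB.instance Definition _ n :=
  GRing.isZmodMorphism.Build (chain n) (chain n.-1) (@bd n) (@bd_is_zmod n).

Definition chain_in n (A : set X) : {pred chain n} :=
  fun c => `[< forall s, s \in dom c ->
               continuous s /\ forall t, A (s t) >].

Arguments chain_in n A : clear implicits.

Lemma chain_in_zmod n A : zmod_closed (chain_in n A).
Proof.
split; first by apply/asboolP => s; rewrite dom0.
move=> a b /asboolP ha /asboolP hb; apply/asboolP => s /domB.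
by rewrite mem_cat => /orP[/ha|/hb].
Qed.
HB.instance Definition _ n A :=
  GRing.isZmodClosed.Build (chain n) (chain_in n A) (@chain_in_zmod n A).

Definition is_cycle n (A B : set X) : {pred chain n} :=
  fun c => (c \in chain_in n A) && (bd c \in chain_in n.-1 B).

Arguments is_cycle n A B : clear implicits.

Lemma is_cycle_zmod n A B : zmod_closed (is_cycle n A B).
Proof.
split; first by apply/andP; rewrite raddf0 !rpred0.
move=> a b /andP[a1 a2] /andP[b1 b2].
by apply/andP; split; rewrite ?raddfB rpredB.
Qed.
HB.instance Definition _ n A B :=
  GRing.isZmodClosed.Build (chain n) (is_cycle n A B) (@is_cycle_zmod n A B).

Record cycles n (A B : set X) :=
  Cycle { cycle_val :> chain n; _ : cycle_val \in is_cycle n A B }.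
HB.instance Definition _ n A B := [isSub for @cycle_val n A B].
HB.instance Definition _ n A B := [Choice of cycles n A B by <:].
HB.instance Definition _ n A B :=
  [SubChoice_isSubZmodule of cycles n A B by <:].

Definition is_boundary n (A B : set X) : {pred cycles n A B} :=
  fun c => `[< exists2 e : chain n.+1, e \in chain_in n.+1 A &
                 \val c - (bd e : chain n) \in chain_in n B >].

Arguments is_boundary n A B : clear implicits.

Lemma is_boundary_zmod n A B : zmod_closed (is_boundary n A B).
Proof.
split.
  apply/asboolP; exists 0; first exact: rpred0.
  by rewrite (raddf0 (@bd n.+1)) subr0 rpred0.
move=> a b /asboolP[e eA ea] /asboolP[f fA fb]; apply/asboolP.
exists (e - f); first exact: rpredB.
have -> : \val (a - b) - (bd (e - f) : chain n) =
          (\val a - (bd e : chain n)) - (\val b - (bd f : chain n)).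
  by rewrite (raddfB (@bd n.+1)) (raddfB \val) !opprD !opprK addrACA.
exact: rpredB.
Qed.
HB.instance Definition _ n A B :=
  GRing.isZmodClosed.Build (cycles n A B) (is_boundary n A B)
    (@is_boundary_zmod n A B).

(* H_n(A, B; Z), for B a subset of A; [homology n A set0] is H_n(A; Z). *)
Definition homology n (A B : set X) : zmodType :=
  @Quotient.quot (cycles n A B) (is_boundary n A B).

(* The class of a chain; meaningful when c is a cycle relative to B. *)
Definition hclass n (A B : set X) (c : chain n) : homology n A B :=
  \pi_(homology n A B) (insubd (0 : cycles n A B) c).

Definition connecting n (A B : set X) (x : homology n A B) :
    homology n.-1 B set0 :=
  hclass B set0 (bd (\val (repr x))).

End Chains.

(* The homomorphism induced by f; meaningful when f is continuous on A and maps
   the pair (A, B) to the pair (A', B'). *)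
Definition hmap (X Y : topologicalType) n (A B : set X) (A' B' : set Y)
    (f : X -> Y) (x : homology n A B) : homology n A' B' :=
  hclass A' B' (fglift (fun s : std_simplex n -> X =>
    << (f \o s : std_simplex n -> Y) >> : chain Y n) (\val (repr x))).

End SingularHomology.

Arguments std_simplex R n : clear implicits.

Section FundamentalGroup.
Variables (R : realType) (X : topologicalType).
Implicit Types (A : set X) (a b : R -> X).

Definition path_in A a (x y : X) :=
  [/\ {within `[0, 1], continuous a}, forall t, t \in `[0, 1] -> A (a t),
      a 0 = x & a 1 = y].

Definition path_homotopic A a b :=
  exists H : R * R -> X,
    [/\ {within `[0, 1] `*` `[0, 1], continuous H},
        forall s t, s \in `[0, 1] -> t \in `[0, 1] -> A (H (s, t)),
        forall t, t \in `[0, 1] -> H (0, t) = a t /\ H (1, t) = b t &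
        forall s, s \in `[0, 1] -> H (s, 0) = a 0 /\ H (s, 1) = a 1].

Definition path_concat a b : R -> X :=
  fun t => if t <= 2^-1 then a (2 * t) else b (2 * t - 1).

Definition simply_connected A :=
  [/\ A !=set0, forall x y, A x -> A y -> exists a, path_in A a x y &
      forall x a, path_in A a x x -> path_homotopic A a (cst x)].

Definition abelian_pi1 A := forall x a b, path_in A a x x -> path_in A b x x ->
  path_homotopic A (path_concat a b) (path_concat b a).

End FundamentalGroup.

Section Manifolds.
Variable R : realType.

Definition half_space n : set 'rV[R]_n :=
  [set v | forall i : 'I_n, i = 0%N :> nat -> 0 <= v 0 i].

Definition homeo (X Y : topologicalType) (A : set X) (B : set Y)
    (f : X -> Y) (g : Y -> X) :=
  [/\ {within A, continuous f}, {within B, continuous g},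
      forall x, A x -> B (f x) /\ g (f x) = x &
      forall y, B y -> A (g y) /\ f (g y) = y].

Section Charts.
Variables (X : topologicalType) (n : nat).

(* f is a chart of M, defined on its open subset M `&` U, onto a relatively open
   subset of the half space of dimension n. *)
Definition chart (M U : set X) (f : X -> 'rV[R]_n) :=
  open U /\ exists V g, open V /\ homeo (M `&` U) (@half_space n `&` V) f g.

Definition mboundary (M : set X) : set X :=
  [set x | M x /\ exists U f, [/\ chart M U f, U x &
     forall i : 'I_n, i = 0%N :> nat -> f x 0 i = 0]].

(* F is an m-dimensional properly and locally flatly embedded submanifold of the
   n-manifold M: in charts it is the coordinate (half-)subspace spanned by the
   first m coordinates. For m > 0 this subspace meets the boundary hyperplane
   transversally. *)
Definition locally_flat (m : nat) (M F : set X) :=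
  F `<=` M /\ forall x, F x -> exists U f,
    [/\ chart M U f, U x &
        forall y, M y -> U y ->
          F y <-> forall i : 'I_n, (m <= i)%N -> f y 0 i = 0].

(* An orientation of a compact connected n-manifold M with boundary B, given by
   its fundamental class: a class restricting to a generator of the infinite
   cyclic group H_n(M, M \ x) at each interior point x. *)
Definition fundamental_class (M B : set X) (mu : homology R n M B) :=
  forall x, M x -> ~ B x -> forall z : homology R n M (M `\ x),
    exists k : int, z = hmap M (M `\ x) id mu *~ k.

Definition compact_manifold :=
  [/\ hausdorff_space X, @second_countable X, compact [set: X] &
      forall x : X, exists U f, chart [set: X] U f /\ U x].

End Charts.

Definition sphere n : set 'rV[R]_n.+1 := [set v | \sum_i v 0 i ^+ 2 = 1].

End Manifolds.

Arguments mboundary R {X} n M.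
Arguments locally_flat R {X} n m M F.
Arguments half_space R n : clear implicits.
Arguments sphere R n : clear implicits.
Arguments compact_manifold R X n : clear implicits.

Notation "\partial[ R ] N" := (mboundary R 4 [set: N])
  (at level 10, N at level 8, format "\partial[ R ]  N").
Notation "'H2bd[ R ] N" := (homology R 2 [set: N] (\partial[R] N))
  (at level 10, N at level 8, format "''H2bd[' R ]  N").

Section FourManifolds.
Variable R : realType.

(* N is a compact simply connected 4-manifold with boundary the 3-sphere,
   oriented by mu. *)
Definition punctured_mfd4 (N : topologicalType)
    (mu : homology R 4 [set: N] (\partial[R] N)) :=
  [/\ compact_manifold R N 4, simply_connected R [set: N],
      exists f g, homeo (\partial[R] N) (sphere R 3) f g &
      fundamental_class mu].

Section Knots.
Variable N : topologicalType.

(* An oriented knot in the boundary of N, as a locally flat embedding of the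
   circle R / Z. *)
Definition knot (k : R -> N) :=
  [/\ continuous k, forall t, k (t + 1) = k t,
      forall s t, k s = k t -> exists m : int, s = t + m%:~R &
      locally_flat R 3 1 (\partial[R] N) (range k)].

Definition knot_class (k : R -> N) : homology R 1 (range k) set0 :=
  hclass (range k) set0
    << ((fun t => k ((\val t) 0 1)) : std_simplex R 1 -> N) >>.

(* The pair (F, phi) is a simple oriented surface in N with oriented boundary k,
   representing x. *)
Definition simple_surface (x : 'H2bd[R] N) (k : R -> N) (F : set N)
    (phi : homology R 2 F (range k)) :=
  [/\ compact F /\ connected F,
      locally_flat R 4 2 [set: N] F /\ F `&` \partial[R] N = range k,
      fundamental_class phi /\ connecting phi = knot_class k,
      hmap [set: N] (\partial[R] N) id phi = x &
      abelian_pi1 R (~` F)].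

(* A compact connected oriented surface F with one boundary circle has genus g
   when H_1(F) is free of rank 2g. *)
Definition has_genus (F : set N) (g : nat) :=
  exists f : homology R 1 F set0 -> 'rV[int]_(2 * g),
    {morph f : x y / x + y} /\ bijective f.

(* The minimum is taken in the extended reals: it is +oo when K bounds no simple
   surface representing x. *)
Definition simple_genus (x : 'H2bd[R] N) (k : R -> N) : \bar R :=
  ereal_inf [set (g%:R)%:E | g in [set g : nat |
    exists F phi, @simple_surface x k F phi /\ has_genus F g]].

End Knots.

Definition has_divisibility (A : zmodType) (x : A) (d : nat) :=
  [/\ (0 < d)%N, exists y, x = y *+ d &
      forall m, (0 < m)%N -> (exists y, x = y *+ m) -> (m <= d)%N].

Definition closed_ball3 : set 'rV[R]_3 := [set v | \sum_i v 0 i ^+ 2 <= 1].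
Definition open_ball3 : set 'rV[R]_3 := [set v | \sum_i v 0 i ^+ 2 < 1].
Definition axis3 : set 'rV[R]_3 :=
  [set v | forall i : 'I_3, (0 < i)%N -> v 0 i = 0].

(* An open embedding of R^3 in the boundary of N that meets the knot k in the
   axis, so that the image of the unit ball is an unknotted ball-arc pair. *)
Definition knot_chart (N : topologicalType) (k : R -> N)
    (phi : 'rV[R]_3 -> N) :=
  [/\ exists psi, homeo [set: 'rV[R]_3] (range phi) phi psi,
      exists2 U, open U & range phi = \partial[R] N `&` U &
      forall v, range k (phi v) <-> axis3 v].

Section BoundarySum.
Variables N1 N2 N : topologicalType.
Variables (phi1 : 'rV[R]_3 -> N1) (phi2 : 'rV[R]_3 -> N2).
Variables (e1 : N1 -> N) (e2 : N2 -> N).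

(* N is the union of N1 and N2 glued along the balls that are the images of the
   unit ball under phi1 and phi2, by the homeomorphism phi2 \o phi1^-1. Taking
   this gluing map loses no generality: a homeomorphism of ball-arc pairs extends
   radially to R^3, hence can be absorbed in phi2. That it reverses the
   orientations of the balls and of the arcs is a consequence of [oriented_sum]
   and [knot_sum] below. *)
Definition glued :=
  [/\ hausdorff_space N,
      [/\ continuous e1, continuous e2, injective e1 & injective e2],
      range e1 `|` range e2 = [set: N] &
      forall a b, e1 a = e2 b <->
        exists2 v, closed_ball3 v & a = phi1 v /\ b = phi2 v].

Let B : set N := e1 @` \partial[R] N1 `|` e2 @` \partial[R] N2.

(* The orientation mu of N restricts to mu1 and mu2 on the two pieces. *)
Definition oriented_sum (mu1 : homology R 4 [set: N1] (\partial[R] N1))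
    (mu2 : homology R 4 [set: N2] (\partial[R] N2))
    (mu : homology R 4 [set: N] (\partial[R] N)) :=
  fundamental_class mu /\
  hmap [set: N] B id mu = hmap [set: N] B e1 mu1 + hmap [set: N] B e2 mu2.

(* x corresponds to (x1, x2) under the isomorphisms
     H_2(N, bd N) ~ H_2(N, bd N1 u bd N2) ~ H_2(N1, bd N1) (+) H_2(N2, bd N2). *)
Definition class_sum (x1 : 'H2bd[R] N1) (x2 : 'H2bd[R] N2) (x : 'H2bd[R] N) :=
  hmap [set: N] B id x = hmap [set: N] B e1 x1 + hmap [set: N] B e2 x2.

(* k is the connected sum of k1 and k2: its image is the union of the two knots
   minus the interior of their common arc, and it has the orientation induced
   by both. *)
Definition knot_sum (k1 : R -> N1) (k2 : R -> N2) (k : R -> N) :=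
  let K12 := e1 @` range k1 `|` e2 @` range k2 in
  range k = e1 @` (range k1 `\` phi1 @` open_ball3)
            `|` e2 @` (range k2 `\` phi2 @` open_ball3) /\
  hmap K12 set0 id (knot_class k) =
    hmap K12 set0 e1 (knot_class k1) + hmap K12 set0 e2 (knot_class k2).

End BoundarySum.

(* (t, z) |-> (t, z ^ d) on R x C. *)
Definition branch_model (d : nat) (v : 'rV[R]_3) : 'rV[R]_3 :=
  let w := ((v 0 1 +i* v 0 2%:R)%C) ^+ d in
  \row_i nth 0 [:: v 0 0; complex.Re w; complex.Im w] i.

(* p : S -> Y is the d-fold cyclic cover of the 3-manifold Y (a subset of X)
   branched along K, with group of deck transformations generated by tau: off K,
   p is a covering on which the powers of tau act simply transitively; near K, p
   is the branch model. *)
Definition cyclic_branched_cover (X S : topologicalType) (d : nat)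
    (Y K : set X) (p : S -> X) (tau : S -> S) :=
  [/\ [/\ compact [set: S], hausdorff_space S & connected [set: S]],
      continuous p /\ range p = Y,
      [/\ continuous tau, forall s, p (tau s) = p s &
          forall s, iter d tau s = s],
      forall y, Y y -> ~ K y -> exists W U q,
        [/\ open W, open U, W y, homeo U (Y `&` W) p q &
            forall s, W (p s) -> exists! i : 'I_d, U (iter i tau s)] &
      forall s, K (p s) -> exists U W (f : S -> 'rV[R]_3) (h : X -> 'rV[R]_3),
        [/\ chart [set: S] U f, chart Y W h, U s, W (p s) &
            (forall u, U u -> W (p u) /\ h (p u) = branch_model d (f u)) /\
            (forall y, Y y -> W y -> K y <-> axis3 (h y))]].

End FourManifolds.

(* Main.v *)
(* Let F1, F2 be surfaces of minimal genus. In N they meet along the common arc of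
   the knots, and F = F1 u F2 is the surface sought. Collar charts along the gluing
   ball show that F is flat, and a neighbourhood of N1 in N deforms into N1,
   preserving N2, F and the complement of F; hence chains and paths of N split into
   parts in N1 and N2. This gives the genus, the fundamental class and the class of
   F. The complement C2 of F2 has abelian fundamental group and N2 is simply
   connected, so pi_1(C2) is generated by meridians of F2; since F2 is connected
   they are all conjugate, hence come from the gluing ball minus the arc. By the
   argument of van Kampen every loop in the complement of F is then homotopic into
   the complement of F1, where loops commute. *)
From HB Require Import structures.
Require Import Defs.
From mathcomp Require Import all_boot all_order all_algebra.
From mathcomp Require Import generic_quotient ring_quotient freeg.
From mathcomp Require Import all_classical all_reals topology ereal normedtype.
From mathcomp Require Import numfun realfun sequences.
From mathcomp Require Import ring lra zify.
Import Order.TTheory GRing.Theory Num.Theory numFieldNormedType.Exports.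
Set Implicit Arguments.
Unset Strict Implicit.
Unset Printing Implicit Defensive.
Local Open Scope classical_set_scope.
Local Open Scope ring_scope.

Local Arguments bd : simpl never.

(** * Free abelian groups *)

(** Three steps need more than the picture suggests. The class of F is compared with x only relative
    to the union B of the old boundaries, which contains the interior of the gluing ball; lifting
    the equality to the boundary of N uses H_2(B, bd N) = 0, that is, the vanishing of H_1 of a
    punctured 3-ball. At a point of the common arc neither piece determines the local orientation,
    so the point is first slid along F off the arc by an ambient isotopy. Finally, meridians are
    never chosen or conjugated. Let Q be the quotient of the abelian group pi_1(C2) by the image of
    pi_1 of the ball minus the arc. The Hurewicz map to Q is a 1-cocycle on C2 that vanishes near
    one point of F2; by connectedness of F2 it vanishes locally at each of its points, so it has
    local primitives across F2 and extends to small simplices of N2. Simple connectivity of N2 then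
    forces Q to be trivial. No exact sequence is set up: each excision or Mayer-Vietoris argument
    splits a subdivided chain explicitly. *)

Lemma freegUz (K : choiceType) (k : int) (x : K) :
  << k *g x >> = << x >> *~ k :> {freeg K / int}.
Proof. by rewrite freegU_mulz intz. Qed.

Section FreeAbelian.
Variables (K : choiceType).

(** The predicate [chain_in] is convertible to an instance of this one, so that the lemmas below
    apply to singular chains directly. *)
Definition fall (P : K -> Prop) : {pred {freeg K / int}} :=
  fun c => `[< forall x, x \in dom c -> P x >].

Lemma fall_zmod P : zmod_closed (fall P).
Proof.
split; first by apply/asboolP => s; rewrite dom0.
move=> a b /asboolP ha /asboolP hb; apply/asboolP => s /domB.
by rewrite mem_cat => /orP[/ha|/hb].
Qed.
HB.instance Definition _ P :=
  GRing.isZmodClosed.Build {freeg K / int} (fall P) (@fall_zmod P).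

Lemma fallU (P : K -> Prop) x : P x -> << x >> \in fall P.
Proof. by move=> Px; apply/asboolP => y; rewrite domU1 inE => /eqP->. Qed.

(** Closure under subtraction yields opposites, sums and integer multiples, which is all that a
    formal sum needs. *)
Lemma fall_ind (P : K -> Prop) (Q : {freeg K / int} -> Prop) :
  Q 0 -> (forall a b, Q a -> Q b -> Q (a - b)) -> (forall x, P x -> Q << x >>) ->
  forall c, c \in fall P -> Q c.
Proof.
move=> Q0 QB QU c /asboolP hc.
have QN a : Q a -> Q (- a) by move=> Qa; rewrite -[- a]add0r; apply: QB.
have QD a b : Q a -> Q b -> Q (a + b).
  by move=> Qa Qb; rewrite -[b]opprK; apply: QB => //; apply: QN.
rewrite -[c]freeg_sumE big_seq; apply: big_ind => // x xc.
have Qx := QU _ (hc _ xc).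
rewrite freegUz; have QMn n : Q (<< x >> *+ n).
  by elim: n => [|n IH]; rewrite ?mulr0n // mulrS; apply: QD.
by case: (coeff x c) => n; [exact: QMn|rewrite NegzE mulrNz; exact/QN/QMn].
Qed.

Lemma fallW (P Q : K -> Prop) : (forall x, P x -> Q x) ->
  {subset fall P <= fall Q}.
Proof. by move=> PQ c /asboolP h; apply/asboolP => x /h /PQ. Qed.

Lemma fallT c : c \in fall (fun=> True). Proof. exact/asboolP. Qed.

Lemma freeg_ext (V : zmodType) (f g : {freeg K / int} -> V) :
  zmod_morphism f -> zmod_morphism g -> (forall x, f << x >> = g << x >>) ->
  f =1 g.
Proof.
move=> fB gB fg c; have z0 h : zmod_morphism h -> h (0 : {freeg K / int}) = 0 :> V.
  by move=> hB; rewrite -[0]subr0 hB subrr.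
apply: (fall_ind (P := fun=> True) (Q := fun c => f c = g c)) (fallT c) => //.
  by rewrite !z0.
by move=> a b ea eb; rewrite fB gB ea eb.
Qed.

Lemma freeg_ext_in (P : K -> Prop) (V : zmodType) (f g : {freeg K / int} -> V) :
  zmod_morphism f -> zmod_morphism g -> (forall x, P x -> f << x >> = g << x >>) ->
  forall c, c \in fall P -> f c = g c.
Proof.
move=> fB gB fg; have z0 h : zmod_morphism h -> h (0 : {freeg K / int}) = 0 :> V.
  by move=> hB; rewrite -[0]subr0 hB subrr.
apply: fall_ind => //; first by rewrite !z0.
by move=> a b ea eb; rewrite fB gB ea eb.
Qed.

(** The target of [fglift] must be an int-module; [zmodule V] provides this structure, so that any
    abelian group can be a target. *)
Definition flift (V : zmodType) (f : K -> V) : {freeg K / int} -> V :=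
  @fglift int (zmodule V) K f.

Lemma flift_is_zmod V f : zmod_morphism (@flift V f).
Proof. exact: (@lift_is_additive int K (zmodule V) f). Qed.
HB.instance Definition _ V f :=
  GRing.isZmodMorphism.Build {freeg K / int} V (@flift V f) (@flift_is_zmod V f).

Lemma fliftU V f x : @flift V f << x >> = f x.
Proof. by rewrite /flift liftU scale1r. Qed.

End FreeAbelian.

Lemma fglift_fall (K K' : choiceType) (P : K -> Prop) (Q : K' -> Prop)
    (f : K -> {freeg K' / int}) :
  (forall x, P x -> f x \in fall Q) ->
  forall c, c \in fall P -> fglift f c \in fall Q.
Proof.
move=> fPQ; apply: fall_ind => [|a b ha hb|x /fPQ].
- by rewrite -[0]subr0 lift_is_additive subrr rpred0.
- by rewrite lift_is_additive rpredB.
- by rewrite liftU scale1r.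
Qed.

Definition gmap (K K' : choiceType) (f : K -> K') :
  {freeg K / int} -> {freeg K' / int} := fglift (fun x => << f x >>).

Lemma gmap_is_zmod (K K' : choiceType) (f : K -> K') : zmod_morphism (@gmap K K' f).
Proof. exact: lift_is_additive. Qed.
HB.instance Definition _ (K K' : choiceType) (f : K -> K') :=
  GRing.isZmodMorphism.Build {freeg K / int} {freeg K' / int} (@gmap K K' f)
    (@gmap_is_zmod K K' f).

Lemma gmapU (K K' : choiceType) (f : K -> K') x : gmap f << x >> = << f x >>.
Proof. by rewrite /gmap liftU scale1r. Qed.

Lemma gmap_comp (K1 K2 K3 : choiceType) (f : K1 -> K2) (g : K2 -> K3) c :
  gmap g (gmap f c) = gmap (g \o f) c.
Proof.
pose F := (gmap g \o gmap f : {freeg K1 / int} -> {freeg K3 / int}).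
apply: (@freeg_ext _ _ F); rewrite /F; try exact: raddfB.
by move=> x /=; rewrite !gmapU.
Qed.

Lemma gmap_fall (K K' : choiceType) (P : K -> Prop) (Q : K' -> Prop) (f : K -> K') :
  (forall x, P x -> Q (f x)) -> forall c, c \in fall P -> gmap f c \in fall Q.
Proof. by move=> PQ; apply: fglift_fall => x /PQ; apply: fallU. Qed.

Lemma eq_gmap_in (K K' : choiceType) (P : K -> Prop) (f g : K -> K') :
  (forall x, P x -> f x = g x) -> forall c, c \in fall P -> gmap f c = gmap g c.
Proof.
move=> fg; apply: freeg_ext_in; try exact: raddfB.
by move=> x Px; rewrite !gmapU fg.
Qed.

(** The cancellation behind the square of a boundary being zero: the terms with j < i are matched
    with the others by the hypothesis, and matched terms have opposite signs. *)
Lemma alt_sum0 (V : zmodType) n (g : nat -> nat -> V) :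
  (forall i j, (j <= i)%N -> (i <= n)%N -> g i.+1 j = g j i) ->
  \sum_(i < n.+2) (\sum_(j < n.+1) g i j *~ (-1) ^+ j) *~ (-1) ^+ i = 0.
Proof.
move=> gE.
under eq_bigr do rewrite mulrz_suml.
transitivity (\sum_(i < n.+2) (\sum_(j < n.+1 | (j < i)%N) g i j *~ (-1) ^+ j *~ (-1) ^+ i
   + \sum_(j < n.+1 | ~~ (j < i)%N) g i j *~ (-1) ^+ j *~ (-1) ^+ i)).
  by apply: eq_bigr => i _; rewrite (bigID (fun j : 'I__ => (j < i)%N)).
rewrite big_split /= big_ord_recl big_pred0 ?add0r; last by [].
rewrite [X in _ + X]big_ord_recr /= [X in _ + (_ + X)]big_pred0 ?addr0; last first.
  by move=> j; rewrite ltn_ord.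
rewrite (exchange_big_dep predT) //= -big_split big1 //= => j _.
rewrite (eq_bigl (fun i : 'I_n.+1 => ~~ (i < j)%N)); last first.
  by move=> i /=; rewrite /bump /= add1n ltnS leqNgt.
rewrite -big_split big1 //= => i; rewrite -leqNgt => ji.
rewrite /bump /= add1n gE // ?exprS; last by rewrite -ltnS.
by rewrite -!mulrzA mulN1r mulrN mulrNz [X in _ *~ X]mulrC addNr.
Qed.

Lemma flift_fall (K K' : choiceType) (P : K -> Prop) (Q : K' -> Prop)
    (f : K -> {freeg K' / int}) :
  (forall x, P x -> f x \in fall Q) ->
  forall c, c \in fall P -> flift f c \in fall Q.
Proof.
move=> fPQ; apply: fall_ind => [|a b ha hb|x /fPQ].
- by rewrite raddf0 rpred0.
- by rewrite raddfB rpredB.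
- by rewrite fliftU.
Qed.

(** * Affine chains *)

Section MatrixChains.
Variable R : realType.

(* Singular chains of affine simplices in R^m, given by their vertices. *)
Definition mch k m := {freeg 'M[R]_(k.+1, m) / int}.

(** Multiplied on the left of a matrix of vertices it deletes row i; multiplied on the right of a
    row vector it inserts a zero at place i. Faces and cofaces thus become matrix products. *)
Definition dmx n (i : nat) : 'M[R]_(n.+1, n.+2) :=
  \matrix_(a, b) (b == bump i a :> nat)%:R.

Lemma dmx_mulE n m (i : nat) (M : 'M[R]_(n.+2, m)) (a : 'I_n.+1)
    (b : 'I_n.+2) c :
  b = bump i a :> nat -> (dmx n i *m M) a c = M b c.
Proof.
move=> bE; rewrite mxE (bigD1 b) //= !mxE bE eqxx mul1r big1 ?addr0 // => j jb.
by rewrite mxE; case: eqP => [e|]; rewrite ?mul0r //; case/eqP: jb; apply/val_inj; rewrite /= e bE.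
Qed.

Lemma bump_lt n (i a : nat) : (i < n.+2)%N -> (a < n.+1)%N -> (bump i a < n.+2)%N.
Proof. by rewrite /bump; case: leqP => /=; lia. Qed.

Lemma dmx_dmx n i j : (j <= i)%N ->
  dmx n j *m dmx n.+1 i.+1 = dmx n i *m dmx n.+1 j.
Proof.
move=> ji; apply/matrixP => a c; have jn : (bump j a < n.+2)%N.
  by have := ltn_ord a; rewrite /bump; case: leqP => /=; lia.
rewrite (@dmx_mulE _ _ _ _ _ (Ordinal jn)) // mxE /=.
have [ia|ia] := leqP i a.
  have h : (bump i a < n.+2)%N by rewrite /bump ia; have := ltn_ord a; lia.
  rewrite (@dmx_mulE _ _ _ _ _ (Ordinal h)) // mxE /=.
  congr (_ %:R); congr nat_of_bool; congr (_ == _).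
  by rewrite /bump; lia.
have h : (bump i a < n.+2)%N by rewrite /bump; have := ltn_ord a; lia.
rewrite (@dmx_mulE _ _ _ _ _ (Ordinal h)) // mxE /=.
congr (_ %:R); congr nat_of_bool; congr (_ == _).
by rewrite /bump; lia.
Qed.

Lemma coface_row_dmx n (i : 'I_n.+2) (v : 'rV[R]_n.+1) :
  coface_row i v = v *m dmx n i.
Proof.
apply/rowP => j; rewrite !mxE; case: unliftP => [k ->|->].
  rewrite (bigD1 k) //= mxE eqxx mulr1 big1 ?addr0 // => l lk.
  rewrite mxE; case: eqP => [e|]; rewrite ?mulr0 //.
  by case/eqP: lk; apply/(@fintype.lift_inj _ i)/val_inj.
rewrite big1 // => l _; rewrite mxE; case: eqP => [e|]; rewrite ?mulr0 //.
by have := neq_bump i l; rewrite -e eqxx.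
Qed.

Definition mbd k m : mch k.+1 m -> mch k m :=
  flift (fun M => \sum_(i < k.+2) << dmx k i *m M >> *~ (-1) ^+ i : mch k m).
HB.instance Definition _ k m :=
  GRing.isZmodMorphism.Build (mch k.+1 m) (mch k m) (@mbd k m) (@flift_is_zmod _ _ _).

Definition subst k m m' (Q : 'M[R]_(m, m')) : mch k m -> mch k m' :=
  gmap (fun M => M *m Q).
HB.instance Definition _ k m m' Q :=
  GRing.isZmodMorphism.Build (mch k m) (mch k m') (@subst k m m' Q)
    (@gmap_is_zmod _ _ _).

Lemma substU k m m' (Q : 'M[R]_(m, m')) M : @subst k m m' Q << M >> = << M *m Q >>.
Proof. exact: gmapU. Qed.

Lemma subst_subst k m1 m2 m3 (Q1 : 'M[R]_(m1, m2)) (Q2 : 'M_(m2, m3)) (u : mch k m1) :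
  subst Q2 (subst Q1 u) = subst (Q1 *m Q2) u.
Proof.
rewrite /subst gmap_comp; apply: (@eq_gmap_in _ _ (fun=> True)); last exact: fallT.
by move=> x _ /=; rewrite mulmxA.
Qed.

Lemma mbdU k m M : @mbd k m << M >> = \sum_(i < k.+2) << dmx k i *m M >> *~ (-1) ^+ i.
Proof. exact: fliftU. Qed.

Lemma mbd_subst k m m' (Q : 'M[R]_(m, m')) (u : mch k.+1 m) :
  mbd (subst Q u) = subst Q (mbd u).
Proof.
pose F := (@mbd k m' \o @subst k.+1 m m' Q); pose G := (@subst k m m' Q \o @mbd k m).
apply: (@freeg_ext _ _ F G); rewrite /F /G; try exact: raddfB.
move=> M /=; rewrite substU !mbdU raddf_sum; apply: eq_bigr => i _.
by rewrite raddfMz /= substU mulmxA.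
Qed.

(** With Q = [dmx n] this carries a chain of the n-simplex to the boundary of the next simplex, one
    copy with its sign for each face. *)
Definition fsum k l m m' (Q : nat -> 'M[R]_(m, m')) (u : mch k m) : mch k m' :=
  \sum_(i < l) subst (Q i) u *~ (-1) ^+ i.

Lemma fsum_is_zmod k l m m' Q : zmod_morphism (@fsum k l m m' Q).
Proof.
move=> u v; rewrite /fsum -sumrB; apply: eq_bigr => i _.
by rewrite raddfB mulrzBl.
Qed.
HB.instance Definition _ k l m m' Q :=
  GRing.isZmodMorphism.Build (mch k m) (mch k m') (@fsum k l m m' Q)
    (@fsum_is_zmod k l m m' Q).

Lemma mbd_fsum k l m m' Q (u : mch k.+1 m) :
  mbd (@fsum _ l m m' Q u) = fsum l Q (mbd u).
Proof.
rewrite /fsum raddf_sum; apply: eq_bigr => i _.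
by rewrite raddfMz /= mbd_subst.
Qed.

Lemma fsum_fsum k n m0 m1 m2 (Q1 : nat -> 'M[R]_(m0, m1)) (Q2 : nat -> 'M_(m1, m2))
    (u : mch k m0) :
  (forall i j, (j <= i)%N -> Q1 j *m Q2 i.+1 = Q1 i *m Q2 j) ->
  fsum n.+2 Q2 (fsum n.+1 Q1 u) = 0.
Proof.
move=> QE; rewrite /fsum.
apply: etrans (@alt_sum0 _ n (fun i j => subst (Q2 i) (subst (Q1 j) u)) _).
  by apply: eq_bigr => i _; rewrite raddf_sum; under eq_bigr do rewrite raddfMz /=.
by move=> i j ji _; rewrite !subst_subst QE.
Qed.

Definition conemx k m (b : 'rV[R]_m) (M : 'M[R]_(k.+1, m)) : 'M[R]_(k.+2, m) :=
  \matrix_(i, j) (if unlift ord0 i is Some a then M a j else b 0 j).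

Definition cone k m (b : 'rV[R]_m) : mch k m -> mch k.+1 m := gmap (conemx b).
HB.instance Definition _ k m b :=
  GRing.isZmodMorphism.Build (mch k m) (mch k.+1 m) (@cone k m b)
    (@gmap_is_zmod _ _ _).

Lemma coneU k m b M : @cone k m b << M >> = << conemx b M >>.
Proof. exact: gmapU. Qed.

Lemma dmx0_cone k m b (M : 'M[R]_(k.+1, m)) : dmx k 0 *m conemx b M = M.
Proof.
apply/matrixP => a c; rewrite (@dmx_mulE _ _ _ _ _ (fintype.lift ord0 a)) // mxE.
by rewrite liftK.
Qed.

Lemma dmxS_cone k m b (M : 'M[R]_(k.+2, m)) (i : nat) : (i < k.+2)%N ->
  dmx k.+1 i.+1 *m conemx b M = conemx b (dmx k i *m M).
Proof.
move=> ik; apply/matrixP => a c; rewrite [RHS]mxE; case: unliftP => [a' ->|->].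
  have h := @bump_lt k i a' ik (ltn_ord a').
  rewrite (@dmx_mulE _ _ _ _ _ (fintype.lift ord0 (Ordinal h))) //=; last first.
    by rewrite /bump /=; lia.
  rewrite mxE liftK (@dmx_mulE _ _ _ _ _ (Ordinal h)) //.
rewrite (@dmx_mulE _ _ _ _ _ ord0) //= mxE.
by case: unliftP => // j /eqP; rewrite eq_sym.
Qed.

Lemma dmx1_cone m b (M : 'M[R]_(1, m)) : dmx 0 1 *m conemx b M = b.
Proof.
apply/matrixP => a c; rewrite !ord1 (@dmx_mulE _ _ _ _ _ ord0) //= mxE.
by case: unliftP => // j /eqP; rewrite eq_sym.
Qed.

(** Deleting the apex gives back the base, and deleting any other vertex gives the cone over a face:
    coning contracts the complex of affine chains. *)
Lemma mbd_cone k m b (u : mch k.+1 m) : mbd (cone b u) = u - cone b (mbd u).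
Proof.
pose F := (@mbd k.+1 m \o @cone k.+1 m b).
pose G := (fun u => u - @cone k m b (mbd u)).
apply: (@freeg_ext _ _ F G); rewrite /F /G; first exact: raddfB.
  by move=> x y; rewrite (raddfB (@mbd k m)) (raddfB (@cone k m b)) !opprD addrACA.
move=> M /=; rewrite coneU !mbdU big_ord_recl /= mulr1z dmx0_cone; congr (_ + _).
rewrite raddf_sum -sumrN; apply: eq_bigr => i _.
rewrite raddfMz /= coneU /bump /= add1n exprS dmxS_cone // -mulrNz.
by rewrite mulN1r.
Qed.

(** In the lowest degree the contraction holds only up to the degree of the chain, because both ends
    of each edge of the cone count. *)
Lemma mbd_cone0 m b (u : mch 0 m) : mbd (cone b u) = u - << b >> *~ deg u.
Proof.
pose F := (@mbd 0 m \o @cone 0 m b).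
pose G := (fun u : mch 0 m => u - << b >> *~ deg u).
apply: (@freeg_ext _ _ F G); rewrite /F /G; first exact: raddfB.
  by move=> x y; rewrite raddfB mulrzBr !opprD addrACA.
move=> M /=; rewrite coneU !mbdU big_ord_recl /= mulr1z dmx0_cone; congr (_ + _).
by rewrite big_ord1 /= dmx1_cone degU.
Qed.

Lemma deg_subst k m m' (Q : 'M[R]_(m, m')) (u : mch k m) : deg (subst Q u) = deg u.
Proof.
pose F := (@deg _ \o @subst k m m' Q).
apply: (@freeg_ext _ _ F (@deg _)); rewrite /F; try exact: raddfB.
by move=> M /=; rewrite substU !degU.
Qed.

(* Natural chain maps, and natural homotopies from the identity (at s = 0) to
   them (at s = 1) in the prism with coordinates (s, t), built by coning. *)
Definition natural_chain (A : forall n, mch n n.+1) :=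
  A 0%N = << 1%:M >> /\
  forall n, mbd (A n.+1) = fsum n.+2 (dmx n) (A n).

Definition bary n : 'rV[R]_n.+1 := const_mx (n.+1%:R^-1).

Fixpoint sd n : mch n n.+1 :=
  if n is m.+1 then cone (bary m.+1) (fsum m.+2 (dmx m) (sd m)) else << 1%:M >>.

(** The error term in the boundary of the cone is the cone over the boundary of a sum of faces,
    which vanishes by induction and [fsum_fsum]. *)
Lemma sd_natural : natural_chain sd.
Proof.
split=> // n; rewrite [sd n.+1]/=; case: n => [|n].
  rewrite mbd_cone0 /fsum big_ord_recl big_ord1 /= mulr1z mulrN1z raddfB /=.
  by rewrite !deg_subst degU subrr subr0.
rewrite mbd_cone mbd_fsum; suff -> : mbd (sd n.+1) = fsum n.+2 (dmx n) (sd n).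
  rewrite fsum_fsum ?raddf0 ?subr0 ?addr0 //.
  exact: dmx_dmx.
elim: n => [|n IH].
  rewrite mbd_cone0 /fsum big_ord_recl big_ord1 /= mulr1z mulrN1z raddfB /=.
  by rewrite !deg_subst degU subrr subr0.
rewrite [in LHS]/= mbd_cone mbd_fsum IH fsum_fsum ?raddf0 ?subr0 ?addr0 //.
exact: dmx_dmx.
Qed.

(** For this trivial choice the prism below is the usual one, and gives homotopy invariance without
    subdivision. *)
Definition idch n : mch n n.+1 := << 1%:M >>.

Lemma idch_natural : natural_chain idch.
Proof.
split=> // n; rewrite /idch mbdU /fsum; apply: eq_bigr => i _.
by rewrite substU mulmx1 mul1mx.
Qed.

Definition inc0 n : 'M[R]_(n.+1, 1 + n.+1) := row_mx 0 1%:M.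
Definition inc1 n : 'M[R]_(n.+1, 1 + n.+1) := row_mx (const_mx 1) 1%:M.
Definition pdmx n i : 'M[R]_(1 + n.+1, 1 + n.+2) := block_mx 1%:M 0 0 (dmx n i).
Definition pbary n : 'rV[R]_(1 + n.+1) := row_mx 0 (bary n).

Lemma dmx_const n m (i : nat) (x : R) : (i < n.+2)%N ->
  dmx n i *m (const_mx x : 'M_(n.+2, m)) = const_mx x.
Proof.
move=> i_n; apply/matrixP => a c; rewrite (@dmx_mulE _ _ _ _ _ (Ordinal (bump_lt i_n (ltn_ord a)))) //.
by rewrite !mxE.
Qed.

Lemma dmx_inc0 n i : dmx n i *m inc0 n.+1 = inc0 n *m pdmx n i.
Proof.
rewrite /inc0 /pdmx mul_mx_row mul_row_block mulmx0 mulmx1 !mul0mx !add0r mulmx0.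
by rewrite mul1mx.
Qed.

Lemma dmx_inc1 n (i : nat) : (i < n.+2)%N -> dmx n i *m inc1 n.+1 = inc1 n *m pdmx n i.
Proof.
move=> h; rewrite /inc1 /pdmx mul_mx_row mul_row_block !mulmx0 mulmx1 mul1mx.
by rewrite dmx_const // mulmx1 addr0 add0r.
Qed.

Lemma pdmx_pdmx n i j : (j <= i)%N ->
  pdmx n j *m pdmx n.+1 i.+1 = pdmx n i *m pdmx n.+1 j.
Proof.
by move=> ji; rewrite /pdmx !mulmx_block !(mulmx0, mul0mx, addr0, add0r) mulmx1 dmx_dmx.
Qed.

Variable A : forall n, mch n n.+1.
Hypothesis natA : natural_chain A.

Fixpoint prism n : mch n.+1 (1 + n.+1) :=
  match n with
  | 0 => cone (pbary 0) (subst (inc1 0) (A 0) - << inc0 0 >>)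
  | m.+1 => cone (pbary m.+1)
      (subst (inc1 m.+1) (A m.+1) - << inc0 m.+1 >> - fsum m.+2 (pdmx m) (prism m))
  end.

Lemma mbd_prism0 : mbd (prism 0) = subst (inc1 0) (A 0) - << inc0 0 >>.
Proof.
by rewrite /= mbd_cone0 raddfB /= deg_subst (proj1 natA) !degU subrr subr0.
Qed.

Lemma mbd_prism_ends n :
  mbd (subst (inc1 n.+1) (A n.+1) - << inc0 n.+1 >>) =
  fsum n.+2 (pdmx n) (subst (inc1 n) (A n) - << inc0 n >>).
Proof.
rewrite raddfB /= mbd_subst (proj2 natA) mbdU raddfB /=; congr (_ - _); last first.
  by rewrite /fsum; apply: eq_bigr => i _; rewrite substU dmx_inc0.
rewrite /fsum raddf_sum; apply: eq_bigr => i _.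
by rewrite raddfMz /= !subst_subst dmx_inc1.
Qed.

(** The chain that is coned, top minus bottom minus sides, is a cycle by induction, and the cone
    over a cycle has that cycle as boundary. *)
Lemma mbd_prism n : mbd (prism n.+1) =
  subst (inc1 n.+1) (A n.+1) - << inc0 n.+1 >> - fsum n.+2 (pdmx n) (prism n).
Proof.
pose z m := subst (inc1 m.+1) (A m.+1) - << inc0 m.+1 >> - fsum m.+2 (pdmx m) (prism m).
have pE m : prism m.+1 = cone (pbary m.+1) (z m) by [].
suff z0 : mbd (z n) = 0 by rewrite pE mbd_cone z0 raddf0 subr0.
elim: n => [|n IH]; rewrite [z _]/z (raddfB (@mbd _ _)) /= mbd_prism_ends mbd_fsum.
  by rewrite mbd_prism0 subrr.
rewrite -/(prism n.+1) pE mbd_cone IH raddf0 subr0 [X in _ - X]raddfB /= fsum_fsum.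
  by rewrite subr0 subrr.
exact: pdmx_pdmx.
Qed.

End MatrixChains.

(** * Continuity on subsets and coordinatewise convergence *)

Section Topology.

Lemma withinP (T U : topologicalType) (A : set T) (f : T -> U) :
  {within A, continuous f} <-> forall x, A x -> f @ within A (nbhs x) --> f x.
Proof. exact: subspace_continuousP. Qed.

Lemma within_comp (T U V : topologicalType) (A : set T) (B : set U)
    (f : T -> U) (g : U -> V) :
  {within A, continuous f} -> (forall x, A x -> B (f x)) ->
  {within B, continuous g} -> {within A, continuous g \o f}.
Proof.
move=> /withinP cf fAB /withinP cg; apply/withinP => x Ax.
apply: cvg_comp (cg _ (fAB _ Ax)) => W WB.
have : within A (nbhs x) (fun y => B (f y) -> W (f y)) := cf x Ax _ WB.
rewrite /within /= => h; change (\forall y \near x, A y -> W (f y)).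
by apply: filterS h => y Wy Ay; exact: Wy Ay (fAB _ Ay).
Qed.

Lemma cont_within (T U : topologicalType) (f : T -> U) :
  {within [set: T], continuous f} <-> continuous f.
Proof. exact: iff_sym (continuous_subspace_setT f). Qed.

Lemma comp_within (T U V : topologicalType) (B : set U) (f : T -> U) (g : U -> V) :
  continuous f -> (forall x, B (f x)) -> {within B, continuous g} ->
  continuous (g \o f).
Proof.
move=> cf fB cg; apply/cont_within; apply: (within_comp (B := B)) => //.
exact/cont_within.
Qed.

Lemma cvg_rV (R : realType) (T : Type) (F : set_system T) (FF : Filter F) n
    (f : T -> 'rV[R]_n) (v : 'rV[R]_n) :
  (forall j, (fun t => f t 0 j) @ F --> v 0 j) -> f @ F --> v.
Proof.
move=> h W [P vP PW]; apply: (filterS (P := fun t => forall j, P ord0 j (f t 0 j))).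
  by move=> t Pt; apply: PW => i j; rewrite (ord1 i).
by apply: filter_forall => j; apply: h; apply: vP.
Qed.

Lemma cont_rV (R : realType) (T : topologicalType) n (f : T -> 'rV[R]_n) :
  (forall j, continuous (fun t => f t 0 j)) -> continuous f.
Proof. by move=> h x; apply: (@cvg_rV _ _ _ (nbhs_filter x)) => j; apply: h. Qed.

Lemma within_rV (R : realType) (T : topologicalType) (A : set T) n (f : T -> 'rV[R]_n) :
  (forall j, {within A, continuous (fun t => f t 0 j)}) -> {within A, continuous f}.
Proof.
move=> h; apply/withinP => x Ax.
apply: (@cvg_rV _ _ _ (within_filter A (nbhs_filter x))) => j.
by move/withinP : (h j); apply.
Qed.

Lemma cvg_coord (R : realType) (T : Type) (F : set_system T) (FF : Filter F) m n
    (f : T -> 'M[R]_(m, n)) (v : 'M[R]_(m, n)) i j :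
  f @ F --> v -> (fun t => f t i j) @ F --> v i j.
Proof. by move=> h; apply: (cvg_comp f (fun M : 'M_(m, n) => M i j) h); apply: coord_continuous. Qed.

Lemma rV_norm_le (R : realType) n (v : 'rV[R]_n) (e : R) : 0 <= e ->
  `|v| <= e <-> forall j, `|v 0 j| <= e.
Proof.
move=> e0; rewrite -[`|v|]/(mx_norm v) mx_normrE; split=> [h j|h].
  apply: le_trans h; exact: (le_bigmax _ (fun ij => `|v ij.1 ij.2|) (0, j)).
by apply: bigmax_le => // -[i j] _ /=; rewrite (ord1 i).
Qed.

Lemma rV_norm_lt (R : realType) n (v : 'rV[R]_n) (e : R) : 0 < e ->
  `|v| < e <-> forall j, `|v 0 j| < e.
Proof.
move=> e0; rewrite -[`|v|]/(mx_norm v) mx_normrE; split=> [h j|h].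
  apply: le_lt_trans h; exact: (le_bigmax _ (fun ij => `|v ij.1 ij.2|) (0, j)).
by apply: bigmax_lt => // -[i j] _ /=; rewrite (ord1 i).
Qed.

Lemma cvg_sumr (R : realType) (T : Type) (F : set_system T) (FF : Filter F)
    (I : Type) (r : seq I) (f : I -> T -> R) (a : I -> R) :
  (forall i, f i @ F --> a i) -> (fun t => \sum_(i <- r) f i t) @ F --> \sum_(i <- r) a i.
Proof.
move=> h; elim: r => [|i r IH].
  by under eq_fun do rewrite big_nil; rewrite big_nil; exact: cvg_cst.
under eq_fun do rewrite big_cons; rewrite big_cons; exact: cvgD.
Qed.

Lemma cvg_mulmx (R : realType) (T : Type) (F : set_system T) (FF : Filter F) m n
    (M : 'M[R]_(m, n)) (f : T -> 'rV[R]_m) (v : 'rV[R]_m) :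
  f @ F --> v -> (fun t => f t *m M) @ F --> v *m M.
Proof.
move=> h; apply: cvg_rV => j; under eq_fun do rewrite mxE.
rewrite mxE; apply: cvg_sumr => i; apply: cvgM; [exact: cvg_coord|exact: cvg_cst].
Qed.

Lemma cont_mulmx (R : realType) (T : topologicalType) m n (M : 'M[R]_(m, n))
    (f : T -> 'rV[R]_m) : continuous f -> continuous (fun t => f t *m M).
Proof. by move=> cf t; apply: cvg_mulmx; apply: cf. Qed.

Lemma set_val_continuous (T : topologicalType) (A : set T) :
  continuous (\val : A -> T).
Proof. exact: initial_continuous. Qed.

Lemma cont_set_type (S T : topologicalType) (A : set T) (f : S -> A) :
  continuous (\val \o f) -> continuous f.
Proof. exact: continuous_comp_initial. Qed.

End Topology.

(** * Realization of affine chains as singular chains *)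

Section Operators.
Variable R : realType.
Local Notation D n := (std_simplex R n).

Definition rows_in k m (W : set 'rV[R]_m) (M : 'M[R]_(k.+1, m)) : Prop :=
  forall i, W (row i M).

(** Convexity for combinations of arbitrary length, in the matrix form in which affine simplices
    produce them. *)
Definition convexS m (W : set 'rV[R]_m) :=
  forall k (M : 'M[R]_(k.+1, m)) v, D k v -> rows_in W M -> W (v *m M).

Definition prism_set n : set 'rV[R]_(1 + n.+1) :=
  [set v | 0 <= lsubmx v 0 0 <= 1 /\ D n (rsubmx v)].

Lemma convex_simplex n : convexS (D n).
Proof.
move=> k M v [v0 v1] MW; split=> [j|].
  rewrite mxE; apply: sumr_ge0 => i _; rewrite mulr_ge0 //.
  by have [/(_ j)] := MW i; rewrite mxE.
under eq_bigr do rewrite mxE; rewrite exchange_big /= -[RHS]v1.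
apply: eq_bigr => i _; rewrite -mulr_sumr; have [_] := MW i.
by under eq_bigr do rewrite mxE; move=> ->; rewrite mulr1.
Qed.

Lemma convex_prism n : convexS (@prism_set n).
Proof.
move=> k M v Dv MW; have [v0 v1] := Dv; split.
  rewrite [X in 0 <= X <= _](_ : _ = \sum_i v 0 i * lsubmx (row i M) 0 0); last first.
    by rewrite !mxE; apply: eq_bigr => i _; rewrite !mxE.
  apply/andP; split.
    by apply: sumr_ge0 => i _; rewrite mulr_ge0 //; have [/andP[]] := MW i.
  rewrite -[leRHS]v1; apply: ler_sum => i _; rewrite -[leRHS]mulr1 ler_wpM2l //.
  by have [/andP[]] := MW i.
have -> : rsubmx (v *m M) = v *m rsubmx M.
  by apply/rowP => j; rewrite !mxE; apply: eq_bigr => i _; rewrite mxE.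
apply: convex_simplex => // i; have [_] := MW i.
by rewrite (_ : rsubmx (row i M) = row i (rsubmx M)) //; apply/rowP => j; rewrite !mxE.
Qed.

Lemma rows_in_mul k m m' (W : set 'rV[R]_m) (W' : set 'rV[R]_m') (Q : 'M[R]_(m, m'))
    (M : 'M[R]_(k.+1, m)) :
  (forall w, W w -> W' (w *m Q)) -> rows_in W M -> rows_in W' (M *m Q).
Proof. by move=> QW MW i; rewrite row_mul; apply: QW. Qed.

Lemma rows_in_cone k m (W : set 'rV[R]_m) b (M : 'M[R]_(k.+1, m)) :
  W b -> rows_in W M -> rows_in W (conemx b M).
Proof.
move=> Wb MW i; have [a ->|->] := unliftP ord0 i.
  by rewrite (_ : row _ _ = row a M) //; apply/rowP => j; rewrite !mxE liftK.
by rewrite (_ : row _ _ = b) //; apply/rowP => j; rewrite !mxE unlift_none.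
Qed.

Lemma rows_in1 n : rows_in (D n) 1%:M.
Proof.
move=> i; split=> [j|]; first by rewrite !mxE ler0n.
rewrite (bigD1 i) //= !mxE eqxx big1 ?addr0 // => j ji; rewrite !mxE.
by rewrite eq_sym (negbTE ji).
Qed.

Lemma dmx_simplex n (i : 'I_n.+2) w : D n w -> D n.+1 (w *m dmx R n i).
Proof.
move=> Dw; rewrite -coface_row_dmx.
have /mem_set Dw' := Dw.
by have /set_mem := coface_subproof i (exist (fun w => w \in D n) w Dw').
Qed.

Lemma bary_simplex n : D n (bary R n).
Proof.
split=> [i|]; first by rewrite mxE invr_ge0 ler0n.
under eq_bigr do rewrite mxE.
by rewrite sumr_const card_ord -[RHS](@mulfV R n.+1%:R) ?pnatr_eq0 // mulr_natl.
Qed.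

(** All matrices in these chains are row-stochastic: their vertices lie in the simplex, so that the
    operators never leave a given singular simplex. *)
Definition sto (A : forall n, mch R n n.+1) :=
  forall n, A n \in fall (rows_in (D n)).

Lemma fsum_fall k l m m' (W : set 'rV[R]_m) (W' : set 'rV[R]_m')
    (Q : nat -> 'M[R]_(m, m')) (u : mch R k m) :
  (forall (i : 'I_l) w, W w -> W' (w *m Q i)) ->
  u \in fall (rows_in (k := k) W) -> fsum l Q u \in fall (rows_in W').
Proof.
move=> QW uW; rewrite /fsum rpred_sum // => i _; rewrite rpredMz //.
apply: gmap_fall uW => M; apply: rows_in_mul; exact: QW.
Qed.

Lemma sd_sto : sto (sd R).
Proof.
elim=> [|n IH]; first by apply: fallU; apply: rows_in1.
apply: (gmap_fall (P := rows_in (D n.+1))) => [M|].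
  by apply: rows_in_cone; exact: bary_simplex.
by apply: fsum_fall IH; apply: dmx_simplex.
Qed.

Lemma idch_sto : sto (idch R).
Proof. by move=> n; apply: fallU; apply: rows_in1. Qed.

Lemma inc0_prism n w : D n w -> prism_set (w *m inc0 R n).
Proof.
move=> Dw; rewrite /inc0 mul_mx_row mulmx0 mulmx1.
by split; rewrite ?row_mxKl ?row_mxKr // mxE lexx ler01.
Qed.

Lemma inc1_prism n w : D n w -> prism_set (w *m inc1 R n).
Proof.
move=> Dw; rewrite /inc1 mul_mx_row mulmx1.
split; rewrite ?row_mxKl ?row_mxKr // mxE; case: Dw => _ w1.
by under eq_bigr do rewrite mxE mulr1; rewrite w1 ler01 lexx.
Qed.

Lemma pdmx_prism n (i : 'I_n.+2) w : prism_set w -> prism_set (w *m pdmx R n i).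
Proof.
move=> [w0 w1]; rewrite -[w]hsubmxK /pdmx mul_row_block !mulmx0 mulmx1 addr0 add0r.
by split; rewrite ?row_mxKl ?row_mxKr //; apply: dmx_simplex.
Qed.

Lemma prism_fall A n : sto A -> prism A n \in fall (rows_in (@prism_set n)).
Proof.
move=> stoA; have base n' : subst (inc1 R n') (A n') - << inc0 R n' >> \in
    fall (rows_in (@prism_set n')).
  rewrite rpredB //.
    by apply: gmap_fall (stoA n') => M; apply: rows_in_mul; apply: inc1_prism.
  apply: fallU => i; rewrite -[inc0 R n']mul1mx row_mul; apply: inc0_prism.
  exact: rows_in1.
have pb n' : prism_set (pbary R n').
  by split; rewrite ?row_mxKl ?row_mxKr; [rewrite mxE lexx ler01|exact: bary_simplex].
elim: n => [|n IH]; (apply: gmap_fall; first by move=> M; apply: rows_in_cone).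
  exact: base.
rewrite rpredB ?base //; apply: fsum_fall IH; exact: pdmx_prism.
Qed.

Section Real.
Variable X : topologicalType.

(** G will matter only on a convex set that contains the vertices, as the hypotheses of [eq_real]
    and [real_chain_in] show. *)
Definition real k m (G : 'rV[R]_m -> X) : mch R k m -> chain R X k :=
  gmap (fun M => (fun t : D k => G (\val t *m M))).
HB.instance Definition _ k m G :=
  GRing.isZmodMorphism.Build (mch R k m) (chain R X k) (@real k m G)
    (@gmap_is_zmod _ _ _).

Lemma realU k m G M : @real k m G << M >> = << fun t : D k => G (\val t *m M) >>.
Proof. exact: gmapU. Qed.

Lemma bdU n (s : D n.+1 -> X) :
  bd (<< s >> : chain R X n.+1) = \sum_(i < n.+2) << (s \o @coface R n i) >> *~ (-1) ^+ i.
Proof.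
rewrite /bd /= liftU scale1r; apply: eq_bigr => i _; exact: freegUz.
Qed.

Lemma bd_real k m (G : 'rV[R]_m -> X) (u : mch R k.+1 m) :
  bd (real G u) = real G (mbd u).
Proof.
pose F := (@bd R X k.+1 \o @real k.+1 m G); pose F' := (@real k m G \o @mbd R k m).
apply: (@freeg_ext _ _ F F'); rewrite /F /F'; try exact: raddfB.
move=> M /=; rewrite realU mbdU raddf_sum; apply: etrans (bdU _) _; apply: eq_bigr => i _.
rewrite raddfMz /= realU; congr (<< _ >> *~ _); apply/funext => t /=.
by rewrite coface_row_dmx mulmxA.
Qed.

Lemma real_subst k m m' (G : 'rV[R]_m' -> X) (Q : 'M[R]_(m, m')) (u : mch R k m) :
  real G (subst Q u) = real (fun v => G (v *m Q)) u.
Proof.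
rewrite /real /subst gmap_comp; apply: (@eq_gmap_in _ _ (fun=> True)); last exact: fallT.
by move=> M _ /=; apply/funext => t; rewrite mulmxA.
Qed.

Lemma eq_real k m (W : set 'rV[R]_m) (G G' : 'rV[R]_m -> X) (u : mch R k m) :
  convexS W -> (forall v, W v -> G v = G' v) -> u \in fall (rows_in W) ->
  real G u = real G' u.
Proof.
move=> cW GG'; apply: eq_gmap_in => M MW; apply/funext => t; apply: GG'.
by apply: cW => //; have /set_mem := valP t.
Qed.

Lemma real_chain_in k m (W : set 'rV[R]_m) (G : 'rV[R]_m -> X) (A : set X) u :
  convexS W -> {within W, continuous G} -> (forall v, W v -> A (G v)) ->
  u \in fall (rows_in (k := k) W) -> real G u \in chain_in A.
Proof.
move=> cW cG GA; apply: gmap_fall => M MW.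
have DW (t : D k) : W (\val t *m M) by apply: cW => //; have /set_mem := valP t.
split=> [|t]; last exact: GA.
apply: (comp_within (B := W) (f := fun t : D k => \val t *m M)) => //.
exact: (cont_mulmx (@set_val_continuous _ (D k))).
Qed.

End Real.

End Operators.

(** * Operators on singular chains *)

Section SingularOperators.
Variable R : realType.
Local Notation D n := (std_simplex R n).

Lemma vertex_simplex n : D n (delta_mx 0 ord0).
Proof.
split=> [j|]; first by rewrite mxE ler0n.
rewrite (bigD1 ord0) //= mxE eqxx big1 ?addr0 // => j j0.
by rewrite mxE (negbTE j0).
Qed.

Definition vertex n : D n := exist (fun w => w \in D n) _ (mem_set (vertex_simplex n)).

(* The inverse of the inclusion of the simplex, with a junk value off it. *)
Definition ins n (v : 'rV[R]_n.+1) : D n := insubd (vertex n) v.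

Lemma insK n (v : 'rV[R]_n.+1) : D n v -> \val (ins v) = v.
Proof. by move=> Dv; rewrite /ins val_insubd mem_set. Qed.

Lemma val_ins n (t : D n) : ins (\val t) = t.
Proof. by rewrite /ins valKd. Qed.

Lemma ins_within n : {within D n, continuous (@ins n)}.
Proof.
apply/withinP => v Dv W; case=> /= V [[U oU UV] Vv VW]; rewrite /= in Vv *.
have Uv : U v by move: Vv; rewrite -UV /= set_valE insK.
change (\forall y \near v, D n y -> W (ins y)).
have := open_nbhs_nbhs (conj oU Uv); apply: filterS => y Uy Dy; apply: VW.
by rewrite -UV /= set_valE insK.
Qed.

Lemma coface_ins n (i : 'I_n.+2) (w : 'rV[R]_n.+1) : D n w ->
  ins (w *m dmx R n i) = coface i (ins w).
Proof.
move=> Dw; apply/val_inj; rewrite insK; last exact: dmx_simplex.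
by rewrite /= insK // coface_row_dmx.
Qed.

Section Push.
Variables X Y : topologicalType.

Definition push n (f : X -> Y) : chain R X n -> chain R Y n :=
  fglift (fun s : D n -> X => << (f \o s : D n -> Y) >> : chain R Y n).
HB.instance Definition _ n f :=
  GRing.isZmodMorphism.Build (chain R X n) (chain R Y n) (@push n f)
    (@gmap_is_zmod _ _ _).

Lemma pushU n f s : @push n f << s >> = << (f \o s : D n -> Y) >>.
Proof. exact: gmapU. Qed.

Lemma bd_push n f (c : chain R X n.+1) : bd (push f c) = push f (bd c).
Proof.
pose F := (@bd R Y n.+1 \o @push n.+1 f); pose F' := (@push n f \o @bd R X n.+1).
apply: (@freeg_ext _ _ F F'); rewrite /F /F'; try exact: raddfB.
move=> s /=; rewrite pushU; apply: etrans (bdU _) _; rewrite bdU.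
rewrite raddf_sum; apply: eq_bigr => i _.
by rewrite raddfMz /= pushU.
Qed.

Lemma bd_push' n f (c : chain R X n) : bd (push f c) = push f (bd c).
Proof. by case: n c => [|n] c; [rewrite /bd raddf0|exact: bd_push]. Qed.

Lemma push_chain_in n f (A : set X) (B : set Y) (c : chain R X n) :
  {within A, continuous f} -> (forall x, A x -> B (f x)) ->
  c \in chain_in A -> push f c \in chain_in B.
Proof.
move=> cf fAB; apply: gmap_fall => s [cs sA]; split=> [|t]; last exact/fAB/sA.
exact: (comp_within (B := A)).
Qed.

End Push.

Lemma push_comp (X Y Z : topologicalType) n (f : X -> Y) (g : Y -> Z) (c : chain R X n) :
  push g (push f c) = push (g \o f) c.
Proof.
rewrite /push -!/(gmap _ _) gmap_comp.
by apply: (@eq_gmap_in _ _ (fun=> True)); last exact: fallT.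
Qed.

Lemma eq_push (X Y : topologicalType) n (f g : X -> Y) (A : set X) (c : chain R X n) :
  (forall x, A x -> f x = g x) -> c \in chain_in A -> push f c = push g c.
Proof.
move=> fg; apply: eq_gmap_in => s [_ sA]; apply/funext => t /=.
exact/fg/sA.
Qed.

Lemma push_id (X : topologicalType) n (c : chain R X n) : push id c = c.
Proof.
apply: (@freeg_ext _ _ (@push X X n id) id); try exact: raddfB; first by [].
by move=> s; rewrite pushU.
Qed.

Lemma chain_inW (X : topologicalType) n (A B : set X) (c : chain R X n) :
  A `<=` B -> c \in chain_in A -> c \in chain_in B.
Proof. by move=> AB; apply: fallW => s [cs sA]; split=> // t; apply/AB/sA. Qed.

Lemma chain_inI (X : topologicalType) n (A B : set X) (c : chain R X n) :
  c \in chain_in A -> c \in chain_in B -> c \in chain_in (A `&` B).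
Proof.
move=> /asboolP cA /asboolP cB; apply/asboolP => s sc.
by have [cs sA] := cA s sc; have [_ sB] := cB s sc; split.
Qed.

Lemma chain_in0 (X : topologicalType) n (c : chain R X n) :
  c \in chain_in set0 -> c = 0.
Proof.
move=> /asboolP h; apply/eqP; rewrite -dom_eq0; case E : (dom c) => [//|s l].
have [|_ /(_ (vertex n)) //] := h s; by rewrite E inE eqxx.
Qed.

Lemma chain_inU (X : topologicalType) n (A : set X) (s : D n -> X) :
  continuous s -> (forall t, A (s t)) -> (<< s >> : chain R X n) \in chain_in A.
Proof. by move=> cs sA; apply: fallU. Qed.

Lemma coface_continuous n (i : 'I_n.+2) : continuous (@coface R n i).
Proof.
apply: cont_set_type; rewrite (_ : _ \o _ = fun v : D n => \val v *m dmx R n i).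
  exact: (cont_mulmx (@set_val_continuous _ (D n))).
by apply/funext => v /=; rewrite coface_row_dmx.
Qed.

Lemma bd_chain_in (X : topologicalType) n (A : set X) (c : chain R X n) :
  c \in chain_in A -> bd c \in chain_in A.
Proof.
case: n c => [|n] c; first by rewrite rpred0.
apply: fglift_fall => s [cs sA]; apply: rpred_sum => i _.
rewrite freegUz rpredMz //; apply: fallU; split=> [|t /=]; last exact: sA.
by move=> t; apply: continuous_comp; [exact: coface_continuous|exact: cs].
Qed.

(** Every simplex is the realization of an identity matrix, which reduces the claim to the
    simplicial identities for [dmx]. *)
Lemma bd_bd (X : topologicalType) n (c : chain R X n.+2) : bd (bd c : chain R X n.+1) = 0.
Proof.
pose F := (@bd R X n.+1 \o @bd R X n.+2); pose F' := (fun _ : chain R X n.+2 => 0 : chain R X n).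
apply: (@freeg_ext _ _ F F'); rewrite /F /F'; first exact: raddfB.
  by move=> x y; rewrite subr0.
move=> s /=; have -> : (<< s >> : chain R X n.+2) = real (s \o @ins _) << 1%:M >>.
  by rewrite realU; congr << _ >>; apply/funext => t /=; rewrite mulmx1 val_ins.
rewrite !bd_real.
have -> : mbd (<< 1%:M >> : mch R n.+2 n.+3) = fsum n.+3 (dmx R n.+1) (idch R n.+1).
  exact: (proj2 (idch_natural R)).
rewrite mbd_fsum (proj2 (idch_natural R)) fsum_fsum ?raddf0 //; exact: dmx_dmx.
Qed.

Section Op.
Variable A : forall n, mch R n n.+1.
Hypotheses (natA : natural_chain A) (stoA : sto A).

Definition opch (X : topologicalType) n : chain R X n -> chain R X n :=
  flift (fun s : D n -> X => real (s \o @ins n) (A n)).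
HB.instance Definition _ (X : topologicalType) n :=
  GRing.isZmodMorphism.Build (chain R X n) (chain R X n) (@opch X n)
    (@flift_is_zmod _ _ _).

Definition prismf (X Y : topologicalType) n (H : R * X -> Y) (s : D n -> X)
  (v : 'rV[R]_(1 + n.+1)) : Y := H (lsubmx v 0 0, s (ins (rsubmx v))).

Definition hch (X Y : topologicalType) n (H : R * X -> Y) : chain R X n -> chain R Y n.+1 :=
  flift (fun s : D n -> X => real (prismf H s) (prism A n)).
HB.instance Definition _ (X Y : topologicalType) n H :=
  GRing.isZmodMorphism.Build (chain R X n) (chain R Y n.+1) (@hch X Y n H)
    (@flift_is_zmod _ _ _).

Section Boundary.
Variables X Y : topologicalType.

Lemma opchU n (s : D n -> X) : opch << s >> = real (s \o @ins n) (A n).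
Proof. exact: fliftU. Qed.

Lemma hchU n (H : R * X -> Y) (s : D n -> X) :
  hch H << s >> = real (prismf H s) (prism A n).
Proof. exact: fliftU. Qed.

Lemma opch_chain_in n (B : set X) (c : chain R X n) :
  c \in chain_in B -> opch c \in chain_in B.
Proof.
apply: flift_fall => s [cs sB]; apply: (real_chain_in (W := D n)).
- exact: convex_simplex.
- apply: (within_comp (B := setT)) => //; first exact: ins_within.
  exact/cont_within.
- by move=> v _; apply: sB.
- exact: stoA.
Qed.

Lemma bd_opch n (c : chain R X n) : bd (opch c) = opch (bd c).
Proof.
case: n c => [|n] c; first by rewrite /bd raddf0.
pose F := (@bd R X n.+1 \o @opch X n.+1); pose F' := (@opch X n \o @bd R X n.+1).
apply: (@freeg_ext _ _ F F'); rewrite /F /F'; try exact: raddfB.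
move=> s /=; rewrite opchU; apply: etrans (bd_real _ _) _; rewrite (proj2 natA).
rewrite bdU.
rewrite !raddf_sum; apply: eq_bigr => i _.
rewrite !raddfMz /= real_subst opchU; congr (_ *~ _).
apply: (eq_real (W := D n)) => //; first exact: convex_simplex.
by move=> v Dv /=; rewrite coface_ins.
Qed.

Lemma hch_chain_in n (H : R * X -> Y) (B : set X) (B' : set Y) (c : chain R X n) :
  {within `[0, 1] `*` B, continuous H} ->
  (forall s x, 0 <= s <= 1 -> B x -> B' (H (s, x))) ->
  c \in chain_in B -> hch H c \in chain_in B'.
Proof.
move=> cH HB; apply: flift_fall => s [cs sB].
apply: (real_chain_in (W := @prism_set R n)); last exact: prism_fall.
- exact: convex_prism.
- pose f (v : 'rV[R]_(1 + n.+1)) : (R * X)%type := (lsubmx v 0 0, s (ins (rsubmx v))).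
  suff cf : {within @prism_set R n, continuous f}.
    apply: (@within_comp _ _ _ _ _ f H cf) cH => v [v0 v1].
    by split=> /=; [rewrite in_itv|exact: sB].
  apply/withinP => v Wv.
  have h1 : (fun v : 'rV[R]_(1 + n.+1) => lsubmx v 0 0) @ within (@prism_set R n) (nbhs v)
      --> lsubmx v 0 0.
    rewrite mxE; under eq_fun do rewrite mxE.
    by apply: cvg_within_filter; apply: coord_continuous.
  have c1 : {within @prism_set R n, continuous (s \o (@ins n \o rsubmx))}.
    apply: (within_comp (B := setT)) => //; last exact/cont_within.
    apply: (within_comp (B := D n)) => [|x []|] //; last exact: ins_within.
    apply: continuous_subspaceT; apply: cont_rV => j.
    under eq_fun do rewrite mxE; exact: coord_continuous.
  by apply: (cvg_pair h1); move/withinP : c1 => /(_ v); apply.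
- by move=> v [v0 v1]; apply: HB.
Qed.

Lemma prismf0 n (H : R * X -> Y) (s : D n -> X) (x : 'rV[R]_n.+1) : D n x ->
  prismf H s (x *m inc0 R n) = H (0, s (ins x)).
Proof.
by move=> Dx; rewrite /prismf /inc0 mul_mx_row mulmx0 mulmx1 row_mxKl row_mxKr mxE.
Qed.

Lemma prismf1 n (H : R * X -> Y) (s : D n -> X) (x : 'rV[R]_n.+1) : D n x ->
  prismf H s (x *m inc1 R n) = H (1, s (ins x)).
Proof.
move=> Dx; rewrite /prismf /inc1 mul_mx_row mulmx1 row_mxKl row_mxKr mxE.
by case: Dx => _ x1; under eq_bigr do rewrite mxE mulr1; rewrite x1.
Qed.

Lemma real_inc0 n (H : R * X -> Y) (s : D n -> X) :
  real (prismf H s) << inc0 R n >> = push (fun x => H (0, x)) << s >>.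
Proof.
rewrite realU pushU; congr << _ >>; apply/funext => t /=.
by rewrite prismf0 ?val_ins //; have /set_mem := valP t.
Qed.

Lemma real_inc1 n (H : R * X -> Y) (s : D n -> X) :
  real (prismf H s) (subst (inc1 R n) (A n)) =
  push (fun x => H (1, x)) (opch << s >>).
Proof.
rewrite real_subst opchU /push -/(gmap _ _) /real gmap_comp.
apply: (eq_gmap_in (P := rows_in (D n))); last exact: stoA.
move=> M MW; apply/funext => t /=; rewrite prismf1 //.
by apply: (@convex_simplex R n) => //; have /set_mem := valP t.
Qed.

Lemma bd_hch0 (H : R * X -> Y) (c : chain R X 0) :
  bd (hch H c) = push (fun x => H (1, x)) (opch c) - push (fun x => H (0, x)) c.
Proof.
pose F := (@bd R Y 1 \o @hch X Y 0 H).
pose F' := (fun c : chain R X 0 =>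
  push (fun x => H (1, x)) (opch c) - push (fun x => H (0, x)) c).
apply: (@freeg_ext _ _ F F'); rewrite /F /F'; first exact: raddfB.
  by move=> x y; rewrite (raddfB (@opch X 0)) !(raddfB (@push X Y 0 _)) !opprD addrACA.
move=> s /=; rewrite hchU; apply: etrans (bd_real _ _) _.
by rewrite (mbd_prism0 natA) raddfB /= real_inc0 real_inc1.
Qed.

(** With [idch] this is homotopy invariance; with [sd] and the projection as homotopy it compares a
    chain with its subdivision. *)
Lemma bd_hch n (H : R * X -> Y) (c : chain R X n.+1) :
  bd (hch H c) = push (fun x => H (1, x)) (opch c) - push (fun x => H (0, x)) c
                 - hch H (bd c).
Proof.
pose F := (@bd R Y n.+2 \o @hch X Y n.+1 H).
pose F' := (fun c : chain R X n.+1 =>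
  push (fun x => H (1, x)) (opch c) - push (fun x => H (0, x)) c - hch H (bd c)).
apply: (@freeg_ext _ _ F F'); rewrite /F /F'; first exact: raddfB.
  move=> x y; rewrite (raddfB (@opch X _)) !(raddfB (@push X Y _ _)).
  rewrite (raddfB (@bd R X _)) (raddfB (@hch X Y _ H)) !opprD.
  by rewrite [X in X + _ = _]addrACA [LHS]addrACA.
move=> s /=; rewrite hchU; apply: etrans (bd_real _ _) _.
rewrite (mbd_prism natA) !(raddfB (real _)) /= real_inc0 real_inc1; congr (_ - _).
rewrite bdU !raddf_sum; apply: eq_bigr => i _.
rewrite !raddfMz /= real_subst hchU; congr (_ *~ _).
apply: (eq_real (@convex_prism R n)); last exact: prism_fall.
move=> v [v0 v1]; rewrite /prismf -[v in v *m _]hsubmxK /pdmx mul_row_block.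
rewrite !mulmx0 mulmx1 addr0 add0r row_mxKl row_mxKr /=.
by rewrite coface_ins.
Qed.

End Boundary.
End Op.
End SingularOperators.

(** * Homology classes and homotopy invariance *)

Section HomologyClasses.
Local Open Scope quotient_scope.
Variable R : realType.
Local Notation D n := (std_simplex R n).

(** For a relative cycle this says that its class in H_n(A, B) is zero. Stated for all chains it is
    a subgroup, and most arguments can stay on chains without forming classes. *)
Definition bounds (X : topologicalType) n (A B : set X) : {pred chain R X n} :=
  fun c => `[< exists2 e : chain R X n.+1, e \in chain_in A & c - bd e \in chain_in B >].

Lemma bounds_zmod (X : topologicalType) n (A B : set X) : zmod_closed (@bounds X n A B).
Proof.
split.
  apply/asboolP; exists (0 : chain R X n.+1); first exact: rpred0.
  by rewrite (raddf0 (@bd R X n.+1)) subrr rpred0.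
move=> a b /asboolP[e eA ea] /asboolP[f fA fb]; apply/asboolP.
exists (e - f); first exact: rpredB.
have -> : a - b - bd (e - f) = (a - bd e) - (b - bd f).
  by rewrite (raddfB (@bd _ _ _)) !opprD !opprK addrACA.
exact: rpredB.
Qed.
HB.instance Definition _ (X : topologicalType) n (A B : set X) :=
  GRing.isZmodClosed.Build (chain R X n) (@bounds X n A B) (@bounds_zmod X n A B).

Section Basic.
Variables (X : topologicalType) (n : nat).
Implicit Types (A B : set X) (c : chain R X n).

Lemma boundsP A B c : c \in bounds A B <->
  exists2 e : chain R X n.+1, e \in chain_in A & c - bd e \in chain_in B.
Proof. by split=> [/asboolP|h]; last apply/asboolP. Qed.

Lemma bounds_bd A B (e : chain R X n.+1) : e \in chain_in A -> bd e \in bounds A B.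
Proof. by move=> eA; apply/boundsP; exists e; rewrite ?subrr ?rpred0. Qed.

Lemma bounds_in A B c : c \in chain_in B -> c \in bounds A B.
Proof.
move=> cB; apply/boundsP; exists (0 : chain R X n.+1); first exact: rpred0.
by rewrite (raddf0 (@bd R X n.+1)) subr0.
Qed.

Lemma boundsW A B A' B' c : A `<=` A' -> B `<=` B' -> c \in bounds A B ->
  c \in bounds A' B'.
Proof.
move=> AA BB /boundsP[e eA ce]; apply/boundsP; exists e; first exact: chain_inW eA.
exact: chain_inW ce.
Qed.

Lemma bounds0P A c : c \in bounds A set0 ->
  exists2 e : chain R X n.+1, e \in chain_in A & c = bd e.
Proof.
by move=> /boundsP[e eA /chain_in0/eqP]; rewrite subr_eq0 => /eqP ->; exists e.
Qed.

Lemma is_cycleP A B c : c \in is_cycle A B <-> c \in chain_in A /\ bd c \in chain_in B.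
Proof. by split=> [/andP[]|[? ?]] //; apply/andP. Qed.

Lemma is_cycleW A B A' B' c : A `<=` A' -> B `<=` B' ->
  c \in is_cycle A B -> c \in is_cycle A' B'.
Proof.
by move=> AA BB /is_cycleP[cA cB]; apply/is_cycleP; split; apply: chain_inW _ cA || apply: chain_inW _ cB.
Qed.

Lemma hclassE A B c c' : c \in is_cycle A B -> c' \in is_cycle A B ->
  hclass A B c = hclass A B c' <-> c - c' \in bounds A B.
Proof.
move=> cc cc'; have -> : hclass A B c = hclass A B c' <->
    (insubd (0 : cycles R n A B) c - insubd 0 c') \in @is_boundary R X n A B.
  by rewrite Quotient.idealrBE; split=> [h|/eqP h]; [exact/eqP|exact: h].
split=> [/asboolP[e eA ce]|/boundsP[e eA ce]].
  apply/boundsP; exists e => //.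
  by move: ce; rewrite raddfB /= !insubdK.
by apply/asboolP; exists e => //; rewrite raddfB /= !insubdK.
Qed.

Lemma hclass_ex A B (x : homology R n A B) :
  exists2 c, c \in is_cycle A B & x = hclass A B c.
Proof.
exists (\val (repr x)); first exact: valP.
by rewrite /hclass valKd reprK.
Qed.

Lemma hclassB A B c c' : c \in is_cycle A B -> c' \in is_cycle A B ->
  hclass A B (c - c') = hclass A B c - hclass A B c'.
Proof.
move=> cc cc'; rewrite /hclass -(raddfB (\pi_(homology R n A B))); congr (\pi _).
by apply/val_inj; rewrite /= !insubdK ?rpredB.
Qed.

Lemma hclass0 A B : hclass A B (0 : chain R X n) = 0.
Proof. by rewrite -(subrr (0 : chain R X n)) hclassB ?rpred0 // subrr. Qed.

Lemma hclassN A B c : c \in is_cycle A B -> hclass A B (- c) = - hclass A B c.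
Proof. by move=> cc; rewrite -[X in hclass _ _ X]sub0r hclassB ?rpred0 // hclass0 sub0r. Qed.

Lemma hclassD A B c c' : c \in is_cycle A B -> c' \in is_cycle A B ->
  hclass A B (c + c') = hclass A B c + hclass A B c'.
Proof.
by move=> cc cc'; rewrite -[c' in LHS]opprK hclassB ?rpredN // hclassN // opprK.
Qed.

Lemma hclassMz A B c (k : int) : c \in is_cycle A B ->
  hclass A B (c *~ k) = hclass A B c *~ k.
Proof.
move=> cc; have H m : hclass A B (c *+ m) = hclass A B c *+ m.
  elim: m => [|m IH]; first by rewrite !mulr0n hclass0.
  by rewrite !mulrS hclassD ?rpredMn // IH.
case: k => m; first exact: H.
by rewrite NegzE !mulrNz -sub0r hclassB ?rpred0 ?rpredMn // hclass0 sub0r H.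
Qed.

Lemma hclass_eq0 A B c : c \in is_cycle A B -> hclass A B c = 0 <-> c \in bounds A B.
Proof. by move=> cc; rewrite -(hclass0 A B) hclassE ?rpred0 // subr0. Qed.

Lemma repr_hclass A B c : c \in is_cycle A B ->
  \val (repr (hclass A B c)) - c \in bounds A B.
Proof.
move=> cc; set y := hclass A B c; apply/hclassE => //; first exact: (valP (repr y)).
by rewrite /hclass valKd reprK.
Qed.

End Basic.

Lemma bounds_push (X Y : topologicalType) n (f : X -> Y) (A B : set X) (A' B' : set Y)
    (c : chain R X n) :
  {within A, continuous f} -> {within B, continuous f} ->
  (forall x, A x -> A' (f x)) -> (forall x, B x -> B' (f x)) ->
  c \in bounds A B -> push f c \in bounds A' B'.
Proof.
move=> cA cB fA fB /boundsP[e eA ce]; apply/boundsP; exists (push f e).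
  exact: push_chain_in eA.
by rewrite bd_push -(raddfB (@push R X Y n f)); apply: push_chain_in ce.
Qed.

Lemma is_cycle_push (X Y : topologicalType) n (f : X -> Y) (A B : set X) (A' B' : set Y)
    (c : chain R X n) :
  {within A, continuous f} -> {within B, continuous f} ->
  (forall x, A x -> A' (f x)) -> (forall x, B x -> B' (f x)) ->
  c \in is_cycle A B -> push f c \in is_cycle A' B'.
Proof.
move=> cA cB fA fB /is_cycleP[hA hB]; apply/is_cycleP; rewrite bd_push'.
by split; apply: push_chain_in _ _ hA || apply: push_chain_in _ _ hB.
Qed.

Lemma hmapE (X Y : topologicalType) n (f : X -> Y) (A B : set X) (A' B' : set Y)
    (c : chain R X n) :
  {within A, continuous f} -> {within B, continuous f} ->
  (forall x, A x -> A' (f x)) -> (forall x, B x -> B' (f x)) ->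
  c \in is_cycle A B -> hmap A' B' f (hclass A B c) = hclass A' B' (push f c).
Proof.
move=> cA cB fA fB cc; rewrite /hmap -/(push f _); apply/hclassE.
- by apply: (is_cycle_push (A := A) (B := B)) => //; exact: (valP (repr _)).
- exact: (is_cycle_push (A := A) (B := B)).
rewrite -(raddfB (@push R X Y n f)); apply: (bounds_push (A := A) (B := B)) => //.
exact: repr_hclass.
Qed.

Lemma connectingE (X : topologicalType) n (A B : set X) (c : chain R X n.+1) :
  c \in is_cycle A B -> connecting (hclass A B c) = hclass B set0 (bd c).
Proof.
move=> cc; have cyc (c' : chain R X n.+1) : c' \in is_cycle A B ->
    (bd c' : chain R X n) \in is_cycle B set0.
  move=> /is_cycleP[_ bB]; apply/is_cycleP; split => //.
  case: n {cc c} c' bB => [|m] c' _; first exact: rpred0.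
  by rewrite bd_bd rpred0.
apply/hclassE; try exact: cyc; first exact: cyc (valP (repr _)).
have /boundsP[e eA h] := repr_hclass cc; rewrite -(raddfB (@bd R X n.+1)).
apply/boundsP; exists (\val (repr (hclass A B c)) - c - bd e) => //.
have e0 : bd (bd e : chain R X n.+1) = 0 := bd_bd e.
have e1 (z : chain R X n.+1) : bd (z - bd e) = bd z.
  by transitivity (bd z - bd (bd e : chain R X n.+1)); [exact: raddfB|rewrite e0 subr0].
by rewrite e1 subrr rpred0.
Qed.

Section Homotopy.
Variables (X Y : topologicalType) (A : forall n, mch R n n.+1).
Hypotheses (natA : natural_chain A) (stoA : sto A).

Lemma hch_bounds n (H : R * X -> Y) (B C : set X) (B' C' : set Y) (c : chain R X n) :
  {within `[0, 1] `*` B, continuous H} ->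
  (forall s x, 0 <= s <= 1 -> B x -> B' (H (s, x))) ->
  (forall s x, 0 <= s <= 1 -> B x -> C x -> C' (H (s, x))) ->
  c \in chain_in B -> bd c \in chain_in C ->
  push (fun x => H (1, x)) (opch A c) - push (fun x => H (0, x)) c \in bounds B' C'.
Proof.
move=> cH HB HC cB cC; apply/boundsP; exists (hch A H c).
  exact: (hch_chain_in stoA cH).
case: n c cB cC => [|n] c cB cC; first by rewrite bd_hch0 // subrr rpred0.
rewrite bd_hch // opprB addrCA subrr addr0.
(* The sides of the prism lie over the boundary of c, which is a chain in both B and C; only there
   is H known to stay in C'. *)
apply: (@hch_chain_in _ _ stoA _ _ _ _ (B `&` C)) => //.
- by apply: continuous_subspaceW cH => -[s x] [? []].
- by move=> s x s01 [Bx Cx]; exact: HC.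
- by apply: (@chain_inI _ _ n) => //; exact: (bd_chain_in cB).
Qed.

End Homotopy.

Lemma opch_id (X : topologicalType) n (c : chain R X n) : opch (idch R) c = c.
Proof.
apply: (@freeg_ext _ _ (@opch R (idch R) X n) id); try exact: raddfB; first by [].
move=> s; rewrite opchU realU; congr << _ >>; apply/funext => t /=.
by rewrite mulmx1 val_ins.
Qed.

Lemma homotopy_bounds (X Y : topologicalType) n (H : R * X -> Y) (B C : set X)
    (B' C' : set Y) (c : chain R X n) :
  {within `[0, 1] `*` B, continuous H} ->
  (forall s x, 0 <= s <= 1 -> B x -> B' (H (s, x))) ->
  (forall s x, 0 <= s <= 1 -> B x -> C x -> C' (H (s, x))) ->
  c \in chain_in B -> bd c \in chain_in C ->
  push (fun x => H (1, x)) c - push (fun x => H (0, x)) c \in bounds B' C'.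
Proof.
move=> cH HB HC cB cC; rewrite -[X in push _ X - _]opch_id.
exact: (hch_bounds (@idch_natural R) (@idch_sto R) cH HB HC).
Qed.

Definition Sd (X : topologicalType) n : chain R X n -> chain R X n := @opch R (sd R) X n.
HB.instance Definition _ (X : topologicalType) n :=
  GRing.Additive.on (@Sd X n).

Lemma within_snd (X Y : topologicalType) (S : set Y) (B : set X) :
  {within S `*` B, continuous (snd : Y * X -> X)}.
Proof. by apply: continuous_subspaceT => x; apply: cvg_snd. Qed.

(** The homotopy is constant, so that the prism over it interpolates between c and its
    subdivision. *)
Lemma Sd_bounds (X : topologicalType) n (B C : set X) (c : chain R X n) :
  c \in is_cycle B C -> Sd c - c \in bounds B C.
Proof.
move=> /is_cycleP[cB cC].
have := hch_bounds (@sd_natural R) (@sd_sto R) (H := snd) (B := B) (C := C)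
  (B' := B) (C' := C) (c := c).
by rewrite !push_id; apply => //; exact: within_snd.
Qed.

Lemma Sd_chain_in (X : topologicalType) n (B : set X) (c : chain R X n) :
  c \in chain_in B -> Sd c \in chain_in B.
Proof. exact: opch_chain_in (@sd_sto R) _ _ _ _. Qed.

Lemma bd_Sd (X : topologicalType) n (c : chain R X n) : bd (Sd c) = Sd (bd c).
Proof. exact: bd_opch (@sd_natural R) (@sd_sto R) _ _ _. Qed.

Lemma iter_Sd_chain_in (X : topologicalType) n (B : set X) m (c : chain R X n) :
  c \in chain_in B -> iter m (@Sd X n) c \in chain_in B.
Proof. by move=> cB; elim: m => [//|m IH]; exact: Sd_chain_in. Qed.

Lemma bd_iter_Sd (X : topologicalType) n m (c : chain R X n) :
  bd (iter m (@Sd X n) c) = iter m (@Sd X n.-1) (bd c).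
Proof. by elim: m => [//|m IH]; rewrite /= bd_Sd IH. Qed.

Lemma iter_SdB (X : topologicalType) n m : zmod_morphism (iter m (@Sd X n)).
Proof. by move=> a b; elim: m => [//|m IH]; rewrite !iterS IH raddfB. Qed.

Lemma iter_Sd_cycle (X : topologicalType) n (B C : set X) m (c : chain R X n) :
  c \in is_cycle B C -> iter m (@Sd X n) c \in is_cycle B C.
Proof.
move=> /is_cycleP[cB cC]; apply/is_cycleP; rewrite bd_iter_Sd.
by split; exact: iter_Sd_chain_in.
Qed.

Lemma iter_Sd_bounds (X : topologicalType) n (B C : set X) m (c : chain R X n) :
  c \in is_cycle B C -> iter m (@Sd X n) c - c \in bounds B C.
Proof.
move=> cc; elim: m => [|m IH]; first by rewrite subrr rpred0.
rewrite -[X in X \in _](subrKA (iter m (@Sd X n) c)) rpredD //=.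
by apply: Sd_bounds; exact: iter_Sd_cycle.
Qed.

End HomologyClasses.

(** * Lebesgue numbers and chains of small simplices *)

Lemma lebesgue_number (R : realType) (V : normedModType R) (X : topologicalType)
    (K : set V) (f : V -> X) (cov : set (set X)) :
  compact K -> {within K, continuous f} -> (forall O, cov O -> open O) ->
  (forall x, K x -> exists2 O, cov O & O (f x)) ->
  exists2 e : R, 0 < e & forall x, K x ->
    exists2 O, cov O & forall y, K y -> `|x - y| < e -> O (f y).
Proof.
move=> /compact_near_coveringP cK /withinP cf oc cv.
pose P (e : R) (x : V) :=
  exists2 O, cov O & forall y, K y -> `|x - y| < e -> O (f y).
have H : \forall e \near 0^'+, K `<=` P e.
  apply: cK => x Kx; have [O cO Ox] := cv x Kx.
  have : \forall y \near x, K y -> O (f y).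
    by have := cf x Kx O (open_nbhs_nbhs (conj (oc _ cO) Ox)).
  move=> /nbhs_ballP[d /= d0 hd].
  (* Half of d is spent on moving the centre from x to y and half on the radius around y. *)
  have d2 : 0 < d / 2 by rewrite divr_gt0.
  exists (ball x (d / 2), [set e : R | 0 < e /\ e < d / 2]); first split => /=.
  + exact: nbhsx_ballx.
  + near=> e; split; first by near: e; exact: nbhs_right_gt.
    by near: e; exact: nbhs_right_lt.
  move=> [y e] /= [xy [e0 ed]]; exists O => // z Kz yz.
  apply: hd => //; rewrite -ball_normE /ball_ /= in xy *.
  rewrite -(subrKA y) (le_lt_trans (ler_normD _ _)) // (splitr d) ltrD //.
  exact: lt_trans ed.
have /filter_ex[e [e0 he]] : \forall e \near 0^'+, 0 < e /\ K `<=` P e.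
  by near=> e; split; near: e => //; exact: nbhs_right_gt.
by exists e.
Unshelve. all: by end_near. Qed.

Section Small.
Variable R : realType.
Local Notation D n := (std_simplex R n).

Definition mesh k m (M : 'M[R]_(k.+1, m)) (d : R) :=
  forall i j, `|row i M - row j M| <= d.

Lemma convex_norm k m (M : 'M[R]_(k.+1, m)) v w (d : R) : D k v ->
  (forall i, `|w - row i M| <= d) -> `|w - v *m M| <= d.
Proof.
move=> [v0 v1] h.
have -> : w - v *m M = \sum_i v 0 i *: (w - row i M).
  rewrite mulmx_sum_row; under [RHS]eq_bigr do rewrite scalerBr.
  by rewrite sumrB -scaler_suml v1 scale1r.
apply: le_trans (ler_norm_sum _ _ _) _; rewrite -[d]mul1r -v1 mulr_suml.
apply: ler_sum => i _; rewrite normrZ ger0_norm // ler_wpM2l //.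
Qed.

(** In the average that defines the barycentre one of the n+1 terms is the vertex itself, whence the
    factor n/(n+1). The bound is claimed for all affine images Q because the induction uses it on
    faces. *)
Lemma sd_mesh n : sd R n \in fall (fun M => rows_in (D n) M /\
  forall m (Q : 'M[R]_(n.+1, m)) d, mesh Q d -> mesh (M *m Q) (n%:R / n.+1%:R * d)).
Proof.
elim: n => [|n IH].
  apply: fallU; split=> [|m Q d _ i j]; first exact: rows_in1.
  by rewrite (ord1 i) (ord1 j) subrr normr0 mul0r mul0r.
apply: (gmap_fall (P := fun M => rows_in (D n.+1) M /\
  forall m (Q : 'M[R]_(n.+2, m)) d, mesh Q d -> mesh (M *m Q) (n%:R / n.+1%:R * d))).
  move=> M [MD hM]; split; first by apply: rows_in_cone => //; exact: bary_simplex.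
  move=> m Q d hQ.
  have d0 : 0 <= d by apply: le_trans (hQ ord0 ord0).
  have rc a : row (fintype.lift ord0 a) (conemx (bary R n.+1) M *m Q) = row a (M *m Q).
    rewrite !row_mul; congr (_ *m _); apply/rowP => j; rewrite !mxE liftK //.
  have r0 : row ord0 (conemx (bary R n.+1) M *m Q) = bary R n.+1 *m Q.
    by rewrite row_mul; congr (_ *m _); apply/rowP => j; rewrite !mxE unlift_none.
  have hb a : `|bary R n.+1 *m Q - row a (M *m Q)| <= n.+1%:R / n.+2%:R * d.
    rewrite row_mul; apply: convex_norm; first exact: MD.
    move=> i; rewrite mulmx_sum_row.
    have -> : \sum_j bary R n.+1 0 j *: row j Q - row i Q =
        \sum_j n.+2%:R^-1 *: (row j Q - row i Q).
      under [RHS]eq_bigr do rewrite scalerBr; rewrite sumrB; congr (_ - _).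
        by apply: eq_bigr => j _; rewrite mxE.
      by rewrite sumr_const card_ord -scaler_nat scalerA mulfV ?scale1r // pnatr_eq0.
    rewrite (bigD1 i) //= subrr scaler0 add0r.
    apply: le_trans (ler_norm_sum _ _ _) _.
    apply: (@le_trans _ _ (\sum_(j < n.+2 | j != i) n.+2%:R^-1 * d)).
      apply: ler_sum => j _; rewrite normrZ ger0_norm ?invr_ge0 ?ler0n //.
      by rewrite ler_wpM2l ?invr_ge0 ?ler0n.
    rewrite sumr_const (_ : #|_| = n.+1); last first.
      by rewrite cardC1 card_ord.
    by rewrite -mulrnAl -(mulr_natl (n.+2%:R^-1)).
  move=> i j; have [a ->|->] := unliftP ord0 i; have [b ->|->] := unliftP ord0 j.
  - rewrite !rc; apply: le_trans (hM _ _ _ hQ _ _) _; rewrite ler_wpM2r //.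
    rewrite ler_pdivrMr ?ltr0n // mulrAC ler_pdivlMr ?ltr0n // -!natrM ler_nat; nia.
  - by rewrite rc r0 distrC.
  - by rewrite rc r0.
  - by rewrite subrr normr0 mulr_ge0 // divr_ge0 ?ler0n.
have := sd_sto R n => _.
rewrite /fsum rpred_sum // => i _; rewrite rpredMz //.
apply: gmap_fall IH => M [MD hM]; split.
  by apply: rows_in_mul MD; exact: dmx_simplex.
move=> m Q d hQ; rewrite -mulmxA; apply: hM => a b.
have rE c : row c (dmx R n i *m Q) = row (fintype.lift i c) Q.
  by apply/rowP => j; rewrite mxE (@dmx_mulE _ _ _ _ _ _ (fintype.lift i c)) // mxE.
by rewrite !rE.
Qed.

Definition affine_terms (X : topologicalType) n (s : D n -> X) (d : R) (s' : D n -> X) :=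
  exists M : 'M[R]_(n.+1), [/\ rows_in (D n) M, mesh M d &
    s' = (fun t : D n => s (ins (\val t *m M)))].

Lemma Sd_affine (X : topologicalType) n (s : D n -> X) d c :
  c \in fall (affine_terms s d) ->
  @Sd R X n c \in fall (affine_terms s (n%:R / n.+1%:R * d)).
Proof.
apply: flift_fall => _ [M [MD hM ->]].
apply: gmap_fall (sd_mesh n) => M' [M'D hM'].
exists (M' *m M); split; last 2 first.
- exact: hM'.
- apply/funext => t /=; rewrite insK ?mulmxA //.
  by apply: (@convex_simplex R n) => //; have /set_mem := valP t.
by move=> i; rewrite row_mul; apply: (@convex_simplex R n) => //; exact: M'D.
Qed.

Lemma iter_Sd_affine (X : topologicalType) n (s : D n -> X) (e : R) : 0 < e ->
  exists m, iter m (@Sd R X n) << s >> \in fall (affine_terms s e).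
Proof.
(* A crude bound for the diameter of the standard simplex. *)
move=> e0; pose d0 : R := \sum_i \sum_j `|row i (1%:M : 'M[R]_n.+1) - row j 1%:M|.
have h0 : << s >> \in fall (affine_terms s d0).
  apply: fallU; exists 1%:M; split; first exact: rows_in1.
    move=> i j; rewrite /d0 (bigD1 i) //= (bigD1 j) //= -addrA lerDl addr_ge0 //.
      by apply: sumr_ge0.
    by apply: sumr_ge0 => k _; apply: sumr_ge0.
  by apply/funext => t; rewrite mulmx1 val_ins.
pose q : R := n%:R / n.+1%:R.
have hm m : iter m (@Sd R X n) << s >> \in fall (affine_terms s (q ^+ m * d0)).
  elim: m => [|m IH]; first by rewrite expr0 mul1r.
  by rewrite iterS exprS -mulrA; apply: Sd_affine.
have q1 : `|q| < 1.
  by rewrite ger0_norm ?divr_ge0 ?ler0n // ltr_pdivrMr ?ltr0n // mul1r ltr_nat.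
have : (fun m => q ^+ m * d0) @ \oo --> (0 * d0 : R).
  by apply: cvgM; [exact: cvg_expr|exact: cvg_cst].
rewrite mul0r => /cvgrPdist_lt /(_ _ e0)[m _ /(_ m)] /= /(_ (leqnn _)).
rewrite sub0r normrN => hlt; exists m; apply: fallW (hm m) => s' [M [MD hM ->]].
by exists M; split=> // i j; apply: le_trans (hM i j) _; apply: le_trans (ler_norm _) (ltW hlt).
Qed.

Definition small (X : topologicalType) (cov : set (set X)) n (s : D n -> X) :=
  continuous s /\ exists2 O, cov O & forall t, O (s t).

Lemma Sd_small (X : topologicalType) (cov : set (set X)) n (c : chain R X n) :
  c \in fall (@small X cov n) -> Sd c \in fall (@small X cov n).
Proof.
apply: (fall_ind (Q := fun c => Sd c \in fall (@small X cov n))).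
- by rewrite raddf0 rpred0.
- by move=> a b ha hb; rewrite raddfB rpredB.
move=> s [cs [O cO sO]]; have : Sd (<< s >> : chain R X n) \in chain_in O.
  by apply: Sd_chain_in; exact: chain_inU.
by apply: fallW => s' [cs' s'O]; split=> //; exists O.
Qed.

Lemma simplex_compact n : compact (D n).
Proof.
apply: bounded_closed_compact.
  exists 1; split=> [|x x1 v [v0 v1]]; first exact: num_real.
  apply: le_trans (ltW x1); apply/rV_norm_le => // j.
  by rewrite ger0_norm // -v1 (bigD1 j) //= lerDl sumr_ge0.
have -> : D n = (\bigcap_(i in [set: 'I_n.+1]) [set v : 'rV[R]_n.+1 | 0 <= v 0 i]) `&`
    [set v : 'rV[R]_n.+1 | \sum_i v 0 i = 1].
  by apply/seteqP; split=> v [v0 v1]; split=> // i; [move=> _; exact: v0|exact: v0].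
apply: closedI.
  apply: closed_bigI => i _; apply: (@preimage_closed _ _ (fun v : 'rV[R]_n.+1 => v 0 i) [set x | 0 <= x]).
    by move=> x _; exact: coord_continuous.
  exact: closed_ge.
apply: (@preimage_closed _ _ (fun v : 'rV[R]_n.+1 => \sum_i v 0 i) [set x | x = 1]).
  by move=> v _; apply: (@cvg_sumr _ _ _ (nbhs_filter v)) => i; exact: coord_continuous.
exact: closed_eq.
Qed.

Lemma iter_Sd_small1 (X : topologicalType) (cov : set (set X)) n (s : D n -> X) :
  continuous s -> (forall O, cov O -> open O) ->
  (forall t, exists2 O, cov O & O (s t)) ->
  exists m, iter m (@Sd R X n) << s >> \in fall (@small X cov n).
Proof.
move=> cs oc sc.
have [||e e0 he] := @lebesgue_number R _ X (D n) (s \o @ins R n) cov (@simplex_compact n) _ oc.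
- apply: (within_comp (B := setT)) => //; first exact: ins_within.
  exact/cont_within.
- by move=> x Dx; exact: sc.
have [m hm] := iter_Sd_affine s (divr_gt0 e0 (ltr0Sn R 1)).
exists m; apply: fallW hm => s' [M [MD hM ->]].
have DM (t : D n) : D n (\val t *m M).
  by apply: (@convex_simplex R n) => //; have /set_mem := valP t.
split.
  move=> t; apply: continuous_comp; last exact: cs.
  have c1 : continuous (fun t : D n => \val t *m M).
    exact: (cont_mulmx (@set_val_continuous _ (D n))).
  exact: (comp_within c1 DM (@ins_within R n)).
have [O cO hO] := he _ (MD ord0); exists O => // t.
apply: hO => //; apply: le_lt_trans (_ : e / 2 < e); last first.
  by rewrite ltr_pdivrMr // ltr_pMr // ltr1n.
by apply: convex_norm => //; have /set_mem := valP t.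
Qed.

Lemma iter_Sd_small (X : topologicalType) (cov : set (set X)) n (A : set X) (c : chain R X n) :
  (forall O, cov O -> open O) -> (forall x, A x -> exists2 O, cov O & O x) ->
  c \in chain_in A ->
  exists m, iter m (@Sd R X n) c \in fall (@small X cov n).
Proof.
(* Smallness survives further subdivision, so the exponents of finitely many simplices can be raised
   to a common one. *)
move=> oc Ac cA; suff [m /(_ m (leqnn _))] : exists m, forall k, (m <= k)%N ->
    iter k (@Sd R X n) c \in fall (@small X cov n) by exists m.
move: c cA; apply: (fall_ind (Q := fun c => exists m, forall k, (m <= k)%N ->
    iter k (@Sd R X n) c \in fall (@small X cov n))) => [|a b [m1 h1] [m2 h2]|s [cs sA]].
- by exists 0%N => k _; rewrite -[0]subr0 iter_SdB subrr rpred0.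
- exists (maxn m1 m2) => k; rewrite geq_max => /andP[k1 k2].
  by rewrite iter_SdB rpredB ?h1 ?h2.
have [m hm] := iter_Sd_small1 cs oc (fun t => Ac _ (sA t)).
exists m => k mk; rewrite -(subnK mk) iterD; elim: (k - m)%N => [//|j IH].
by rewrite iterS; exact: Sd_small.
Qed.

Lemma fall_split (X : topologicalType) n (P1 P2 : (D n -> X) -> Prop) (c : chain R X n) :
  c \in fall (fun s => P1 s \/ P2 s) ->
  exists c1 c2, [/\ c = c1 + c2, c1 \in fall P1 & c2 \in fall P2].
Proof.
move: c; apply: (fall_ind (Q := fun c => exists c1 c2 : chain R X n,
  [/\ c = c1 + c2, c1 \in fall P1 & c2 \in fall P2])) => [|a b [a1 [a2 [-> h1 h2]]] [b1 [b2 [-> g1 g2]]]|s [Ps|Ps]].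
- by exists 0, 0; rewrite addr0 !rpred0.
- by exists (a1 - b1), (a2 - b2); rewrite opprD addrACA !rpredB.
- by exists << s >>, 0; rewrite addr0 rpred0; split=> //; exact: fallU.
- by exists 0, << s >>; rewrite add0r rpred0; split=> //; exact: fallU.
Qed.

(** This is the form of excision on which all Mayer-Vietoris arguments below rest. *)
Lemma small_split (X : topologicalType) n (A U1 U2 : set X) (c : chain R X n) :
  open U1 -> open U2 -> A `<=` U1 `|` U2 -> c \in chain_in A ->
  exists m c1 c2, [/\ iter m (@Sd R X n) c = c1 + c2,
    c1 \in chain_in (A `&` U1) & c2 \in chain_in (A `&` U2)].
Proof.
move=> oU1 oU2 AU cA.
have [O [->|->] //|x /AU[Ux|Ux]|m hm] := @iter_Sd_small X [set U1; U2] n A c _ _ cA.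
- by exists U1 => //; left.
- by exists U2 => //; right.
exists m; apply: (fall_split (P1 := fun s => continuous s /\ forall t, (A `&` U1) (s t))
  (P2 := fun s => continuous s /\ forall t, (A `&` U2) (s t))).
have /asboolP hA := iter_Sd_chain_in m cA; move/asboolP : hm => hm.
apply/asboolP => s sm; have [cs sA] := hA _ sm; have [_ [O [->|->] sO]] := hm _ sm.
- by left; split=> // t; split.
- by right; split=> // t; split.
Qed.

End Small.

(** * Continuity on subsets *)

Section WithinContinuity.
Variables (R : realType) (T : topologicalType) (A : set T).
Implicit Types f g : T -> R.

Lemma cw_cst (U : topologicalType) (u : U) : {within A, continuous (fun _ : T => u)}.
Proof. by apply: continuous_subspaceT => x; exact: cvg_cst. Qed.

Lemma cw_id : {within A, continuous (fun x : T => x)}.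
Proof. by apply: continuous_subspaceT => x. Qed.

Lemma cw_add f g : {within A, continuous f} -> {within A, continuous g} ->
  {within A, continuous (fun x => f x + g x)}.
Proof.
by move=> /withinP cf /withinP cg; apply/withinP => x Ax; exact: cvgD (cf x Ax) (cg x Ax).
Qed.

Lemma cw_opp f : {within A, continuous f} -> {within A, continuous (fun x => - f x)}.
Proof. by move=> /withinP cf; apply/withinP => x Ax; exact: cvgN (cf x Ax). Qed.

Lemma cw_mul f g : {within A, continuous f} -> {within A, continuous g} ->
  {within A, continuous (fun x => f x * g x)}.
Proof.
by move=> /withinP cf /withinP cg; apply/withinP => x Ax; exact: cvgM (cf x Ax) (cg x Ax).
Qed.

Lemma cw_inv f : (forall x, A x -> f x != 0) -> {within A, continuous f} ->
  {within A, continuous (fun x => (f x)^-1)}.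
Proof.
move=> f0 /withinP cf; apply/withinP => x Ax; exact: cvgV (f0 x Ax) (cf x Ax).
Qed.

Lemma cw_norm f : {within A, continuous f} -> {within A, continuous (fun x => `|f x|)}.
Proof. by move=> /withinP cf; apply/withinP => x Ax; exact: cvg_norm (cf x Ax). Qed.

Lemma maxr_absE (a b : R) : Num.max a b = (a + b + `|a - b|) / 2.
Proof.
have [h|h] := orP (le_total a b).
  by rewrite (max_r h) ler0_norm; lra.
by rewrite (max_l h) ger0_norm; lra.
Qed.

Lemma minr_absE (a b : R) : Num.min a b = (a + b - `|a - b|) / 2.
Proof.
have [h|h] := orP (le_total a b).
  by rewrite (min_l h) ler0_norm; lra.
by rewrite (min_r h) ger0_norm; lra.
Qed.

Lemma cw_max f g : {within A, continuous f} -> {within A, continuous g} ->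
  {within A, continuous (fun x => Num.max (f x) (g x))}.
Proof.
move=> cf cg; under eq_fun do rewrite maxr_absE.
apply: cw_mul; last exact: cw_cst.
by apply: cw_add; [exact: cw_add|apply: cw_norm; apply: cw_add => //; exact: cw_opp].
Qed.

Lemma cw_min f g : {within A, continuous f} -> {within A, continuous g} ->
  {within A, continuous (fun x => Num.min (f x) (g x))}.
Proof.
move=> cf cg; under eq_fun do rewrite minr_absE.
apply: cw_mul; last exact: cw_cst.
by apply: cw_add; [exact: cw_add|apply: cw_opp; apply: cw_norm; apply: cw_add => //; exact: cw_opp].
Qed.

Lemma cw_sqrt f : {within A, continuous f} ->
  {within A, continuous (fun x => Num.sqrt (f x))}.
Proof.
move=> cf; apply: (@within_comp _ _ _ A setT f (@Num.sqrt R)) => //.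
apply: continuous_subspaceT; exact: sqrt_continuous.
Qed.

Lemma cw_coord m n (f : T -> 'M[R]_(m, n)) i j : {within A, continuous f} ->
  {within A, continuous (fun x => f x i j)}.
Proof.
move=> /withinP cf; apply/withinP => x Ax; apply: cvg_coord; exact: cf.
Qed.

Lemma cw_pair (U V : topologicalType) (f : T -> U) (g : T -> V) :
  {within A, continuous f} -> {within A, continuous g} ->
  {within A, continuous (fun x => (f x, g x))}.
Proof.
move=> /withinP cf /withinP cg; apply/withinP => x Ax.
exact: (cvg_pair (cf x Ax) (cg x Ax)).
Qed.

Lemma cw_fst (U V : topologicalType) (f : T -> U * V) : {within A, continuous f} ->
  {within A, continuous (fun x => (f x).1)}.
Proof.
move=> /withinP cf; apply/withinP => x Ax; exact: cvg_comp (cf x Ax) (@cvg_fst _ _ _ _ _).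
Qed.

Lemma cw_snd (U V : topologicalType) (f : T -> U * V) : {within A, continuous f} ->
  {within A, continuous (fun x => (f x).2)}.
Proof.
move=> /withinP cf; apply/withinP => x Ax; exact: cvg_comp (cf x Ax) (@cvg_snd _ _ _ _ _).
Qed.

Lemma cw_comp (U V : topologicalType) (B : set U) (f : T -> U) (g : U -> V) :
  {within B, continuous g} -> {within A, continuous f} -> (forall x, A x -> B (f x)) ->
  {within A, continuous (fun x => g (f x))}.
Proof. by move=> cg cf fAB; exact: within_comp cf fAB cg. Qed.

Lemma cw_compT (U V : topologicalType) (f : T -> U) (g : U -> V) :
  continuous g -> {within A, continuous f} ->
  {within A, continuous (fun x => g (f x))}.
Proof. by move=> cg cf; apply: (@cw_comp _ _ setT) => //; exact: continuous_subspaceT. Qed.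

End WithinContinuity.

(** Restricted continuity is proved by descent on the syntax of the function, down to facts in the
    context. *)
Ltac wcont1 :=
  lazymatch goal with
  | |- forall _ _, nbhs (@from_subspace _ _ ?A ?F _) _ -> _ =>
    change {within A, continuous F}
  | |- forall _, continuous_at _ (@from_subspace _ _ _ ?F) =>
    lazymatch F with
    | (fun _ => ?c) => exact: cw_cst
    | (fun y => y) => exact: cw_id
    | @fst _ _ => apply: (@cw_fst _ _ _ _ (fun y => y)); exact: cw_id
    | @snd _ _ => apply: (@cw_snd _ _ _ _ (fun y => y)); exact: cw_id
    | @Algebra.opp _ => apply: (@cw_opp _ _ _ (fun y => y))
    | (fun y => @Algebra.add _ (@?f y) (@?g y)) => apply: cw_add
    | (fun y => @Algebra.opp _ (@?f y)) => apply: cw_opp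
    | (fun y => @GRing.mul _ (@?f y) (@?g y)) => apply: cw_mul
    | (fun y => @Order.max _ _ (@?f y) (@?g y)) => apply: cw_max
    | (fun y => @Order.min _ _ (@?f y) (@?g y)) => apply: cw_min
    | (fun y => @Num.norm _ _ (@?f y)) => apply: cw_norm
    | (fun y => @Num.Def.sqrtr _ (@?f y)) => apply: cw_sqrt
    | (fun y => @pair _ _ (@?f y) (@?g y)) => apply: cw_pair
    | (fun y => @fun_of_matrix _ _ _ (@?f y) _ _) => apply: cw_coord
    | (fun y => @fst _ _ (@?f y)) => apply: cw_fst
    | (fun y => @snd _ _ (@?f y)) => apply: cw_snd
    end
  end.
Ltac wcont := repeat (first [assumption | wcont1]).

Section TopologyMore.

Lemma open_within (T U : topologicalType) (A : set T) (f : T -> U) (B : set U) :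
  {within A, continuous f} -> open B ->
  exists2 V, open V & A `&` f @^-1` B = A `&` V.
Proof.
move=> /continuousP cf oB; have /open_subspaceP[V oV VE] := cf _ oB.
by exists V => //; rewrite setIC -VE setIC.
Qed.

Lemma open_preim (T U : topologicalType) (A : set T) (f : T -> U) (B : set U) :
  open A -> {within A, continuous f} -> open B -> open (A `&` f @^-1` B).
Proof. by move=> oA cf oB; have [V oV ->] := open_within cf oB; exact: openI. Qed.

Lemma closed_within (T U : topologicalType) (A : set T) (f : T -> U) (B : set U) :
  closed A -> {within A, continuous f} -> closed B -> closed (A `&` f @^-1` B).
Proof.
move=> cA cf cB; have [V oV VE] := open_within cf (closed_openC cB).
have -> : A `&` f @^-1` B = A `&` ~` V.
  apply/seteqP; split=> x [Ax h]; split => //.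
    by move=> Vx; have : (A `&` V) x by []; rewrite -VE => -[_]; apply.
  apply: contrapT => nB; apply: h; have : (A `&` f @^-1` (~` B)) x by [].
  by rewrite VE => -[].
by apply: closedI => //; exact: open_closedC.
Qed.

Lemma within_eq (T U : topologicalType) (A : set T) (f g : T -> U) :
  (forall x, A x -> f x = g x) -> {within A, continuous f} -> {within A, continuous g}.
Proof.
by move=> fg; apply: subspace_eq_continuous => x /set_mem Ax; exact: fg.
Qed.

Lemma within_local (T U : topologicalType) (A : set T) (f : T -> U) :
  (forall x, A x -> exists V, [/\ open V, V x & {within A `&` V, continuous f}]) ->
  {within A, continuous f}.
Proof.
move=> h; apply/withinP => x Ax; have [V [oV Vx /withinP cf]] := h x Ax.
move=> W WW; have := cf x (conj Ax Vx) W WW.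
rewrite /within /= !nbhs_simpl /= => H.
have VN := open_nbhs_nbhs (conj oV Vx).
by apply: filterS2 VN H => y Vy Hy Ay; exact: Hy (conj Ay Vy).
Qed.

Lemma homeo_sym (X Y : topologicalType) (A : set X) (B : set Y) f g :
  homeo A B f g -> homeo B A g f.
Proof. by case=> cf cg fg gf; split. Qed.

Lemma homeo_subl (X Y : topologicalType) (A A' : set X) (B : set Y) f g :
  homeo A B f g -> A' `<=` A -> homeo A' (B `&` g @^-1` A') f g.
Proof.
move=> [cf cg fg gf] AA; split.
- exact: continuous_subspaceW cf.
- by apply: continuous_subspaceW cg => x [].
- by move=> x A'x; have [Bf gfx] := fg x (AA _ A'x); split=> //; split=> //=; rewrite gfx.
- by move=> y [By A'g]; split=> //; have [] := gf y By.
Qed.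

Lemma homeo_comp (X Y Z : topologicalType) (A : set X) (B : set Y) (C : set Z) f g f' g' :
  homeo A B f g -> homeo B C f' g' -> homeo A C (f' \o f) (g \o g').
Proof.
move=> [cf cg fg gf] [cf' cg' fg' gf']; split.
- by apply: within_comp cf _ cf' => x Ax; have [] := fg x Ax.
- by apply: within_comp cg' _ cg => x Cx; have [] := gf' x Cx.
- move=> x Ax; have [Bf e] := fg x Ax; have [Cf e'] := fg' _ Bf.
  by split=> //=; rewrite e'.
- move=> x Cx; have [Bf e] := gf' x Cx; have [Cf e'] := gf _ Bf.
  by split=> //=; rewrite e'.
Qed.

(** A closed part of K is compact, so its image in a Hausdorff space is closed. *)
Lemma compact_inverse (X Y : topologicalType) (K : set X) (f : X -> Y) (g : Y -> X) :
  hausdorff_space Y -> compact K -> {within K, continuous f} ->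
  (forall x, K x -> g (f x) = x) -> {within f @` K, continuous g}.
Proof.
move=> hY cK cf gf; apply/continuous_closedP => C cC.
have cKC : compact (K `&` C).
  exact: compact_closedI.
have ccf : compact (f @` (K `&` C)).
  apply: continuous_compact => //; apply: continuous_subspaceW cf => x [] //.
apply/closed_subspaceP; exists (f @` (K `&` C)); first exact: compact_closed.
apply/seteqP; split=> y [].
- move=> [x [Kx Cx] <-] _; split; last by exists x.
  by change (C (g (f x))); rewrite gf.
- move=> Cy [x Kx xy]; subst y; have {}Cy : C (g (f x)) by [].
  by rewrite gf // in Cy; split; exists x.
Qed.

End TopologyMore.

(** * Invariance of the boundary in the presence of a surface *)

(* A homeomorphism between relatively open subsets of the half-space cannot move a
   boundary point into the interior: otherwise every point of N would be a boundary
   point, so that the surface F would be equal to its boundary circle. *)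
Section BoundaryInvariance.
Variable R : realType.
Local Notation H4 := (half_space R 4).

Definition boundary_invariant := forall (V W : set 'rV[R]_4) f g,
  open V -> open W -> homeo (H4 `&` V) (H4 `&` W) f g ->
  forall x, H4 x -> V x -> x 0 0 = 0 -> (f x) 0 0 = 0.

Lemma half_spaceP n (v : 'rV[R]_n.+1) : half_space R n.+1 v <-> 0 <= v 0 0.
Proof. by split=> [/(_ 0)|h i i0]; [apply|rewrite (_ : i = 0) //; exact/val_inj]. Qed.

(** The coordinates are the two binary digits of i. *)
Definition corner (i : 'I_4) : R * R := ((odd i)%:R, (1 < i)%N%:R).

Lemma corner_segment (i j l : 'I_4) (t : R) : i != j -> l != i -> l != j ->
  ~ ((1 - t) * (corner i).1 + t * (corner j).1 = (corner l).1 /\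
     (1 - t) * (corner i).2 + t * (corner j).2 = (corner l).2).
Proof.
rewrite /corner; case: i => -[|[|[|[|//]]]] ?; case: j => -[|[|[|[|//]]]] ?;
  case: l => -[|[|[|[|//]]]] ? //= _ _ _ []; rewrite ?mulr1n ?mulr0n; lra.
Qed.

Lemma sort4 (a : 'I_4 -> R) : injective a ->
  exists u x v y : 'I_4, [/\ uniq [:: u; x; v; y], a u < a x, a x < a v & a v < a y].
Proof.
move=> ia; pose r i j := a i <= a j.
have ps := perm_sort r (enum 'I_4).
have ss : sorted r (sort r (enum 'I_4)) by apply: sort_sorted => i j; exact: le_total.
have us : uniq (sort r (enum 'I_4)) by rewrite sort_uniq enum_uniq.
have sz : size (sort r (enum 'I_4)) = 4 by rewrite size_sort size_enum_ord.
move: us sz ss; case: (sort _ _) => [//|u [//|x [//|v [//|y [|//]]]]] us _ /= /and4P[h1 h2 h3 _].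
have lt p q : p != q -> r p q -> a p < a q.
  by move=> pq; rewrite /r lt_neqAle => ->; rewrite andbT; apply: contra pq => /eqP/ia ->.
have [ux [xv vy]] : u != x /\ x != v /\ v != y.
  by move: us; rewrite /= !inE !negb_or => /and4P[/and3P[? _ _] /andP[? _] ? _].
exists u, x, v, y; split; [exact: us|exact: lt|exact: lt|exact: lt].
Qed.

Lemma int01 (m : int) : -1 < m -> m < 2 -> m = 0 \/ m = 1.
Proof. lia. Qed.

(* Two points of the circle separate two others, but the corners of a square do not
   separate each other. *)
Lemma circle_no_square (N : topologicalType) (k : R -> N) (j : R * R -> N) :
  hausdorff_space N -> continuous k -> (forall t, k (t + 1) = k t) ->
  (forall s t, k s = k t -> exists m : int, s = t + m%:~R) ->
  {within `[0, 1] `*` `[0, 1], continuous j} ->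
  (forall p, (`[0, 1] `*` `[0, 1])%classic p -> range k (j p)) ->
  (forall p q, (`[0, 1] `*` `[0, 1])%classic p -> (`[0, 1] `*` `[0, 1])%classic q ->
     j p = j q -> p = q) -> False.
Proof.
move=> hN ck kp ki cj jk ji.
have cor i : (`[0, 1] `*` `[0, 1])%classic (corner i).
  by case: i => -[|[|[|[|//]]]] ?; split; rewrite /corner /= in_itv /= ?lexx ?ler01.
have kz t (m : int) : k (t + m%:~R) = k t.
  have kn s (n : nat) : k (s + n%:R) = k s.
    by elim: n => [|n IH]; rewrite ?addr0 // -natr1 addrA kp.
  case: m => n; first exact: kn.
  have -> : (Negz n)%:~R = - n.+1%:R :> R by rewrite NegzE mulrNz -pmulrn.
  by rewrite -(kn (t - n.+1%:R) n.+1) subrK.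
(* The parameters of the corners are chosen in [0, 1), where k is injective. *)
have h (i : 'I_4) : exists a, 0 <= a < 1 /\ k a = j (corner i).
  have [t _ kt] := jk _ (cor i); exists (t - (Num.floor t)%:~R).
  split; last by rewrite -mulrNz kz.
  have /andP[] := mem_rg1_floor t.
  by move=> ? ?; lra.
pose a i := projT1 (cid (h i)).
have [a01 ka] : (forall i, 0 <= a i < 1) /\ forall i, k (a i) = j (corner i).
  by split=> i; have [] := projT2 (cid (h i)).
have ia : injective a.
  move=> i l il; have : corner i = corner l by apply: ji => //; rewrite -!ka il.
  move=> e; have /eqP := congr1 fst e; have /eqP := congr1 snd e.
  rewrite /= !eqr_nat {e il}; case: i => -[|[|[|[|//]]]] ?; case: l => -[|[|[|[|//]]]] ? //=;
    by move=> _ _; exact/val_inj.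
have [u [x [v [y [uq ux xv vy]]]]] := sort4 ia.
have arc (b c : R) : closed (k @` `[b, c]).
  apply: compact_closed => //; apply: continuous_compact; last exact: segment_compact.
  exact: continuous_subspaceT.
pose seg (t : R) : R * R := ((1 - t) * (corner x).1 + t * (corner y).1,
                (1 - t) * (corner x).2 + t * (corner y).2).
have segI t : t \in `[0, 1] -> (`[0, 1] `*` `[0, 1])%classic (seg t).
  rewrite in_itv /= => /andP[t0 t1].
  have [/= x1 x2] := cor x; have [/= y1 y2] := cor y.
  move: x1 x2 y1 y2; rewrite !in_itv /= => /andP[? ?] /andP[? ?] /andP[? ?] /andP[? ?].
  by split; apply/andP; split; nra.
have cseg : {within `[0, 1], continuous (j \o seg)}.
  have cs : {within `[0, 1], continuous seg}.
    by rewrite /seg; wcont.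
  by apply: (within_comp cs _ cj) => t t01; apply: segI.
(* In cyclic order the corners are u, x, v, y. The sets A and B collect the times at which the
   segment from corner x to corner y is mapped into one or the other arc between u and v. They are
   closed, cover [0, 1] and contain 0 and 1 respectively; they are disjoint since the segment avoids
   the corners u and v. *)
pose A := `[0 : R, 1] `&` (j \o seg) @^-1` (k @` `[a u, a v]).
pose B := `[0 : R, 1] `&` (j \o seg) @^-1` (k @` `[a v, a u + 1]).
have cA : closed A by apply: closed_within => //; exact: itv_closed.
have cB : closed B by apply: closed_within => //; exact: itv_closed.
have AB0 : A `&` B = set0.
  apply/seteqP; split=> // t [[t01 [s1 s1I e1]] [_ [s2 s2I e2]]].
  have [m mE] := ki s2 s1 (etrans e2 (esym e1)).
  move: s1I s2I; rewrite /= !in_itv /= => /andP[? ?] /andP[? ?].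
  have /andP[? ?] := a01 u; have /andP[? ?] := a01 v.
  (* The parameters of a common point differ by an integer, and only 0 and 1 fit the lengths of the
     arcs; so the arcs share just their ends. *)
  have m01 : m = 0 \/ m = 1.
    have : (-1)%:~R < m%:~R :> R by rewrite intrN; lra.
    have : m%:~R < 2%:~R :> R by lra.
    by move=> h2 h1; apply: int01; rewrite -(@ltr_int R).
  have : j (seg t) = j (corner u) \/ j (seg t) = j (corner v).
    rewrite -!ka -[j (seg t)]e1; case: m01 => mm; rewrite mm ?addr0 in mE.
      by right; congr k; lra.
    by left; congr k; rewrite -[1%:~R]/(1 : R) in mE; lra.
  move: uq; rewrite /= !inE !negb_or => /and4P[/and3P[ux' _ uy'] /andP[xv' xy'] vy' _].
  case=> /(ji _ _ (segI _ t01) (cor _)) e.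
    by apply: (@corner_segment x y u t xy' ux' uy'); rewrite -e.
  by apply: (@corner_segment x y v t xy' _ vy'); rewrite -?e // eq_sym.
have ABT : `[0 : R, 1] `<=` A `|` B.
  move=> t t01; have [s _ ks] := jk _ (segI _ t01).
  have [s' s'01 ks'] : exists2 s', a u <= s' < a u + 1 & k s' = j (seg t).
    exists (s - (Num.floor (s - a u))%:~R); last by rewrite -mulrNz kz.
    have /andP[] := mem_rg1_floor (s - a u).
    by rewrite ?intrD => ? ?; lra.
  have [s'v|s'v] := leP s' (a v); [left|right]; split=> //; exists s' => //;
    rewrite /= in_itv /=; lra.
have A0 : A 0.
  split; first by rewrite /= in_itv /= lexx ler01.
  exists (a x); first by rewrite /= in_itv /= !ltW.
  by rewrite ka /= /seg subr0 !mul1r !mul0r !addr0 -surjective_pairing.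
have B1 : B 1.
  split; first by rewrite /= in_itv /= lexx ler01.
  exists (a y).
    rewrite /= in_itv /= ltW //=; have /andP[? ?] := a01 u; have /andP[? ?] := a01 y; lra.
  by rewrite ka /= /seg subrr !mul1r !mul0r !add0r -surjective_pairing.
have : connected `[0 : R, 1] by exact: segment_connected.
move=> /(_ A); apply: contraPP => _ /(_ _ _ _) h1.
have AE : A = `[0, 1]%classic.
  apply: h1; first by exists 0.
  - exists (~` B); first exact: closed_openC.
    apply/seteqP; split=> t; first by move=> [t01 At]; split=> // Bt; have : (A `&` B) t by []; rewrite AB0.
    by move=> [t01 nB]; have [] := ABT t t01.
  - by exists A => //; apply/seteqP; split=> t; [move=> [t01 At]|move=> [_ [t01 At]]].
have : (A `&` B) 1 by split => //; rewrite AE /= in_itv /= lexx ler01.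
by rewrite AB0.
Qed.

End BoundaryInvariance.

(** * Collars *)

Section Collars.
Variable R : realType.
Local Notation H4 := (half_space R 4).

Definition row4 (a b c d : R) : 'rV[R]_4 := \row_i nth 0 [:: a; b; c; d] i.
Definition row3 (a b c : R) : 'rV[R]_3 := \row_i nth 0 [:: a; b; c] i.

Lemma eq_row4 (v w : 'rV[R]_4) : v 0 0 = w 0 0 -> v 0 1 = w 0 1 ->
  v 0 (inord 2) = w 0 (inord 2) -> v 0 (inord 3) = w 0 (inord 3) -> v = w.
Proof.
move=> h0 h1 h2 h3; apply/rowP => -[[|[|[|[|//]]]] p].
- by rewrite (_ : Ordinal p = 0) //; exact/val_inj.
- by rewrite (_ : Ordinal p = 1) //; exact/val_inj.
- by rewrite (_ : Ordinal p = inord 2) //; apply/val_inj; rewrite /= inordK.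
- by rewrite (_ : Ordinal p = inord 3) //; apply/val_inj; rewrite /= inordK.
Qed.

Lemma eq_row3 (v w : 'rV[R]_3) : v 0 0 = w 0 0 -> v 0 1 = w 0 1 ->
  v 0 (inord 2) = w 0 (inord 2) -> v = w.
Proof.
move=> h0 h1 h2; apply/rowP => -[[|[|[|//]]] p].
- by rewrite (_ : Ordinal p = 0) //; exact/val_inj.
- by rewrite (_ : Ordinal p = 1) //; exact/val_inj.
- by rewrite (_ : Ordinal p = inord 2) //; apply/val_inj; rewrite /= inordK.
Qed.

Lemma row4E a b c d : ((row4 a b c d) 0 0 = a) * ((row4 a b c d) 0 1 = b) *
  ((row4 a b c d) 0 (inord 2) = c) * ((row4 a b c d) 0 (inord 3) = d).
Proof. by rewrite !mxE !inordK. Qed.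

Lemma row3E a b c : ((row3 a b c) 0 0 = a) * ((row3 a b c) 0 1 = b) *
  ((row3 a b c) 0 (inord 2) = c).
Proof. by rewrite !mxE !inordK. Qed.

Lemma cw_row4 (T : topologicalType) (A : set T) (a b c d : T -> R) :
  {within A, continuous a} -> {within A, continuous b} ->
  {within A, continuous c} -> {within A, continuous d} ->
  {within A, continuous (fun x => row4 (a x) (b x) (c x) (d x))}.
Proof.
move=> ca cb cc cd; apply: within_rV => -[[|[|[|[|//]]]] p]; under eq_fun do rewrite mxE /=;
  assumption.
Qed.

Lemma cw_row3 (T : topologicalType) (A : set T) (a b c : T -> R) :
  {within A, continuous a} -> {within A, continuous b} ->
  {within A, continuous c} ->
  {within A, continuous (fun x => row3 (a x) (b x) (c x))}.
Proof.
move=> ca cb cc; apply: within_rV => -[[|[|[|//]]] p]; under eq_fun do rewrite mxE /=;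
  assumption.
Qed.

Lemma flat2P (v : 'rV[R]_4) : (forall i : 'I_4, (2 <= i)%N -> v 0 i = 0) <->
  v 0 (inord 2) = 0 /\ v 0 (inord 3) = 0.
Proof.
split=> [h|[h2 h3] [[|[|[|[|//]]]] p] //= _].
- by split; apply: h; rewrite inordK.
- by rewrite (_ : Ordinal p = inord 2) //; apply/val_inj; rewrite /= inordK.
- by rewrite (_ : Ordinal p = inord 3) //; apply/val_inj; rewrite /= inordK.
Qed.

Lemma axis3P (v : 'rV[R]_3) : axis3 v <-> v 0 1 = 0 /\ v 0 (inord 2) = 0.
Proof.
split=> [h|[h1 h2] [[|[|[|//]]] p] //= _].
- by split; apply: h => //; rewrite inordK.
- by rewrite (_ : Ordinal p = 1) //; exact/val_inj.
- by rewrite (_ : Ordinal p = inord 2) //; apply/val_inj; rewrite /= inordK.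
Qed.

Lemma open_coord_gt0 n (i : 'I_n) : open [set v : 'rV[R]_n | 0 < v 0 i].
Proof.
rewrite (_ : [set v | _] = (fun v : 'rV[R]_n => v 0 i) @^-1` [set x | 0 < x]) //.
apply: open_comp; last exact: open_gt.
by move=> v _; exact: coord_continuous.
Qed.

Lemma shift_cont n (t : 'rV[R]_n) : continuous (fun v : 'rV[R]_n => v + t).
Proof.
apply/cont_within; apply: within_rV => j; under eq_fun do rewrite mxE.
by wcont.
Qed.

Lemma open_shift n (t : 'rV[R]_n) (W : set 'rV[R]_n) : open W -> open [set v | W (v + t)].
Proof.
move=> oW; rewrite (_ : [set v | _] = (fun v => v + t) @^-1` W) //.
by apply: open_comp => // v _; exact: shift_cont.
Qed.

Lemma shift_within n (t : 'rV[R]_n) (A : set 'rV[R]_n) : {within A, continuous (+%R^~ t)}.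
Proof. by apply: continuous_subspaceT; exact: shift_cont. Qed.

(** Near q, translate the chart value h q to f x and then apply g: the result is a chart that sends
    q to the boundary point x. *)
Lemma chart_flip (N : topologicalType) (V W : set 'rV[R]_4) f g x :
  open V -> open W -> homeo (H4 `&` V) (H4 `&` W) f g ->
  H4 x -> V x -> x 0 0 = 0 -> 0 < (f x) 0 0 ->
  forall (q : N) U (h : N -> 'rV[R]_4), chart [set: N] U h -> U q -> 0 < (h q) 0 0 ->
  (\partial[R] N) q.
Proof.
move=> oV oW fg Hx Vx x0 y0 q U h [oU [Vq [gq [oVq hq]]]] Uq z0.
have [cf cg fgK gfK] := fg; have [ch cgq hK gK] := hq.
pose tau := f x - h q.
pose P1 := [set p : 'rV[R]_4 | [/\ Vq p, 0 < p 0 0, W (p + tau) & 0 < (p + tau) 0 0]].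
pose P2 := [set w : 'rV[R]_4 | [/\ W w, 0 < w 0 0, Vq (w - tau) & 0 < (w - tau) 0 0]].
have oP1 : open P1.
  have -> : P1 = (Vq `&` [set v | 0 < v 0 0]) `&`
      ([set v | W (v + tau)] `&` [set v | [set v : 'rV[R]_4 | 0 < v 0 0] (v + tau)]).
    by apply/seteqP; split=> p [] => [? ? ? ?|[? ?] [? ?]]; split.
  by repeat apply: openI => //; try exact: open_coord_gt0; apply: open_shift => //;
     exact: open_coord_gt0.
have oP2 : open P2.
  have -> : P2 = (W `&` [set v | 0 < v 0 0]) `&`
      ([set v | Vq (v - tau)] `&` [set v | [set v : 'rV[R]_4 | 0 < v 0 0] (v - tau)]).
    by apply/seteqP; split=> p [] => [? ? ? ?|[? ?] [? ?]]; split.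
  by repeat apply: openI => //; try exact: open_coord_gt0; apply: open_shift => //;
     exact: open_coord_gt0.
have h1 : homeo P1 (([set: N] `&` U) `&` h @^-1` P1) gq h.
  by apply: homeo_subl (homeo_sym hq) _ => p [? p0 _ _]; split=> //; apply/half_spaceP/ltW.
have h2 : homeo P1 P2 (fun p => p + tau) (fun p => p - tau).
  split; try exact: shift_within.
  - by move=> p [? ? ? ?]; rewrite /P2 /= addrK.
  - by move=> p [? ? ? ?]; rewrite /P1 /= subrK.
have h3 : homeo P2 ((H4 `&` V) `&` f @^-1` P2) g f.
  by apply: homeo_subl (homeo_sym fg) _ => p [? p0 _ _]; split=> //; apply/half_spaceP/ltW.
have [V3 oV3 V3E] := open_within cf oP2.
have P1q : P1 (h q).
  have [[_ Vhq] _] := hK q (conj I Uq); split=> //; rewrite /tau addrCA subrr addr0 //.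
  by have [[]] := fgK x (conj Hx Vx).
split=> //; exists (([set: N] `&` U) `&` h @^-1` P1), (g \o ((fun p => p + tau) \o h)).
split.
- split; first by apply: open_preim => //; apply: openI => //; exact: openT.
  exists (V `&` V3), ((gq \o (fun p => p - tau)) \o f); split; first exact: openI.
  rewrite setTI setIA -V3E.
  exact: homeo_comp (homeo_comp (homeo_sym h1) h2) h3.
- by split.
- move=> i i0; rewrite (_ : i = 0); last exact/val_inj.
  rewrite /= /tau addrCA subrr addr0.
  by have [_ ->] := fgK x (conj Hx Vx).
Qed.

Lemma mboundaryE (N : topologicalType) (M : set N) q : mboundary R 4 M q <->
  M q /\ exists U h, [/\ chart M U h, U q & (h q : 'rV[R]_4) 0 0 = 0].
Proof.
split=> -[Mq [U [h [c Uq h0]]]]; split=> //; exists U, h; split=> //; first exact: h0.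
by move=> i i0; rewrite (_ : i = 0) //; exact/val_inj.
Qed.

Lemma surface_boundary_invariant (N : topologicalType) (F : set N) (k : R -> N) :
  compact_manifold R N 4 -> knot k -> locally_flat R 4 2 [set: N] F ->
  F `&` \partial[R] N = range k -> boundary_invariant R.
Proof.
move=> [hN _ _ chN] [ck kp ki _] [_ lF] FbN V W f g oV oW fg x Hx Vx x0.
apply: contrapT => fx0; have [cf cg fgK gfK] := fg.
have y0 : 0 < (f x) 0 0.
  rewrite lt_def; apply/andP; split; first exact/eqP.
  by have [[/half_spaceP]] := fgK x (conj Hx Vx).
have bN q : (\partial[R] N) q.
  have [U [h [c Uq]]] := chN q; have := c; case=> oU [Vq [gq [oVq [_ _ hK _]]]].
  have [[/half_spaceP h0 _] _] := hK q (conj I Uq).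
  move: h0; rewrite le_eqVlt => /orP[/eqP h0|h0]; last exact: (chart_flip oV oW fg Hx Vx x0 y0 c Uq).
  by apply/mboundaryE; split=> //; exists U, h.
have Fk : F = range k by rewrite -FbN; apply/seteqP; split=> [q Fq|q []].
have Fx : F (k 0) by rewrite Fk; exists 0.
have [U [h [[oU [Vq [gq [oVq [ch cgq hK gK]]]]] Uk0 Fh]]] := lF _ Fx.
have [[/half_spaceP z0 Vz] _] := hK _ (conj I Uk0).
have [/(_ Fx)/flat2P[z2 z3] _] := Fh _ I Uk0.
have [d /= d0 dV] := (nbhs_ballP _ _).1 (open_nbhs_nbhs (conj oVq Vz)).
pose z := h (k 0); pose e := d / 2.
have e0 : 0 < e by rewrite divr_gt0.
(* A square in the flat plane of the chart, erected upwards from z to remain in the half-space. It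
   embeds in F, which is now a circle. *)
pose s (p : R * R) := row4 (z 0 0 + e * p.1) (z 0 1 + e * p.2) 0 0.
have HVs p : (`[0, 1] `*` `[0, 1])%classic p -> (H4 `&` Vq) (s p).
  case: p => a b [/=]; rewrite !in_itv /= => /andP[a0 a1] /andP[b0 b1]; split.
    by apply/half_spaceP; rewrite row4E /= addr_ge0 ?mulr_ge0 // ltW.
  apply: dV; rewrite -ball_normE /=; apply/rV_norm_lt => //.
  have ed : e < d by rewrite ltr_pdivrMr // ltr_pMr // ltr1n.
  have bnd c : 0 <= c -> c <= 1 -> `|- (e * c)| < d.
    move=> c0 c1; rewrite normrN ger0_norm ?mulr_ge0 // ?ltW //.
    by apply: le_lt_trans ed; rewrite ler_piMr // ltW.
  move=> j; rewrite mxE [X in _ + X]mxE; case: j => -[|[|[|[|//]]]] p.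
  - rewrite (_ : Ordinal p = 0); last exact/val_inj.
    by rewrite row4E opprD addrA subrr add0r; exact: bnd.
  - rewrite (_ : Ordinal p = 1); last exact/val_inj.
    by rewrite row4E opprD addrA subrr add0r; exact: bnd.
  - rewrite (_ : Ordinal p = inord 2); last by apply/val_inj; rewrite /= inordK.
    by rewrite row4E z2 subr0 normr0.
  - rewrite (_ : Ordinal p = inord 3); last by apply/val_inj; rewrite /= inordK.
    by rewrite row4E z3 subr0 normr0.
apply: (@circle_no_square R N k (gq \o s)) => //.
- apply: (@cw_comp _ _ _ _ _ _ gq cgq _ HVs).
  by rewrite /s; apply: cw_row4; wcont.
- move=> p /HVs HV; rewrite -Fk; have [[_ Ug] hg] := gK _ HV.
  by apply/(Fh _ I Ug)/flat2P; rewrite hg !row4E.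
- move=> p q /HVs HVp /HVs HVq /= /(congr1 h).
  have [_ ->] := gK _ HVp; have [_ ->] := gK _ HVq => e1.
  case: p q e1 {HVp HVq} => a b [a' b'] e1.
  have := congr1 (fun v : 'rV[R]_4 => v 0 0) e1; have := congr1 (fun v : 'rV[R]_4 => v 0 1) e1.
  rewrite !row4E /= => /addrI/(mulfI (lt0r_neq0 e0)) -> /addrI/(mulfI (lt0r_neq0 e0)) ->.
  by [].
Qed.

Hypothesis binv : boundary_invariant R.

(** Two charts at q differ by a homeomorphism between relatively open parts of the half-space, to
    which [binv] applies. *)
Lemma chart_boundary (N : topologicalType) (U : set N) (h : N -> 'rV[R]_4) q :
  chart [set: N] U h -> U q -> (\partial[R] N) q <-> (h q) 0 0 = 0.
Proof.
move=> c Uq; split; last by move=> h0; apply/mboundaryE; split=> //; exists U, h.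
move=> /mboundaryE[_ [U2 [h2 [c2 U2q h20]]]].
have [oU [V [g [oV hg]]]] := c; have [oU2 [V2 [g2 [oV2 hg2]]]] := c2.
have [ch cg hK gK] := hg; have [ch2 cg2 hK2 gK2] := hg2.
have [V3 oV3 V3E] := open_within cg oU2.
have [V4 oV4 V4E] := open_within cg2 oU.
have t1 : homeo (U `&` U2) ((H4 `&` V) `&` g @^-1` (U `&` U2)) h g.
  by apply: homeo_subl hg _ => p [].
have t2 : homeo (U `&` U2) ((H4 `&` V2) `&` g2 @^-1` (U `&` U2)) h2 g2.
  by apply: homeo_subl hg2 _ => p [].
have E1 : (H4 `&` V) `&` g @^-1` (U `&` U2) = H4 `&` (V `&` V3).
  rewrite [RHS]setIA -V3E; apply/seteqP; split=> p; first by move=> [? [? ?]].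
  by move=> [HV ?]; split=> //; split => //; have [[]] := gK _ HV.
have E2 : (H4 `&` V2) `&` g2 @^-1` (U `&` U2) = H4 `&` (V2 `&` V4).
  rewrite [RHS]setIA -V4E; apply/seteqP; split=> p; first by move=> [? [? ?]].
  by move=> [HV ?]; split=> //; split => //; have [[]] := gK2 _ HV.
rewrite E1 in t1; rewrite E2 in t2.
have t := homeo_comp (homeo_sym t2) t1.
have [_ _ k1 _] := t2; have [[Hq Vq2] q2] := k1 q (conj Uq U2q).
have := binv (openI oV2 oV4) (openI oV oV3) t Hq Vq2 h20.
by rewrite /= q2.
Qed.

Definition qbox (v : 'rV[R]_3) (e : R) : set (R * 'rV[R]_3) :=
  [set q | 0 <= q.1 < e /\ `|q.2 - v| < e].

(* A product neighbourhood c of phi v in N: the coordinate t measures the distance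
   to the boundary, which is parametrized by phi, and F is the product of the axis
   with the half-line. *)
Definition collar (N : topologicalType) (F : set N) (phi : 'rV[R]_3 -> N)
    (v : 'rV[R]_3) (e : R) (c : R * 'rV[R]_3 -> N) (c' : N -> R * 'rV[R]_3) :=
  [/\ 0 < e, exists U, open U /\ homeo U (qbox v e) c' c,
      forall w, `|w - v| < e -> c (0, w) = phi w,
      forall q, qbox v e q -> (F (c q) <-> axis3 q.2) &
      forall q, qbox v e q -> ((\partial[R] N) (c q) <-> q.1 = 0)].

Lemma qbox_sub v e e' : e' <= e -> qbox v e' `<=` qbox v e.
Proof.
move=> ee [t w] /= [/andP[t0 te] we]; split; last exact: lt_le_trans ee.
by rewrite t0 /=; exact: lt_le_trans ee.
Qed.

Lemma norm_lt_open (v : 'rV[R]_3) e : open [set w : 'rV[R]_3 | `|w - v| < e].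
Proof.
rewrite (_ : [set w | _] = ball v e); first exact: ball_open.
by apply/seteqP; split=> w; rewrite -ball_normE /= distrC.
Qed.

Lemma qbox_open v e : exists2 O, open O &
  forall q, qbox v e q <-> 0 <= q.1 /\ O q.
Proof.
exists ([set q : R * 'rV[R]_3 | q.1 < e] `&` [set q : R * 'rV[R]_3 | `|q.2 - v| < e]).
  apply: openI.
    rewrite (_ : [set q | _] = fst @^-1` [set x | x < e]) //.
    apply: open_comp; [by move=> q _; exact: cvg_fst|exact: open_lt].
  rewrite (_ : [set q | _] = snd @^-1` [set w | `|w - v| < e]) //.
  apply: open_comp; [by move=> q _; exact: cvg_snd|exact: norm_lt_open].
by move=> [t w]; split=> [[/andP[? ?] ?]|[? [? ?]]]; split=> //; apply/andP.
Qed.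

Lemma collar_shrink (N : topologicalType) (F : set N) phi v e e' c c' :
  0 < e' -> e' <= e -> collar F phi v e c c' -> collar F phi v e' c c'.
Proof.
move=> e0 ee [_ [U [oU hU]] c0 cF cb].
have [O oO OE] := qbox_open v e'.
split=> //; last 3 first.
- by move=> w we; apply: c0; exact: lt_le_trans ee.
- by move=> q /(qbox_sub ee); exact: cF.
- by move=> q /(qbox_sub ee); exact: cb.
have [cc' cc c'K cK] := hU.
exists (U `&` c' @^-1` qbox v e'); split; last first.
  exact: homeo_sym (homeo_subl (homeo_sym hU) (qbox_sub ee)).
have -> : U `&` c' @^-1` qbox v e' = U `&` c' @^-1` O.
  apply/seteqP; split=> x [Ux]; first by move=> /OE[].
  by move=> Ox; split=> //; apply/OE; split=> //; have [[/andP[]]] := c'K _ Ux.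
exact: open_preim.
Qed.

End Collars.

Section CollarExists.
Variable R : realType.
Local Notation H4 := (half_space R 4).
Hypothesis binv : boundary_invariant R.

Lemma chart_restrict (N : topologicalType) n (M U U' : set N) (h : N -> 'rV[R]_n) :
  chart M U h -> open U' -> chart M (U `&` U') h.
Proof.
move=> [oU [V [g [oV hg]]]] oU'; split; first exact: openI.
have [ch cg hK gK] := hg.
have [V3 oV3 V3E] := open_within cg oU'.
exists (V `&` V3), g; split; first exact: openI.
rewrite setIA [X in homeo _ X](setIA) -V3E.
have -> : (half_space R n `&` V) `&` g @^-1` U' =
    (half_space R n `&` V) `&` g @^-1` ((M `&` U) `&` U').
  by apply/seteqP; split=> p [Vp h']; split=> //; [split=> //; have [] := gK p Vp|case: h'].
by apply: homeo_subl hg _ => p [].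
Qed.

Definition lift4 (t : R) (y : 'rV[R]_3) : 'rV[R]_4 :=
  row4 t (y 0 0) (y 0 1) (y 0 (inord 2)).
Definition proj3 (x : 'rV[R]_4) : 'rV[R]_3 :=
  row3 (x 0 1) (x 0 (inord 2)) (x 0 (inord 3)).

Lemma lift4K t y : proj3 (lift4 t y) = y.
Proof. by apply: eq_row3; rewrite /proj3 row3E row4E. Qed.

Lemma proj3K (x : 'rV[R]_4) : lift4 (x 0 0) (proj3 x) = x.
Proof. by apply: eq_row4; rewrite /lift4 row4E ?row3E. Qed.

Lemma lift4_norm t y (x : 'rV[R]_4) e : 0 < e -> `|t - x 0 0| < e ->
  `|y - proj3 x| < e -> `|lift4 t y - x| < e.
Proof.
move=> e0 te /rV_norm_lt ye; apply/rV_norm_lt => //; have {}ye := ye e0.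
move=> j; rewrite mxE [X in _ + X]mxE; case: j => -[|[|[|[|//]]]] p.
- by rewrite (_ : Ordinal p = 0) ?row4E //; exact/val_inj.
- rewrite (_ : Ordinal p = 1) ?row4E; last exact/val_inj.
  by have := ye 0; rewrite mxE [X in _ + X]mxE row3E.
- rewrite (_ : Ordinal p = inord 2) ?row4E; last by apply/val_inj; rewrite /= inordK.
  by have := ye 1; rewrite mxE [X in _ + X]mxE row3E.
- rewrite (_ : Ordinal p = inord 3) ?row4E; last by apply/val_inj; rewrite /= inordK.
  by have := ye (inord 2); rewrite mxE [X in _ + X]mxE row3E.
Qed.

Lemma cw_proj3 (T : topologicalType) (A : set T) (f : T -> 'rV[R]_4) :
  {within A, continuous f} -> {within A, continuous (fun x => proj3 (f x))}.
Proof. by move=> cf; apply: cw_row3; wcont. Qed.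

Lemma cw_lift4 (T : topologicalType) (A : set T) (t : T -> R) (f : T -> 'rV[R]_3) :
  {within A, continuous t} -> {within A, continuous f} ->
  {within A, continuous (fun x => lift4 (t x) (f x))}.
Proof. by move=> ct cf; apply: cw_row4; wcont. Qed.

(** In a chart that flattens F, the pair (t, w) is sent to the point at height t above phi w. Since
    F is a product in the direction of the first chart coordinate, this respects F. *)
Lemma collar_exists (N : topologicalType) (F : set N) (k : R -> N)
    (phi : 'rV[R]_3 -> N) (v : 'rV[R]_3) :
  knot_chart k phi -> closed F -> locally_flat R 4 2 [set: N] F ->
  F `&` \partial[R] N = range k ->
  exists e c c', collar F phi v e c c'.
Proof.
move=> [[psi [cphi cpsi phiK psiK]] [U1 oU1 phiU] kax] clF [_ lF] FbN.
have bp w : (\partial[R] N) (phi w).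
  by have [] := phiK w I; rewrite phiU => -[].
have axF w : F (phi w) <-> axis3 w.
  by rewrite -kax -FbN; split=> [Fw|[]] //; split.
(* B tells whether the chart meets F. If phi v is off F, the chart is shrunk to avoid F and the
   equations are void; this treats both cases at once. *)
have [U0 [h [c0 U0v [B hF]]]] : exists U0 (h : N -> 'rV[R]_4),
    [/\ chart [set: N] U0 h, U0 (phi v) & exists B : Prop,
     forall y, U0 y -> (F y <-> [/\ B, h y 0 (inord 2) = 0 & h y 0 (inord 3) = 0])].
  have [Fv|nFv] := pselect (F (phi v)).
    have [U [h [c Uv hF]]] := lF _ Fv; exists U, h; split=> //; exists True => y Uy.
    by rewrite (hF y I Uy) flat2P; split=> [[]|[]].
  have /mboundaryE[_ [U [h [c Uv _]]]] := bp v.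
  exists (U `&` ~` F), h; split=> //; first exact: chart_restrict c (closed_openC clF).
  by exists False => y [Uy nFy]; split=> // -[].
have [oU0 [V0 [g0 [oV0 [ch cg hK gK]]]]] := c0.
rewrite setTI in ch hK gK.
pose z := h (phi v); have z0 : z 0 0 = 0 by apply/(chart_boundary binv c0 U0v).
have [_ Vz] : (H4 `&` V0) z by have [] := hK _ U0v.
have [r /= r0 rV] := (nbhs_ballP _ _).1 (open_nbhs_nbhs (conj oV0 Vz)).
pose pr x := proj3 (h x); pose th w := pr (phi w).
have inV t y : 0 <= t < r -> `|y - th v| < r -> (H4 `&` V0) (lift4 t y).
  move=> /andP[t0 tr] yr; split; first by apply/half_spaceP; rewrite row4E.
  apply: rV; rewrite -ball_normE /= distrC; apply: lift4_norm => //.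
  by rewrite -/z z0 subr0 ger0_norm.
have cpr : {within U0, continuous pr} by exact: cw_proj3.
pose O1 := U0 `&` pr @^-1` [set y | `|y - th v| < r].
have oO1 : open O1 by apply: open_preim => //; exact: norm_lt_open.
have O1v : O1 (phi v) by split=> //=; rewrite subrr normr0.
have [d /= d0 dO1] : exists2 d : R, 0 < d & forall w, `|w - v| < d -> O1 (phi w).
  have cp : continuous phi by exact/cont_within.
  have /nbhs_ballP[d /= d0 hd] := cp v O1 (open_nbhs_nbhs (conj oO1 O1v)).
  by exists d => // w wd; apply: hd; rewrite -ball_normE /= distrC.
pose e := Num.min d r.
have e0 : 0 < e by rewrite lt_min d0.
have ed w : `|w - v| < e -> O1 (phi w) by rewrite lt_min => /andP[/dO1].
have er t : t < e -> t < r by rewrite lt_min => /andP[].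
have hphi w : `|w - v| < e -> h (phi w) = lift4 0 (th w).
  move=> /ed[Uw _]; rewrite -[h (phi w)]proj3K.
  by have /(chart_boundary binv c0 Uw) -> := bp w.
pose Uo := O1 `&` (fun x => h x 0 0) @^-1` [set t | t < e].
have oUo : open Uo.
  apply: (open_preim oO1); last exact: (@open_lt R e).
  by apply: cw_coord; apply: continuous_subspaceW ch => x [].
(* The foot of x: its projection to the boundary along the first chart coordinate. *)
pose y x := g0 (lift4 0 (pr x)).
have yV x : Uo x -> (H4 `&` V0) (lift4 0 (pr x)).
  by move=> [[_ ?] _]; apply: inV; rewrite ?lexx.
have UoO : Uo `<=` U0 by move=> x [[]].
have cy : {within Uo, continuous y}.
  apply: (cw_comp cg _ yV); apply: cw_lift4; first exact: cw_cst.
  exact: continuous_subspaceW cpr.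
have hy x : Uo x -> U0 (y x) /\ h (y x) = lift4 0 (pr x) by move=> /yV/gK.
have by_ x : Uo x -> (\partial[R] N) (y x).
  by move=> /hy[Uy hyx]; apply/(chart_boundary binv c0 Uy); rewrite hyx row4E.
have [O2 oO2 O2E] := open_within cpsi (@norm_lt_open R v e).
pose U := Uo `&` y @^-1` (U1 `&` O2).
have oU : open U by apply: open_preim => //; exact: openI.
have Uy x : U x -> [/\ range phi (y x), `|psi (y x) - v| < e & phi (psi (y x)) = y x].
  move=> [Uox [U1y O2y]]; have ry : range phi (y x) by rewrite phiU; split=> //; exact: by_.
  split=> //; last by have [] := psiK _ ry.
  by have : (range phi `&` O2) (y x) by []; rewrite -O2E => -[].
pose c (q : R * 'rV[R]_3) := g0 (lift4 q.1 (th q.2)).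
pose c' x := (h x 0 0, psi (y x)).
have qV q : qbox v e q -> (H4 `&` V0) (lift4 q.1 (th q.2)).
  move=> [/andP[q0 qe] /ed[_ qr]]; apply: inV => //; rewrite q0 /=; exact: er.
have c00 w : `|w - v| < e -> c (0, w) = phi w.
  move=> we; rewrite /c /= -hphi //; have [Uw _] := ed _ we.
  by have [] := hK _ Uw.
have hc q : qbox v e q -> U0 (c q) /\ h (c q) = lift4 q.1 (th q.2).
  by move=> /qV/gK.
exists e, c, c'; split=> //.
- exists U; split=> //; split.
  + apply: cw_pair.
      by apply: cw_coord; apply: continuous_subspaceW ch => x [/UoO].
    apply: (cw_comp cpsi) => [|x /Uy[]//].
    by apply: continuous_subspaceW cy => x [].
  + apply: (cw_comp cg _ qV); apply: cw_lift4; first by wcont.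
    apply: (@cw_comp _ _ _ _ O1 (fun q => phi q.2) pr).
    * by apply: continuous_subspaceW cpr => x [].
    * by apply: (cw_comp cphi) => //; wcont.
    * by move=> q [_ /ed].
  + move=> x Ux; have [ry ye py] := Uy x Ux; have [Uox _] := Ux; have U0x := UoO _ Uox.
    have [[/half_spaceP hx0 _] hx] := hK _ U0x.
    split; first by split=> //=; rewrite hx0; case: Uox.
    by rewrite /c /= /th py /pr (hy _ Uox).2 lift4K proj3K.
  + move=> q qe; have [Uc hcq] := hc q qe; have [/andP[q0 q1] q2] := qe.
    have [U0p prp] := ed _ q2.
    have prc : pr (c q) = th q.2 by rewrite /pr hcq lift4K.
    have yc : y (c q) = phi q.2 by rewrite /y prc -/(c (0, q.2)) c00.
    have pq : psi (phi q.2) = q.2 by have [] := phiK q.2 I.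
    have rq : range phi (phi q.2) by exists q.2.
    split; last by rewrite /c' yc pq hcq row4E -surjective_pairing.
    split; first by split; [split=> //=; rewrite prc|rewrite /= hcq row4E].
    rewrite /= yc; split; first by move: rq; rewrite phiU => -[].
    have : (range phi `&` psi @^-1` [set w | `|w - v| < e]) (phi q.2).
      by split=> //=; rewrite pq.
    by rewrite O2E => -[].
- move=> q qe; have [Uc hcq] := hc q qe; have [_ q2] := qe; have [Up _] := ed _ q2.
  rewrite -axF (hF _ Uc) (hF _ Up) hcq hphi // /lift4 !row4E.
  by [].
- move=> q qe; have [Uc hcq] := hc q qe.
  by rewrite (chart_boundary binv c0 Uc) hcq row4E.
Qed.

End CollarExists.

(* Everything that the gluing construction needs to know about (N, F, K). *)
Section Piece.
Variable R : realType.

Record piece (N : topologicalType) (F : set N) (phi : 'rV[R]_3 -> N) := Piece {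
  piece_hausdorff : hausdorff_space N;
  piece_compact : compact [set: N];
  piece_closed : closed F;
  piece_phi : continuous phi;
  piece_inj : injective phi;
  piece_bd : forall w, (\partial[R] N) (phi w);
  piece_axis : forall w, F (phi w) <-> axis3 w;
  piece_collar : forall v, exists e c c', collar F phi v e c c' }.

Lemma piece_of_surface (N : topologicalType) (F : set N) (k : R -> N)
    (phi : 'rV[R]_3 -> N) :
  boundary_invariant R -> compact_manifold R N 4 -> knot_chart k phi -> compact F ->
  locally_flat R 4 2 [set: N] F -> F `&` \partial[R] N = range k -> piece F phi.
Proof.
move=> binv [hN _ cN _] kc cF lF FbN.
have clF : closed F by exact: compact_closed.
have [[psi [cphi cpsi phiK psiK]] [U1 oU1 phiU] kax] := kc.
have bp w : (\partial[R] N) (phi w).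
  by have [] := phiK w I; rewrite phiU => -[].
split=> //; first exact/cont_within.
- by move=> w w' e; have [_ <-] := phiK w I; have [_ <-] := phiK w' I; rewrite e.
- by move=> w; rewrite -kax -FbN; split=> [Fw|[]].
- by move=> v; exact: (collar_exists binv v kc clF lF FbN).
Qed.

End Piece.

Section ClosedGlue.

Lemma within_closed_glue (T U : topologicalType) (A C1 C2 : set T) (g : T -> U) :
  closed C1 -> closed C2 -> A `<=` C1 `|` C2 ->
  {within A `&` C1, continuous g} -> {within A `&` C2, continuous g} ->
  {within A, continuous g}.
Proof.
move=> cC1 cC2 AC /withinP g1 /withinP g2; apply/withinP => x Ax W WW.
have near1 C : closed C -> (forall y, (A `&` C) y -> g @ within (A `&` C) (nbhs y) --> g y) ->
    \forall y \near x, A y -> C y -> W (g y).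
  move=> cC gC; have [Cx|nCx] := pselect (C x).
    have := gC x (conj Ax Cx) W WW; rewrite /within /= !nbhs_simpl /=.
    by apply: filterS => y h Ay Cy; exact: h (conj Ay Cy).
  have : nbhs x (~` C) by apply: open_nbhs_nbhs; split=> //; exact: closed_openC.
  by apply: filterS => y.
change (\forall y \near x, A y -> W (g y)).
apply: filterS2 (near1 _ cC1 g1) (near1 _ cC2 g2) => y h1 h2 Ay.
by have [Cy|Cy] := AC y Ay; [exact: h1|exact: h2].
Qed.

End ClosedGlue.

(** * Charts of the boundary connected sum *)

Section Glue.
Variables (R : realType) (N1 N2 N : topologicalType).
Variables (F1 : set N1) (F2 : set N2) (phi1 : 'rV[R]_3 -> N1) (phi2 : 'rV[R]_3 -> N2).
Variables (e1 : N1 -> N) (e2 : N2 -> N).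
Hypotheses (p1 : piece F1 phi1) (p2 : piece F2 phi2) (hN : glued phi1 phi2 e1 e2).
Local Notation H4 := (half_space R 4).

Lemma glued_hausdorff : hausdorff_space N. Proof. by case: hN. Qed.
Lemma glued_e1 : continuous e1. Proof. by case: hN => _ []. Qed.
Lemma glued_e2 : continuous e2. Proof. by case: hN => _ []. Qed.
Lemma glued_inj1 : injective e1. Proof. by case: hN => _ []. Qed.
Lemma glued_inj2 : injective e2. Proof. by case: hN => _ []. Qed.

Lemma gluedP a b : e1 a = e2 b <->
  exists2 v, closed_ball3 v & a = phi1 v /\ b = phi2 v.
Proof. by case: hN. Qed.

Lemma glued_phi w : closed_ball3 w -> e1 (phi1 w) = e2 (phi2 w).
Proof. by move=> ?; apply/gluedP; exists w. Qed.

Lemma glued_cover y : (exists a, y = e1 a) \/ exists b, y = e2 b.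
Proof.
case: hN => _ _ cov _; have : [set: N] y by [].
by rewrite -cov => -[[a _ <-]|[b _ <-]]; [left; exists a|right; exists b].
Qed.

Lemma e1_closed C : closed C -> closed (e1 @` C).
Proof.
move=> cC; apply: compact_closed; first exact: glued_hausdorff.
apply: continuous_compact; first exact/continuous_subspaceT/glued_e1.
by rewrite -[C]setTI; apply: compact_closedI => //; exact: piece_compact p1.
Qed.

Lemma e2_closed C : closed C -> closed (e2 @` C).
Proof.
move=> cC; apply: compact_closed; first exact: glued_hausdorff.
apply: continuous_compact; first exact/continuous_subspaceT/glued_e2.
by rewrite -[C]setTI; apply: compact_closedI => //; exact: piece_compact p2.
Qed.

(** N carries the quotient topology, because e1 and e2 are closed maps by compactness. *)
Lemma open_glue (U : set N) : open (e1 @^-1` U) -> open (e2 @^-1` U) -> open U.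
Proof.
move=> o1 o2; rewrite -closedC.
have -> : ~` U = (e1 @` (~` (e1 @^-1` U))) `|` (e2 @` (~` (e2 @^-1` U))).
  apply/seteqP; split=> y; last by move=> [[a Ua <-]|[b Ub <-]].
  by move=> Uy; have [[a e]|[b e]] := glued_cover y; subst y; [left|right];
    [exists a|exists b].
by apply: closedU; [apply: e1_closed|apply: e2_closed]; exact: open_closedC.
Qed.

Definition gsurf : set N := e1 @` F1 `|` e2 @` F2.

Lemma gsurf1 a : gsurf (e1 a) <-> F1 a.
Proof.
split=> [[[a' Fa /glued_inj1 <-//]|[b Fb /esym/gluedP[w cw [-> bE]]]]|Fa].
  by apply/(piece_axis p1)/(piece_axis p2); rewrite -bE.
by left; exists a.
Qed.

Lemma gsurf2 b : gsurf (e2 b) <-> F2 b.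
Proof.
split=> [[[a Fa /gluedP[w cw [aE ->]]]|[b' Fb /glued_inj2 <-//]]|Fb].
  by apply/(piece_axis p2)/(piece_axis p1); rewrite -aE.
by right; exists b.
Qed.

(** In the glued charts coordinate 1 is nonnegative on the side of N1; this reflection carries the
    side of N2 there. *)
Definition flip4 (x : 'rV[R]_4) : 'rV[R]_4 :=
  row4 (x 0 0) (- x 0 1) (x 0 (inord 2)) (x 0 (inord 3)).

Lemma flip4K x : flip4 (flip4 x) = x.
Proof. by apply: eq_row4; rewrite /flip4 !row4E ?opprK. Qed.

Lemma flip4_id (x : 'rV[R]_4) : x 0 1 = 0 -> flip4 x = x.
Proof. by move=> x1; apply: eq_row4; rewrite /flip4 !row4E // x1 oppr0. Qed.

Lemma flip4_norm (x : 'rV[R]_4) e : 0 < e -> `|x| < e -> `|flip4 x| < e.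
Proof.
move=> e0 /rV_norm_lt h; have {}h := h e0; apply/rV_norm_lt => // -[[|[|[|[|//]]]] p].
- by rewrite mxE; exact: h.
- by rewrite mxE /= normrN; exact: h.
- by rewrite mxE; exact: h.
- by rewrite mxE; exact: h.
Qed.

Lemma cw_flip4 (T : topologicalType) (A : set T) (f : T -> 'rV[R]_4) :
  {within A, continuous f} -> {within A, continuous (fun x => flip4 (f x))}.
Proof. by move=> cf; apply: cw_row4; wcont. Qed.

Section GlueChart.
Variables (v : 'rV[R]_3) (e : R).
Variables (c1 : R * 'rV[R]_3 -> N1) (c1' : N1 -> R * 'rV[R]_3).
Variables (c2 : R * 'rV[R]_3 -> N2) (c2' : N2 -> R * 'rV[R]_3).
Hypotheses (k1 : collar F1 phi1 v e c1 c1') (k2 : collar F2 phi2 v e c2 c2').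
Variables (V : set 'rV[R]_4) (T : 'rV[R]_4 -> R) (W : 'rV[R]_4 -> 'rV[R]_3).
Variable (S : R * 'rV[R]_3 -> 'rV[R]_4).
Local Notation Q := (qbox v e).
Let P := H4 `&` V.
Hypotheses (oV : open V) (cT : {within P, continuous T}) (cW : {within P, continuous W})
  (cS : {within Q, continuous S})
  (PQ : forall x, P x -> Q (T x, W x))
  (TWK : forall x, P x -> 0 <= x 0 1 -> S (T x, W x) = x)
  (SH : forall q, Q q -> H4 (S q) /\ 0 <= (S q) 0 1)
  (SK : forall q, Q q -> P (S q) -> T (S q) = q.1 /\ W (S q) = q.2)
  (x1P : forall x, P x -> (x 0 1 = 0 <-> T x = 0 /\ closed_ball3 (W x)))
  (flipP : forall x, P x -> [/\ P (flip4 x), T (flip4 x) = T x & W (flip4 x) = W x]).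

(** The pair (T, W) folds the chart domain P along coordinate 1 onto collar coordinates, the same
    for both sides, and S unfolds them over the nonnegative half. By [x1P] the fold is exactly the
    part over the gluing ball. Points of the open ball and of its sphere differ only in the choice
    of T, W and S. *)
Definition gparam (x : 'rV[R]_4) : N :=
  if 0 <= x 0 1 then e1 (c1 (T x, W x)) else e2 (c2 (T x, W x)).

Lemma gparam1 (x : 'rV[R]_4) : 0 <= x 0 1 -> gparam x = e1 (c1 (T x, W x)).
Proof. by rewrite /gparam => ->. Qed.

Lemma collar_glue w : closed_ball3 w -> `|w - v| < e -> e1 (c1 (0, w)) = e2 (c2 (0, w)).
Proof.
move=> cw we; case: k1 => _ _ -> // _ _; case: k2 => _ _ -> // _ _.
exact: glued_phi.
Qed.

Lemma gparam2 x : P x -> x 0 1 <= 0 -> gparam x = e2 (c2 (T x, W x)).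
Proof.
move=> Px x10; rewrite /gparam; case: ifP => // x11.
have /(x1P Px)[Tx Wx] : x 0 1 = 0 by apply/eqP; rewrite eq_le x10.
by rewrite Tx; apply: collar_glue => //; have [_] := PQ Px.
Qed.

Lemma gsurf_gparam x : P x -> gsurf (gparam x) <-> axis3 (W x).
Proof.
move=> Px; have Qx := PQ Px; rewrite /gparam; case: ifP => _.
  by rewrite gsurf1; case: k1 => _ _ _ /(_ _ Qx).
by rewrite gsurf2; case: k2 => _ _ _ /(_ _ Qx).
Qed.

Lemma glue_chart : exists U f, [/\ chart [set: N] U f,
  (forall x, P x -> U (gparam x) /\ f (gparam x) = x) &
  (forall y, U y -> P (f y) /\ gparam (f y) = y)].
Proof.
have [_ [U1 [oU1 [cc1' cc1 c1'K c1K]]] c10 _ cb1] := k1.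
have [_ [U2 [oU2 [cc2' cc2 c2'K c2K]]] c20 _ cb2] := k2.
pose A1 a := U1 a /\ P (S (c1' a)).
pose A2 b := U2 b /\ P (S (c2' b)).
(* A point common to both pieces lies on the fold, where [flip4] is the identity; so the two
   formulas for f below agree. *)
have compat a b : e1 a = e2 b -> (A1 a \/ A2 b) ->
    [/\ A1 a, A2 b, c1' a = c2' b & (S (c1' a)) 0 1 = 0].
  move=> /gluedP[w cw [-> ->]] h.
  have we : `|w - v| < e /\ P (S (0, w)).
    case: h => -[Uw Pw].
      have [[q1 q2] qE] := c1'K _ Uw.
      have /cb1 : Q (c1' (phi1 w)) by [].
      rewrite qE => -[/(_ (piece_bd p1 w)) z _].
      have e3 : c1' (phi1 w) = (0, w).
        rewrite [c1' _]surjective_pairing z; congr (_, _).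
        by apply: (piece_inj p1); rewrite -[LHS]c10 // -[X in (X, _)]z -surjective_pairing.
      by move: Pw q2; rewrite e3.
    have [[q1 q2] qE] := c2'K _ Uw.
    have /cb2 : Q (c2' (phi2 w)) by [].
    rewrite qE => -[/(_ (piece_bd p2 w)) z _].
    have e3 : c2' (phi2 w) = (0, w).
      rewrite [c2' _]surjective_pairing z; congr (_, _).
      by apply: (piece_inj p2); rewrite -[LHS]c20 // -[X in (X, _)]z -surjective_pairing.
    by move: Pw q2; rewrite e3.
  case: we => we Pw.
  have Q0 : Q (0, w) by split=> //=; rewrite lexx; case: k1.
  have [Uw1 e3] := c1K _ Q0; have [Uw2 e4] := c2K _ Q0.
  rewrite c10 // in Uw1 e3; rewrite c20 // in Uw2 e4.
  rewrite /A1 /A2 e3 e4; split=> //.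
  by apply/(x1P Pw); have [-> ->] := SK Q0 Pw.
(* The value 0 is a default outside U. *)
pose f (y : N) : 'rV[R]_4 :=
  if pselect (exists a, y = e1 a /\ A1 a) is left h then S (c1' (projT1 (cid h)))
  else if pselect (exists b, y = e2 b /\ A2 b) is left h
  then flip4 (S (c2' (projT1 (cid h)))) else 0.
have f1 a : A1 a -> f (e1 a) = S (c1' a).
  move=> Aa; rewrite /f; case: pselect => [h|[]]; last by exists a.
  by case: (cid h) => a' /= [/glued_inj1 ->].
have f2 b : A2 b -> f (e2 b) = flip4 (S (c2' b)).
  move=> Ab; rewrite /f; case: pselect => [h|nh].
    case: (cid h) => a /= [/esym eab _].
    by have [_ _ <- /flip4_id ->] := compat a b eab (or_intror Ab).
  case: pselect => [h|[]]; last by exists b.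
  by case: (cid h) => b' /= [/glued_inj2 ->].
pose U : set N := e1 @` A1 `|` e2 @` A2.
have U1E a : U (e1 a) <-> A1 a.
  split=> [[[a' Aa /glued_inj1 <-//]|[b Ab /esym eab]]|Aa]; last by left; exists a.
  by have [] := compat a b eab (or_intror Ab).
have U2E b : U (e2 b) <-> A2 b.
  split=> [[[a Aa eab]|[b' Ab /glued_inj2 <-//]]|Ab]; last by right; exists b.
  by have [] := compat a b eab (or_introl Aa).
have cS1 : {within U1, continuous (S \o c1')}.
  by apply: (within_comp cc1' _ cS) => a /c1'K[].
have cS2 : {within U2, continuous (S \o c2')}.
  by apply: (within_comp cc2' _ cS) => a /c2'K[].
have openf (O : set 'rV[R]_4) : open O -> open (U `&` f @^-1` O).
  move=> oO; apply: open_glue.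
    have -> : e1 @^-1` (U `&` f @^-1` O) = U1 `&` (S \o c1') @^-1` (V `&` O).
      apply/seteqP; split=> a.
        by move=> [/U1E Aa]; rewrite /= f1 //; case: Aa => Ua [_ ?].
      move=> [Ua [Va Oa]]; have Aa : A1 a.
        by split=> //; split=> //; have [] := SH (c1'K _ Ua).1.
      by split; [exact/U1E|rewrite /= f1].
    by apply: open_preim => //; exact: openI.
  have -> : e2 @^-1` (U `&` f @^-1` O) =
      (U2 `&` (S \o c2') @^-1` V) `&` (flip4 \o (S \o c2')) @^-1` O.
    apply/seteqP; split=> a.
      by move=> [/U2E Aa]; rewrite /= f2 //; case: Aa => Ua [_ ?].
    move=> [[Ua Va] Oa]; have Aa : A2 a.
      by split=> //; split=> //; have [] := SH (c2'K _ Ua).1.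
    by split; [exact/U2E|rewrite /= f2].
  apply: open_preim => //; first exact: open_preim.
  by apply: cw_flip4; apply: continuous_subspaceW cS2 => x [].
have UfP y : U y -> P (f y) /\ gparam (f y) = y.
  move=> Uy; have [[a ya]|[b yb]] := glued_cover y; subst y.
    have Aa := (U1E a).1 Uy; rewrite f1 //; have [Ua Pa] := Aa; split=> //.
    have [Qa qE] := c1'K _ Ua; rewrite gparam1; last exact: (SH Qa).2.
    by have [-> ->] := SK Qa Pa; rewrite -surjective_pairing qE.
  have Ab := (U2E b).1 Uy; rewrite f2 //; have [Ub Pb] := Ab.
  have [Pf Tf Wf] := flipP Pb; have [Qb qE] := c2'K _ Ub.
  split=> //; rewrite gparam2 //.
    by rewrite Tf Wf; have [-> ->] := SK Qb Pb; rewrite -surjective_pairing qE.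
  by rewrite row4E oppr_le0; have [] := SH Qb.
have PU x : P x -> U (gparam x) /\ f (gparam x) = x.
  move=> Px; have Qx := PQ Px; have [x0|x0] := leP 0 (x 0 1).
    rewrite gparam1 //; have [Ua ca] := c1K _ Qx.
    have Aa : A1 (c1 (T x, W x)) by split=> //; rewrite ca TWK.
    by split; [exact/U1E|rewrite f1 // ca TWK].
  rewrite gparam2 //; last exact: ltW.
  have [Pf Tf Wf] := flipP Px; have [Ua ca] := c2K _ Qx.
  have Sx : S (T x, W x) = flip4 x.
    by rewrite -Tf -Wf TWK // row4E oppr_ge0 ltW.
  have Ab : A2 (c2 (T x, W x)) by split=> //; rewrite ca Sx.
  by split; [exact/U2E|rewrite f2 // ca Sx flip4K].
have oU : open U by have := openf setT openT; rewrite preimage_setT setIT.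
exists U, f; split=> //; split=> //; exists V, gparam; split=> //; rewrite setTI.
split=> //.
  by rewrite continuous_open_subspace //; apply/continuous_inP.
have cTW : {within P, continuous (fun x => (T x, W x))} by exact: cw_pair.
apply: (@within_closed_glue _ _ _ [set x : 'rV[R]_4 | 0 <= x 0 1] [set x : 'rV[R]_4 | x 0 1 <= 0]).
- apply: (@preimage_closed _ _ (fun v : 'rV[R]_4 => v 0 1) [set x | 0 <= x]).
    by move=> x _; exact: coord_continuous.
  exact: closed_ge.
- apply: (@preimage_closed _ _ (fun v : 'rV[R]_4 => v 0 1) [set x | x <= 0]).
    by move=> x _; exact: coord_continuous.
  exact: closed_le.
- by move=> x _; case: (lerP 0 (x 0 1)) => [|/ltW]; [left|right].
- apply: (@within_eq _ _ _ (fun x => e1 (c1 (T x, W x)))) => [x [_ x0]|]; first by rewrite gparam1.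
  apply: cw_compT; first exact: glued_e1.
  apply: (cw_comp cc1) => [|x [/PQ //]].
  by apply: continuous_subspaceW cTW => x [].
- apply: (@within_eq _ _ _ (fun x => e2 (c2 (T x, W x)))) => [x [Px x0]|]; first by rewrite gparam2.
  apply: cw_compT; first exact: glued_e2.
  apply: (cw_comp cc2) => [|x [/PQ //]].
  by apply: continuous_subspaceW cTW => x [].
Qed.

End GlueChart.

End Glue.

Section GlueInstances.
Variables (R : realType) (N1 N2 N : topologicalType).
Variables (F1 : set N1) (F2 : set N2) (phi1 : 'rV[R]_3 -> N1) (phi2 : 'rV[R]_3 -> N2).
Variables (e1 : N1 -> N) (e2 : N2 -> N).
Hypotheses (p1 : piece F1 phi1) (p2 : piece F2 phi2) (hN : glued phi1 phi2 e1 e2).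
Local Notation H4 := (half_space R 4).
Local Notation F := (gsurf F1 F2 e1 e2).

Lemma collar_pair v e0 : 0 < e0 -> exists e, [/\ 0 < e, e <= e0 &
  exists c1 c1' c2 c2', collar F1 phi1 v e c1 c1' /\ collar F2 phi2 v e c2 c2'].
Proof.
move=> e00; have [r1 [c1 [c1' k1]]] := piece_collar p1 v.
have [r2 [c2 [c2' k2]]] := piece_collar p2 v.
have r10 : 0 < r1 by case: k1.
have r20 : 0 < r2 by case: k2.
exists (Num.min e0 (Num.min r1 r2)); split.
- by rewrite !lt_min e00 r10 r20.
- by rewrite ge_min lexx.
exists c1, c1', c2, c2'; split.
  by apply: collar_shrink k1; rewrite ?lt_min ?e00 ?r10 ?r20 // !ge_min lexx ?orbT.
by apply: collar_shrink k2; rewrite ?lt_min ?e00 ?r10 ?r20 // !ge_min lexx ?orbT.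
Qed.

Definition ssq (w : 'rV[R]_3) := \sum_i w 0 i ^+ 2.
Definition rho w := Num.sqrt (ssq w).

Lemma ssqE w : ssq w = w 0 0 ^+ 2 + w 0 1 ^+ 2 + w 0 (inord 2) ^+ 2.
Proof.
rewrite /ssq !big_ord_recl big_ord0 addr0 addrA; congr (_ ^+ 2 + _ ^+ 2 + _ ^+ 2);
  congr (w 0 _); apply/val_inj => //=; by rewrite inordK.
Qed.

Lemma ssq_ge0 w : 0 <= ssq w.
Proof. by apply: sumr_ge0 => i _; exact: sqr_ge0. Qed.

Lemma ssq_eq0 w : ssq w = 0 -> w = 0.
Proof.
rewrite ssqE => h; have h0 := sqr_ge0 (w 0 0); have h1 := sqr_ge0 (w 0 1).
have h2 := sqr_ge0 (w 0 (inord 2)).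
apply: eq_row3; rewrite mxE; apply/eqP; rewrite -sqrf_eq0; apply/eqP; lra.
Qed.

Lemma rho_ge0 w : 0 <= rho w. Proof. exact: sqrtr_ge0. Qed.

Lemma rhoZ a w : rho (a *: w) = `|a| * rho w.
Proof.
rewrite /rho (_ : ssq (a *: w) = a ^+ 2 * ssq w); last first.
  by rewrite /ssq mulr_sumr; apply: eq_bigr => i _; rewrite mxE exprMn.
by rewrite sqrtrM ?sqr_ge0 // sqrtr_sqr.
Qed.

Lemma closed_ballE w : closed_ball3 w <-> rho w <= 1.
Proof.
rewrite /rho -[1 in X in _ <-> X]sqrtr1 ler_sqrt //; split; exact.
Qed.

Lemma cw_ssq (T : topologicalType) (A : set T) (f : T -> 'rV[R]_3) :
  {within A, continuous f} -> {within A, continuous (fun x => ssq (f x))}.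
Proof.
move=> cf; apply: (@within_eq _ _ _ (fun x => f x 0 0 * f x 0 0 + f x 0 1 * f x 0 1
  + f x 0 (inord 2) * f x 0 (inord 2))); first by move=> x _; rewrite ssqE !expr2.
by wcont.
Qed.

Lemma cw_rho (T : topologicalType) (A : set T) (f : T -> 'rV[R]_3) :
  {within A, continuous f} -> {within A, continuous (fun x => rho (f x))}.
Proof. by move=> cf; apply: cw_sqrt; exact: cw_ssq. Qed.

Lemma near_ball n (f : 'rV[R]_n.+1 -> R) v (a : R) : {within [set: 'rV[R]_n.+1], continuous f} ->
  f v < a -> exists2 e, 0 < e & forall w, `|w - v| < e -> f w < a.
Proof.
move=> /cont_within cf fv.
have /nbhs_ballP[e /= e0 he] := cf v _ (open_nbhs_nbhs (conj (@open_lt R a) fv)).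
by exists e => // w we; apply: he; rewrite -ball_normE /= distrC.
Qed.

Lemma cw_addmx (T : topologicalType) n (A : set T) (f g : T -> 'rV[R]_n) :
  {within A, continuous f} -> {within A, continuous g} ->
  {within A, continuous (fun x => f x + g x)}.
Proof.
move=> cf cg; apply: within_rV => j.
by apply: (@within_eq _ _ _ (fun x => f x 0 j + g x 0 j)) => [x _|]; [rewrite mxE|wcont].
Qed.

Lemma cw_scalemx (T : topologicalType) n (A : set T) (a : T -> R) (f : T -> 'rV[R]_n) :
  {within A, continuous a} -> {within A, continuous f} ->
  {within A, continuous (fun x => a x *: f x)}.
Proof.
move=> cf cg; apply: within_rV => j.
by apply: (@within_eq _ _ _ (fun x => a x * f x 0 j)) => [x _|]; [rewrite mxE|wcont].
Qed.

Lemma cw_mulmxr (T : topologicalType) m n (A : set T) (M : 'M[R]_(m, n)) (f : T -> 'rV[R]_m) :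
  {within A, continuous f} -> {within A, continuous (fun x => f x *m M)}.
Proof.
by move=> cf; apply: (@cw_compT _ _ _ _ f (fun v => v *m M)) => //; apply: cont_mulmx => x.
Qed.

Lemma open_ball4 (p : 'rV[R]_4) e : open [set x : 'rV[R]_4 | `|x - p| < e].
Proof.
rewrite (_ : [set w | _] = ball p e); first exact: ball_open.
by apply/seteqP; split=> w; rewrite -ball_normE /= distrC.
Qed.

Lemma ar1 (a e : R) : - e < a -> e <= 1 -> 0 <= a + 1.
Proof. lra. Qed.

(** [ar2] to [ar5] say that (a, b) -> (min a b, 1 + b - a) and (t, r) -> (t + max 0 (1 - r), t + max
    0 (r - 1)) are inverse to each other. This piecewise linear map opens a quadrant to a
    half-plane: the ray b = 0 becomes the part r <= 1 of the line t = 0, the seam, and the ray a = 0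
    becomes the part r >= 1, the remaining boundary. *)
Lemma ar2 (a b : R) : Num.min a b + Num.max 0 (1 - (1 + b - a)) = a.
Proof. by rewrite minElt maxElt; case: ifP; case: ifP; lra. Qed.

Lemma ar3 (a b : R) : Num.min a b + Num.max 0 (1 + b - a - 1) = b.
Proof. by rewrite minElt maxElt; case: ifP; case: ifP; lra. Qed.

Lemma ar4 (t r : R) : Num.min (t + Num.max 0 (1 - r)) (t + Num.max 0 (r - 1)) = t.
Proof. by rewrite minElt !maxElt; do ![case: ifP]; lra. Qed.

Lemma ar5 (t r : R) : 1 + (t + Num.max 0 (r - 1)) - (t + Num.max 0 (1 - r)) = r.
Proof. by rewrite !maxElt; do ![case: ifP]; lra. Qed.

Lemma ar6 (a b : R) : 0 <= a -> 0 <= b -> Num.min a b = 0 -> 1 + b - a <= 1 -> b = 0.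
Proof. by rewrite minElt; case: ifP; lra. Qed.

Lemma near_ballv m n (f : 'rV[R]_m -> 'rV[R]_n) v e : 0 < e ->
  {within [set: 'rV[R]_m], continuous f} ->
  exists2 d, 0 < d & forall w, `|w - v| < d -> `|f w - f v| < e.
Proof.
move=> e0 /cont_within cf.
have oB : open (ball (f v) e) by exact: ball_open.
have /nbhs_ballP[d /= d0 hd] := cf v _ (open_nbhs_nbhs (conj oB (ballxx _ e0))).
exists d => // w wd; have := hd w; rewrite -!ball_normE /= !(distrC _ w) => /(_ wd).
by rewrite distrC.
Qed.

(** Two collars are doubled along their common boundary: T is the absolute value of coordinate 1,
    and the ball supplies the other three coordinates. *)
Lemma glue_chart_interior v : ssq v < 1 -> exists U f,
  [/\ chart [set: N] U f, U (e1 (phi1 v)), 0 < (f (e1 (phi1 v)) : 'rV[R]_4) 0 0 /\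
     (forall y, U y -> range e1 y -> range e2 y -> f y 0 1 = 0) &
    axis3 v -> forall y, U y -> (F y <-> f y 0 (inord 2) = 0 /\ f y 0 (inord 3) = 0)].
Proof.
move=> v1.
have [r r0 hr] : exists2 e, 0 < e & forall w, `|w - v| < e -> ssq w < 1.
  by apply: near_ball v1; apply: cw_ssq; exact: cw_id.
have m0 : 0 < Num.min 1 r by rewrite lt_min ltr01.
have [e [e0 er [c1 [c1' [c2 [c2' [k1 k2]]]]]]] := collar_pair v m0.
move: er; rewrite le_min => /andP[e_1 er].
have hb w : `|w - v| < e -> closed_ball3 w.
  by move=> we; apply/ltW/hr; exact: lt_le_trans er.
(* The centre has first coordinate 1 and e is at most 1, so the whole box lies in the interior of
   the half-space. *)
pose p0 : 'rV[R]_4 := row4 1 0 0 0.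
pose V := [set x : 'rV[R]_4 | `|x - p0| < e].
pose T (x : 'rV[R]_4) := `|x 0 1|.
pose W (x : 'rV[R]_4) := v + row3 (x 0 0 - 1) (x 0 (inord 2)) (x 0 (inord 3)).
pose S (q : R * 'rV[R]_3) := row4 (q.2 0 0 - v 0 0 + 1) q.1 (q.2 0 1 - v 0 1)
  (q.2 0 (inord 2) - v 0 (inord 2)).
have Vc (x : 'rV[R]_4) : V x <-> [/\ `|x 0 0 - 1| < e, `|x 0 1| < e, `|x 0 (inord 2)| < e
    & `|x 0 (inord 3)| < e].
  split=> [/rV_norm_lt h|[h0 h1 h2 h3]].
    have {}h := h e0; have := h 0; have := h 1; have := h (inord 2); have := h (inord 3).
    rewrite !(mxE _ _ _ (inord 3)) !(mxE _ _ _ (inord 2)) !(mxE _ _ _ 1) !(mxE _ _ _ 0).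
    by rewrite !inordK //= !subr0.
  apply/rV_norm_lt => // -[[|[|[|[|//]]]] p]; rewrite mxE [X in _ + X]mxE mxE /= ?subr0.
  - by rewrite (_ : Ordinal p = 0) //; exact/val_inj.
  - by rewrite (_ : Ordinal p = 1) //; exact/val_inj.
  - by rewrite (_ : Ordinal p = inord 2) //; apply/val_inj; rewrite /= inordK.
  - by rewrite (_ : Ordinal p = inord 3) //; apply/val_inj; rewrite /= inordK.
have Wv x : `|W x - v| < e <-> [/\ `|x 0 0 - 1| < e, `|x 0 (inord 2)| < e
    & `|x 0 (inord 3)| < e].
  rewrite /W addrAC subrr add0r; split=> [/rV_norm_lt h|[h0 h1 h2]].
    have {}h := h e0; have := h 0; have := h 1; have := h (inord 2); by rewrite !row3E.
  apply/rV_norm_lt => // -[[|[|[|//]]] p]; by rewrite mxE.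
have PQ x : (H4 `&` V) x -> qbox v e (T x, W x).
  by move=> [_ /Vc[? ? ? ?]]; split; [rewrite /= /T normr_ge0|apply/Wv].
have p0P : (H4 `&` V) p0.
  by split; [apply/half_spaceP; rewrite row4E|rewrite /V /= subrr normr0].
have [|||||||||U [f [cU PU UP]]] := @glue_chart R N1 N2 N F1 F2 phi1 phi2 e1 e2 p1 p2 hN v e
  c1 c1' c2 c2' k1 k2 V T W S (@open_ball4 p0 e).
- by rewrite /T; wcont.
- apply: cw_addmx; first exact: cw_cst.
  by apply: cw_row3; wcont.
- by apply: cw_row4; wcont.
- exact: PQ.
- move=> x _ x1; apply: eq_row4; rewrite /S /T /W !row4E /=.
  + by rewrite [X in X - _]mxE row3E [v 0 0 + _]addrC addrK subrK.
  + by rewrite ger0_norm.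
  + by rewrite [X in X - _]mxE row3E [v 0 1 + _]addrC addrK.
  + by rewrite [X in X - _]mxE row3E [v 0 (inord 2) + _]addrC addrK.
- move=> [t w] [/andP[t0 _] /rV_norm_lt we]; split; last by rewrite row4E.
  apply/half_spaceP; rewrite row4E /=; have := we e0 0.
  rewrite mxE [X in _ + X]mxE ltr_norml => /andP[h _].
  exact: ar1 h e_1.
- move=> [t w] [/andP[t0 _] _] _; rewrite /T /W /S !row4E /= ger0_norm //; split=> //.
  apply: eq_row3; rewrite mxE row3E; first by rewrite addrK addrC subrK.
    by rewrite addrC subrK.
  by rewrite addrC subrK.
- move=> x Px; split=> [x1|[/normr0_eq0 //]].
  by rewrite /T x1 normr0; split=> //; apply: hb; have [] := PQ x Px.
- move=> x [Hx /Vc[h0 h1 h2 h3]]; split.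
  + split; first by apply/half_spaceP; rewrite row4E; apply/half_spaceP.
    by apply/Vc; rewrite !row4E normrN.
  + by rewrite /T row4E normrN.
  + by rewrite /W !row4E.
have Wp0 : W p0 = v.
  by apply: eq_row3; rewrite /W mxE row3E row4E ?subrr addr0.
have Tp0 : T p0 = 0 by rewrite /T row4E normr0.
have [Up0 fp0] := PU _ p0P.
have gp0 : gparam e1 e2 c1 c2 T W p0 = e1 (phi1 v).
  rewrite gparam1 ?row4E // Wp0 Tp0; case: k1 => _ _ -> //.
  by rewrite subrr normr0.
exists U, f; split=> //.
- by rewrite -gp0.
- split; first by rewrite -gp0 fp0 row4E.
  move=> y Uy [a _ ay] [b _ by_]; have [Py yE] := UP y Uy.
  have [w cw [aw bw]] : exists2 w, closed_ball3 w & a = phi1 w /\ b = phi2 w.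
    by apply/(gluedP hN); rewrite ay by_.
  have Qy := PQ _ Py; move: yE; rewrite /gparam; case: ifP => _ yE.
    have c1E : c1 (T (f y), W (f y)) = a by apply: (glued_inj1 hN); rewrite yE ay.
    have [_ _ _ _ /(_ _ Qy)] := k1; rewrite c1E aw /=.
    by case=> /(_ (piece_bd p1 w)) /normr0_eq0.
  have c2E : c2 (T (f y), W (f y)) = b by apply: (glued_inj2 hN); rewrite yE by_.
  have [_ _ _ _ /(_ _ Qy)] := k2; rewrite c2E bw /=.
  by case=> /(_ (piece_bd p2 w)) /normr0_eq0.
- move=> /axis3P[v1' v2'] y Uy; have [Py <-] := UP y Uy.
  rewrite (gsurf_gparam p1 p2 hN k1 k2 PQ Py) axis3P /W !mxE v1' v2' !add0r !inordK //=.
  by have [_ ->] := UP y Uy.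
Qed.

Lemma ssq_gt0 w : w != 0 -> 0 < ssq w.
Proof.
by move=> w0; rewrite lt_neqAle ssq_ge0 andbT; apply: contra w0 => /eqP/esym/ssq_eq0 ->.
Qed.

Lemma rho_gt0 w : w != 0 -> 0 < rho w.
Proof. by move=> w0; rewrite sqrtr_gt0; exact: ssq_gt0. Qed.

(** For v on the axis a scalar matrix does, and keeps the equations of the axis; otherwise
    [row_ebase] completes v to a basis. *)
Lemma frame_exists (v : 'rV[R]_3) : v != 0 -> exists B : 'M[R]_3,
  [/\ B \in unitmx, row3 1 0 0 *m B = v &
   axis3 v -> forall c a b, axis3 (c *: (row3 1 a b *m B)) <-> c * a = 0 /\ c * b = 0].
Proof.
move=> v0; have [/axis3P[v1 v2]|nav] := pselect (axis3 v).
  have v00 : v 0 0 != 0.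
    by apply: contra v0 => /eqP h; apply/eqP/eq_row3; rewrite mxE.
  exists (v 0 0)%:M; split.
  - by rewrite -scalemx1 unitmxZ ?unitmx1 ?unitfE.
  - by rewrite mul_mx_scalar; apply: eq_row3; rewrite mxE row3E ?mulr1 ?mulr0.
  - move=> _ c a b; rewrite mul_mx_scalar axis3P !mxE /= !inordK //=.
    split=> -[/eqP h1 /eqP h2]; move: h1 h2.
      by rewrite !mulf_eq0 !(negPf v00) /= => /orP h1 /orP h2; split;
        apply/eqP; rewrite mulf_eq0; apply/orP.
    by rewrite !mulf_eq0 => /orP h1 /orP h2; split;
        apply/eqP; rewrite !mulf_eq0 (negPf v00) /=; apply/orP.
pose c := (col_ebase v) 0 0.
have vE : v = c *: row 0 (row_ebase v).
  rewrite -[LHS]mulmx_ebase rank_rV v0 (mx11_scalar (col_ebase v)) mul_scalar_mx -scalemxAl.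
  rewrite rowE; congr (_ *: (_ *m _))
 ; apply/rowP=> j; rewrite !mxE ltnS; case: j => -[|j] p //=; rewrite andbT.
have c0 : c != 0 by apply: contra v0 => /eqP h; rewrite vE h scale0r.
exists (c *: row_ebase v); split=> //.
  by rewrite unitmxZ ?unitfE // row_ebase_unit.
rewrite -scalemxAr [RHS]vE rowE; congr (_ *: (_ *m _)).
by apply: eq_row3; rewrite row3E !mxE //= -val_eqE /= inordK.
Qed.

(** At a point of the sphere each collar is a half-plane in the radius and the height, times the
    directions of the rays. The map of [ar2] to [ar5] closes each half-plane to a quadrant, and two
    quadrants glued along one side form a half-plane again. The frame is adapted to v so that the
    axis remains a coordinate line. *)
Lemma glue_chart_corner v : ssq v = 1 -> exists U f,
  [/\ chart [set: N] U f, U (e1 (phi1 v)), (f (e1 (phi1 v)) : 'rV[R]_4) 0 0 = 0 &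
    axis3 v -> forall y, U y -> (F y <-> f y 0 (inord 2) = 0 /\ f y 0 (inord 3) = 0)].
Proof.
move=> v1.
have v0 : v != 0.
  by apply/eqP => h; move/eqP: v1; rewrite h ssqE !mxE expr0n /= !addr0 eq_sym oner_eq0.
have [B [Bu Bv Bax]] := frame_exists v0.
pose z (w : 'rV[R]_3) : 'rV[R]_3 := w *m invmx B.
have zv : z v = row3 1 0 0 by rewrite /z -Bv mulmxK.
have cz (T : topologicalType) (A : set T) f : {within A, continuous f} ->
    {within A, continuous (fun x => z (f x))} by exact: cw_mulmxr.
have [r r0 hr] : exists2 e, 0 < e & forall w, `|w - v| < e -> - (z w 0 0) < 0.
  by apply: near_ball; [wcont; apply: cz; exact: cw_id|rewrite zv row3E oppr_lt0 ltr01].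
have m0 : 0 < Num.min 1 r by rewrite lt_min ltr01.
have [e [e0 er [c1 [c1' [c2 [c2' [k1 k2]]]]]]] := collar_pair v m0.
move: er; rewrite le_min => /andP[e_1 er].
have hz w : `|w - v| < e -> 0 < z w 0 0.
  by move=> we; rewrite -oppr_lt0; apply: hr; exact: lt_le_trans er.
pose Y (x : 'rV[R]_4) : 'rV[R]_3 := row3 1 (x 0 (inord 2)) (x 0 (inord 3)) *m B.
have zY x : z (Y x) = row3 1 (x 0 (inord 2)) (x 0 (inord 3)) by rewrite /z mulmxK.
have Y0 x : Y x != 0.
  apply/eqP => h; have /eqP := congr1 (fun w => z w 0 0) h.
  by rewrite zY row3E /z mul0mx mxE oner_eq0.
have rY0 x : 0 < rho (Y x) by exact: rho_gt0.
(* The height T and the radius of W are those of the quadrant map; the direction of W is that of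
   [Y x], which ranges over the rays near v. *)
pose T (x : 'rV[R]_4) := Num.min (x 0 0) `|x 0 1|.
pose W (x : 'rV[R]_4) := ((1 + `|x 0 1| - x 0 0) / rho (Y x)) *: Y x.
pose S (q : R * 'rV[R]_3) := row4 (q.1 + Num.max 0 (1 - rho q.2)) (q.1 + Num.max 0 (rho q.2 - 1))
  (z q.2 0 1 / z q.2 0 0) (z q.2 0 (inord 2) / z q.2 0 0).
have cY : {within [set: 'rV[R]_4], continuous Y}.
  by apply: cw_mulmxr; apply: cw_row3; wcont.
have cW : {within [set: 'rV[R]_4], continuous W}.
  apply: cw_scalemx => //; apply: cw_mul; first by wcont.
  by apply: cw_inv; [move=> x _; exact: lt0r_neq0|exact: cw_rho].
have rv : rho v = 1 by rewrite /rho v1 sqrtr1.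
have Yv : Y 0 = v by rewrite /Y !mxE.
have W0 : W 0 = v by rewrite /W Yv rv !mxE normr0 addr0 subr0 divr1 scale1r.
have [d d0 hd] : exists2 d, 0 < d & forall x, `|x - 0| < d -> `|W x - v| < e.
  by have := near_ballv 0 e0 cW; rewrite W0.
pose m := Num.min d e.
have m0' : 0 < m by rewrite lt_min d0.
pose V := [set x : 'rV[R]_4 | `|x - 0| < m].
have Vc (x : 'rV[R]_4) j : V x -> `|x 0 j| < e.
  rewrite /V /= subr0 lt_min => /andP[_ /rV_norm_lt h]; exact: h.
have Vflip x : V x -> V (flip4 x) by rewrite /V /= !subr0; exact: flip4_norm.
have rW x : (H4 `&` V) x -> rho (W x) = 1 + `|x 0 1| - x 0 0.
  move=> [_ /(Vc x 0)]; rewrite ltr_norml => /andP[_ x0].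
  rewrite /W rhoZ normrM normfV (ger0_norm (rho_ge0 _)) divfK ?gt_eqF //.
  by rewrite ger0_norm // subr_ge0 (le_trans (ltW x0)) // (le_trans e_1) // lerDl normr_ge0.
have zW x : z (W x) = ((1 + `|x 0 1| - x 0 0) / rho (Y x)) *:
    row3 1 (x 0 (inord 2)) (x 0 (inord 3)) by rewrite /W /z -scalemxAl -/(z _) zY.
have PQ x : (H4 `&` V) x -> qbox v e (T x, W x).
  move=> [/half_spaceP Hx Vx]; split; rewrite /= /T.
    rewrite le_min Hx normr_ge0 /= gt_min; apply/orP; left.
    by have := Vc x 0 Vx; rewrite ger0_norm.
  by apply: hd; move: Vx; rewrite /V /= lt_min => /andP[].
have [|||||||||U [f [cU PU UP]]] := @glue_chart R N1 N2 N F1 F2 phi1 phi2 e1 e2 p1 p2 hN v e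
  c1 c1' c2 c2' k1 k2 V T W S (@open_ball4 0 m).
- by rewrite /T; wcont.
- exact: continuous_subspaceW cW.
- have cr : {within qbox v e, continuous (fun q : R * 'rV[R]_3 => rho q.2)}.
    by apply: cw_rho; wcont.
  have c2z : {within qbox v e, continuous (fun q : R * 'rV[R]_3 => z q.2)}.
    by apply: cz; wcont.
  have c2i : {within qbox v e, continuous (fun q : R * 'rV[R]_3 => (z q.2 0 0)^-1)}.
    by apply: cw_inv; [move=> q [_ /hz ?]; exact: lt0r_neq0|wcont].
  apply: cw_row4; try by wcont.
- exact: PQ.
- move=> x Px x1; rewrite /S /= (rW x Px) (zW x); rewrite /T ger0_norm //.
  have c0 : (1 + x 0 1 - x 0 0) / rho (Y x) != 0.
    apply: contraTneq (hz (W x) (PQ x Px).2) => h.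
    by rewrite zW ger0_norm // h scale0r mxE ltxx.
  apply: eq_row4; rewrite row4E.
  + exact: ar2.
  + exact: ar3.
  + by rewrite !mxE /= mulr1 mulrC mulKf.
  + by rewrite !mxE /= inordK //= mulr1 mulrC mulKf.
- move=> [t w] [/andP[/= t0 _] we]; rewrite /S /=; split; last by rewrite row4E addr_ge0 // le_max lexx.
  by apply/half_spaceP; rewrite row4E addr_ge0 // le_max lexx.
- move=> [t w] [/andP[/= t0 _] /= we] _; rewrite /S /=.
  have z0 := hz _ we.
  rewrite /T /W /Y !row4E.
  have -> : row3 1 (z w 0 1 / z w 0 0) (z w 0 (inord 2) / z w 0 0) = (z w 0 0)^-1 *: z w.
    by apply: eq_row3; rewrite row3E [RHS]mxE ?mulVf ?gt_eqF // mulrC.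
  have rw0 : 0 < rho w.
    by apply: rho_gt0; apply: contraTneq z0 => ->; rewrite /z mul0mx mxE ltxx.
  have -> : (z w 0 0)^-1 *: z w *m B = (z w 0 0)^-1 *: w by rewrite -scalemxAl mulmxKV.
  rewrite rhoZ normfV [`|z w 0 0|]gtr0_norm //.
  have a1 : 0 <= Num.max 0 (rho w - 1) by rewrite le_max lexx.
  rewrite ger0_norm ?addr_ge0 //; split.
    rewrite /=; exact: ar4.
  rewrite scalerA -[RHS]scale1r; congr (_ *: _).
  have -> : 1 + (t + Num.max 0 (rho w - 1)) - (t + Num.max 0 (1 - rho w)) = rho w.
    exact: ar5.
  by rewrite -mulrA -invfM mulrAC mulVf ?mul1r ?divff ?gt_eqF.
- move=> x Px; have [/half_spaceP Hx Vx] := Px; rewrite closed_ballE rW // /T.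
  split=> [->|[/eqP]]; first by rewrite normr0 min_r // addr0 gerBl.
  by move=> /eqP h1 h2; apply/eqP; rewrite -normr_eq0; apply/eqP/(ar6 Hx).
- move=> x [Hx Vx]; split.
  + by split; [apply/half_spaceP; rewrite row4E; apply/half_spaceP|exact: Vflip].
  + by rewrite /T !row4E normrN.
  + by rewrite /W /Y !row4E normrN.
have P0 : (H4 `&` V) 0.
  by split; [apply/half_spaceP; rewrite mxE|rewrite /V /= subrr normr0].
have [U0 f0] := PU _ P0.
have T0 : T 0 = 0 by rewrite /T !mxE normr0 minxx.
have gp0 : gparam e1 e2 c1 c2 T W 0 = e1 (phi1 v).
  rewrite gparam1 ?mxE // W0 T0; case: k1 => _ _ -> //.
  by rewrite subrr normr0.
exists U, f; split=> //.
- by rewrite -gp0.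
- by rewrite -gp0 f0 mxE.
- move=> /Bax Bax' y Uy; have [Py <-] := UP y Uy.
  rewrite (gsurf_gparam p1 p2 hN k1 k2 PQ Py) /W /Y Bax'.
  have c0 : (1 + `|f y 0 1| - f y 0 0) / rho (Y (f y)) != 0.
    apply: contraTneq (hz _ (PQ _ Py).2) => h.
    by rewrite zW h scale0r mxE ltxx.
  have [_ ->] := UP y Uy; rewrite -/(Y _).
  split=> -[/eqP h1 /eqP h2]; move: h1 h2.
    by rewrite ![_ * f _ _ _ == 0]mulf_eq0 (negPf c0) /= => /eqP -> /eqP ->.
  by move=> /eqP -> /eqP ->; rewrite !mulr0.
Qed.

End GlueInstances.

Lemma glued_sym (R : realType) (N1 N2 N : topologicalType) (phi1 : 'rV[R]_3 -> N1)
    (phi2 : 'rV[R]_3 -> N2) (e1 : N1 -> N) (e2 : N2 -> N) :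
  glued phi1 phi2 e1 e2 -> glued phi2 phi1 e2 e1.
Proof.
move=> [hN [c1 c2 i1 i2] cov gl]; split=> //; first by rewrite setUC.
move=> b a; split=> [/esym/gl[v cv [-> ->]]|[v cv [-> ->]]]; first by exists v.
by apply/esym/gl; exists v.
Qed.

Lemma gsurf_sym (N1 N2 N : topologicalType) (F1 : set N1) (F2 : set N2)
  (e1 : N1 -> N) (e2 : N2 -> N) : gsurf F2 F1 e2 e1 = gsurf F1 F2 e1 e2.
Proof. exact: setUC. Qed.

(** * Boundary and flatness of the glued surface *)

Section GlueTransfer.
Variables (R : realType) (N1 N2 N : topologicalType).
Variables (F1 : set N1) (F2 : set N2) (phi1 : 'rV[R]_3 -> N1) (phi2 : 'rV[R]_3 -> N2).
Variables (e1 : N1 -> N) (e2 : N2 -> N).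
Hypotheses (p1 : piece F1 phi1) (p2 : piece F2 phi2) (hN : glued phi1 phi2 e1 e2).
Local Notation F := (gsurf F1 F2 e1 e2).
Local Notation D1 := (phi1 @` @closed_ball3 R).

Lemma disk_preimage : e1 @^-1` range e2 = D1.
Proof.
apply/seteqP; split=> a.
  by move=> [b _ /esym /(gluedP hN)[v cv [-> _]]]; exists v.
by move=> [v cv <-]; exists (phi2 v) => //; apply/esym/(gluedP hN); exists v.
Qed.

Lemma disk_closed : closed D1.
Proof.
rewrite -disk_preimage; apply: preimage_closed; first by move=> x _; exact: (glued_e1 hN).
exact: (e2_closed p2 hN closedT).
Qed.

Lemma open_off_disk (U : set N1) : open U -> U `&` D1 = set0 -> open (e1 @` U).
Proof.
move=> oU UD; apply: (open_glue p1 p2 hN).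
  rewrite (_ : _ @^-1` _ = U) //; apply/seteqP; split=> a; last by move=> Ua; exists a.
  by move=> [a' Ua /(glued_inj1 hN) <-].
rewrite (_ : _ @^-1` _ = set0); first exact: open0.
apply/seteqP; split=> // b [a Ua eab]; suff : (U `&` D1) a by rewrite UD.
by split=> //; rewrite -disk_preimage; exists b.
Qed.

(** Off the gluing ball e1 is an open map, so a chart of N1 is carried over unchanged. *)
Lemma transfer_chart (U : set N1) (h : N1 -> 'rV[R]_4) : chart [set: N1] U h ->
  U `&` D1 = set0 ->
  exists2 h', chart [set: N] (e1 @` U) h' & forall a, h' (e1 a) = h a.
Proof.
move=> [oU [V [g [oV [ch cg hK gK]]]]] UD; rewrite setTI in ch hK gK.
pose h' y := if pselect (exists a, e1 a = y) is left p then h (projT1 (cid p)) else 0.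
have h'E a : h' (e1 a) = h a.
  rewrite /h'; case: pselect => [p|[]]; last by exists a.
  by case: (cid p) => a' /= /(glued_inj1 hN) ->.
exists h' => //; split; first exact: open_off_disk.
exists V, (e1 \o g); split=> //; rewrite setTI; split.
- rewrite continuous_open_subspace; last exact: open_off_disk.
  apply/continuous_inP; first exact: open_off_disk.
  move=> O oO; rewrite (_ : _ `&` _ = e1 @` (U `&` h @^-1` O)).
    by apply: open_off_disk; [exact: open_preim|rewrite setIAC UD set0I].
  apply/seteqP; split=> y.
    by move=> [[a Ua <-]]; rewrite /= h'E => Oa; exists a.
  by move=> [a [Ua Oa] <-]; split; [exists a|rewrite /= h'E].
- by apply: cw_compT => //; exact: (glued_e1 hN).
- by move=> _ [a Ua <-]; rewrite h'E; have [? gh] := hK a Ua; rewrite /= gh.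
- by move=> y /gK[Uy hy]; split; [exists (g y)|rewrite /= h'E].
Qed.

Hypotheses (binv : boundary_invariant R) (m1 : compact_manifold R N1 4).

(** Each kind of point has its own chart: the doubled collar in the open ball, the opened corner on
    the sphere, and the old chart elsewhere. *)
Lemma glued_bd1 a : (\partial[R] N) (e1 a) <->
  (\partial[R] N1) a /\ ~ (phi1 @` @open_ball3 R) a.
Proof.
have [[v cv va]|nD] := pselect (D1 a).
  subst a; have bv := piece_bd p1 v.
  have ov : (phi1 @` @open_ball3 R) (phi1 v) <-> ssq v < 1.
    by split=> [[w ow /(piece_inj p1) <-//]|?]; exists v.
  rewrite ov; have [v1|v1] := ltP (ssq v) 1.
    have [U [f [cU Uv [f0 _] _]]] := glue_chart_interior p1 p2 hN v1.
    have bE := chart_boundary binv cU Uv.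
    by split=> [/bE h|[_ []//]]; move: f0; rewrite h ltxx.
  have /(glue_chart_corner p1 p2 hN) : ssq v = 1 by apply/eqP; rewrite eq_le v1 andbT.
  move=> [U [f [cU Uv f0 _]]]; split=> // _.
  exact/(chart_boundary binv cU Uv).
have no : ~ (phi1 @` @open_ball3 R) a.
  by move=> [v ov va]; apply: nD; exists v => //; exact: ltW.
have [U [h [cU Ua]]] : exists U h, chart [set: N1] U (h : N1 -> 'rV[R]_4) /\ U a.
  by case: m1 => _ _ _ /(_ a).
have cU' := chart_restrict cU (closed_openC disk_closed).
have Ua' : (U `&` ~` D1) a by [].
have [|h' ch' h'E] := transfer_chart cU'; first by rewrite -setIA setICl setI0.
have Uea : (e1 @` (U `&` ~` D1)) (e1 a) by exists a.
rewrite (chart_boundary binv ch' Uea) h'E (chart_boundary binv cU' Ua').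
by split=> [|[]].
Qed.

Lemma glued_flat1 a : locally_flat R 4 2 [set: N1] F1 -> F1 a -> exists U f,
  [/\ chart [set: N] U f, U (e1 a) & forall y, U y ->
     (F y <-> (f y : 'rV[R]_4) 0 (inord 2) = 0 /\ f y 0 (inord 3) = 0)].
Proof.
move=> [_ lF] Fa; have [[v cv va]|nD] := pselect (D1 a).
  subst a; have ax := (piece_axis p1 v).1 Fa.
  have [v1|v1] := ltP (ssq v) 1.
    by have [U [f [cU Uv _ /(_ ax)]]] := glue_chart_interior p1 p2 hN v1; exists U, f.
  have /(glue_chart_corner p1 p2 hN) : ssq v = 1 by apply/eqP; rewrite eq_le v1 andbT.
  by move=> [U [f [cU Uv _ /(_ ax)]]]; exists U, f.
have [U [h [cU Ua hF]]] := lF a Fa.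
have cU' := chart_restrict cU (closed_openC disk_closed).
have [|h' ch' h'E] := transfer_chart cU'; first by rewrite -setIA setICl setI0.
exists (e1 @` (U `&` ~` D1)), h'; split=> //; first by exists a.
move=> _ [b [Ub _] <-]; rewrite h'E (gsurf1 p1 p2 hN) (hF b I Ub).
exact: flat2P.
Qed.

End GlueTransfer.

Section GlueSurface.
Variables (R : realType) (N1 N2 N : topologicalType).
Variables (F1 : set N1) (F2 : set N2) (phi1 : 'rV[R]_3 -> N1) (phi2 : 'rV[R]_3 -> N2).
Variables (e1 : N1 -> N) (e2 : N2 -> N).
Hypotheses (p1 : piece F1 phi1) (p2 : piece F2 phi2) (hN : glued phi1 phi2 e1 e2).
Hypotheses (binv : boundary_invariant R) (m1 : compact_manifold R N1 4)
  (m2 : compact_manifold R N2 4).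
Local Notation F := (gsurf F1 F2 e1 e2).

Lemma glued_bd2 b : (\partial[R] N) (e2 b) <->
  (\partial[R] N2) b /\ ~ (phi2 @` @open_ball3 R) b.
Proof. exact: glued_bd1 p2 p1 (glued_sym hN) binv m2 b. Qed.

Lemma gsurf_flat : locally_flat R 4 2 [set: N1] F1 -> locally_flat R 4 2 [set: N2] F2 ->
  locally_flat R 4 2 [set: N] F.
Proof.
move=> l1 l2; split=> // _ [[a Fa <-]|[b Fb <-]].
  have [U [f [cU Uy fF]]] := glued_flat1 p1 p2 hN l1 Fa.
  by exists U, f; split=> // y _ /fF ->; rewrite flat2P.
have := glued_flat1 p2 p1 (glued_sym hN) l2 Fb; rewrite gsurf_sym => -[U [f [cU Uy fF]]].
by exists U, f; split=> // y _ /fF ->; rewrite flat2P.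
Qed.

Lemma gsurf_bd (k1 : R -> N1) (k2 : R -> N2) (k : R -> N) :
  F1 `&` \partial[R] N1 = range k1 -> F2 `&` \partial[R] N2 = range k2 ->
  range k = e1 @` (range k1 `\` phi1 @` @open_ball3 R)
            `|` e2 @` (range k2 `\` phi2 @` @open_ball3 R) ->
  F `&` \partial[R] N = range k.
Proof.
move=> f1 f2 ->; apply/seteqP; split=> y.
  move=> [[[a Fa <-]|[b Fb <-]]].
    by move=> /(glued_bd1 p1 p2 hN binv m1)[ba na]; left; exists a => //; split=> //; rewrite -f1.
  by move=> /glued_bd2[ba na]; right; exists b => //; split=> //; rewrite -f2.
rewrite -f1 -f2 => -[[a [[Fa ba] na] <-]|[b [[Fb ba] na] <-]].
  by split; [left; exists a|apply/(glued_bd1 p1 p2 hN binv m1)].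
by split; [right; exists b|apply/glued_bd2].
Qed.

Lemma gsurf_compact : compact F1 -> compact F2 -> compact F.
Proof.
move=> c1 c2; apply: compactU; apply: continuous_compact => //; apply: continuous_subspaceT.
  exact: (glued_e1 hN).
exact: (glued_e2 hN).
Qed.

Lemma gsurf_connected : connected F1 -> connected F2 -> connected F.
Proof.
move=> c1 c2.
have cb : closed_ball3 (0 : 'rV[R]_3).
  by apply/closed_ballE; rewrite /rho ssqE !mxE expr0n /= !addr0 sqrtr0 ler01.
have ax : axis3 (0 : 'rV[R]_3) by move=> i _; rewrite mxE.
apply: connectedU.
- exists (e1 (phi1 0)); split; first by exists (phi1 0) => //; apply/(piece_axis p1).
  rewrite (glued_phi hN cb); exists (phi2 0) => //; exact/(piece_axis p2).
- by apply: connected_continuous_connected => //; exact/continuous_subspaceT/(glued_e1 hN).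
- by apply: connected_continuous_connected => //; exact/continuous_subspaceT/(glued_e2 hN).
Qed.

End GlueSurface.

(** * Collapsing a piece onto its ball *)

Section Collapse.
Variables (R : realType) (N : topologicalType) (F : set N) (phi : 'rV[R]_3 -> N).
Hypothesis p : piece F phi.
Local Notation D := (phi @` @closed_ball3 R).

(* A homotopy of N rel the disk D that preserves F and its complement, and
   eventually maps a neighbourhood of S into D. *)
Definition collapses (S : set N) := exists (K : R * N -> N) (O : set N),
  [/\ {within `[0, 1] `*` [set: N], continuous K},
      forall b, K (0, b) = b,
      forall s b, s \in `[0, 1] -> D b -> K (s, b) = b,
      forall s b, s \in `[0, 1] -> (F (K (s, b)) <-> F b) &
      [/\ open O, S `<=` O & forall b, O b -> D (K (1, b))]].

Lemma in01_0 : (0 : R) \in `[0, 1].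
Proof. by rewrite in_itv /= lexx ler01. Qed.

Lemma in01_1 : (1 : R) \in `[0, 1].
Proof. by rewrite in_itv /= lexx ler01. Qed.

Lemma collapses0 : collapses set0.
Proof.
exists snd, set0; split=> //; first by wcont.
by split=> //; exact: open0.
Qed.

Lemma collapses_sub S S' : S `<=` S' -> collapses S' -> collapses S.
Proof.
move=> SS [K [O [cK K0 KD KF [oO SO OD]]]]; exists K, O; split=> //; split=> //.
exact: subset_trans SO.
Qed.

(** The second homotopy is applied to the first. S2 lies in D, so the first fixes it; and what the
    first has brought into D is fixed by the second. *)
Lemma collapsesU S1 S2 : S2 `<=` D -> collapses S1 -> collapses S2 -> collapses (S1 `|` S2).
Proof.
move=> S2D [K1 [O1 [cK1 K10 K1D K1F [oO1 SO1 OD1]]]] [K2 [O2 [cK2 K20 K2D K2F [oO2 SO2 OD2]]]].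
exists (fun q => K2 (q.1, K1 q)), (O1 `|` (fun b => K1 (1, b)) @^-1` O2); split.
- apply: (cw_comp cK2) => [|q [q1 _]]; last by split.
  by apply: cw_pair => //; wcont.
- by move=> b; rewrite /= K10 K20.
- by move=> s b s01 Db; rewrite /= K1D // K2D.
- by move=> s b s01; rewrite /= K2F // K1F.
split.
- apply: openU => //; rewrite -[X in open X]setTI; apply: open_preim oO2; first exact: openT.
  apply: (cw_comp cK1) => [|b _]; last by split=> //=; exact: in01_1.
  by apply: cw_pair; [exact: cw_cst|exact: cw_id].
- move=> b [/SO1|S2b]; first by left.
  by right; rewrite /= K1D //; [exact: SO2|exact: in01_1|exact: S2D].
- by move=> b [/OD1 h|/OD2//]; rewrite /= K2D //; exact: in01_1.
Qed.

Lemma qball_compact v (e : R) : 0 <= e ->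
  compact [set q : R * 'rV[R]_3 | 0 <= q.1 <= e /\ `|q.2 - v| <= e].
Proof.
move=> e0.
have c3 : compact [set w : 'rV[R]_3 | forall i, `[v 0 i - e, v 0 i + e]%classic (w 0 i)].
  apply: (@rV_compact R _ (fun i => `[v 0 i - e, v 0 i + e]%classic)) => i.
  exact: segment_compact.
rewrite (_ : [set q | _] = `[0, e] `*` [set w : 'rV[R]_3 | forall i,
    `[v 0 i - e, v 0 i + e]%classic (w 0 i)]).
  by apply: compact_setX => //; exact: segment_compact.
have E (w : 'rV[R]_3) : `|w - v| <= e <->
    forall i, `[v 0 i - e, v 0 i + e]%classic (w 0 i).
  by rewrite rV_norm_le //; split=> h i; have := h i; rewrite !mxE ler_distl /= in_itv.
by apply/seteqP; split=> -[t w] /=; rewrite in_itv /= => -[? /E ?].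
Qed.

(** The squeeze lowers the height by at most this amount and pulls w radially towards the unit ball
    by a factor that never drops below 1 minus it; points of the ball stay. The factor 1/4 bounds
    the amount by e/8, so that a point of norm at most 2 moves by at most e/4 and stays in the
    box. *)
Definition bump v e (q : R * 'rV[R]_3) := 4^-1 * Num.max 0 (e / 2 - Num.max q.1 `|q.2 - v|).
Definition shrink (l : R) (w : 'rV[R]_3) := Num.max (Num.max 1 (rho w))^-1 (1 - l) *: w.
Definition squeeze v e (a : R * (R * 'rV[R]_3)) :=
  (Num.max 0 (a.2.1 - a.1 * bump v e a.2), shrink (a.1 * bump v e a.2) a.2.2).

Lemma cw_normrV (T : topologicalType) n (A : set T) (f : T -> 'rV[R]_n) :
  {within A, continuous f} -> {within A, continuous (fun x => `|f x|)}.
Proof. by move=> cf; apply: (@cw_compT _ _ _ _ f Num.norm) => //; exact: norm_continuous. Qed.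

Lemma cw_bump (T : topologicalType) (A : set T) v e (f : T -> R * 'rV[R]_3) :
  {within A, continuous f} -> {within A, continuous (fun x => bump v e (f x))}.
Proof.
move=> cf; have c2 : {within A, continuous (fun x => `|(f x).2 - v|)}.
  by apply: cw_normrV; apply: cw_addmx; [wcont|exact: cw_cst].
by rewrite /bump; wcont.
Qed.

Lemma max1_gt0 (r : R) : 0 < Num.max 1 r.
Proof. by rewrite lt_max ltr01. Qed.

Lemma cw_squeeze (T : topologicalType) (A : set T) v e (f : T -> R * (R * 'rV[R]_3)) :
  {within A, continuous f} -> {within A, continuous (fun x => squeeze v e (f x))}.
Proof.
move=> cf; have cb : {within A, continuous (fun x => bump v e (f x).2)} by apply: cw_bump; wcont.
have cr : {within A, continuous (fun x => rho (f x).2.2)} by apply: cw_rho; wcont.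
apply: cw_pair; first by wcont.
apply: cw_scalemx; last by wcont.
apply: cw_max; last by wcont.
by apply: cw_inv; [move=> x _; rewrite gt_eqF // max1_gt0|wcont].
Qed.

Lemma bump_ge0 v e q : 0 <= bump v e q.
Proof. by rewrite /bump mulr_ge0 ?invr_ge0 // le_max lexx. Qed.

Lemma bump_le v e q : 0 < e -> 0 <= q.1 -> bump v e q <= e / 8.
Proof.
move=> e0 q1; have : 0 <= Num.max q.1 `|q.2 - v| by rewrite le_max q1.
by rewrite /bump; move: (Num.max q.1 _) => m m0; rewrite maxElt; case: ifP; lra.
Qed.

Lemma bump_eq0 v e q : e / 2 <= Num.max q.1 `|q.2 - v| -> bump v e q = 0.
Proof. by move=> h; rewrite /bump max_l ?mulr0 // subr_le0. Qed.

Lemma shrink_bound l (w : 'rV[R]_3) : 0 <= l -> let m := Num.max (Num.max 1 (rho w))^-1 (1 - l) in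
  [/\ 1 - l <= m, 0 < m & m <= 1].
Proof.
move=> l0 /=; split; first by rewrite le_max lexx orbT.
  by rewrite lt_max invr_gt0 max1_gt0.
by rewrite ge_max invf_le1 ?max1_gt0 // le_max lexx /= gerBl.
Qed.

Lemma shrink0 w : shrink 0 w = w.
Proof.
by rewrite /shrink subr0 max_r ?scale1r // invf_le1 ?max1_gt0 // le_max lexx.
Qed.

Lemma shrink_id l w : 0 <= l -> rho w <= 1 -> shrink l w = w.
Proof. by move=> l0 w1; rewrite /shrink (max_l w1) invr1 max_l ?scale1r // gerBl. Qed.

Lemma shrink_axis l w : 0 <= l -> axis3 (shrink l w) <-> axis3 w.
Proof.
move=> l0; have [_ m0 _] := shrink_bound w l0; rewrite /shrink.
split=> h i i0; last by rewrite mxE h ?mulr0.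
by have /eqP := h i i0; rewrite mxE mulf_eq0 gt_eqF //= => /eqP.
Qed.

Lemma rho_norm (w : 'rV[R]_3) j : rho w <= 1 -> `|w 0 j| <= 1.
Proof.
move=> w1; rewrite -sqrtr_sqr; apply: le_trans w1; apply: ler_wsqrtr.
by rewrite /ssq (bigD1 j) //= lerDl sumr_ge0 // => i _; exact: sqr_ge0.
Qed.

Lemma rV_norm_le1 (w : 'rV[R]_3) a : 0 <= a -> (forall j, `|w 0 j| <= a) -> `|w| <= a.
Proof. by move=> a0 h; apply/rV_norm_le. Qed.

Lemma sq_ar1 (a b e : R) : a < e / 2 -> e <= 1 -> b <= 1 -> a + b <= 2.
Proof. lra. Qed.

Lemma sq_ar2 (a e m q : R) : a < e / 2 -> 0 < e -> m <= 1 -> 1 - m <= e / 8 -> q <= 2 ->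
  0 <= q -> a + (1 - m) * q < e.
Proof.
move=> h1 e0 h2 h3 h4 q0; have : (1 - m) * q <= e / 8 * 2 by apply: ler_pM; rewrite ?subr_ge0.
lra.
Qed.

Lemma squeeze_in v e s q : closed_ball3 v -> 0 < e -> e <= 1 -> s \in `[0, 1] ->
  qbox v e q -> qbox v e (squeeze v e (s, q)).
Proof.
move=> /closed_ballE v1 e0 e1; rewrite in_itv /= => /andP[s0 s1] [/andP[t0 te] we].
have b0 := bump_ge0 v e q; have sb : 0 <= s * bump v e q by rewrite mulr_ge0.
split; rewrite /squeeze /=.
  by rewrite le_max lexx /= gt_max e0 (le_lt_trans _ te) // gerBl.
have [/bump_eq0 ->|hm] := leP (e / 2) (Num.max q.1 `|q.2 - v|); first by rewrite mulr0 shrink0.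
have we2 : `|q.2 - v| < e / 2 by move: hm; rewrite gt_max => /andP[].
have sb8 : s * bump v e q <= e / 8.
  by apply: le_trans (bump_le v e0 t0); rewrite ler_piMl.
have [m1 m0 m2] := shrink_bound q.2 sb.
rewrite /shrink; move: m1 m0 m2; set m := Num.max _ _ => m1 m0 m2.
have -> : m *: q.2 - v = (q.2 - v) + (m - 1) *: q.2.
  by rewrite scalerBl scale1r [RHS]addrC subrKA.
apply: le_lt_trans (ler_normD _ _) _.
have v2 : `|v| <= 1 by apply: rV_norm_le1 => // j; exact: rho_norm.
have q2 : `|q.2| <= 2.
  rewrite -(subrK v q.2); apply: le_trans (ler_normD _ _) _.
  exact: sq_ar1 we2 e1 v2.
rewrite normrZ (distrC m 1) (@ger0_norm _ (1 - m)) ?subr_ge0 //.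
apply: (sq_ar2 we2) => //.
rewrite lerBlDr -lerBlDl; apply: le_trans m1; by rewrite lerD2l lerN2.
Qed.

Lemma squeeze_axis v e s q : s \in `[0, 1] ->
  axis3 (squeeze v e (s, q)).2 <-> axis3 q.2.
Proof.
by rewrite in_itv /= => /andP[s0 s1]; apply: shrink_axis; rewrite mulr_ge0 // bump_ge0.
Qed.

Lemma squeeze0 v e q : 0 <= q.1 -> squeeze v e (0, q) = q.
Proof.
by move=> q1; rewrite /squeeze /= mul0r subr0 shrink0 max_r // -surjective_pairing.
Qed.

Lemma squeeze_far v e s q : 0 <= q.1 -> e / 2 <= Num.max q.1 `|q.2 - v| ->
  squeeze v e (s, q) = q.
Proof.
move=> q1 /bump_eq0 h; rewrite /squeeze /= h mulr0 subr0 shrink0 max_r //.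
by rewrite -surjective_pairing.
Qed.

Lemma squeeze_disk v e s w : s \in `[0, 1] -> closed_ball3 w ->
  squeeze v e (s, (0, w)) = (0, w).
Proof.
rewrite in_itv /= => /andP[s0 _] /closed_ballE w1.
have sb : 0 <= s * bump v e (0, w) by rewrite mulr_ge0 // bump_ge0.
by rewrite /squeeze /= shrink_id // max_l // subr_le0.
Qed.

Lemma squeeze_flat v e q : q.1 < bump v e q -> Num.max 1 (rho q.2) * (1 - bump v e q) < 1 ->
  (squeeze v e (1, q)).1 = 0 /\ closed_ball3 (squeeze v e (1, q)).2.
Proof.
move=> q1 q2; rewrite /squeeze /= !mul1r; split; first by rewrite max_l // subr_le0 ltW.
have M0 := max1_gt0 (rho q.2).
apply/closed_ballE; rewrite /shrink rhoZ max_l; last first.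
  by rewrite -[_^-1]mul1r ler_pdivlMr // mulrC ltW.
by rewrite gtr0_norm ?invr_gt0 // -ler_pdivlMl ?invr_gt0 // invrK mulr1 le_max lexx orbT.
Qed.

(** The squeeze in one collar box, extended by the identity. It is already the identity outside the
    compact half-size box C, whence continuity of the extension. *)
Lemma collapses_local v : closed_ball3 v -> exists O, [/\ open O, O (phi v) &
  collapses (D `&` O)].
Proof.
move=> cv; have [e0 [c [c' k0]]] := piece_collar p v.
have e00 : 0 < e0 by case: k0.
pose e := Num.min 1 e0; have e_gt0 : 0 < e by rewrite lt_min ltr01.
have k : collar F phi v e c c' by apply: collar_shrink k0; rewrite ?ge_min ?lexx ?orbT.
have e1 : e <= 1 by rewrite ge_min lexx.
have [_ [U [oU [cc' cc c'K cK]]] c0 cF cb] := k.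
pose K (a : R * N) := if pselect (U a.2) then c (squeeze v e (a.1, c' a.2)) else a.2.
have KU s b : U b -> K (s, b) = c (squeeze v e (s, c' b)).
  by move=> Ub; rewrite /K; case: pselect.
have KnU s b : ~ U b -> K (s, b) = b by move=> Ub; rewrite /K; case: pselect.
pose C := c @` [set q : R * 'rV[R]_3 | 0 <= q.1 <= e / 2 /\ `|q.2 - v| <= e / 2].
have e2 : e / 2 < e by rewrite ltr_pdivrMr // ltr_pMr // ltr1n.
have clC : closed C.
  apply: compact_closed; first exact: piece_hausdorff p.
  apply: continuous_compact; last by apply: qball_compact; rewrite divr_ge0 // ltW.
  apply: continuous_subspaceW cc => q [/andP[q0 q1] q2].
  by split; [rewrite q0 /=|]; exact: le_lt_trans e2.
have Kfar s b : ~ C b -> K (s, b) = b.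
  move=> nC; have [Ub|/KnU//] := pselect (U b); rewrite KU //.
  have [Qb qE] := c'K b Ub; rewrite squeeze_far //; first by case: Qb => /andP[].
  rewrite leNgt; apply/negP; rewrite gt_max => /andP[/ltW h1 /ltW h2]; apply: nC.
  by exists (c' b) => //; split=> //; case: Qb => /andP[-> _].
have KD s b : s \in `[0, 1] -> D b -> K (s, b) = b.
  move=> s01 [w cw wb]; subst b; have [Ub|/KnU//] := pselect (U (phi w)); rewrite KU //.
  have [Qb qE] := c'K _ Ub.
  have z : (c' (phi w)).1 = 0 by apply/(cb _ Qb); rewrite qE; exact: (piece_bd p).
  have e3 : c' (phi w) = (0, w).
    rewrite [c' _]surjective_pairing z; congr (_, _); apply: (piece_inj p).
    by rewrite -c0; [rewrite -[in LHS]z -surjective_pairing|case: Qb].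
  by rewrite e3 squeeze_disk // -qE e3.
pose B q := [/\ q.1 < bump v e q & Num.max 1 (rho q.2) * (1 - bump v e q) < 1].
(* These two inequalities make the squeeze at time 1 reach height zero and radius at most one. *)
pose O := (U `&` (fun b => (c' b).1 - bump v e (c' b)) @^-1` [set x | x < 0]) `&`
  (fun b => Num.max 1 (rho (c' b).2) * (1 - bump v e (c' b))) @^-1` [set x | x < 1].
have oO : open O.
  have cbu : {within U, continuous (fun b => bump v e (c' b))} by exact: cw_bump.
  have crh : {within U, continuous (fun b => rho (c' b).2)} by apply: cw_rho; wcont.
  apply: open_preim; last exact: open_lt.
    by apply: open_preim; [exact: oU|wcont|exact: open_lt].
  by apply: (@continuous_subspaceW _ _ _ U) => [b []//|]; wcont.
have Q0 : qbox v e (0, v) by split=> /=; rewrite ?lexx //= subrr normr0.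
have [Uv vE] := cK _ Q0; rewrite c0 ?subrr ?normr0 // in Uv vE.
have bv : 0 < bump v e (0, v).
  by rewrite /bump /= subrr normr0 maxxx subr0 mulr_gt0 // lt_max divr_gt0 ?orbT.
exists O; split=> //.
  rewrite /O /setI /= vE /= subr_lt0; split=> //.
  by rewrite max_l ?mul1r ?gtrBl //; apply/closed_ballE.
exists K, O; split=> //.
- apply: (@within_local _ _ _ K) => -[s b] [/= s01 _]; have [Ub|nUb] := pselect (U b).
    exists (snd @^-1` U); split=> //; first by apply: open_comp => // q _; exact: cvg_snd.
    apply: (@within_eq _ _ _ (fun a => c (squeeze v e (a.1, c' a.2)))) => [[s' b'] [_ Ub']|].
      by rewrite KU.
    apply: (cw_comp cc) => [|[s' b'] [[/= s01' _] Ub']]; last first.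
      by apply: squeeze_in => //; case: (c'K b' Ub').
    apply: cw_squeeze; apply: cw_pair; first by wcont.
    by apply: (cw_comp cc') => [|a [_]//]; wcont.
  exists (snd @^-1` (~` C)); split=> /=.
  + by apply: open_comp => [q _|]; [exact: cvg_snd|exact: closed_openC].
  + move=> [q [/andP[q1 q2] q3] bE]; apply: nUb; rewrite -bE.
    by apply: (cK q _).1; split; [rewrite q1 /=|]; exact: le_lt_trans e2.
  + apply: (@within_eq _ _ _ snd) => [[s' b'] [_ /Kfar ->]//|]; wcont.
- move=> b; have [Ub|/KnU//] := pselect (U b); rewrite KU //.
  by have [[/andP[? _] _] qE] := c'K b Ub; rewrite squeeze0.
- move=> s b s01; have [Ub|/KnU->//] := pselect (U b); rewrite KU //.
  have [Qb qE] := c'K b Ub; rewrite cF; last exact: squeeze_in.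
  by rewrite squeeze_axis // -cF // qE.
- split=> //.
  move=> b [[Ub /= h1] /= h2]; rewrite KU //.
  move: h1; rewrite subr_lt0 => h1; have [h3 h4] := squeeze_flat h1 h2.
  exists (squeeze v e (1, c' b)).2 => //.
  have Qb : qbox v e (squeeze v e (1, c' b)).
    by apply: squeeze_in => //; [exact: in01_1|case: (c'K b Ub)].
  by rewrite -c0 -?h3 -?surjective_pairing //; case: Qb.
Qed.

Lemma ball3_compact : compact (@closed_ball3 R).
Proof.
have c3 : compact [set w : 'rV[R]_3 | forall i, `[-1, 1]%classic (w 0 i)].
  by apply: (@rV_compact R _ (fun i => `[-1, 1]%classic)) => i; exact: segment_compact.
apply: subclosed_compact c3 _ => [|w /closed_ballE w1 i]; last first.
  by rewrite /= in_itv /= -ler_norml; exact: rho_norm.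
change (closed ((@ssq R) @^-1` [set x | x <= 1])).
apply: preimage_closed; last exact: closed_le.
by move=> w _; move: w; apply/cont_within; apply: cw_ssq; exact: cw_id.
Qed.

Lemma disk_compact : compact D.
Proof.
apply: continuous_compact; last exact: ball3_compact.
exact/continuous_subspaceT/(piece_phi p).
Qed.

(** Compactness of the ball leaves finitely many local collapses to compose. *)
Lemma disk_collapse : collapses D.
Proof.
pose f (v : 'rV[R]_3) := if pselect (closed_ball3 v) is left h
  then projT1 (cid (collapses_local h)) else set0.
have fP v : closed_ball3 v -> [/\ open (f v), f v (phi v) & collapses (D `&` f v)].
  by move=> cv; rewrite /f; case: pselect => // h; case: (cid _).
have := ball3_compact; rewrite compact_cover => /(_ _ (@closed_ball3 R) (fun v => phi @^-1` f v)).
case=> [v cv|v cv|E _ DE].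
- by apply: open_comp => [w _|]; [exact: (piece_phi p)|case: (fP v cv)].
- by exists v => //; case: (fP v cv).
have : forall s : seq 'rV[R]_3, collapses (\bigcup_(v in [set v | v \in s]) (D `&` f v)).
  elim=> [|v s IH]; first by apply: collapses_sub collapses0 => b [v].
  have [cv|nc] := pselect (closed_ball3 v); last first.
    apply: collapses_sub IH => b [u /=]; rewrite inE => /orP[/eqP ->|us fb]; last by exists u.
    by rewrite /f; case: pselect => // _ [_].
  have [_ _ cf] := fP v cv.
  apply: collapses_sub (collapsesU _ cf IH).
    move=> b [u /=]; rewrite inE => /orP[/eqP ->|us] fb; [by left|by right; exists u].
  by move=> b [u _ []].
move=> /(_ (finmap.enum_fset E)); apply: collapses_sub => _ [w cw <-].
by have [v vE fb] := DE w cw; exists v => //; split=> //; exists w.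
Qed.

End Collapse.

Section GluedCollapse.
Variables (R : realType) (N1 N2 N : topologicalType).
Variables (F1 : set N1) (F2 : set N2) (phi1 : 'rV[R]_3 -> N1) (phi2 : 'rV[R]_3 -> N2).
Variables (e1 : N1 -> N) (e2 : N2 -> N).
Hypotheses (p1 : piece F1 phi1) (p2 : piece F2 phi2) (hN : glued phi1 phi2 e1 e2).
Local Notation F := (gsurf F1 F2 e1 e2).

Lemma e1_inverse : exists2 j, {within range e1, continuous j} & forall a, j (e1 a) = a.
Proof.
pose b0 := phi1 0.
pose j y := if pselect (exists a, e1 a = y) is left h then projT1 (cid h) else b0.
have jE a : j (e1 a) = a.
  rewrite /j; case: pselect => [h|[]]; last by exists a.
  by case: (cid h) => a' /= /(glued_inj1 hN).
exists j => //; apply: compact_inverse => //.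
- exact: glued_hausdorff hN.
- exact: piece_compact p1.
- exact/continuous_subspaceT/(glued_e1 hN).
Qed.

Definition collapse_spec (K : R * N -> N) (O : set N) :=
  [/\ {within `[0, 1] `*` [set: N], continuous K}, forall y, K (0, y) = y,
      forall s a, s \in `[0, 1] -> K (s, e1 a) = e1 a,
      forall s b, s \in `[0, 1] -> range e2 (K (s, e2 b)) &
      (forall s y, s \in `[0, 1] -> (F (K (s, y)) <-> F y)) /\
      [/\ open O, range e1 `<=` O & forall y, O y -> range e1 (K (1, y))]].

End GluedCollapse.

Section GluedCollapse2.
Variables (R : realType) (N1 N2 N : topologicalType).
Variables (F1 : set N1) (F2 : set N2) (phi1 : 'rV[R]_3 -> N1) (phi2 : 'rV[R]_3 -> N2).
Variables (e1 : N1 -> N) (e2 : N2 -> N).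
Hypotheses (p1 : piece F1 phi1) (p2 : piece F2 phi2) (hN : glued phi1 phi2 e1 e2).
Local Notation F := (gsurf F1 F2 e1 e2).

Lemma e2_inverse : exists2 j, {within range e2, continuous j} & forall b, j (e2 b) = b.
Proof. exact: e1_inverse p2 (glued_sym hN). Qed.

Lemma range1_closed : closed (range e1).
Proof. exact: (e1_closed p1 hN closedT). Qed.

Lemma range2_closed : closed (range e2).
Proof. exact: (e2_closed p2 hN closedT). Qed.

(** The collapse of N2, extended by the identity of N1; the two agree on the ball because the
    collapse fixes it. *)
Lemma glued_collapse : exists K O, @collapse_spec R _ _ _ F1 F2 e1 e2 K O.
Proof.
have [k [O2 [ck k0 kD kF [oO2 DO OD]]]] := disk_collapse p2.
have [j cj jE] := e2_inverse.
pose K (q : R * N) := if pselect (range e1 q.2) then q.2 else e2 (k (q.1, j q.2)).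
have Ke1 s a : K (s, e1 a) = e1 a.
  by rewrite /K; case: pselect => // -[]; exists a.
have Ke2 s b : s \in `[0, 1] -> K (s, e2 b) = e2 (k (s, b)).
  move=> s01; rewrite /K; case: pselect => [h|nh]; last by rewrite /= jE.
  have [a _ /= eab] := h.
  have [v cv [_ bE]] := (gluedP hN a b).1 eab.
  by rewrite kD //; exists v.
exists K, (range e1 `|` e2 @` O2); split.
- apply: (@within_closed_glue _ _ _ (snd @^-1` range e1) (snd @^-1` range e2)).
  + apply: preimage_closed; [by move=> q _; exact: cvg_snd|exact: range1_closed].
  + apply: preimage_closed; [by move=> q _; exact: cvg_snd|exact: range2_closed].
  + move=> [s y] _; have [[a ->]|[b ->]] := glued_cover hN y; [by left; exists a|by right; exists b].
  + apply: (@within_eq _ _ _ snd); last by wcont.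
    by move=> [s y] [_ [a _ /= <-]]; rewrite Ke1.
  + apply: (@within_eq _ _ _ (fun q => e2 (k (q.1, j q.2)))).
      by move=> [s y] [[/= s01 _] [b _ /= <-]]; rewrite Ke2 // jE.
    apply: cw_compT; first exact: glued_e2 hN.
    apply: (cw_comp ck) => [|[s y] [[/= s01 _] _]]; last by split.
    apply: cw_pair; first by wcont.
    by apply: (cw_comp cj) => [|q []]; first by wcont.
- move=> y; have [[a ->]|[b ->]] := glued_cover hN y; first by rewrite Ke1.
  by rewrite Ke2 ?k0 // in01_0.
- by move=> s a _; exact: Ke1.
- by move=> s b s01; rewrite Ke2 //; exists (k (s, b)).
split=> [s y s01|].
  have [[a ->]|[b ->]] := glued_cover hN y; first by rewrite Ke1.
  by rewrite Ke2 // !(gsurf2 p1 p2 hN) kF.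
split=> [|y|y].
- apply: (open_glue p1 p2 hN).
    rewrite (_ : _ @^-1` _ = setT); first exact: openT.
    by apply/seteqP; split=> // a _; left; exists a.
  rewrite (_ : _ @^-1` _ = O2) //; apply/seteqP; split=> b; last by move=> Ob; right; exists b.
  move=> [[a _ eab]|[b' Ob /(glued_inj2 hN) <-//]].
  by have [v cv [_ ->]] := (gluedP hN a b).1 eab; apply: DO; exists v.
- by left.
- move=> [[a _ <-]|[b Ob <-]]; first by rewrite Ke1; exists a.
  rewrite Ke2 ?in01_1 //; have [v cv <-] := OD b Ob.
  by exists (phi1 v) => //; exact: (glued_phi hN cv).
Qed.

Section Split.
Variables (K : R * N -> N) (O : set N).
Hypothesis hK : @collapse_spec R _ _ _ F1 F2 e1 e2 K O.

(** Subdivide for the cover by O and the complement of [range e1], then apply K at time 1: the first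
    part is moved into [range e1], and the second stays in [range e2]. *)
Lemma split_cycle n (A B : set N) (z : chain R N n) :
  (forall s y, s \in `[0, 1] -> A y -> A (K (s, y))) ->
  (forall s y, s \in `[0, 1] -> A y -> B y -> B (K (s, y))) ->
  z \in is_cycle A B -> exists c1 c2,
  [/\ c1 \in chain_in (e1 @^-1` A), c2 \in chain_in (e2 @^-1` A),
      bd (push e1 c1 + push e2 c2) \in chain_in B &
      push e1 c1 + push e2 c2 - z \in bounds A B].
Proof.
move=> KA KB zc; have [zA zB] := (is_cycleP _ _ _).1 zc.
have [cK K0 K1 K2 [KF [oO O1 KO]]] := hK.
have oU : open (~` range e1) by apply: closed_openC; exact: range1_closed.
have AU : A `<=` O `|` ~` range e1.
  by move=> y _; have [/O1|] := pselect (range e1 y); [left|right].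
have [m [u1 [u2 [mE u1A u2A]]]] := small_split oO oU AU zA.
have [j1 cj1 j1E] := e1_inverse p1 hN; have [j2 cj2 j2E] := e2_inverse.
have cK1 : {within setT, continuous (fun y => K (1, y))}.
  apply: (cw_comp cK) => [|y _]; last by split=> //=; exact: in01_1.
  by apply: cw_pair; [exact: cw_cst|exact: cw_id].
have v1A : push (fun y => K (1, y)) u1 \in chain_in (A `&` range e1).
  apply: push_chain_in u1A; first exact: continuous_subspaceW cK1.
  by move=> y [Ay Oy]; split; [apply: KA => //; exact: in01_1|exact: KO].
have v2A : push (fun y => K (1, y)) u2 \in chain_in (A `&` range e2).
  apply: push_chain_in u2A; first exact: continuous_subspaceW cK1.
  move=> y [Ay nr]; split; first by apply: KA => //; exact: in01_1.
  have [[a yE]|[b ->]] := glued_cover hN y; first by case: nr; exists a.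
  by apply: K2; exact: in01_1.
have lift (X : topologicalType) (e : X -> N) j (u : chain R N n) :
    {within range e, continuous j} -> (forall a, j (e a) = a) -> u \in chain_in (A `&` range e) ->
    push j u \in chain_in (e @^-1` A) /\ push e (push j u) = u.
  move=> cj jE uA; split.
    apply: push_chain_in uA; first by apply: continuous_subspaceW cj => y [].
    by move=> y [Ay [a _ ay]]; rewrite /= -ay jE ay.
  rewrite push_comp -[RHS]push_id; apply: eq_push uA => y [_ [a _ ay]].
  by rewrite /= -ay jE.
have [w1A w1E] := lift _ _ _ _ cj1 j1E v1A.
have [w2A w2E] := lift _ _ _ _ cj2 j2E v2A.
exists (push j1 (push (fun y => K (1, y)) u1)), (push j2 (push (fun y => K (1, y)) u2)).
have E : push e1 (push j1 (push (fun y => K (1, y)) u1)) +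
    push e2 (push j2 (push (fun y => K (1, y)) u2)) =
    push (fun y => K (1, y)) (iter m (@Sd R N n) z) by rewrite w1E w2E mE raddfD.
have mc := iter_Sd_cycle m zc; have [mA mB] := (is_cycleP _ _ _).1 mc.
split=> //.
  rewrite E bd_push'; apply: (push_chain_in (A := A `&` B)).
  - exact: continuous_subspaceW cK1.
  - by move=> y [Ay By]; apply: KB => //; exact: in01_1.
  - by apply: chain_inI => //; exact: bd_chain_in.
rewrite E -[X in X \in _](subrKA (iter m (@Sd R N n) z)) rpredD //; last exact: iter_Sd_bounds.
have := homotopy_bounds (H := K) (B := A) (C := B) (B' := A) (C' := B) _ _ _ mA mB.
rewrite (eq_push (f := fun x => K (0, x)) (g := id) (A := setT)) //; last first.
  exact: chain_inW mA.
rewrite push_id; apply.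
- by apply: continuous_subspaceW cK => q [].
- by move=> s y s01 Ay; apply: KA.
- by move=> s y s01 Ay By; apply: KB.
Qed.

End Split.
End GluedCollapse2.

(** * Genus of the sum *)

Section Contractible.
Variable R : realType.

Definition augm (X : topologicalType) n : chain R X n -> int :=
  flift (fun _ : std_simplex R n -> X => 1 : int).
HB.instance Definition _ (X : topologicalType) n :=
  GRing.isZmodMorphism.Build (chain R X n) int (@augm X n) (@flift_is_zmod _ _ _).

Lemma augmU (X : topologicalType) n (s : std_simplex R n -> X) :
  augm (<< s >> : chain R X n) = 1.
Proof. exact: fliftU. Qed.

Definition cst_simplex (X : topologicalType) n (x : X) : chain R X n :=
  << (fun _ => x) : std_simplex R n -> X >>.

Lemma cst_simplex_in (X : topologicalType) n (A : set X) x : A x ->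
  cst_simplex n x \in chain_in A.
Proof. by move=> Ax; apply: chain_inU => [|//]; exact: cst_continuous. Qed.

Lemma push_cst (X Y : topologicalType) n (y : Y) (c : chain R X n) :
  push (fun _ => y) c = cst_simplex n y *~ augm c.
Proof.
pose f := @push R X Y n (fun _ => y).
pose g := (fun c : chain R X n => cst_simplex n y *~ augm c).
apply: (@freeg_ext _ _ f g); rewrite /f /g; first exact: raddfB.
  by move=> a b; rewrite raddfB mulrzBr.
by move=> s; rewrite pushU augmU mulr1z.
Qed.

Lemma bd_cst1 (X : topologicalType) (x : X) : bd (cst_simplex 1 x) = 0.
Proof. by rewrite /cst_simplex bdU !big_ord_recl big_ord0 /= addr0 expr0 expr1 mulr1z mulrNz mulr1z subrr. Qed.

Lemma bd_cst2 (X : topologicalType) (x : X) : bd (cst_simplex 2 x) = cst_simplex 1 x.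
Proof.
rewrite /cst_simplex bdU !big_ord_recl big_ord0 /= addr0 expr0 expr1 mulr1z mulrNz mulr1z.
by rewrite /bump /=; exact: addNKr.
Qed.

Lemma augm_bd1 (X : topologicalType) (c : chain R X 1) : augm (bd c) = 0.
Proof.
pose f := (@augm X 0 \o @bd R X 1); pose g := (fun _ : chain R X 1 => 0 : int).
apply: (@freeg_ext _ _ f g); rewrite /f /g; first exact: raddfB.
  by move=> a b; rewrite subr0.
move=> s; rewrite /= bdU raddf_sum /=; rewrite (eq_bigr (fun i : 'I_2 => (1 : int) *~ (-1) ^+ i)).
  by rewrite !big_ord_recl big_ord0.
by move=> i _; rewrite raddfMz; congr (_ *~ _); exact: augmU.
Qed.

Lemma augm_bd2 (X : topologicalType) (c : chain R X 2) : augm (bd c) = augm c.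
Proof.
pose f := (@augm X 1 \o @bd R X 2); pose g := @augm X 2.
apply: (@freeg_ext _ _ f g); rewrite /f /g; try exact: raddfB.
move=> s; rewrite /= bdU raddf_sum /=; rewrite (eq_bigr (fun i : 'I_3 => (1 : int) *~ (-1) ^+ i)).
  by rewrite augmU !big_ord_recl big_ord0.
by move=> i _; rewrite raddfMz; congr (_ *~ _); exact: augmU.
Qed.

Definition contracts (X : topologicalType) (A : set X) (x0 : X) :=
  A x0 /\ exists H : R * X -> X,
  [/\ {within `[0, 1] `*` A, continuous H}, forall x, A x -> H (0, x) = x,
      forall x, A x -> H (1, x) = x0 &
      forall s x, 0 <= s <= 1 -> A x -> A (H (s, x))].

(** The contraction makes c homologous to its image under a constant map, which is a multiple of a
    constant simplex. *)
Lemma contracts_bounds (X : topologicalType) n (A : set X) x0 (c : chain R X n) :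
  contracts A x0 -> c \in is_cycle A set0 -> c - cst_simplex n x0 *~ augm c \in bounds A set0.
Proof.
move=> [_ [H [cH H0 H1 HA]]] /is_cycleP[cA /chain_in0 c0].
have := homotopy_bounds (B' := A) (C' := set0) (C := set0) cH HA _ cA.
rewrite (eq_push (f := fun x => H (1, x)) (g := fun _ => x0) (A := A)) //.
rewrite (eq_push (f := fun x => H (0, x)) (g := id) (A := A)) // push_id.
rewrite push_cst -opprB rpredN; apply => [s x _ _ []//|].
by rewrite c0 rpred0.
Qed.

Lemma contracts_bounds0 (X : topologicalType) (A : set X) x0 (c : chain R X 0) :
  contracts A x0 -> c \in chain_in A -> augm c = 0 -> c \in bounds A set0.
Proof.
move=> cA Ac c0; have := @contracts_bounds _ _ A x0 c cA.
rewrite c0 mulr0z subr0; apply; apply/is_cycleP; split=> //; exact: rpred0.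
Qed.

Lemma contracts_bounds1 (X : topologicalType) (A : set X) x0 (c : chain R X 1) :
  contracts A x0 -> c \in is_cycle A set0 -> c \in bounds A set0.
Proof.
move=> cA cc; rewrite -(subrK (cst_simplex 1 x0 *~ augm c) c) rpredD //.
  exact: contracts_bounds.
by rewrite -bd_cst2 rpredMz // bounds_bd // cst_simplex_in //; case: cA.
Qed.

(** In degree 2 the boundary preserves [augm], so a cycle has augmentation zero and the constant
    term disappears. *)
Lemma contracts_bounds2 (X : topologicalType) (A : set X) x0 (c : chain R X 2) :
  contracts A x0 -> c \in is_cycle A set0 -> c \in bounds A set0.
Proof.
move=> cA cc; have := contracts_bounds cA cc; have /is_cycleP[_ /chain_in0 c0] := cc.
by rewrite -augm_bd2 c0 raddf0 mulr0z subr0.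
Qed.

Definition star_shaped n (A : set 'rV[R]_n) v0 :=
  A v0 /\ forall s v, 0 <= s <= 1 -> A v -> A ((1 - s) *: v + s *: v0).

Lemma star_contracts n (A : set 'rV[R]_n) v0 : star_shaped A v0 -> contracts A v0.
Proof.
move=> [A0 sA]; split=> //; exists (fun q => (1 - q.1) *: q.2 + q.1 *: v0); split.
- by apply: cw_addmx; apply: cw_scalemx; wcont.
- by move=> x _; rewrite /= subr0 scale1r scale0r addr0.
- by move=> x _; rewrite /= subrr scale0r scale1r add0r.
- by move=> s x s01 Ax; apply: sA.
Qed.

Lemma homeo_contracts (X Y : topologicalType) (A : set X) (B : set Y) f g x0 :
  homeo A B f g -> contracts A x0 -> contracts B (f x0).
Proof.
move=> [cf cg fK gK] [A0 [H [cH H0 H1 HA]]]; split; first by have [] := fK _ A0.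
exists (fun q => f (H (q.1, g q.2))); split.
- apply: (cw_comp cf) => [|[s y] [/= s01 /gK[Ay _]]]; last by apply: HA; rewrite // -?in_itv.
  apply: (cw_comp cH) => [|[s y] [/= s01 /gK[Ay _]]]; last by split.
  apply: cw_pair; first by wcont.
  by apply: (cw_comp cg) => [|q []]; first by wcont.
- by move=> y /gK[Ay gy]; rewrite /= H0.
- by move=> y /gK[Ay gy]; rewrite /= H1.
- by move=> s y s01 /gK[Ay _] /=; have [] := fK _ (HA s _ s01 Ay).
Qed.

End Contractible.
Arguments contracts R {X} A x0.

Section PieceContract.
Variables (R : realType) (N : topologicalType) (F : set N) (phi : 'rV[R]_3 -> N).
Hypothesis p : piece F phi.

Lemma disk_homeo (A : set 'rV[R]_3) : A `<=` @closed_ball3 R ->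
  exists psi, homeo A (phi @` A) phi psi.
Proof.
move=> AB; pose psi y := if pselect (exists v, phi v = y) is left h then projT1 (cid h) else 0.
have pE v : psi (phi v) = v.
  rewrite /psi; case: pselect => [h|[]]; last by exists v.
  by case: (cid h) => w /= /(piece_inj p).
exists psi; split.
- exact/continuous_subspaceT/(piece_phi p).
- have := @compact_inverse _ _ (@closed_ball3 R) phi psi (piece_hausdorff p) (@ball3_compact R).
  move=> h; apply: continuous_subspaceW (h _ _).
  + by move=> _ [v Av <-]; exists v => //; exact: AB.
  + exact/continuous_subspaceT/(piece_phi p).
  + by move=> v _; exact: pE.
- by move=> v Av; split; [exists v|rewrite pE].
- by move=> _ [v Av <-]; rewrite pE.
Qed.

Lemma ball3_star : star_shaped (@closed_ball3 R) 0.
Proof.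
split; first by apply/closed_ballE; rewrite /rho ssqE !mxE expr0n /= !addr0 sqrtr0 ler01.
move=> s v /andP[s0 s1] /closed_ballE v1; apply/closed_ballE; rewrite scaler0 addr0 rhoZ.
rewrite ger0_norm ?subr_ge0 //; apply: mulr_ile1 => //; rewrite ?subr_ge0 ?rho_ge0 //.
by rewrite gerBl.
Qed.

Definition arc3 : set 'rV[R]_3 := [set v | axis3 v /\ closed_ball3 v].

Lemma arc3_star : star_shaped arc3 0.
Proof.
have [b0 bs] := ball3_star; split; first by split=> // i _; rewrite mxE.
move=> s v s01 [av bv]; split; last exact: bs.
by move=> i i0; rewrite !mxE av // mulr0 add0r mulr0.
Qed.

Lemma arc_contracts : contracts R (phi @` arc3) (phi 0).
Proof.
have [|psi h] := @disk_homeo arc3; first by move=> v [].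
exact: homeo_contracts h (star_contracts arc3_star).
Qed.

Lemma arc_sub : phi @` arc3 `<=` F.
Proof. by move=> _ [v [av _] <-]; exact/(piece_axis p). Qed.

(** Tietze extension of the one coordinate that varies along the arc. *)
Lemma arc_retraction : exists2 g : N -> 'rV[R]_3, continuous g &
  (forall y, arc3 (g y)) /\ forall v, arc3 v -> g (phi v) = v.
Proof.
have [|psi [_ cpsi pK qK]] := @disk_homeo arc3; first by move=> v [].
have clA : closed (phi @` arc3).
  have -> : phi @` arc3 = F `&` (phi @` @closed_ball3 R).
    apply/seteqP; split=> [_ [v [av cv] <-]|y [Fy [v cv vy]]].
      by split; [exact/(piece_axis p)|exists v].
    by exists v => //; split=> //; apply/(piece_axis p); rewrite vy.
  apply: closedI; first exact: piece_closed p.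
  by apply: compact_closed; [exact: piece_hausdorff p|exact: (disk_compact p)].
have nN : normal_space N.
  by apply: compact_normal; [exact: piece_hausdorff p|exact: piece_compact p].
have [||g [gE cg gb]] := continuous_bounded_extension nN clA (f := fun y => psi y 0 0) (M := 1) ltr01.
- exact: cw_coord.
- by move=> _ [v av <-]; have [_ ->] := pK v av; case: av => _ /closed_ballE; exact: rho_norm.
exists (fun y => row3 (g y) 0 0).
  apply/cont_within; apply: cw_row3; try exact: cw_cst; exact: continuous_subspaceT.
split=> [y|v av].
  split; first by apply/axis3P; rewrite !mxE /= !inordK.
  apply/closed_ballE; rewrite /rho ssqE !row3E expr0n /= !addr0 sqrtr_sqr; exact: gb.
have pv : (phi @` arc3) (phi v) by exists v.
rewrite -gE; last exact/mem_set; have [_ ->] := pK v av.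
by case: av => /axis3P[v1 v2] _; apply: eq_row3; rewrite row3E.
Qed.

End PieceContract.

Section Genus.
Variables (R : realType) (N1 N2 N : topologicalType).
Variables (F1 : set N1) (F2 : set N2) (phi1 : 'rV[R]_3 -> N1) (phi2 : 'rV[R]_3 -> N2).
Variables (e1 : N1 -> N) (e2 : N2 -> N).
Hypotheses (p1 : piece F1 phi1) (p2 : piece F2 phi2) (hN : glued phi1 phi2 e1 e2).
Local Notation F := (gsurf F1 F2 e1 e2).

(** The identity on N1 and, on F2, the retraction onto the common arc; this collapses F onto F1. *)
Lemma surface_retraction : exists r : N -> N1, [/\ {within F, continuous r},
  forall a, r (e1 a) = a & forall b, F2 b -> (phi1 @` @arc3 R) (r (e2 b))].
Proof.
have [g cg [ga gK]] := arc_retraction p2.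
have [j1 cj1 j1E] := e1_inverse p1 hN; have [j2 cj2 j2E] := e1_inverse p2 (glued_sym hN).
pose r y := if pselect (range e1 y) then j1 y else phi1 (g (j2 y)).
have r1 a : r (e1 a) = a by rewrite /r; case: pselect => [h|[]]; [exact: j1E|exists a].
have r2 b : F2 b -> r (e2 b) = phi1 (g b).
  move=> Fb; rewrite /r; case: pselect => [h|nh]; last by rewrite j2E.
  have [a _ eab] := h; have [v cv [aE bE]] := (gluedP hN a b).1 eab.
  rewrite /= -eab j1E aE bE gK //; split=> //.
  by apply/(piece_axis p2); rewrite -bE.
exists r; split=> //; last by move=> b Fb; rewrite r2 //; exists (g b).
apply: (@within_closed_glue _ _ _ (range e1) (range e2)).
- exact: range1_closed p1 hN.
- exact: range1_closed p2 (glued_sym hN).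
- by move=> y _; have [[a ->]|[b ->]] := glued_cover hN y; [left|right].
- apply: (@within_eq _ _ _ j1); last by apply: continuous_subspaceW cj1 => y [].
  by move=> y [_ [a _ <-]]; rewrite r1 j1E.
- apply: (@within_eq _ _ _ (fun y => phi1 (g (j2 y)))).
    move=> y [Fy [b _ be]]; subst y.
    by rewrite r2 ?j2E //; apply/(gsurf2 p1 p2 hN).
  apply: cw_compT; first exact: piece_phi p1.
  apply: cw_compT; first exact: cg.
  by apply: continuous_subspaceW cj2 => y [].
Qed.

(** After retraction onto F1 the second summand is a cycle in the arc, where it bounds. *)
Lemma bounds_summand n (c1 : chain R N1 n) (c2 : chain R N2 n) :
  (forall c, c \in is_cycle (phi1 @` @arc3 R) set0 -> (c : chain R N1 n) \in bounds (phi1 @` @arc3 R) set0) ->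
  c1 \in is_cycle F1 set0 -> c2 \in is_cycle F2 set0 ->
  push e1 c1 + push e2 c2 \in bounds F set0 -> c1 \in bounds F1 set0.
Proof.
move=> arcb cc1 cc2 bc; have [r [cr r1 r2]] := surface_retraction.
have [c1F _] := (is_cycleP _ _ _).1 cc1.
have rF y : F y -> F1 (r y).
  move=> [[a Fa <-]|[b Fb <-]]; first by rewrite r1.
  by apply: (arc_sub p1); exact: r2.
have [_ _ ce2] : [/\ True, continuous e1 & continuous e2] by case: hN => _ [].
have cre2 : {within F2, continuous (r \o e2)}.
  apply: (cw_comp cr) => [|b Fb]; first exact: continuous_subspaceT.
  exact/(gsurf2 p1 p2 hN).
have := bounds_push (f := r) (A' := F1) (B' := set0) cr (@continuous_subspaceW _ _ _ _ _ (@sub0set _ _) cr) rF (fun _ f => f) bc.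
rewrite raddfD /= !push_comp (eq_push (f := r \o e1) (g := id) (A := F1)) ?push_id //; last first.
  by move=> a _ /=; rewrite r1.
move=> b12; rewrite -(addrK (push (r \o e2) c2) c1) rpredB //.
apply: (@boundsW _ _ _ (phi1 @` @arc3 R) set0); [exact: (arc_sub p1)|by []|apply: arcb].
apply: is_cycle_push cc2 => //; exact: continuous_subspaceW cre2.
Qed.

End Genus.

Section Genus2.
Variables (R : realType) (N1 N2 N : topologicalType).
Variables (F1 : set N1) (F2 : set N2) (phi1 : 'rV[R]_3 -> N1) (phi2 : 'rV[R]_3 -> N2).
Variables (e1 : N1 -> N) (e2 : N2 -> N).
Hypotheses (p1 : piece F1 phi1) (p2 : piece F2 phi2) (hN : glued phi1 phi2 e1 e2).
Local Notation F := (gsurf F1 F2 e1 e2).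

(** The Mayer-Vietoris map from H_n(F1) + H_n(F2) to H_n(F); in degree 1 it is bijective because the
    common arc is contractible. *)
Definition sum_class n (x : homology R n F1 set0 * homology R n F2 set0) : homology R n F set0 :=
  hclass F set0 (push e1 (\val (repr x.1)) + push e2 (\val (repr x.2))).

Lemma push_e_cycle n (c1 : chain R N1 n) (c2 : chain R N2 n) :
  c1 \in is_cycle F1 set0 -> c2 \in is_cycle F2 set0 ->
  (push e1 c1 \in is_cycle F set0) /\ (push e2 c2 \in is_cycle F set0).
Proof.
move=> cc1 cc2; split.
  apply: (is_cycle_push _ _ _ _ cc1) => //; first exact/continuous_subspaceT/(glued_e1 hN).
    exact/continuous_subspaceT/(glued_e1 hN).
  by move=> a Fa; left; exists a.
apply: (is_cycle_push _ _ _ _ cc2) => //; first exact/continuous_subspaceT/(glued_e2 hN).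
  exact/continuous_subspaceT/(glued_e2 hN).
by move=> a Fa; right; exists a.
Qed.

Lemma push_e_bounds n (c1 : chain R N1 n) (c2 : chain R N2 n) :
  c1 \in bounds F1 set0 -> c2 \in bounds F2 set0 ->
  push e1 c1 + push e2 c2 \in bounds F set0.
Proof.
move=> cc1 cc2; apply: rpredD.
  apply: (bounds_push _ _ _ _ cc1) => //; first exact/continuous_subspaceT/(glued_e1 hN).
    exact/continuous_subspaceT/(glued_e1 hN).
  by move=> a Fa; left; exists a.
apply: (bounds_push _ _ _ _ cc2) => //; first exact/continuous_subspaceT/(glued_e2 hN).
  exact/continuous_subspaceT/(glued_e2 hN).
by move=> a Fa; right; exists a.
Qed.

Lemma reprP (X : topologicalType) n (A B : set X) (x : homology R n A B) :
  \val (repr x) \in is_cycle A B.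
Proof. exact: valP. Qed.

Lemma sum_classE n c1 c2 : c1 \in is_cycle F1 set0 -> c2 \in is_cycle F2 set0 ->
  sum_class (hclass F1 set0 c1, hclass F2 set0 c2) =
  hclass F set0 (push e1 c1 + push e2 c2 : chain R N n).
Proof.
move=> cc1 cc2; have [d1 d2] := push_e_cycle cc1 cc2.
have [d3 d4] := push_e_cycle (reprP (hclass F1 set0 c1)) (reprP (hclass F2 set0 c2)).
rewrite /sum_class; apply/hclassE; [exact: rpredD|exact: rpredD|].
by rewrite opprD addrACA -!raddfB; apply: push_e_bounds; exact: repr_hclass.
Qed.

Lemma sum_class_additive n : zmod_morphism (@sum_class n).
Proof.
move=> [x1 x2] [y1 y2].
have [a1 ca1 ->] := hclass_ex x1; have [a2 ca2 ->] := hclass_ex x2.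
have [b1 cb1 ->] := hclass_ex y1; have [b2 cb2 ->] := hclass_ex y2.
have -> : (hclass F1 set0 a1, hclass F2 set0 a2) - (hclass F1 set0 b1, hclass F2 set0 b2)
    = (hclass F1 set0 (a1 - b1), hclass F2 set0 (a2 - b2)) by rewrite !hclassB.
rewrite !sum_classE ?rpredB // -hclassB; last first.
- by have [? ?] := push_e_cycle cb1 cb2; rewrite rpredD.
- by have [? ?] := push_e_cycle ca1 ca2; rewrite rpredD.
by congr (hclass _ _ _); rewrite !raddfB opprD addrACA.
Qed.

Lemma sum_class_inj : injective (@sum_class 1).
Proof.
suff h x : @sum_class 1 x = 0 -> x = 0.
  move=> x y xy; apply/eqP; rewrite -subr_eq0; apply/eqP/h.
  by rewrite sum_class_additive xy subrr.
case: x => x1 x2; have [a1 ca1 ->] := hclass_ex x1; have [a2 ca2 ->] := hclass_ex x2.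
have [d1 d2] := push_e_cycle ca1 ca2.
rewrite sum_classE // => /(hclass_eq0 _).1; rewrite rpredD // => /(_ isT) b.
have b1 : a1 \in bounds F1 set0.
  apply: bounds_summand p1 p2 hN _ _ _ _ ca1 ca2 b => c.
  exact: contracts_bounds1 (arc_contracts p1).
have b2 : a2 \in bounds F2 set0.
  rewrite addrC -gsurf_sym in b.
  apply: bounds_summand p2 p1 (glued_sym hN) _ _ _ _ ca2 ca1 b => c.
  exact: contracts_bounds1 (arc_contracts p2).
by congr (_, _); apply/hclass_eq0.
Qed.

(** The boundaries of the two parts cancel, hence lie in both surfaces and so in the arc; a 0-chain
    of augmentation zero bounds there. *)
Lemma arc_pair c1 c2 : c1 \in chain_in F1 -> c2 \in chain_in F2 ->
  bd (push e1 c1 + push e2 c2 : chain R N 1) = 0 ->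
  exists2 w, w \in chain_in (phi1 @` @arc3 R) & bd c1 = bd w.
Proof.
move=> c1F c2F /eqP; rewrite raddfD /= addr_eq0 => /eqP bdE.
have [j1 cj1 j1E] := e1_inverse p1 hN.
have b1 : bd (push e1 c1) \in chain_in (e1 @` (phi1 @` @arc3 R)).
  have h1 : bd (push e1 c1) \in chain_in (e1 @` F1).
    apply: bd_chain_in; apply: push_chain_in c1F; first exact/continuous_subspaceT/(glued_e1 hN).
    by move=> a Fa; exists a.
  have h2 : bd (push e1 c1) \in chain_in (e2 @` F2).
    rewrite bdE rpredN; apply: bd_chain_in; apply: push_chain_in c2F.
      exact/continuous_subspaceT/(glued_e2 hN).
    by move=> a Fa; exists a.
  apply: chain_inW (chain_inI h1 h2) => y [[a Fa <-] [b Fb /esym/(gluedP hN)[v cv [aE bE]]]].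
  exists a => //; exists v => //; split=> //.
  by apply/(piece_axis p1); rewrite -aE.
have b1' : bd c1 \in chain_in (phi1 @` @arc3 R).
  have -> : bd c1 = push j1 (bd (push e1 c1)).
    rewrite bd_push' push_comp -[LHS]push_id.
    by apply: (@eq_push _ _ _ _ _ _ setT) => [a _ /=|]; [rewrite j1E|apply: chain_inW (bd_chain_in c1F)].
  apply: push_chain_in b1; first by apply: continuous_subspaceW cj1 => _ [a _ <-]; exists a.
  by move=> _ [a [v av <-] <-]; rewrite j1E; exists v.
have := contracts_bounds0 (arc_contracts p1) b1' (augm_bd1 c1).
by move=> /bounds0P[w ? ->]; exists w.
Qed.

Lemma sum_class_surj y : exists x, @sum_class 1 x = y.
Proof.
have [z cz ->] := hclass_ex y.
have [K [O hK]] := glued_collapse p1 p2 hN.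
have [_ _ _ _ [KF _]] := hK.
have [|s q _ _ []|c1 [c2 [c1A c2A bc bs]]] := split_cycle p1 p2 hN hK _ _ cz.
  by move=> s q s01 Fq; apply/KF.
have F1E : e1 @^-1` F = F1 by apply/seteqP; split=> a /(gsurf1 p1 p2 hN).
have F2E : e2 @^-1` F = F2 by apply/seteqP; split=> a /(gsurf2 p1 p2 hN).
rewrite F1E in c1A; rewrite F2E in c2A.
have bc0 := chain_in0 bc.
have [w warc bw] := arc_pair c1A c2A bc0.
have [j1 cj1 j1E] := e1_inverse p1 hN.
have [|psi [cphi cpsi pK qK]] := @disk_homeo _ _ _ _ p1 (@arc3 R); first by move=> v [].
(* The chain w of the arc, seen from N2. Subtracting it on one side and adding it on the other makes
   both parts cycles without changing their sum in N. *)
pose w2 := push (phi2 \o psi) w.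
have w2E : push e2 w2 = push e1 w.
  rewrite push_comp; apply: eq_push warc => _ [v av <-] /=.
  by have [_ ->] := pK v av; rewrite (glued_phi hN) //; case: av.
have w2F : w2 \in chain_in F2.
  apply: push_chain_in warc; first by apply: cw_compT cpsi; exact: piece_phi p2.
  move=> _ [v av <-] /=; have [_ ->] := pK v av.
  by apply/(piece_axis p2); case: av.
have wF : w \in chain_in F1 by apply: chain_inW warc; exact: (arc_sub p1).
have [j2 cj2 j2E] := e1_inverse p2 (glued_sym hN).
have bd2 : bd c2 = - bd w2.
  have inj u : push j2 (push e2 u) = u :> chain R N2 0.
    by rewrite push_comp -[RHS]push_id; congr push; apply/funext => b /=; rewrite j2E.
  apply: (can_inj inj); rewrite raddfN /= -!bd_push w2E.
  have -> : bd (push e1 w) = bd (push e1 c1).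
    by rewrite !bd_push; congr (push e1 _); exact: esym.
  by move/eqP: bc0; rewrite raddfD /= addrC addr_eq0 => /eqP.
exists (hclass F1 set0 (c1 - w), hclass F2 set0 (c2 + w2)).
have cy1 : c1 - w \in is_cycle F1 set0.
  by apply/is_cycleP; rewrite raddfB /= bw subrr rpred0 rpredB.
have cy2 : c2 + w2 \in is_cycle F2 set0.
  by apply/is_cycleP; rewrite raddfD /= bd2 addNr rpred0 rpredD.
rewrite sum_classE //.
have -> : push e1 (c1 - w) + push e2 (c2 + w2) = push e1 c1 + push e2 c2.
  by rewrite raddfB raddfD /= w2E addrACA addNr addr0.
apply/hclassE => //; apply/is_cycleP; split; last exact: bc.
apply: rpredD.
  apply: push_chain_in c1A; first exact/continuous_subspaceT/(glued_e1 hN).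
  by move=> a Fa; left; exists a.
apply: push_chain_in c2A; first exact/continuous_subspaceT/(glued_e2 hN).
by move=> a Fa; right; exists a.
Qed.

Lemma gsurf_genus g1 g2 : has_genus R F1 g1 -> has_genus R F2 g2 -> has_genus R F (g1 + g2).
Proof.
move=> [f1 [f1D [h1 f1K h1K]]] [f2 [f2D [h2 f2K h2K]]].
pose S := @sum_class 1.
have [T TE] := choice sum_class_surj.
have TK : cancel T S by move=> y; exact: TE.
have ST : cancel S T by move=> x; apply: sum_class_inj; rewrite -/S TK.
have TD : {morph T : x y / x + y}.
  move=> x y; apply: sum_class_inj; rewrite -/S TK.
  have SB : zmod_morphism S := @sum_class_additive 1.
  have S0 : S 0 = 0 by have := SB 0 0; rewrite !subr0 subrr.
  have SN u : S (- u) = - S u by have := SB 0 u; rewrite !sub0r S0 sub0r.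
  by rewrite -[T y]opprK SB SN opprK !TK.
have E : (2 * g1 + 2 * g2 = 2 * (g1 + g2))%N by rewrite mulnDr.
pose f (y : homology R 1 F set0) : 'rV[int]_(2 * (g1 + g2)) :=
  castmx (erefl, E) (row_mx (f1 (T y).1) (f2 (T y).2)).
exists f; split.
  move=> x y; rewrite /f TD /= f1D f2D -add_row_mx.
  by apply/matrixP => i j; rewrite mxE !castmxE mxE.
pose c (v : 'rV[int]_(2 * (g1 + g2))) := castmx (esym (erefl 1%N), esym E) v.
exists (fun v => S (h1 (lsubmx (c v)), h2 (rsubmx (c v)))).
  by move=> y /=; rewrite /f /c castmxK row_mxKl row_mxKr f1K f2K -surjective_pairing TK.
by move=> v /=; rewrite /f /c ST /= h1K h2K hsubmxK castmxKV.
Qed.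

End Genus2.

(** * The relative class of the sum *)

Section PuncturedBall.
Variable R : realType.

Lemma homeo_bounds (X Y : topologicalType) n (A : set X) (B : set Y) f g :
  homeo A B f g ->
  (forall c : chain R X n, c \in is_cycle A set0 -> c \in bounds A set0) ->
  forall c : chain R Y n, c \in is_cycle B set0 -> c \in bounds B set0.
Proof.
move=> [cf cg fK gK] hA c cc; have [cB _] := (is_cycleP _ _ _).1 cc.
have <- : push f (push g c) = c.
  by rewrite push_comp -[RHS]push_id; apply: eq_push cB => y /gK[].
apply: (@bounds_push _ _ _ _ _ A set0) => //.
- exact: continuous_subspaceW cf.
- by move=> x /fK[].
apply: hA; apply: is_cycle_push cc => //; first exact: continuous_subspaceW cg.
by move=> y /gK[].
Qed.

Lemma subrACA (V : zmodType) (a b x y : V) : a - b - (x - y) = a - x - (b - y).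
Proof. by rewrite !opprB addrACA [RHS]addrACA [- x + _]addrC. Qed.

Lemma iter_Sd0 (X : topologicalType) n m : iter m (@Sd R X n) 0 = 0.
Proof. by elim: m => //= m ->; rewrite raddf0. Qed.

Lemma simplex0 (X : topologicalType) (s : std_simplex R 0 -> X) :
  s = fun _ => s (@vertex R 0).
Proof.
apply/funext => t; congr s; apply/val_inj/rowP => j; rewrite !ord1 /= mxE /=.
by have /set_mem[_] := valP t; rewrite big_ord1.
Qed.

Lemma joined_bounds0 (X : topologicalType) (A : set X) w0 (c : chain R X 0) :
  (forall x, A x -> cst_simplex R 0 x - cst_simplex R 0 w0 \in bounds A set0) ->
  c \in chain_in A -> augm c = 0 -> c \in bounds A set0.
Proof.
move=> hA cA c0; suff : c - cst_simplex R 0 w0 *~ augm c \in bounds A set0.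
  by rewrite c0 mulr0z subr0.
have cA' : c \in fall (fun s => continuous s /\ forall t, A (s t)) by exact: cA.
apply: (fall_ind (Q := fun c => c - cst_simplex R 0 w0 *~ augm c \in bounds A set0)) cA'.
- by rewrite raddf0 mulr0z subr0 rpred0.
- move=> a b ha hb; have -> : augm (a - b : chain R X 0) = augm a - augm b by exact: raddfB.
  by rewrite mulrzBr subrACA; exact: rpredB.
- by move=> s [_ sA]; rewrite augmU mulr1z (simplex0 s); apply: hA.
Qed.

Lemma segment_bounds0 n (A : set 'rV[R]_n) (x y : 'rV[R]_n) :
  (forall s, 0 <= s <= 1 -> A ((1 - s) *: x + s *: y)) ->
  cst_simplex R 0 y - cst_simplex R 0 x \in bounds A set0.
Proof.
move=> hA.
pose s (v : std_simplex R 1) := (1 - (\val v) 0 1) *: x + (\val v) 0 1 *: y.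
have cs : continuous s.
  apply/cont_within; apply: cw_addmx; apply: cw_scalemx; wcont;
    exact/cont_within/set_val_continuous.
have sA v : A (s v).
  apply: hA; have /set_mem[v0 v1] := valP v; rewrite v0 /= -v1 !big_ord_recl big_ord0 addr0.
  by rewrite (_ : fintype.lift ord0 ord0 = 1) ?lerDr //; exact/val_inj.
have e : (<< s >> : chain R 'rV[R]_n 1) \in chain_in A by exact: chain_inU.
have := bounds_bd set0 e; rewrite bdU !big_ord_recl big_ord0 addr0 expr0 expr1 mulr1z mulrNz mulr1z.
have E i p : s (@coface R 0 i p) = if i == ord0 then y else x.
  have /set_mem[_] := valP p; rewrite big_ord1 => p1.
  rewrite /s /= !mxE; case: unliftP => [k kE|iE].
    have i0 : i = 0.
      apply/eqP; apply: contraT => i0.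
      have i1 : i = 1 by case: i {kE} i0 => -[|[|//]] q //= _; exact/val_inj.
      by move/eqP: kE; rewrite i1 (negPf (neq_lift _ _)).
    by rewrite i0 eqxx ord1 p1 subrr scale0r scale1r add0r.
  by rewrite -iE subr0 scale1r scale0r addr0.
rewrite (_ : s \o @coface R 0 ord0 = fun=> y); last by apply/funext => p; rewrite /= E.
by rewrite (_ : s \o @coface R 0 (fintype.lift ord0 ord0) = fun=> x) //; apply/funext => p; rewrite /= E.
Qed.

(** The open ball minus the half of the axis where u v_0 <= 0. For u = 1 and u = -1 these
    star-shaped sets cover the punctured ball and meet in the ball off the axis. *)
Definition pball (u : R) : set 'rV[R]_3 := [set v | ssq v < 1 /\ (axis3 v -> 0 < u * v 0 0)].

Lemma conv_lt1 (s x y : R) : 0 <= s -> s <= 1 -> x < 1 -> y < 1 -> (1 - s) * x + s * y < 1.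
Proof.
move=> s0 s1 x1 y1; have [->|sn] := eqVneq s 0; first by lra.
have h1 : 0 < s * (1 - y) by rewrite mulr_gt0 ?subr_gt0 // lt_neqAle eq_sym sn.
have h2 : 0 <= (1 - s) * (1 - x) by rewrite mulr_ge0 // subr_ge0 // ltW.
by nra.
Qed.

Lemma conv_eq0 (s x : R) : 0 <= s -> s <= 1 -> 0 <= x -> (1 - s) / 2 + s * x = 0 -> x = 0.
Proof.
move=> s0 s1 x0 h; have sx : 0 <= s * x by rewrite mulr_ge0.
have s_1 : s = 1 by lra.
by rewrite s_1 in h; lra.
Qed.

Lemma ssq_convex s (v w : 'rV[R]_3) : 0 <= s <= 1 -> ssq v < 1 -> ssq w < 1 ->
  ssq ((1 - s) *: v + s *: w) < 1.
Proof.
move=> /andP[s0 s1] v1 w1.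
apply: (@le_lt_trans _ _ ((1 - s) * ssq v + s * ssq w)); last exact: conv_lt1.
rewrite /ssq !mulr_sumr -big_split /=; apply: ler_sum => i _.
rewrite !mxE; move: (v 0 i) (w 0 i) => a b.
have : 0 <= s * (1 - s) * (a - b) ^+ 2 by rewrite mulr_ge0 ?sqr_ge0 // mulr_ge0 // subr_ge0.
by clear; nra.
Qed.

Lemma pball_star (u : R) : u ^+ 2 = 1 -> star_shaped (pball u) (row3 (u / 2) 0 0).
Proof.
move=> u1; have pp : ssq (row3 (u / 2) 0 0) < 1.
  by rewrite ssqE !row3E expr0n /= !addr0 exprMn u1; lra.
have p0 : 0 < u * (row3 (u / 2) 0 0 : 'rV[R]_3) 0 0 by rewrite row3E mulrA -expr2 u1; lra.
split=> // s v s01 [v1 va]; split; first exact: ssq_convex.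
have /andP[s0 s1] := s01.
move=> ax; rewrite mxE mulrDr [X in u * X + _]mxE [X in _ + u * X]mxE !(mulrCA u).
move: s1; rewrite le_eqVlt => /predU1P[->|s1]; first by rewrite subrr mul0r add0r mul1r.
have s1' : 1 - s != 0 by rewrite subr_eq0 gt_eqF.
have av : axis3 v.
  move: ax => /axis3P; rewrite !mxE /= !inordK //= mulr0 !addr0 => -[/eqP h1 /eqP h2].
  apply/axis3P; move: h1 h2; rewrite !mulf_eq0 (negPf s1') /=.
  by move=> /eqP -> /eqP ->.
apply: ltr_wpDr; first by rewrite mulr_ge0 // ltW.
by rewrite mulr_gt0 ?subr_gt0 //; exact: va.
Qed.

Lemma axis3_closed : closed (@axis3 R).
Proof.
have -> : @axis3 R = (fun v : 'rV[R]_3 => v 0 1) @^-1` [set 0] `&`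
    (fun v : 'rV[R]_3 => v 0 (inord 2)) @^-1` [set 0].
  by apply/seteqP; split=> v; rewrite axis3P.
by apply: closedI; (apply: preimage_closed; [move=> v _; exact: coord_continuous|exact: closed_eq]).
Qed.

(** The straight segment to the base point meets the axis only if x lies exactly opposite to it;
    then the detour through w1 avoids the axis. *)
Lemma off_axis_joined (x : 'rV[R]_3) : ssq x < 1 -> ~ axis3 x ->
  cst_simplex R 0 x - cst_simplex R 0 (row3 0 (2^-1) 0) \in
    bounds [set v | ssq v < 1 /\ ~ axis3 v] set0.
Proof.
move=> x1 xa; pose w0 : 'rV[R]_3 := row3 0 (2^-1) 0; pose w1 : 'rV[R]_3 := row3 0 0 (2^-1).
have w0b : ssq w0 < 1 by rewrite ssqE !row3E expr0n /= !add0r addr0; lra.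
have w1b : ssq w1 < 1 by rewrite ssqE !row3E expr0n /= !add0r; lra.
have seg (v w : 'rV[R]_3) : ssq v < 1 -> ssq w < 1 ->
    (forall s, 0 <= s <= 1 -> ~ axis3 ((1 - s) *: v + s *: w)) ->
    cst_simplex R 0 w - cst_simplex R 0 v \in bounds [set v | ssq v < 1 /\ ~ axis3 v] set0.
  by move=> v1 w2 h; apply: segment_bounds0 => s s01; split; [exact: ssq_convex|exact: h].
rewrite axis3P in xa.
have [xx|xx] := pselect (x 0 (inord 2) = 0 /\ x 0 1 < 0); last first.
  apply: seg => // s /andP[s0 s1] /axis3P[].
  rewrite !mxE /= !inordK //= mulr0 add0r => h1 /eqP h2.
  move: h2; rewrite mulf_eq0 => /orP[/eqP z|/eqP z]; first by move: h1; rewrite z; lra.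
  apply: xa; split=> //; apply: conv_eq0 s0 s1 _ h1.
  by rewrite leNgt; apply/negP => h; apply: xx.
case: xx => x2 x3.
rewrite -[X in X \in _](subrKA (cst_simplex R 0 w1)) rpredD //; apply: seg => // s /andP[s0 s1] /axis3P[];
  rewrite !mxE /= !inordK //= ?mulr0 ?addr0 ?add0r.
  rewrite x2 mulr0 addr0 => /eqP; rewrite mulf_eq0 => /orP[/eqP ->|/eqP z]; first by lra.
  by move: x3; rewrite z ltxx.
by lra.
Qed.

Definition punctured_ball : set 'rV[R]_3 := [set v | ssq v < 1 /\ v <> 0].

(** Mayer-Vietoris for [pball 1] and [pball (-1)]: 1-cycles bound in either set, and their
    intersection is path-connected. *)
Lemma punctured_ball_bounds1 (c : chain R 'rV[R]_3 1) :
  c \in is_cycle punctured_ball set0 -> c \in bounds punctured_ball set0.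
Proof.
move=> cc; have [cS /chain_in0 c0] := (is_cycleP _ _ _).1 cc.
pose U (u : R) : set 'rV[R]_3 := ~` (@axis3 R `&` (fun v => u * v 0 0) @^-1` [set x | x <= 0]).
have oU u : open (U u).
  apply: closed_openC; apply: closedI; first exact: axis3_closed.
  apply: preimage_closed; last exact: closed_le.
  by move=> v _; move: v; apply/cont_within; wcont.
have pU u : punctured_ball `&` U u `<=` pball u.
  by move=> v [[v1 _] Uv]; split=> // ax; rewrite ltNge; apply/negP => ?; apply: Uv.
have Up u : pball u `<=` punctured_ball.
  move=> v [v1 va]; split=> // v0; move: va; rewrite v0 mxE mulr0 ltxx => h.
  by have /h : axis3 (0 : 'rV[R]_3) by move=> i _; rewrite mxE.
have [|m [c1 [c2 [mE c1U c2U]]]] := small_split (oU 1) (oU (-1)) _ cS.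
  move=> v [v1 v0]; have [ax|ax] := pselect (axis3 v); last by left=> -[].
  have [h|h|h] := ltgtP (v 0 0) 0.
  - by right=> -[_ /=]; rewrite mulN1r oppr_le0 leNgt h.
  - by left=> -[_ /=]; rewrite mul1r leNgt h.
  - exfalso; apply: v0; move/axis3P: ax => [h1 h2]; apply: eq_row3; rewrite mxE //.
have {}c1U := chain_inW (@pU _) c1U; have {}c2U := chain_inW (@pU _) c2U.
have /eqP : bd (c1 + c2) = 0.
  by rewrite -mE bd_iter_Sd c0 iter_Sd0.
rewrite raddfD /= addr_eq0 => /eqP bd12.
pose W : set 'rV[R]_3 := [set v | ssq v < 1 /\ ~ axis3 v].
have Wp u : W `<=` pball u by move=> v [v1 na]; split.
have bW : bd c1 \in chain_in W.
  have h2 : bd c1 \in chain_in (pball (-1)) by rewrite bd12 rpredN; exact: bd_chain_in.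
  apply: chain_inW (chain_inI (bd_chain_in c1U) h2) => v [[v1 h3] [_ h4]]; split=> // ax.
  by have := h3 ax; have := h4 ax; clear; lra.
have bb : bd c1 \in bounds W set0.
  apply: (joined_bounds0 _ bW (augm_bd1 c1)) => x [x1 xa]; exact: off_axis_joined.
have [w wW wE] := bounds0P bb.
have b1 : c1 - w \in bounds (pball 1) set0.
  apply: (contracts_bounds1 (star_contracts (pball_star _))); first by rewrite expr1n.
  apply/is_cycleP; rewrite raddfB /= wE subrr rpred0; split=> //.
  by rewrite rpredB //; exact: chain_inW wW.
have b2 : c2 + w \in bounds (pball (-1)) set0.
  apply: (contracts_bounds1 (star_contracts (pball_star _))); first by rewrite sqrrN expr1n.
  apply/is_cycleP; rewrite raddfD /= -wE bd12 subrr rpred0; split=> //.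
  by rewrite rpredD //; exact: chain_inW wW.
have b12 : iter m (@Sd R _ 1) c \in bounds punctured_ball set0.
  rewrite mE.
  have -> : c1 + c2 = (c1 - w) + (c2 + w) :> chain R 'rV[R]_3 1 by rewrite addrACA addNr addr0.
  by apply: rpredD; [apply: boundsW b1|apply: boundsW b2].
rewrite -[c](subKr (iter m (@Sd R _ 1) c)) rpredB //; exact: iter_Sd_bounds.
Qed.

End PuncturedBall.

Section BoundaryClosed.
Variables (R : realType) (N1 N2 N : topologicalType).
Variables (F1 : set N1) (F2 : set N2) (phi1 : 'rV[R]_3 -> N1) (phi2 : 'rV[R]_3 -> N2).
Variables (e1 : N1 -> N) (e2 : N2 -> N).
Hypotheses (p1 : piece F1 phi1) (p2 : piece F2 phi2) (hN : glued phi1 phi2 e1 e2).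
Hypotheses (binv : boundary_invariant R) (m1 : compact_manifold R N1 4).

Lemma glued_chart1 a : exists U h, chart [set: N] U (h : N -> 'rV[R]_4) /\ U (e1 a).
Proof.
have [[v cv va]|nD] := pselect ((phi1 @` @closed_ball3 R) a).
  subst a; have [v1|v1] := ltP (ssq v) 1.
    by have [U [f [cU Uv _ _]]] := glue_chart_interior p1 p2 hN v1; exists U, f.
  have /(glue_chart_corner p1 p2 hN) : ssq v = 1 by apply/eqP; rewrite eq_le v1 andbT.
  by move=> [U [f [cU Uv _ _]]]; exists U, f.
have [U [h [cU Ua]]] : exists U h, chart [set: N1] U (h : N1 -> 'rV[R]_4) /\ U a.
  by case: m1 => _ _ _ /(_ a).
have cU' := chart_restrict cU (closed_openC (disk_closed p2 hN)).
have [|h' ch' h'E] := transfer_chart p1 p2 hN cU'; first by rewrite -setIA setICl setI0.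
by exists (e1 @` (U `&` ~` (phi1 @` @closed_ball3 R))), h'; split=> //; exists a.
Qed.

End BoundaryClosed.

Section ClassInjective.
Variables (R : realType) (N1 N2 N : topologicalType).
Variables (F1 : set N1) (F2 : set N2) (phi1 : 'rV[R]_3 -> N1) (phi2 : 'rV[R]_3 -> N2).
Variables (e1 : N1 -> N) (e2 : N2 -> N).
Hypotheses (p1 : piece F1 phi1) (p2 : piece F2 phi2) (hN : glued phi1 phi2 e1 e2).
Hypotheses (binv : boundary_invariant R) (m1 : compact_manifold R N1 4)
  (m2 : compact_manifold R N2 4).

Lemma glued_bd_closed : closed (\partial[R] N).
Proof.
rewrite -[X in closed X]setCK; apply: open_closedC; rewrite openE => y nb.
have [U [h [cU Uy]]] : exists U h, chart [set: N] U (h : N -> 'rV[R]_4) /\ U y.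
  have [[a ->]|[b ->]] := glued_cover hN y; first exact: glued_chart1 p1 p2 hN m1 a.
  exact: glued_chart1 p2 p1 (glued_sym hN) m2 b.
have [oU [V [g [_ [ch _ _ _]]]]] := cU; rewrite setTI in ch.
have oW : open (U `&` (fun z => h z 0 0) @^-1` ~` [set 0]).
  by apply: open_preim => //; [wcont|apply: closed_openC; exact: closed_eq].
have Wy : (U `&` (fun z => h z 0 0) @^-1` ~` [set 0]) y.
  by split=> // h0; apply: nb; apply/(chart_boundary binv cU Uy).
apply: filterS (open_nbhs_nbhs (conj oW Wy)) => z [Uz hz] /(chart_boundary binv cU Uz).
exact: hz.
Qed.

Local Notation B := (e1 @` \partial[R] N1 `|` e2 @` \partial[R] N2).
Let m := e1 \o phi1.
Local Notation D := (m @` @closed_ball3 R).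

Lemma center_ball : @closed_ball3 R 0.
Proof. by case: (ball3_star R). Qed.

Lemma glue_map_homeo : exists psi, homeo (@closed_ball3 R) D m psi.
Proof.
have [|psi [c1 c2 pK qK]] := @disk_homeo _ _ _ _ p1 (@closed_ball3 R); first by [].
have [j cj jE] := e1_inverse p1 hN; exists (psi \o j); split.
- by apply: cw_compT => //; exact: (glued_e1 hN).
- apply: (cw_comp c2) => [|_ [v cv <-]]; last by rewrite jE; exists v.
  by apply: continuous_subspaceW cj => _ [v cv <-]; exists (phi1 v).
- by move=> v cv; split; [exists v|rewrite /m /= jE; have [] := pK v cv].
- by move=> _ [v cv <-]; rewrite /m /= jE; have [_ ->] := pK v cv.
Qed.

Lemma seam_bd v : closed_ball3 v -> (\partial[R] N) (m v) <-> ssq v = 1.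
Proof.
move=> cv; rewrite /m /= (glued_bd1 p1 p2 hN binv m1); split=> [[_ h]|v1].
  apply/eqP; rewrite eq_le cv leNgt; apply/negP => v1; apply: h; exists v => //.
split; first exact: piece_bd p1 v.
by move=> [w ow /(piece_inj p1) wv]; move: ow; rewrite wv /open_ball3 /= -/(ssq v) v1 ltxx.
Qed.

Lemma bd_cover y : B y <-> (\partial[R] N) y \/ (m @` @open_ball3 R) y.
Proof.
split=> [[[a ba <-]|[b bb <-]]|[]].
- have [[v ov va]|nv] := pselect ((phi1 @` @open_ball3 R) a).
    by right; exists v => //; rewrite -va.
  by left; apply/(glued_bd1 p1 p2 hN binv m1).
- have [[v ov va]|nv] := pselect ((phi2 @` @open_ball3 R) b).
    by right; exists v => //; rewrite -va /m /= (glued_phi hN) //; exact: ltW.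
  by left; apply/(glued_bd2 p1 p2 hN binv m2).
- have [[a ->]|[b ->]] := glued_cover hN y.
    by move=> /(glued_bd1 p1 p2 hN binv m1)[ba _]; left; exists a.
  by move=> /(glued_bd2 p1 p2 hN binv m2)[ba _]; right; exists b.
- by move=> [v _ <-]; left; exists (phi1 v) => //; exact: piece_bd p1 v.
Qed.

Lemma seam_sub : D `<=` B.
Proof. by move=> _ [v _ <-]; left; exists (phi1 v) => //; exact: piece_bd p1 v. Qed.

(** Without its centre the gluing ball is pushed out to its sphere, which belongs to the boundary of
    N. *)
Lemma radial_homotopy : exists H : R * N -> N,
  [/\ {within `[0, 1] `*` (B `&` ~` [set m 0]), continuous H}, forall y, H (0, y) = y,
      forall s y, 0 <= s <= 1 -> (B `&` ~` [set m 0]) y -> B (H (s, y)),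
      forall s y, (\partial[R] N) y -> H (s, y) = y &
      forall y, (B `&` ~` [set m 0]) y -> (\partial[R] N) (H (1, y))].
Proof.
have [psi [cm cpsi mK pK]] := glue_map_homeo.
(* The factor is chosen such that the radius becomes (1 - s) rho v + s. *)
pose r s (v : 'rV[R]_3) := (1 - s + s / rho v) *: v.
pose H (q : R * N) := if pselect ((\partial[R] N) q.2) then q.2 else
  if pselect (D q.2) then m (r q.1 (psi q.2)) else q.2.
have Hb s y : (\partial[R] N) y -> H (s, y) = y by rewrite /H; case: pselect.
have Hm s v : closed_ball3 v -> H (s, m v) = m (r s v).
  move=> cv; rewrite /H /=; case: pselect => [h|nh].
    have v1 := (seam_bd cv).1 h.
    rewrite /=.
    by rewrite /r /rho v1 sqrtr1 divr1 subrK scale1r.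
  case: pselect => [h|[]]; last by exists v.
  by have [_ ->] := mK v cv.
have r0 v : r 0 v = v by rewrite /r subr0 mul0r addr0 scale1r.
have rr s v : 0 <= s <= 1 -> v != 0 -> rho (r s v) = (1 - s) * rho v + s.
  move=> /andP[s0 s1] v0; have rv := rho_gt0 v0.
  rewrite /r rhoZ ger0_norm; last by rewrite addr_ge0 ?subr_ge0 // divr_ge0 // ltW.
  by rewrite mulrDl divfK // gt_eqF.
have rB s v : 0 <= s <= 1 -> v != 0 -> closed_ball3 v -> closed_ball3 (r s v).
  move=> s01 v0 /closed_ballE v1; apply/closed_ballE; rewrite rr //.
  case/andP: s01 => s0 s1; rewrite -[leRHS](subrK s) lerD2r.
  by rewrite ler_piMr // subr_ge0.
have nz v : m v <> m 0 -> v != 0 by move=> h; apply/eqP => v0; apply: h; rewrite v0.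
have cl_D : closed D.
  by apply: compact_closed; [exact: glued_hausdorff hN|apply: continuous_compact => //; exact: ball3_compact].
exists H; split=> //.
- apply: (@within_closed_glue _ _ _ (snd @^-1` \partial[R] N) (snd @^-1` D)).
  + apply: preimage_closed; [by move=> q _; exact: cvg_snd|exact: glued_bd_closed].
  + by apply: preimage_closed; [by move=> q _; exact: cvg_snd|].
  + move=> [s y] [_ [/bd_cover[]]]; [by left|move=> [v ov vy] _; right].
    by exists v; [exact: ltW|exact: vy].
  + by apply: (@within_eq _ _ _ snd); [move=> [s y] [_ /= by_]; rewrite Hb|wcont].
  + apply: (@within_eq _ _ _ (fun q => m (r q.1 (psi q.2)))).
      by move=> [s y] [_ [v cv /= <-]]; have [_ ->] := mK v cv; rewrite Hm.
    have cp : {within (`[0, 1] `*` (B `&` ~` [set m 0])) `&` snd @^-1` D,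
        continuous (fun q : R * N => psi q.2)}.
      by apply: (cw_comp cpsi) => [|q []]; first by wcont.
    apply: (cw_comp cm) => [|[s y] [[/= s01 [_ ny]] [v cv vy]]]; last first.
      have v0 : v != 0 by apply: nz; rewrite vy.
      by rewrite -vy; have [_ ->] := mK v cv; apply: rB => //; rewrite -in_itv.
    apply: cw_scalemx => //; apply: cw_add; first by wcont.
    apply: cw_mul; first by wcont.
    apply: cw_inv; last exact: cw_rho.
    move=> [s y] [[_ [_ /= ny]] [v cv /= vy]]; rewrite -vy; have [_ ->] := mK v cv.
    by rewrite gt_eqF // rho_gt0 //; apply: nz; rewrite vy.
- move=> y; rewrite /H /=; case: pselect => // nb; case: pselect => // Dy /=.
  by rewrite r0; have [_ ->] := pK y Dy.
- move=> s y s01 [/bd_cover[h _|[v ov <-] nv]]; first by rewrite Hb //; apply/bd_cover; left.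
  have cv : closed_ball3 v by exact: ltW.
  by rewrite Hm //; apply: seam_sub; exists (r s v) => //; apply: rB => //; exact: nz.
- move=> y [/bd_cover[h _|[v ov <-] nv]]; first by rewrite Hb.
  have cv : closed_ball3 v by exact: ltW.
  have v0 : v != 0 by exact: nz.
  have s01 : 0 <= (1 : R) <= 1 by rewrite ler01 lexx.
  rewrite Hm //; apply/seam_bd; first exact: rB.
  have := rr 1 v s01 v0; rewrite subrr mul0r add0r => h.
  by rewrite -[ssq _]sqr_sqrtr ?ssq_ge0 // -/(rho _) h expr1n.
Qed.

(** Here H_2(B, bd N) is H_2 of the ball relative to its sphere, which is H_1 of a sphere.
    Concretely, b is split into a part b1 off the centre and a part b2 off bd N. The boundary of b2
    is a cycle of the punctured ball and bounds a chain q there; b2 - q bounds in the ball, and the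
    radial homotopy pushes b1 + q into bd N. *)
Lemma boundary_chain (b : chain R N 2) : b \in is_cycle B (\partial[R] N) ->
  b \in bounds B (\partial[R] N).
Proof.
move=> cb; have [bB bbd] := (is_cycleP _ _ _).1 cb.
have [psi hm] := glue_map_homeo.
have nc : ~ (\partial[R] N) (m 0).
  by move=> /(seam_bd center_ball)/eqP; rewrite ssqE !mxE expr0n /= !addr0 eq_sym oner_eq0.
have oU1 : open (~` [set m 0]).
  apply: closed_openC; apply: compact_closed; first exact: glued_hausdorff hN.
  exact: compact_set1.
have oU2 : open (~` \partial[R] N) by apply: closed_openC; exact: glued_bd_closed.
have [|n [b1 [b2 [nE b1U b2U]]]] := small_split oU1 oU2 _ bB.
  by move=> y _; have [->|h] := pselect (y = m 0); [right|left].
have nc' := iter_Sd_cycle n cb; have [nB nbd] := (is_cycleP _ _ _).1 nc'.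
pose P := m @` @punctured_ball R.
have bdE : bd (iter n (@Sd R N 2) b) = bd b1 + bd b2 by rewrite nE raddfD.
have b2P : bd b2 \in chain_in P.
  have h1 : bd b2 \in chain_in (B `&` ~` [set m 0]).
    rewrite (_ : bd b2 = bd (iter n (@Sd R N 2) b) - bd b1); last by rewrite bdE addrAC subrr add0r.
    rewrite rpredB //; last exact: bd_chain_in.
    apply: chain_inW nbd => y by_; split; first by apply/bd_cover; left.
    by move=> ym; apply: nc; rewrite -ym.
  apply: chain_inW (chain_inI h1 (bd_chain_in b2U)) => y [[By yc] [_ nb]].
  have [//|[v ov vy]] := (bd_cover y).1 By.
  by exists v => //; split=> // v0; apply: yc; rewrite /= -vy v0.
have [_ cpsi mK pK] := hm.
have PD : P `<=` D by move=> _ [v [ov _] <-]; exists v => //; exact: ltW.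
have [q qP qE] : exists2 q, q \in chain_in P & bd b2 = bd q.
  apply: bounds0P; apply: (homeo_bounds (A := @punctured_ball R) (f := m) (g := psi)).
  - split.
    + apply: continuous_subspaceT => x; apply: continuous_comp; first exact: piece_phi p1 x.
      exact: (glued_e1 hN).
    + exact: continuous_subspaceW cpsi.
    + by move=> v pv; split; [exists v|have [] := mK v; first by apply: ltW; case: pv].
    + move=> _ [v [ov v0] <-]; have [|_ ->] := mK v; first exact: ltW.
      by [].
  - by move=> c; exact: punctured_ball_bounds1.
  - by apply/is_cycleP; rewrite bd_bd rpred0.
have Dc : b2 - q \in bounds D set0.
  apply: (contracts_bounds2 (homeo_contracts hm (star_contracts (ball3_star R)))).
  apply/is_cycleP; rewrite raddfB /= qE subrr rpred0; split=> //; apply: rpredB.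
    apply: chain_inW b2U => y [By nb]; have [//|[v ov vy]] := (bd_cover y).1 By.
    by exists v => //; exact: ltW.
  exact: chain_inW qP.
have [H [cH H0 HB Hb H1]] := radial_homotopy.
have b1q : b1 + q \in chain_in (B `&` ~` [set m 0]).
  rewrite rpredD //; apply: chain_inW qP => _ [v [ov v0] <-]; split.
    by apply: seam_sub; exists v => //; exact: ltW.
  move=> /= mv; apply: v0; have [|_ <-] := mK v; first exact: ltW.
  by rewrite mv; have [_ ->] := mK 0 center_ball.
have b1qb : bd (b1 + q) \in chain_in (\partial[R] N).
  by rewrite raddfD /= -qE -bdE.
have rad : b1 + q \in bounds B (\partial[R] N).
  have := homotopy_bounds (B' := B) (C' := \partial[R] N) cH HB _ b1q b1qb.
  rewrite (eq_push (f := fun x => H (0, x)) (g := id) (fun x _ => H0 x) b1q).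
  rewrite push_id => h; rewrite -[X in X \in _](subKr (push (fun x => H (1, x)) (b1 + q))).
  apply: rpredB; last by apply: h => s x _ _ bx; rewrite Hb.
  apply: bounds_in; apply: push_chain_in b1q => [|y]; last exact: H1.
  apply: (cw_comp cH) => [|y Ay]; last by split=> //=; exact: in01_1.
  by apply: cw_pair; [exact: cw_cst|exact: cw_id].
have itb : iter n (@Sd R N 2) b \in bounds B (\partial[R] N).
  rewrite nE (_ : b1 + b2 = (b1 + q) + (b2 - q)); last by rewrite addrACA subrr addr0.
  by apply: rpredD => //; apply: boundsW Dc => //; exact: seam_sub.
rewrite -[b](subKr (iter n (@Sd R _ 2) b)) rpredB //; exact: iter_Sd_bounds.
Qed.

(** The map H_2(N, bd N) -> H_2(N, B) is injective by the sequence of the triple. This lifts the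
    equation [class_sum], stated relative to B, to the boundary of N. *)
Lemma class_injective (u : chain R N 2) : u \in is_cycle [set: N] (\partial[R] N) ->
  u \in bounds [set: N] B -> u \in bounds [set: N] (\partial[R] N).
Proof.
move=> /is_cycleP[uN ub] /boundsP[e eN uB].
rewrite -(subrK (bd e) u) rpredD //; last exact: bounds_bd.
apply: (@boundsW _ _ _ B (\partial[R] N)) => //; apply: boundary_chain.
by apply/is_cycleP; rewrite raddfB /= bd_bd subr0.
Qed.

End ClassInjective.

(** * Moving points of the surface *)

Section TentMap.
Variable R : realType.

(** A piecewise linear homeomorphism of the line with support [-e, e] that takes 0 to k e, followed
    by its inverse in closed form. Its slopes are 1 + k and 1 - k, positive for k up to 1/2. *)
Definition tent_fw (e k u : R) := u + k * Num.max 0 (e - `|u|).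
Definition tent_bw (e k u : R) :=
  u - Num.max 0 (Num.min (k * (u + e) / (1 + k)) (k * (e - u) / (1 - k))).

Variables (e k : R).
Hypotheses (k0 : 0 <= k) (k1 : k <= 2^-1).

Let kp : 0 < 1 + k. Proof. by move: k0; lra. Qed.
Let km : 0 < 1 - k. Proof. by move: k1; lra. Qed.

Lemma tent_bw_out u : e <= `|u| -> tent_bw e k u = u.
Proof.
move=> h; rewrite /tent_bw max_l ?subr0 // ge_min.
have [u0|u0] := lerP 0 u.
  apply/orP; right; rewrite ger0_norm // in h.
  by rewrite ler_pdivrMr // mul0r mulr_ge0_le0 // subr_le0.
apply/orP; left; rewrite ltr0_norm // in h.
by rewrite ler_pdivrMr // mul0r mulr_ge0_le0 //; move: h; lra.
Qed.

Lemma tent_bw_low u : - e <= u -> u <= k * e ->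
  (u - tent_bw e k u) * (1 + k) = k * (u + e).
Proof.
move=> u1 u2; rewrite /tent_bw subKr.
set a := k * (u + e) / (1 + k); set b := k * (e - u) / (1 - k).
have aE : a * (1 + k) = k * (u + e) by rewrite /a divfK ?gt_eqF.
have bE : b * (1 - k) = k * (e - u) by rewrite /b divfK ?gt_eqF.
have a0 : 0 <= a by rewrite -(pmulr_lge0 _ kp) aE mulr_ge0 // -lerBlDr sub0r.
(* The two branches of the inverse cross exactly at u = k e, which decides the minimum. *)
have E : (a - b) * ((1 + k) * (1 - k)) = 2 * k * (u - k * e).
  transitivity (a * (1 + k) * (1 - k) - b * (1 - k) * (1 + k)); first by ring.
  by rewrite aE bE; ring.
have ab : a <= b.
  rewrite -subr_le0 -(pmulr_lle0 _ (mulr_gt0 kp km)) E.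
  by rewrite mulr_ge0_le0 ?mulr_ge0 // subr_le0.
by rewrite (min_l ab) (max_r a0).
Qed.

Lemma tent_bw_high u : k * e <= u -> u <= e ->
  (u - tent_bw e k u) * (1 - k) = k * (e - u).
Proof.
move=> u1 u2; rewrite /tent_bw subKr.
set a := k * (u + e) / (1 + k); set b := k * (e - u) / (1 - k).
have aE : a * (1 + k) = k * (u + e) by rewrite /a divfK ?gt_eqF.
have bE : b * (1 - k) = k * (e - u) by rewrite /b divfK ?gt_eqF.
have b0 : 0 <= b by rewrite -(pmulr_lge0 _ km) bE mulr_ge0 // subr_ge0.
have E : (a - b) * ((1 + k) * (1 - k)) = 2 * k * (u - k * e).
  transitivity (a * (1 + k) * (1 - k) - b * (1 - k) * (1 + k)); first by ring.
  by rewrite aE bE; ring.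
have ab : b <= a.
  rewrite -subr_ge0 -(pmulr_lge0 _ (mulr_gt0 kp km)) E.
  by rewrite mulr_ge0 ?mulr_ge0 // subr_ge0.
by rewrite (min_r ab) (max_r b0).
Qed.

Lemma tent_fw_out u : e <= `|u| -> tent_fw e k u = u.
Proof. by move=> h; rewrite /tent_fw max_l ?mulr0 ?addr0 // subr_le0. Qed.

Lemma tent_fw_low u : - e <= u -> u <= 0 -> tent_fw e k u = u + k * (e + u).
Proof.
by move=> u1 u2; rewrite /tent_fw ler0_norm // opprK max_r // addrC -lerBlDr sub0r.
Qed.

Lemma tent_fw_high u : 0 <= u -> u <= e -> tent_fw e k u = u + k * (e - u).
Proof. by move=> u1 u2; rewrite /tent_fw ger0_norm // max_r // subr_ge0. Qed.

Lemma tent_fwK u : tent_bw e k (tent_fw e k u) = u.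
Proof.
have [h|] := lerP e `|u|; first by rewrite tent_fw_out // tent_bw_out.
rewrite ltr_norml => /andP[u1 u2]; have [u0|u0] := lerP 0 u.
  rewrite (tent_fw_high u0 (ltW u2)); set y := u + _.
  have y1 : k * e <= y.
    rewrite -subr_ge0 (_ : y - k * e = u * (1 - k)); last by rewrite /y; ring.
    by rewrite mulr_ge0 // ltW.
  have y2 : y <= e.
    rewrite -subr_ge0 (_ : e - y = (e - u) * (1 - k)); last by rewrite /y; ring.
    by rewrite mulr_ge0 ?subr_ge0 // ltW // -subr_gt0.
  have E := tent_bw_high y1 y2.
  apply/eqP; rewrite -subr_eq0 -(mulIr_eq0 _ (mulIf (lt0r_neq0 km))); apply/eqP.
  transitivity ((y - u) * (1 - k) - (y - tent_bw e k y) * (1 - k)); first by ring.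
  by rewrite E /y; ring.
rewrite (tent_fw_low (ltW u1) (ltW u0)); set y := u + _.
have y1 : - e <= y.
  rewrite -subr_ge0 (_ : y - - e = (u + e) * (1 + k)); last by rewrite /y; ring.
  by rewrite mulr_ge0 ?ltW // -[u]opprK addrC subr_gt0 // ltrNl.
have y2 : y <= k * e.
  rewrite -subr_le0 (_ : y - k * e = u * (1 + k)); last by rewrite /y; ring.
  by rewrite mulr_le0_ge0 // ltW.
have E := tent_bw_low y1 y2.
apply/eqP; rewrite -subr_eq0 -(mulIr_eq0 _ (mulIf (lt0r_neq0 kp))); apply/eqP.
transitivity ((y - u) * (1 + k) - (y - tent_bw e k y) * (1 + k)); first by ring.
by rewrite E /y; ring.
Qed.

Lemma tent_bw_in u : `|u| <= e -> `|tent_bw e k u| <= e.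
Proof.
rewrite ler_norml => /andP[u1 u2].
suff : 0 <= u - tent_bw e k u /\ u - tent_bw e k u <= u + e.
  by rewrite ler_norml; move: u2; clear; move=> h [h1 h2]; apply/andP; split; lra.
have [h|h] := lerP u (k * e).
  have E := tent_bw_low u1 h; split.
    by rewrite -(pmulr_lge0 _ kp) E mulr_ge0 // -lerBlDr sub0r.
  rewrite -(ler_pM2r kp) E mulrC ler_wpM2l // ?lerDr // -lerBlDr sub0r //.
have E := tent_bw_high (ltW h) u2; split.
  by rewrite -(pmulr_lge0 _ km) E mulr_ge0 // subr_ge0.
rewrite -(ler_pM2r km) E; move: h u2 k0 k1; clear => h u2 k0 k1; nra.
Qed.

Lemma tent_fw_in u : `|u| <= e -> `|tent_fw e k u| <= e.
Proof.
rewrite ler_norml => /andP[u1 u2]; have [u0|u0] := lerP 0 u.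
  by rewrite tent_fw_high //; move: k0 k1; clear -u0 u2 => *; rewrite ler_norml; apply/andP; split; nra.
by rewrite (tent_fw_low u1 (ltW u0)); move: k0 k1; clear -u0 u1 => *; rewrite ler_norml; apply/andP; split; nra.
Qed.

Lemma tent_bw_eq0 u : 0 < e -> tent_bw e k u = 0 -> u = k * e.
Proof.
move=> e0; have [h|] := lerP e `|u|.
  by rewrite tent_bw_out // => u0; move: h; rewrite u0 normr0 leNgt e0.
rewrite ltr_norml => /andP[u1 u2] bu; have [h|h] := lerP u (k * e).
  by have := tent_bw_low (ltW u1) h; rewrite bu; lra.
by have := tent_bw_high (ltW h) (ltW u2); rewrite bu; lra.
Qed.

End TentMap.

Lemma tent_bw0 (R : realType) (e u : R) : tent_bw e 0 u = u.
Proof. by rewrite /tent_bw !mul0r minxx maxxx subr0. Qed.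

Lemma tent_fw0 (R : realType) (e u : R) : tent_fw e 0 u = u.
Proof. by rewrite /tent_fw mul0r addr0. Qed.

Section ChartSupport.
Variables (R : realType) (N : topologicalType).
Hypothesis hN : hausdorff_space N.

Lemma box4_compact (p : 'rV[R]_4) (e : R) : 0 <= e -> compact [set x : 'rV[R]_4 | `|x - p| <= e].
Proof.
move=> e0.
have c4 : compact [set w : 'rV[R]_4 | forall i, `[p 0 i - e, p 0 i + e]%classic (w 0 i)].
  apply: (@rV_compact R _ (fun i => `[p 0 i - e, p 0 i + e]%classic)) => i.
  exact: segment_compact.
rewrite (_ : [set x | _] = [set w : 'rV[R]_4 | forall i, `[p 0 i - e, p 0 i + e]%classic (w 0 i)]) //.
by apply/seteqP; split=> w /=; rewrite rV_norm_le // => h i; have := h i; rewrite !mxE ler_distl /= in_itv.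
Qed.

(** A map supported in a compact box of a chart extends by the identity; the image of the box is
    closed as N is Hausdorff, so the extension is continuous. *)
Lemma chart_support (U : set N) (f : N -> 'rV[R]_4) (p : 'rV[R]_4) (e : R) (S : set R)
    (a : R * 'rV[R]_4 -> 'rV[R]_4) V g :
  open U -> open V -> homeo U (half_space R 4 `&` V) f g -> 0 <= e ->
  (forall x : 'rV[R]_4, `|x - p| <= e -> (half_space R 4 `&` V) x) ->
  {within S `*` [set: 'rV[R]_4], continuous a} ->
  (forall s x, S s -> e < `|x - p| -> a (s, x) = x) ->
  (forall s x, S s -> `|x - p| <= e -> `|a (s, x) - p| <= e) ->
  exists G : R * N -> N, [/\ {within S `*` [set: N], continuous G},
    forall s q, S s -> U q -> U (G (s, q)) /\ f (G (s, q)) = a (s, f q) &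
    forall s q, ~ U q -> G (s, q) = q].
Proof.
move=> oU oV [cf cg fK gK] e0 boxV ca aid abox.
pose G (z : R * N) := if pselect (U z.2) then g (a (z.1, f z.2)) else z.2.
have GU s q : U q -> G (s, q) = g (a (s, f q)) by rewrite /G /=; case: pselect.
have GnU s q : ~ U q -> G (s, q) = q by rewrite /G /=; case: pselect.
have aV s q : S s -> U q -> (half_space R 4 `&` V) (a (s, f q)).
  move=> Ss Uq; have [h|h] := lerP `|f q - p| e; first exact/boxV/abox.
  by rewrite aid //; have [] := fK q Uq.
exists G; split=> //; last by move=> s q Ss Uq; rewrite GU //; have [] := gK _ (aV s q Ss Uq).
pose C := g @` [set x : 'rV[R]_4 | `|x - p| <= e].
have clC : closed C.
  apply: compact_closed => //; apply: continuous_compact; last exact: box4_compact.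
  by apply: continuous_subspaceW cg => x /boxV.
have Gfar s q : S s -> ~ C q -> G (s, q) = q.
  move=> Ss nC; have [Uq|/GnU//] := pselect (U q); rewrite GU //.
  have [_ gf] := fK q Uq; have [h|h] := lerP `|f q - p| e; last by rewrite aid.
  by case: nC; exists (f q).
apply: within_local => -[s q] [/= Ss _]; have [Uq|nUq] := pselect (U q).
  exists (snd @^-1` U); split=> //; first by apply: open_comp => // z _; exact: cvg_snd.
  apply: (@within_eq _ _ _ (fun z => g (a (z.1, f z.2)))) => [[s' q'] [_ Uq']|].
    by rewrite GU.
  apply: (cw_comp cg) => [|[s' q'] [[/= Ss' _] Uq']]; last exact: aV.
  apply: (cw_comp ca) => [|[s' q'] [[/= Ss' _] Uq']]; last by split.
  apply: cw_pair; first by wcont.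
  by apply: (cw_comp cf) => [|z [_]//]; first by wcont.
exists (snd @^-1` (~` C)); split=> /=.
+ by apply: open_comp => [z _|]; [exact: cvg_snd|exact: closed_openC].
+ by move=> [x /boxV xV xq]; apply: nUq; rewrite -xq; have [] := gK x xV.
+ by apply: (@within_eq _ _ _ snd) => [[s' q'] [[/= Ss' _] /Gfar ->]//|]; wcont.
Qed.

(* The isotopy of a box that slides its centre along the second coordinate. *)
Definition slide_amount (p : 'rV[R]_4) (e s : R) (x : 'rV[R]_4) :=
  s / 2 * Num.max 0 (1 - Num.max `|x 0 0 - p 0 0| (Num.max `|x 0 (inord 2) - p 0 (inord 2)|
    `|x 0 (inord 3) - p 0 (inord 3)|) / e).

Definition slide (t : R -> R -> R -> R) (p : 'rV[R]_4) (e : R) (q : R * 'rV[R]_4) : 'rV[R]_4 :=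
  row4 (q.2 0 0) (p 0 1 + t e (slide_amount p e q.1 q.2) (q.2 0 1 - p 0 1))
    (q.2 0 (inord 2)) (q.2 0 (inord 3)).

Lemma slide_amount_bound p e s x : 0 < e -> 0 <= s <= 1 -> 
  0 <= slide_amount p e s x <= 2^-1.
Proof.
move=> e0 /andP[s0 s1]; rewrite /slide_amount.
set m := Num.max `|_| _; have m0 : 0 <= m / e by rewrite divr_ge0 ?le_max ?normr_ge0 // ltW.
have M0 : 0 <= Num.max 0 (1 - m / e) by rewrite le_max lexx.
have M1 : Num.max 0 (1 - m / e) <= 1 by rewrite ge_max ler01 gerBl.
by rewrite mulr_ge0 ?divr_ge0 //=; move: s0 s1 M0 M1; clear; move: (Num.max 0 _) => M; nra.
Qed.

Lemma cw_slide_amount p e : 0 < e ->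
  {within `[0, 1] `*` [set: 'rV[R]_4], continuous (fun q : R * 'rV[R]_4 => slide_amount p e q.1 q.2)}.
Proof.
move=> e0; rewrite /slide_amount; apply: cw_mul; first by wcont.
apply: cw_max; first by wcont.
by apply: cw_add; wcont.
Qed.

Section Slide.
Variables (t : R -> R -> R -> R) (p : 'rV[R]_4) (e : R).
Hypotheses (e0 : 0 < e) (t0 : forall u, t e 0 u = u)
  (tout : forall k u, 0 <= k -> k <= 2^-1 -> e <= `|u| -> t e k u = u)
  (tin : forall k u, 0 <= k -> k <= 2^-1 -> `|u| <= e -> `|t e k u| <= e).

Lemma slide0 x : slide t p e (0, x) = x.
Proof.
by apply: eq_row4; rewrite row4E //= /slide_amount !mul0r t0 addrC subrK.
Qed.

Lemma slide_out s x : 0 <= s <= 1 -> e < `|x - p| -> slide t p e (s, x) = x.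
Proof.
move=> s01 xe; have /andP[k0 k1] := slide_amount_bound p x e0 s01.
suff h : t e (slide_amount p e s x) (x 0 1 - p 0 1) = x 0 1 - p 0 1.
  by apply: eq_row4; rewrite row4E //= h addrC subrK.
have [h1|h1] := lerP e `|x 0 1 - p 0 1|; first exact: tout.
set m := Num.max `|x 0 0 - p 0 0| (Num.max `|x 0 (inord 2) - p 0 (inord 2)|
    `|x 0 (inord 3) - p 0 (inord 3)|).
have [h2|] := lerP e m.
  by rewrite /slide_amount -/m max_l ?mulr0 // subr_le0 ler_pdivlMr // mul1r.
rewrite !gt_max => /andP[h3 /andP[h4 h5]]; exfalso; move: xe; rewrite ltNge => /negP; apply.
apply/ltW/rV_norm_lt => // -[[|[|[|[|//]]]] q]; rewrite mxE [X in _ + X]mxE.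
- by rewrite (_ : Ordinal q = 0) //; exact/val_inj.
- by rewrite (_ : Ordinal q = 1) //; exact/val_inj.
- by rewrite (_ : Ordinal q = inord 2) //; apply/val_inj; rewrite /= inordK.
- by rewrite (_ : Ordinal q = inord 3) //; apply/val_inj; rewrite /= inordK.
Qed.

Lemma slide_in s x : 0 <= s <= 1 -> `|x - p| <= e -> `|slide t p e (s, x) - p| <= e.
Proof.
move=> s01 /rV_norm_le xe; have {}xe := xe (ltW e0).
have /andP[k0 k1] := slide_amount_bound p x e0 s01.
apply/rV_norm_le; first exact: ltW.
move=> -[[|[|[|[|//]]]] q]; rewrite mxE [X in _ + X]mxE.
- rewrite (_ : Ordinal q = 0); last exact/val_inj.
  by rewrite row4E; have := xe 0; rewrite mxE [X in _ + X]mxE.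
- rewrite (_ : Ordinal q = 1); last exact/val_inj.
  rewrite row4E addrAC subrr add0r; apply: tin => //.
  by have := xe 1; rewrite mxE [X in _ + X]mxE.
- rewrite (_ : Ordinal q = inord 2); last by apply/val_inj; rewrite /= inordK.
  by rewrite row4E; have := xe (inord 2); rewrite mxE [X in _ + X]mxE.
- rewrite (_ : Ordinal q = inord 3); last by apply/val_inj; rewrite /= inordK.
  by rewrite row4E; have := xe (inord 3); rewrite mxE [X in _ + X]mxE.
Qed.

End Slide.

Lemma cw_slide_fw p e : 0 < e ->
  {within `[0, 1] `*` [set: 'rV[R]_4], continuous (slide (@tent_fw R) p e)}.
Proof.
move=> e0; have ca := @cw_slide_amount p _ e0; rewrite /slide /tent_fw.
apply: cw_row4; wcont.
Qed.

Lemma cw_slide_bw p e : 0 < e ->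
  {within `[0, 1] `*` [set: 'rV[R]_4], continuous (slide (@tent_bw R) p e)}.
Proof.
move=> e0; have ca := @cw_slide_amount p _ e0; rewrite /slide /tent_bw.
have c1 : {within `[0, 1] `*` [set: 'rV[R]_4],
    continuous (fun q : R * 'rV[R]_4 => (1 + slide_amount p e q.1 q.2)^-1)}.
  apply: cw_inv; last by wcont.
  move=> [s x] [/=]; rewrite in_itv /= => s01 _; have /andP[k0 _] := slide_amount_bound p x e0 s01.
  by rewrite gt_eqF // ltr_pwDl.
have c2 : {within `[0, 1] `*` [set: 'rV[R]_4],
    continuous (fun q : R * 'rV[R]_4 => (1 - slide_amount p e q.1 q.2)^-1)}.
  apply: cw_inv; last by wcont.
  move=> [s x] [/=]; rewrite in_itv /= => s01 _; have /andP[_ k1] := slide_amount_bound p x e0 s01.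
  by rewrite gt_eqF // subr_gt0 (le_lt_trans k1) // invf_lt1 // ltr1n.
apply: cw_row4; try by wcont.
Qed.

Lemma slide_fwK p e x : 0 < e -> slide (@tent_bw R) p e (1, slide (@tent_fw R) p e (1, x)) = x.
Proof.
move=> e0; have s01 : 0 <= (1 : R) <= 1 by rewrite ler01 lexx.
have /andP[k0 k1] := slide_amount_bound p x e0 s01.
have aE : slide_amount p e 1 (slide (@tent_fw R) p e (1, x)) = slide_amount p e 1 x.
  by rewrite /slide_amount /slide !row4E.
apply: eq_row4; rewrite /slide !row4E //=.
by rewrite -/(slide (@tent_fw R) p e (1, x)) aE [X in tent_bw _ _ X]addrAC subrr add0r tent_fwK // addrC subrK.
Qed.

Hypothesis binv : boundary_invariant R.

(** A slide of a flat chart along coordinate 1, a direction of the surface. G is the backward slide,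
    which brings y' to y, and g' is the forward slide at time 1. The box stays off the boundary, so
    boundary points do not move. *)
Lemma move_point (F : set N) (U : set N) (f : N -> 'rV[R]_4) y :
  chart [set: N] U f -> U y -> 0 < (f y) 0 0 ->
  (forall q, U q -> (F q <-> f q 0 (inord 2) = 0 /\ f q 0 (inord 3) = 0)) ->
  F y -> exists y' (G : R * N -> N) g', [/\
    [/\ U y', F y', 0 < (f y') 0 0 & (f y') 0 1 != (f y) 0 1],
    {within `[0, 1] `*` [set: N], continuous G} /\ continuous g',
    forall q, G (0, q) = q /\ G (1, g' q) = q,
    forall s q, s \in `[0, 1] -> [/\ F (G (s, q)) <-> F q, F (g' q) <-> F q &
       (\partial[R] N) q -> G (s, q) = q] &
    forall q, G (1, q) = y <-> q = y'].
Proof.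
move=> cU Uy y0 FU Fy; have [oU [V [g [oV hg]]]] := cU; rewrite setTI in hg.
have [cf cg fK gK] := hg; pose p := f y.
have [[Hp Vp] gp] := fK y Uy.
have oVp : open (V `&` (fun x : 'rV[R]_4 => x 0 0) @^-1` [set r | 0 < r]).
  by apply: open_preim; [exact: oV|wcont|exact: open_gt].
have [r /= r0 rV] := (nbhs_ballP _ _).1 (open_nbhs_nbhs (conj oVp (conj Vp y0))).
pose e := r / 2; have e0 : 0 < e by rewrite divr_gt0.
have box (x : 'rV[R]_4) : `|x - p| <= e -> V x /\ 0 < x 0 0.
  move=> xe; apply: rV; rewrite -ball_normE /= distrC; apply: le_lt_trans xe _.
  by rewrite /e ltr_pdivrMr // ltr_pMr // ltr1n.
have boxV (x : 'rV[R]_4) : `|x - p| <= e -> (half_space R 4 `&` V) x.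
  by move=> /box[Vx x0]; split=> //; apply/half_spaceP/ltW.
have itv (s : R) : `[0, 1]%classic s -> 0 <= s <= 1 by rewrite /= in_itv.
have b0 := tent_bw0 e; have f0 := tent_fw0 e.
have bo k u : 0 <= k -> k <= 2^-1 -> e <= `|u| -> tent_bw e k u = u.
  by move=> k0 k1; exact: tent_bw_out.
have bi k u : 0 <= k -> k <= 2^-1 -> `|u| <= e -> `|tent_bw e k u| <= e.
  by move=> k0 k1; exact: tent_bw_in.
have fo k u : 0 <= k -> k <= 2^-1 -> e <= `|u| -> tent_fw e k u = u.
  by move=> _ _; exact: tent_fw_out.
have fi k u : 0 <= k -> k <= 2^-1 -> `|u| <= e -> `|tent_fw e k u| <= e.
  by move=> k0 k1; exact: tent_fw_in.
have Bo s (x : 'rV[R]_4) : `[0, 1]%classic s -> e < `|x - p| -> slide (@tent_bw R) p e (s, x) = x.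
  by move=> /itv s01; apply: slide_out.
have Bi s (x : 'rV[R]_4) : `[0, 1]%classic s -> `|x - p| <= e -> `|slide (@tent_bw R) p e (s, x) - p| <= e.
  by move=> /itv s01; apply: slide_in.
have Fo s (x : 'rV[R]_4) : `[0, 1]%classic s -> e < `|x - p| -> slide (@tent_fw R) p e (s, x) = x.
  by move=> /itv s01; apply: slide_out.
have Fi s (x : 'rV[R]_4) : `[0, 1]%classic s -> `|x - p| <= e -> `|slide (@tent_fw R) p e (s, x) - p| <= e.
  by move=> /itv s01; apply: slide_in.
have [G [cG GU GnU]] := @chart_support U f p e `[0, 1]%classic (slide (@tent_bw R) p e) V g oU oV hg
  (ltW e0) boxV (@cw_slide_bw p _ e0)
  Bo Bi.
have [K [cK KU KnU]] := @chart_support U f p e `[0, 1]%classic (slide (@tent_fw R) p e) V g oU oV hg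
  (ltW e0) boxV (@cw_slide_fw p _ e0)
  Fo Fi.
have i0 : `[0, 1]%classic (0 : R) by exact: in01_0.
have i1 : `[0, 1]%classic (1 : R) by exact: in01_1.
have finj a b : U a -> U b -> f a = f b -> a = b.
  by move=> Ua Ub ab; have [_ <-] := fK a Ua; have [_ <-] := fK b Ub; rewrite ab.
(* At time 1 the slide amount at the centre is 1/2, so that the centre is moved by e/2. *)
pose x' : 'rV[R]_4 := row4 (p 0 0) (p 0 1 + 2^-1 * e) (p 0 (inord 2)) (p 0 (inord 3)).
have x'e : `|x' - p| <= e.
  apply/rV_norm_le; first exact: ltW.
  move=> -[[|[|[|[|//]]]] q]; rewrite mxE [X in _ + X]mxE.
  - by rewrite (_ : Ordinal q = 0) ?row4E ?subrr ?normr0 ?ltW //; exact/val_inj.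
  - rewrite (_ : Ordinal q = 1); last exact/val_inj.
    rewrite row4E addrAC subrr add0r gtr0_norm ?mulr_gt0 //.
    by rewrite ler_piMl ?(ltW e0) // invf_le1 // ler1n.
  - rewrite (_ : Ordinal q = inord 2); last by apply/val_inj; rewrite /= inordK.
    by rewrite row4E subrr normr0 ltW.
  - rewrite (_ : Ordinal q = inord 3); last by apply/val_inj; rewrite /= inordK.
    by rewrite row4E subrr normr0 ltW.
have [Ux' fx'] := gK x' (boxV _ x'e).
exists (g x'), G, (fun q => K (1, q)).
have FUy := (FU y Uy).1 Fy.
split.
- split=> //; [by apply/(FU _ Ux'); rewrite fx' !row4E|by rewrite fx' row4E|].
  rewrite fx' row4E -/p.
  by rewrite -subr_eq0 addrAC subrr add0r gt_eqF // mulr_gt0.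
- split=> //; apply/cont_within; apply: (cw_comp cK) => [|q _]; last by split.
  by apply: cw_pair; [exact: cw_cst|exact: cw_id].
- move=> q; have [Uq|nUq] := pselect (U q); last by rewrite GnU // KnU // GnU.
  split.
    apply: finj => //; first by have [] := GU 0 q i0 Uq.
    by have [_ ->] := GU 0 q i0 Uq; rewrite slide0 // => u; rewrite tent_bw0.
  have [UK fKq] := KU 1 q i1 Uq; have [UG fG] := GU 1 _ i1 UK.
  by apply: finj => //; rewrite fG fKq slide_fwK.
- move=> s q s01; have [Uq|nUq] := pselect (U q); last by rewrite GnU // KnU.
  have [UK fKq] := KU 1 q i1 Uq; have [UG fG] := GU s q s01 Uq.
  split.
  + by rewrite !FU // fG !row4E.
  + by rewrite !FU // fKq !row4E.
  + move=> /(chart_boundary binv cU Uq) q0; apply: finj => //; rewrite fG Bo //.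
    by rewrite ltNge; apply/negP => /box[_]; rewrite q0 ltxx.
- have s01 : 0 <= (1 : R) <= 1 by rewrite ler01 lexx.
  have aE (x : 'rV[R]_4) : x 0 0 = p 0 0 -> x 0 (inord 2) = p 0 (inord 2) -> x 0 (inord 3) = p 0 (inord 3) ->
      slide_amount p e 1 x = 2^-1.
    by move=> h0 h2 h3; rewrite /slide_amount h0 h2 h3 !subrr normr0 !maxxx mul0r subr0 max_r // mulr1 mul1r.
  have k0 : 0 <= (2^-1 : R) by rewrite invr_ge0.
  move=> q; split=> [Gq|->].
    have [Uq|nUq] := pselect (U q); last by rewrite GnU // in Gq; case: nUq; rewrite Gq.
    have [_] := GU 1 q i1 Uq; rewrite Gq -/p => pE.
    have E j := congr1 (fun x : 'rV[R]_4 => x 0 j) pE.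
    have := E 0; have := E 1; have := E (inord 2); have := E (inord 3); rewrite /= !row4E => E3 E2 E1 E0.
    have t0 : tent_bw e 2^-1 (f q 0 1 - p 0 1) = 0.
      by move/eqP: E1; rewrite aE // addrC eq_sym -subr_eq0 addrK => /eqP.
    have := tent_bw_eq0 k0 (lexx _) e0 t0 => q1.
    apply: finj => //; rewrite fx'; apply: eq_row4; rewrite row4E -?E0 -?E2 -?E3 //.
    by rewrite -q1 addrC subrK.
  have [Uq fG] := GU 1 _ i1 Ux'; apply: finj => //; rewrite fG fx' /slide /=.
  apply: eq_row4; rewrite !row4E // aE ?row4E // [X in tent_bw _ _ X]addrAC subrr add0r.
  have := @tent_fwK R e 2^-1 k0 (lexx _) 0; rewrite /tent_fw normr0 subr0 add0r (max_r (ltW e0)) => ->.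
  by rewrite addr0.
Qed.

(** The condition of [fundamental_class] at the single point y, on chains: z generates H_2(F, F
    minus y). *)
Definition fund (F : set N) (z : chain R N 2) (y : N) :=
  forall c : chain R N 2, c \in is_cycle F (F `\ y) ->
  exists k : int, c - z *~ k \in bounds F (F `\ y).

(** A relative cycle at y is carried to y' by g', compared with z there, and brought back by G at
    time 1. As the isotopy fixes the boundary of z, the image of z differs from z by a boundary
    relative to F minus y. *)
Lemma fund_move (F B : set N) (z : chain R N 2) y y' (G : R * N -> N) g' :
  {within `[0, 1] `*` [set: N], continuous G} -> continuous g' ->
  (forall q, G (0, q) = q /\ G (1, g' q) = q) ->
  (forall s q, s \in `[0, 1] -> [/\ F (G (s, q)) <-> F q, F (g' q) <-> F q &
     B q -> G (s, q) = q]) ->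
  (forall q, G (1, q) = y <-> q = y') -> ~ B y -> z \in is_cycle F B ->
  fund F z y' -> fund F z y.
Proof.
move=> cG cg' G0 GF Gy nBy zc hy' c cc.
have [zF zB] := (is_cycleP _ _ _).1 zc; have [cF cb] := (is_cycleP _ _ _).1 cc.
have GF1 q := GF 1 q (in01_1 R).
have cG1 : continuous (fun q => G (1, q)).
  apply/cont_within; apply: (cw_comp cG) => [|q _]; last by split=> //=; exact: in01_1.
  by apply: cw_pair; [exact: cw_cst|exact: cw_id].
have g'y q : g' q = y' -> q = y.
  by move=> h; have [_ <-] := G0 q; rewrite h; apply/Gy.
have [k hk] : exists k : int, push g' c - z *~ k \in bounds F (F `\ y').
  apply: hy'; apply: is_cycle_push cc; try exact: continuous_subspaceT.
    by move=> q Fq; have [_ h _] := GF1 q; apply/h.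
  move=> q [Fq qy]; split; first by have [_ h _] := GF1 q; apply/h.
  by move=> /g'y.
exists k.
have h1 : c - push (fun q => G (1, q)) z *~ k \in bounds F (F `\ y).
  have -> : c - push (fun q => G (1, q)) z *~ k = push (fun q => G (1, q)) (push g' c - z *~ k).
    rewrite raddfB raddfMz /= push_comp; congr (_ - _).
    rewrite -[LHS]push_id; congr push; apply/funext => q /=.
    by have [_ ->] := G0 q.
  apply: bounds_push hk; try exact: continuous_subspaceT.
    by move=> q Fq; have [h _ _] := GF1 q; apply/h.
  move=> q [Fq qy]; split; first by have [h _ _] := GF1 q; apply/h.
  by move=> /Gy.
have h2 : push (fun q => G (1, q)) z - z \in bounds F (F `\ y).
  have := homotopy_bounds (H := G) (B := F) (C := B) (B' := F) (C' := F `\ y) _ _ _ zF zB.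
  rewrite (eq_push (f := fun x => G (0, x)) (g := id) (fun x _ => (G0 x).1) zF) push_id; apply.
  - by apply: continuous_subspaceW cG => q [].
  - by move=> s q s01 Fq; have [h _ _] := GF s q s01; apply/h.
  - move=> s q s01 Fq Bq; have [_ _ /(_ Bq) ->] := GF s q s01.
    by split=> // qy; apply: nBy; rewrite -qy.
rewrite -[X in X \in _](subrKA (push (fun q => G (1, q)) z *~ k)) rpredD //.
by rewrite -mulrzBl rpredMz.
Qed.

Lemma fundamental_classP (M B : set N) (c : chain R N 2) : B `<=` M -> c \in is_cycle M B ->
  fundamental_class (hclass M B c) <-> forall y, M y -> ~ B y -> fund M c y.
Proof.
move=> BM cc.
have sub y : ~ B y -> B `<=` M `\ y.
  by move=> nBy q Bq; split; [exact: BM|move=> qy; apply: nBy; rewrite -qy].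
have cc' y : ~ B y -> c \in is_cycle M (M `\ y).
  by move=> nBy; apply: is_cycleW cc => //; exact: sub.
have E y : ~ B y -> hmap M (M `\ y) id (hclass M B c) = hclass M (M `\ y) c.
  move=> nBy; rewrite (hmapE (A := M) (B := B)) ?push_id //; try exact: cw_id.
  exact: sub.
split=> h y My nBy.
  move=> d dc; have [k] := h y My nBy (hclass M (M `\ y) d).
  rewrite E // -hclassMz; last exact: cc'.
  by move=> /hclassE; rewrite rpredMz ?cc' // => /(_ dc isT) ?; exists k.
move=> x; have [d dc ->] := hclass_ex x; have [k hk] := h y My nBy d dc.
exists k; rewrite E // -hclassMz; last exact: cc'.
by apply/hclassE => //; rewrite rpredMz ?cc'.
Qed.

End ChartSupport.

Lemma split_sub (V : zmodType) (c v1 v2 x y : V) :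
  c - (x + y) = (v1 - x) + (v2 - y) - (v1 + v2 - c).
Proof. by rewrite addrACA -opprD opprB [RHS]addrC subrKA. Qed.

(** * Fundamental class of the sum *)

Section FundSide.
Variables (R : realType) (N1 N2 N : topologicalType).
Variables (F1 : set N1) (F2 : set N2) (phi1 : 'rV[R]_3 -> N1) (phi2 : 'rV[R]_3 -> N2).
Variables (e1 : N1 -> N) (e2 : N2 -> N).
Hypotheses (p1 : piece F1 phi1) (p2 : piece F2 phi2) (hN : glued phi1 phi2 e1 e2).
Local Notation F := (gsurf F1 F2 e1 e2).

(** After a cycle is split, its part in N2 avoids the point e1 a and hence vanishes relative to the
    complement of that point, as does u. What remains is a cycle of F1. *)
Lemma fund_side1 a (c1 : chain R N1 2) (u : chain R N 2) :
  F1 a -> ~ (phi1 @` @closed_ball3 R) a -> u \in chain_in (F `\ e1 a) ->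
  fund F1 c1 a -> fund F (push e1 c1 + u) (e1 a).
Proof.
move=> Fa nD uF fc1 c cc.
have [K [O hK]] := glued_collapse p1 p2 hN; have [_ _ K1 K2 [KF _]] := hK.
have nr : ~ range e2 (e1 a) by move=> h; apply: nD; rewrite -(disk_preimage hN).
have [|s q s01 Fq [_ qy]|v1 [v2 [v1A v2A bdv hv]]] := split_cycle p1 p2 hN hK _ _ cc.
- by move=> s q s01 Fq; apply/KF.
- split; first exact/KF.
  have [[a' qE]|[b qE]] := glued_cover hN q; subst q; first by rewrite /= K1.
  by move=> h; apply: nr; rewrite -h; exact: K2.
have F1E : e1 @^-1` F = F1 by apply/seteqP; split=> x /(gsurf1 p1 p2 hN).
have F2E : e2 @^-1` F = F2 by apply/seteqP; split=> x /(gsurf2 p1 p2 hN).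
rewrite F1E in v1A; rewrite F2E in v2A.
have ce1 := glued_e1 hN; have ce2 := glued_e2 hN.
have w2 : push e2 v2 \in chain_in (F `\ e1 a).
  apply: push_chain_in v2A; first exact: continuous_subspaceT.
  move=> b Fb; split; first by right; exists b.
  by move=> ba; apply: nr; exists b.
have [j1 cj1 j1E] := e1_inverse p1 hN.
have v1c : v1 \in is_cycle F1 (F1 `\ a).
  apply/is_cycleP; split=> //.
  have h : bd (push e1 v1) \in chain_in (e1 @` (F1 `\ a)).
    have h1 : bd (push e1 v1) \in chain_in (F `\ e1 a).
      rewrite -[X in X \in _](addrK (bd (push e2 v2))) -raddfD /= rpredB //.
      exact: (bd_chain_in w2).
    have h2 : bd (push e1 v1) \in chain_in (e1 @` F1).
      apply: bd_chain_in; apply: push_chain_in v1A; first exact: continuous_subspaceT.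
      by move=> x Fx; exists x.
    apply: chain_inW (chain_inI h1 h2) => y [[_ n] [x Fx xE]]; exists x => //.
    by split=> // xa; apply: n; rewrite /= -xE xa.
  have -> : bd v1 = push j1 (bd (push e1 v1)).
    rewrite bd_push' push_comp -[LHS]push_id.
    apply: (@eq_push _ _ _ _ _ _ setT) => [x _ /=|]; first by rewrite j1E.
    exact: chain_inW (bd_chain_in v1A).
  apply: push_chain_in h; first by apply: continuous_subspaceW cj1 => _ [x _ <-]; exists x.
  by move=> _ [x hx <-]; rewrite j1E.
have [k hk] := fc1 v1 v1c; exists k.
have hk' : push e1 v1 - push e1 c1 *~ k \in bounds F (F `\ e1 a).
  rewrite -raddfMz -raddfB; apply: bounds_push hk; try exact: continuous_subspaceT.
    by move=> x Fx; left; exists x.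
  move=> x [Fx xa]; split; first by left; exists x.
  by move=> /(glued_inj1 hN).
rewrite mulrzDl (@split_sub _ c (push e1 v1) (push e2 v2)).
by rewrite rpredB // rpredD //; apply: bounds_in; rewrite rpredB // rpredMz.
Qed.

End FundSide.

Section KnotCycle.
Variables (R : realType) (N : topologicalType).

Definition knot_chain (k : R -> N) : chain R N 1 :=
  << (fun t => k ((\val t) 0 1)) : std_simplex R 1 -> N >>.

Lemma knot_chain_cycle (k : R -> N) : continuous k -> (forall t, k (t + 1) = k t) ->
  knot_chain k \in is_cycle (range k) set0.
Proof.
move=> ck kp; apply/is_cycleP; split.
  apply: chain_inU => [|t]; last by exists ((\val t) 0 1).
  apply/cont_within; apply: cw_compT ck _; apply: cw_coord.
  exact/cont_within/set_val_continuous.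
rewrite /knot_chain bdU !big_ord_recl big_ord0 addr0 expr0 expr1 mulr1z mulrNz mulr1z.
set s := fun t : std_simplex R 1 => _.
have E i : s \o @coface R 0 i = fun=> k 0.
  apply/funext => p; have /set_mem[_] := valP p; rewrite big_ord1 => p1.
  rewrite /s /= !mxE; case: unliftP => [j jE|//].
  by rewrite ord1 p1 -[1]add0r kp.
have -> : << s \o @coface R 0 ord0 >> = << s \o @coface R 0 (fintype.lift ord0 ord0) >>
   :> chain R N 0 by rewrite !E.
by rewrite subrr rpred0.
Qed.

End KnotCycle.

Section FundSum.
Variables (R : realType) (N1 N2 N : topologicalType).
Variables (F1 : set N1) (F2 : set N2) (phi1 : 'rV[R]_3 -> N1) (phi2 : 'rV[R]_3 -> N2).
Variables (e1 : N1 -> N) (e2 : N2 -> N).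
Hypotheses (p1 : piece F1 phi1) (p2 : piece F2 phi2) (hN : glued phi1 phi2 e1 e2).
Hypotheses (binv : boundary_invariant R) (m1 : compact_manifold R N1 4)
  (m2 : compact_manifold R N2 4).
Variables (k1 : R -> N1) (k2 : R -> N2) (k : R -> N).
Hypotheses (fb1 : F1 `&` \partial[R] N1 = range k1) (fb2 : F2 `&` \partial[R] N2 = range k2)
  (kr : range k = e1 @` (range k1 `\` phi1 @` @open_ball3 R)
            `|` e2 @` (range k2 `\` phi2 @` @open_ball3 R)).
Local Notation F := (gsurf F1 F2 e1 e2).
Local Notation K12 := (e1 @` range k1 `|` e2 @` range k2).

Lemma off_knot_off_disk a : F1 a -> ~ range k1 a -> ~ (phi1 @` @closed_ball3 R) a.
Proof.
move=> Fa nk [v cv va]; apply: nk; rewrite -fb1; split=> //; rewrite -va; exact: piece_bd p1 v.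
Qed.

Lemma knots_sub1 a : K12 (e1 a) -> range k1 a.
Proof.
move=> [[a' ka /(glued_inj1 hN) <-//]|[b kb /esym/(gluedP hN)[v cv [-> bE]]]].
rewrite -fb1; split; last exact: piece_bd p1 v.
move: kb; rewrite -fb2 bE => -[/(piece_axis p2) av _]; exact/(piece_axis p1).
Qed.

Lemma fund_sum1 a (c1 : chain R N1 2) (c2 : chain R N2 2) (w : chain R N 2) :
  F1 a -> ~ range k1 a -> c2 \in chain_in F2 -> w \in chain_in K12 ->
  fund F1 c1 a -> fund F (push e1 c1 + (push e2 c2 + w)) (e1 a).
Proof.
move=> Fa nk c2F wK; have nD := off_knot_off_disk Fa nk.
apply: (fund_side1 p1 p2 hN Fa nD); rewrite rpredD //.
  apply: push_chain_in c2F; first exact/continuous_subspaceT/(glued_e2 hN).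
  move=> b Fb; split; first by right; exists b.
  by move=> ba; apply: nD; rewrite -(disk_preimage hN); exists b.
apply: chain_inW wK => y Ky; split.
  case: Ky => -[x kx <-]; [left|right]; exists x => //.
    by move: kx; rewrite -fb1 => -[].
  by move: kx; rewrite -fb2 => -[].
by move=> ya; apply: nk; apply: knots_sub1; rewrite -ya.
Qed.

End FundSum.

Section SumClass.
Variables (R : realType) (N1 N2 N : topologicalType).
Variables (F1 : set N1) (F2 : set N2) (phi1 : 'rV[R]_3 -> N1) (phi2 : 'rV[R]_3 -> N2).
Variables (e1 : N1 -> N) (e2 : N2 -> N).
Hypotheses (p1 : piece F1 phi1) (p2 : piece F2 phi2) (hN : glued phi1 phi2 e1 e2).
Hypotheses (binv : boundary_invariant R) (m1 : compact_manifold R N1 4)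
  (m2 : compact_manifold R N2 4).
Variables (k1 : R -> N1) (k2 : R -> N2) (k : R -> N).
Hypotheses (fb1 : F1 `&` \partial[R] N1 = range k1) (fb2 : F2 `&` \partial[R] N2 = range k2)
  (kr : range k = e1 @` (range k1 `\` phi1 @` @open_ball3 R)
            `|` e2 @` (range k2 `\` phi2 @` @open_ball3 R)).
Local Notation F := (gsurf F1 F2 e1 e2).
Local Notation K12 := (e1 @` range k1 `|` e2 @` range k2).
Local Notation B := (e1 @` \partial[R] N1 `|` e2 @` \partial[R] N2).

Lemma fund_sum2 b (c1 : chain R N1 2) (c2 : chain R N2 2) (w : chain R N 2) :
  F2 b -> ~ range k2 b -> c1 \in chain_in F1 -> w \in chain_in K12 ->
  fund F2 c2 b -> fund F (push e1 c1 + (push e2 c2 + w)) (e2 b).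
Proof.
move=> Fb nk c1F wK fb; rewrite addrCA -gsurf_sym.
by apply: (fund_sum1 p2 p1 (glued_sym hN) fb2 fb1 Fb nk c1F _ fb); rewrite setUC.
Qed.

(** On the seam neither surface alone controls the local homology, so the point is moved along F to
    one side, where [fund_sum1] or [fund_sum2] applies. *)
Lemma fund_sum_seam v (c1 : chain R N1 2) (c2 : chain R N2 2) (w : chain R N 2) :
  axis3 v -> ssq v < 1 -> c1 \in chain_in F1 -> c2 \in chain_in F2 -> w \in chain_in K12 ->
  push e1 c1 + (push e2 c2 + w) \in is_cycle F (range k) ->
  (forall a, F1 a -> ~ range k1 a -> fund F1 c1 a) ->
  (forall b, F2 b -> ~ range k2 b -> fund F2 c2 b) ->
  fund F (push e1 c1 + (push e2 c2 + w)) (e1 (phi1 v)).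
Proof.
move=> av v1 c1F c2F wK zc f1 f2.
have [U [f [cU Uy [y0 seam] /(_ av) FU]]] := glue_chart_interior p1 p2 hN v1.
have cv : closed_ball3 v by exact: ltW.
have Fy : F (e1 (phi1 v)) by apply/(gsurf1 p1 p2 hN)/(piece_axis p1).
have FN := gsurf_bd p1 p2 hN binv m1 m2 fb1 fb2 kr.
have [y' [G [g' [[Uy' Fy' y'0 y'1] [cG cg'] G0 GF Gy]]]] :=
  move_point (glued_hausdorff hN) binv cU Uy y0 FU Fy.
have bdk q : range k q -> (\partial[R] N) q by rewrite -FN => -[].
apply: (fund_move cG cg' G0 _ Gy _ zc).
- by move=> s q s01; have [h1 h2 h3] := GF s q s01; split=> // /bdk.
- by move=> /bdk/(chart_boundary binv cU Uy) h; move: y0; rewrite h ltxx.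
have fy0 : f (e1 (phi1 v)) 0 1 = 0.
  by apply: seam => //; exists (phi2 v) => //; rewrite (glued_phi hN).
rewrite fy0 in y'1.
have nb' : ~ (\partial[R] N) y' by move=> /(chart_boundary binv cU Uy') h; move: y'0; rewrite h ltxx.
(* Points of both pieces have chart coordinate 1 equal to 0, and the slide has changed this
   coordinate. *)
have nr : ~ (range e1 y' /\ range e2 y').
  by move=> [r1 r2]; move/negP: y'1; apply; apply/eqP; exact: seam.
case: Fy' => -[x Fx xE]; subst y'.
  have nk : ~ range k1 x.
    rewrite -fb1 => -[_ bx]; apply: nb'; apply/(glued_bd1 p1 p2 hN binv m1); split=> // -[u ou ux].
    apply: nr; split; first by exists x.
    by exists (phi2 u) => //; rewrite -ux (glued_phi hN) //; exact: ltW.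
  by apply: (fund_sum1 p1 p2 hN fb1 fb2) => //; exact: f1.
have nk : ~ range k2 x.
  rewrite -fb2 => -[_ bx]; apply: nb'; apply/(glued_bd2 p1 p2 hN binv m2); split=> // -[u ou ux].
  apply: nr; split; last by exists x.
  by exists (phi1 u) => //; rewrite -ux (glued_phi hN) //; exact: ltW.
by apply: fund_sum2 => //; exact: f2.
Qed.

(** The connecting map determines the boundary only up to a chain d in the knot; subtracting d does
    not alter the relative class. *)
Lemma normalized_cycle (X : topologicalType) (A : set X) (h : R -> X)
    (phi : homology R 2 A (range h)) :
  continuous h -> (forall t, h (t + 1) = h t) -> range h `<=` A ->
  connecting phi = knot_class h ->
  exists c, [/\ c \in is_cycle A (range h), phi = hclass A (range h) c & bd c = knot_chain h].
Proof.
move=> ch hp hA; have [c cc ->] := hclass_ex phi; rewrite connectingE // => hE.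
have kc := knot_chain_cycle ch hp.
have [cA cb] := (is_cycleP _ _ _).1 cc.
have /hclassE := hE => /(_ _ kc) h1.
have [|d dA dE] := bounds0P (h1 _).
  by apply/is_cycleP; split=> //; rewrite bd_bd rpred0.
exists (c - d).
have dc : d \in is_cycle A (range h).
  by apply/is_cycleP; split; [exact: chain_inW dA|exact: bd_chain_in].
split; first exact: rpredB.
  rewrite hclassB // (_ : hclass A (range h) d = 0) ?subr0 //.
  by apply/hclass_eq0 => //; exact: bounds_in.
by rewrite raddfB /= -dE opprB addrCA subrr addr0.
Qed.

Lemma gsurf_class (phi1' : homology R 2 F1 (range k1)) (phi2' : homology R 2 F2 (range k2)) x :
  knot k1 -> knot k2 -> knot k ->
  fundamental_class phi1' -> connecting phi1' = knot_class k1 ->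
  fundamental_class phi2' -> connecting phi2' = knot_class k2 ->
  hmap K12 set0 id (knot_class k) =
    hmap K12 set0 e1 (knot_class k1) + hmap K12 set0 e2 (knot_class k2) ->
  class_sum e1 e2 (hmap [set: N1] (\partial[R] N1) id phi1')
    (hmap [set: N2] (\partial[R] N2) id phi2') x ->
  exists phi : homology R 2 F (range k),
    [/\ fundamental_class phi, connecting phi = knot_class k &
        hmap [set: N] (\partial[R] N) id phi = x].
Proof.
move=> [ck1 kp1 _ _] [ck2 kp2 _ _] [ck kp _ _] f1 cn1 f2 cn2 hK hx.
have s1 : range k1 `<=` F1 by rewrite -fb1; exact: subIsetl.
have s2 : range k2 `<=` F2 by rewrite -fb2; exact: subIsetl.
have FN := gsurf_bd p1 p2 hN binv m1 m2 fb1 fb2 kr.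
have sF : range k `<=` F by rewrite -FN; exact: subIsetl.
have sb : range k `<=` \partial[R] N by rewrite -FN; exact: subIsetr.
have [c1 [cc1 E1 bd1]] := normalized_cycle ck1 kp1 s1 cn1.
have [c2 [cc2 E2 bd2]] := normalized_cycle ck2 kp2 s2 cn2.
have [c1F c1b] := (is_cycleP _ _ _).1 cc1; have [c2F c2b] := (is_cycleP _ _ _).1 cc2.
have ce1 := glued_e1 hN; have ce2 := glued_e2 hN.
have kc := knot_chain_cycle ck kp; have kc1 := knot_chain_cycle ck1 kp1.
have kc2 := knot_chain_cycle ck2 kp2.
have sK : range k `<=` K12.
  by rewrite kr => _ [[a [ka _] <-]|[b [kb _] <-]]; [left; exists a|right; exists b].
have w1 (X Y : topologicalType) (f : X -> Y) (A : set X) : continuous f ->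
  {within A, continuous f} by move=> cf; exact: continuous_subspaceT.
have pc1 : push e1 (knot_chain k1) \in is_cycle K12 set0.
  by apply: is_cycle_push kc1; [exact: w1|exact: w1|move=> a ka; left; exists a|].
have pc2 : push e2 (knot_chain k2) \in is_cycle K12 set0.
  by apply: is_cycle_push kc2; [exact: w1|exact: w1|move=> a ka; right; exists a|].
(* A chain inside the two knots that corrects the sum of their chains to the chain of k. Adding it
   makes the boundary of z exactly the knot chain. *)
have [w wK wE] : exists2 w : chain R N 2, w \in chain_in K12 &
    knot_chain k - (push e1 (knot_chain k1) + push e2 (knot_chain k2)) = bd w.
  apply: bounds0P; apply/hclassE; [exact: is_cycleW kc|exact: rpredD|].
  move: hK; rewrite !hmapE ?push_id ?hclassD //; try exact: w1; try exact: cw_id.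
  - by move=> b kb; right; exists b.
  - by move=> a ka; left; exists a.
pose z := push e1 c1 + (push e2 c2 + w).
have bdz : bd z = knot_chain k.
  by rewrite /z !raddfD /= !bd_push bd1 bd2 -wE addrA addrC subrK.
have KF : K12 `<=` F.
  by move=> _ [[a /s1 Fa <-]|[b /s2 Fb <-]]; [left; exists a|right; exists b].
have zF : z \in chain_in F.
  rewrite !rpredD //; last exact: chain_inW wK.
    by apply: push_chain_in c1F; [exact: w1|move=> a Fa; left; exists a].
  by apply: push_chain_in c2F; [exact: w1|move=> a Fa; right; exists a].
have zc : z \in is_cycle F (range k).
  by apply/is_cycleP; split=> //; rewrite bdz; have [] := (is_cycleP _ _ _).1 kc.
rewrite E1 in f1 hx; rewrite E2 in f2 hx.
have {}f1 := (fundamental_classP s1 cc1).1 f1.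
have {}f2 := (fundamental_classP s2 cc2).1 f2.
exists (hclass F (range k) z); split.
- apply/(fundamental_classP sF zc) => y Fy nk.
  have seam v : axis3 v -> ssq v < 1 -> fund F z (e1 (phi1 v)).
    by move=> av v1; exact: fund_sum_seam.
  case: Fy => -[a Fa aE]; subst y.
    have [ka|nka] := pselect (range k1 a); last by apply: (fund_sum1 p1 p2 hN fb1 fb2) => //; exact: f1.
    have [[v ov va]|no] := pselect ((phi1 @` @open_ball3 R) a); last first.
      by case: nk; rewrite kr; left; exists a.
    by rewrite -va; apply: seam => //; apply/(piece_axis p1); rewrite va.
  have [ka|nka] := pselect (range k2 a); last by apply: fund_sum2 => //; exact: f2.
  have [[v ov va]|no] := pselect ((phi2 @` @open_ball3 R) a); last first.
    by case: nk; rewrite kr; right; exists a.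
  rewrite -va -(glued_phi hN); last exact: ltW.
  by apply: seam => //; apply/(piece_axis p2); rewrite va.
- by rewrite connectingE // bdz.
have zN : z \in is_cycle [set: N] (\partial[R] N) by apply: is_cycleW zc.
rewrite (hmapE (A := F) (B := range k)) ?push_id //; try exact: cw_id.
have [u uc uE] := hclass_ex x; rewrite uE in hx *.
(* Relative to B the correction w vanishes, and the equality becomes the hypothesis on x. *)
apply/hclassE => //; apply: (class_injective p1 p2 hN binv m1 m2); first exact: rpredB.
have sB : \partial[R] N `<=` B by move=> y by_; apply/(bd_cover p1 p2 hN binv m1 m2); left.
have b1 : range k1 `<=` \partial[R] N1 by rewrite -fb1; exact: subIsetr.
have b2 : range k2 `<=` \partial[R] N2 by rewrite -fb2; exact: subIsetr.
have q1 : push e1 c1 \in is_cycle [set: N] B.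
  apply: is_cycle_push cc1; [exact: w1|exact: w1|by []|].
  by move=> a /b1 ba; left; exists a.
have q2 : push e2 c2 \in is_cycle [set: N] B.
  apply: is_cycle_push cc2; [exact: w1|exact: w1|by []|].
  by move=> a /b2 ba; right; exists a.
have cc1N : c1 \in is_cycle [set: N1] (\partial[R] N1) by exact: is_cycleW cc1.
have cc2N : c2 \in is_cycle [set: N2] (\partial[R] N2) by exact: is_cycleW cc2.
have hz : u - (push e1 c1 + push e2 c2) \in bounds [set: N] B.
  apply/hclassE; [exact: is_cycleW uc|exact: rpredD|].
  move: hx; rewrite /class_sum.
  rewrite (hmapE (c := u)) ?push_id //; try exact: cw_id.
  rewrite (hmapE (c := c1)) ?push_id //; try exact: cw_id.
  rewrite (hmapE (c := c2)) ?push_id //; try exact: cw_id.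
  rewrite (hmapE (c := c1)) //; try exact: w1; last by move=> a ba; left; exists a.
  rewrite (hmapE (c := c2)) //; try exact: w1; last by move=> a ba; right; exists a.
  by rewrite hclassD.
have wB : w \in bounds [set: N] B.
  apply: bounds_in; apply: chain_inW wK => _ [[a /b1 ba <-]|[b /b2 bb <-]];
    [by left; exists a|by right; exists b].
have -> : z - u = w - (u - (push e1 c1 + push e2 c2)).
  by rewrite /z opprB [RHS]addrA; congr (_ - _); rewrite addrA addrC.
exact: rpredB.
Qed.

End SumClass.

(** * Homotopy classes of paths *)

Section PathTools.
Variables (R : realType) (X : topologicalType).
Implicit Types (A : set X) (a b c : R -> X).

Definition ppath A a := {within `[0, 1], continuous a} /\ forall t, t \in `[0, 1] -> A (a t).

Lemma path_inP A a x y : path_in A a x y <-> [/\ ppath A a, a 0 = x & a 1 = y].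
Proof. by split=> [[ca aA a0 a1]|[[ca aA] a0 a1]]; split. Qed.

Lemma path_inW A A' a x y : A `<=` A' -> path_in A a x y -> path_in A' a x y.
Proof. by move=> AA [ca aA a0 a1]; split=> // t /aA/AA. Qed.

Definition phom A a b := [/\ path_homotopic A a b, ppath A a & ppath A b].

Lemma phom_ends A a b : phom A a b -> a 0 = b 0 /\ a 1 = b 1.
Proof.
move=> [[H [_ _ h01 hst]] _ _].
have i0 := in01_0 R; have i1 := in01_1 R.
have [h0 h1] := hst 1 i1; have [_ e0] := h01 0 i0; have [_ e1] := h01 1 i1.
by rewrite -h0 -h1 e0 e1.
Qed.

Lemma phom_eq A a b : ppath A a -> (forall t, t \in `[0, 1] -> a t = b t) -> phom A a b.
Proof.
move=> [ca aA] ab.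
have cb : {within `[0, 1], continuous b} by apply: (within_eq _ ca) => t /= t01; exact: ab.
have bA t : t \in `[0, 1] -> A (b t) by move=> t01; rewrite -ab //; exact: aA.
split=> //; exists (fun q => a q.2); split.
- by apply: (cw_comp ca) => [|[s t] []//]; wcont.
- by move=> s t _ t01; exact: aA.
- by move=> t t01; rewrite ab.
- by move=> s s01.
Qed.

Lemma phom_refl A a : ppath A a -> phom A a a.
Proof. by move=> pa; apply: phom_eq. Qed.

Lemma itv01_opp (s : R) : (s \in `[0, 1]) -> 1 - s \in `[0, 1].
Proof. by rewrite !in_itv /= => /andP[s0 s1]; rewrite subr_ge0 s1 gerBl. Qed.

Lemma phom_sym A a b : phom A a b -> phom A b a.
Proof.
move=> h; have [e0 e1] := phom_ends h; case: h => [[H [cH HA h01 hst]] pa pb].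
split=> //; exists (fun q => H (1 - q.1, q.2)); split.
- apply: (cw_comp cH) => [|[s t] [/= s01 t01]]; last by split=> //; exact: itv01_opp.
  by apply: cw_pair; wcont.
- by move=> s t s01 t01; apply: HA => //; exact: itv01_opp.
- by move=> t t01; rewrite subr0 subrr; have [? ?] := h01 t t01.
- by move=> s s01; rewrite -e0 -e1; exact: hst (itv01_opp s01).
Qed.

Lemma half_lo (s : R) : s \in `[0, 1] -> s <= 2^-1 -> 2 * s \in `[0, 1].
Proof. by rewrite !in_itv /= => /andP[s0 s1] s2; apply/andP; split; lra. Qed.

Lemma half_hi (s : R) : s \in `[0, 1] -> 2^-1 <= s -> 2 * s - 1 \in `[0, 1].
Proof. by rewrite !in_itv /= => /andP[s0 s1] s2; apply/andP; split; lra. Qed.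

Lemma in01E (s : R) : s \in `[0, 1] -> 0 <= s <= 1.
Proof. by rewrite in_itv. Qed.

Lemma phom_trans A a b c : phom A a b -> phom A b c -> phom A a c.
Proof.
move=> h1 h2; have [e0 e1] := phom_ends h1.
case: h1 => [[H [cH HA h01 hst]] pa pb]; case: h2 => [[K [cK KA k01 kst]] _ pc].
pose G (q : R * R) := if q.1 <= 2^-1 then H (2 * q.1, q.2) else K (2 * q.1 - 1, q.2).
have G1 s t : s <= 2^-1 -> G (s, t) = H (2 * s, t) by rewrite /G /= => ->.
have G2 s t : t \in `[0, 1] -> 2^-1 <= s -> G (s, t) = K (2 * s - 1, t).
  move=> t01; rewrite le_eqVlt => /predU1P[<-|s2]; last by rewrite /G /= leNgt s2.
  rewrite G1 // mulfV // subrr; have [_ ->] := h01 t t01; by have [-> _] := k01 t t01.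
have lo := half_lo; have hi := half_hi.
split=> //; exists G; split.
- apply: (@within_closed_glue _ _ _ (fst @^-1` [set s : R | s <= 2^-1]) (fst @^-1` [set s : R | 2^-1 <= s])).
  + by apply: preimage_closed; [move=> q _; exact: cvg_fst|exact: closed_le].
  + by apply: preimage_closed; [move=> q _; exact: cvg_fst|exact: closed_ge].
  + by move=> [s t] _ /=; case: (lerP s 2^-1) => [|/ltW]; [left|right].
  + apply: (@within_eq _ _ _ (fun q : R * R => H (2 * q.1, q.2))); first by move=> [s t] [h s2]; rewrite G1.
    apply: (cw_comp cH) => [|[s t] [[/= s01 t01] s2]]; last by split=> //; exact: lo.
    by apply: cw_pair; wcont.
  + apply: (@within_eq _ _ _ (fun q : R * R => K (2 * q.1 - 1, q.2))).
      by move=> [s t] [[/= s01 t01] s2]; rewrite G2.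
    apply: (cw_comp cK) => [|[s t] [[/= s01 t01] s2]]; last by split=> //; exact: hi.
    by apply: cw_pair; wcont.
- move=> s t s01 t01; have [s2|/ltW s2] := lerP s 2^-1.
    by rewrite G1 //; apply: HA => //; exact: lo.
  by rewrite G2 //; apply: KA => //; exact: hi.
- move=> t t01; rewrite G1 ?invr_ge0 // G2 // ?invf_le1 ?ler1n // mulr0 mulr1.
  have -> : 2 - 1 = 1 :> R by lra.
  by have [-> _] := h01 t t01; have [_ ->] := k01 t t01.
- move=> s s01; have [s2|/ltW s2] := lerP s 2^-1.
    by rewrite !G1 //; exact: hst (lo s s01 s2).
  by rewrite !G2 ?in01_0 ?in01_1 // e0 e1; exact: kst (hi s s01 s2).
Qed.

Lemma path_concat1 a b t : t <= 2^-1 -> path_concat a b t = a (2 * t).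
Proof. by rewrite /path_concat => ->. Qed.

Lemma path_concat2 a b t : a 1 = b 0 -> 2^-1 <= t -> path_concat a b t = b (2 * t - 1).
Proof.
move=> ab; rewrite le_eqVlt => /predU1P[<-|t2]; last by rewrite /path_concat leNgt t2.
by rewrite path_concat1 // mulfV // subrr.
Qed.

Lemma path_concat_ends a b : a 1 = b 0 ->
  path_concat a b 0 = a 0 /\ path_concat a b 1 = b 1.
Proof.
move=> ab; rewrite path_concat1 ?invr_ge0 // path_concat2 ?invf_le1 ?ler1n // mulr0 mulr1.
by have -> : 2 - 1 = 1 :> R by lra.
Qed.

Lemma ppath_concat A a b : ppath A a -> ppath A b -> a 1 = b 0 -> ppath A (path_concat a b).
Proof.
move=> [ca aA] [cb bA] ab; split; last first.
  move=> t t01; have [t2|/ltW t2] := lerP t 2^-1.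
    by rewrite path_concat1 //; apply/aA/half_lo.
  by rewrite path_concat2 //; apply/bA/half_hi.
apply: (@within_closed_glue _ _ _ [set s : R | s <= 2^-1] [set s : R | 2^-1 <= s]).
- exact: closed_le.
- exact: closed_ge.
- by move=> s _ /=; case: (lerP s 2^-1) => [|/ltW]; [left|right].
- apply: (@within_eq _ _ _ (fun t : R => a (2 * t))); first by move=> t [h t2]; rewrite path_concat1.
  by apply: (cw_comp ca) => [|t [/= t01 t2]]; [apply: cw_mul; [exact: cw_cst|exact: cw_id]|exact: half_lo].
- apply: (@within_eq _ _ _ (fun t : R => b (2 * t - 1))); first by move=> t [h t2]; rewrite path_concat2.
  by apply: (cw_comp cb) => [|t [/= t01 t2]]; [apply: cw_add; [apply: cw_mul; [exact: cw_cst|exact: cw_id]|exact: cw_cst]|exact: half_hi].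
Qed.

Lemma phom_concat A a a' b b' : phom A a a' -> phom A b b' -> a 1 = b 0 ->
  phom A (path_concat a b) (path_concat a' b').
Proof.
move=> h1 h2 ab; have [ea0 ea1] := phom_ends h1; have [eb0 eb1] := phom_ends h2.
case: h1 => [[H [cH HA h01 hst]] pa pa']; case: h2 => [[K [cK KA k01 kst]] pb pb'].
have ab' : a' 1 = b' 0 by rewrite -ea1 -eb0.
pose G (q : R * R) := if q.2 <= 2^-1 then H (q.1, 2 * q.2) else K (q.1, 2 * q.2 - 1).
have G1 s t : t <= 2^-1 -> G (s, t) = H (s, 2 * t) by rewrite /G /= => ->.
have G2 s t : s \in `[0, 1] -> 2^-1 <= t -> G (s, t) = K (s, 2 * t - 1).
  move=> s01; rewrite le_eqVlt => /predU1P[<-|t2]; last by rewrite /G /= leNgt t2.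
  rewrite G1 // mulfV // subrr; have [_ ->] := hst s s01; by have [-> _] := kst s s01.
split; [|exact: ppath_concat|exact: ppath_concat]; exists G; split.
- apply: (@within_closed_glue _ _ _ (snd @^-1` [set s : R | s <= 2^-1]) (snd @^-1` [set s : R | 2^-1 <= s])).
  + by apply: preimage_closed; [move=> q _; exact: cvg_snd|exact: closed_le].
  + by apply: preimage_closed; [move=> q _; exact: cvg_snd|exact: closed_ge].
  + by move=> [s t] _ /=; case: (lerP t 2^-1) => [|/ltW]; [left|right].
  + apply: (@within_eq _ _ _ (fun q : R * R => H (q.1, 2 * q.2))); first by move=> [s t] [h s2]; rewrite G1.
    apply: (cw_comp cH) => [|[s t] [[/= s01 t01] t2]]; last by split=> //; exact: half_lo.
    by apply: cw_pair; wcont.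
  + apply: (@within_eq _ _ _ (fun q : R * R => K (q.1, 2 * q.2 - 1))).
      by move=> [s t] [[/= s01 t01] s2]; rewrite G2.
    apply: (cw_comp cK) => [|[s t] [[/= s01 t01] t2]]; last by split=> //; exact: half_hi.
    by apply: cw_pair; wcont.
- move=> s t s01 t01; have [t2|/ltW t2] := lerP t 2^-1.
    by rewrite G1 //; apply: HA => //; exact: half_lo.
  by rewrite G2 //; apply: KA => //; exact: half_hi.
- move=> t t01; have [t2|/ltW t2] := lerP t 2^-1.
    by rewrite !G1 // !path_concat1 //; exact: h01 (half_lo t01 t2).
  by rewrite !G2 ?in01_0 ?in01_1 // !path_concat2 //; exact: k01 (half_hi t01 t2).
- move=> s s01; have [-> ->] := path_concat_ends ab.
  rewrite G1 ?invr_ge0 // G2 ?invf_le1 ?ler1n // mulr0 mulr1.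
  have -> : 2 - 1 = 1 :> R by lra.
  by have [-> _] := hst s s01; have [_ ->] := kst s s01.
Qed.

Definition convexV n (S : set 'rV[R]_n) := forall s x y, 0 <= s <= 1 -> S x -> S y ->
  S ((1 - s) *: x + s *: y).

(** A straight-line homotopy in the convex set S. The laws of path composition below all come from
    comparing two parametrizations of one map. *)
Lemma reparam n (S : set 'rV[R]_n) (w : 'rV[R]_n -> X) (f g : R -> 'rV[R]_n) A :
  convexV S -> {within S, continuous w} -> (forall x, S x -> A (w x)) ->
  {within `[0, 1], continuous f} -> {within `[0, 1], continuous g} ->
  (forall t, t \in `[0, 1] -> S (f t)) -> (forall t, t \in `[0, 1] -> S (g t)) ->
  f 0 = g 0 -> f 1 = g 1 -> phom A (w \o f) (w \o g).
Proof.
move=> cS cw wA cf cg fS gS f0 f1.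
split; last first.
- by split=> [|t t01]; [exact: (cw_comp cw)|exact/wA/gS].
- by split=> [|t t01]; [exact: (cw_comp cw)|exact/wA/fS].
exists (fun q => w ((1 - q.1) *: f q.2 + q.1 *: g q.2)); split.
- apply: (cw_comp cw) => [|[s t] [/= s01 t01]]; last first.
    by apply: cS; [exact: in01E|exact: fS|exact: gS].
  have cfs : {within `[0, 1] `*` `[0, 1], continuous (fun q : R * R => f q.2)}.
    by apply: (cw_comp cf) => [|[s t] []//]; wcont.
  have cgs : {within `[0, 1] `*` `[0, 1], continuous (fun q : R * R => g q.2)}.
    by apply: (cw_comp cg) => [|[s t] []//]; wcont.
  by apply/withinP => q Aq; apply: cvgD; apply: cvgZ;
    [have /withinP h : {within `[0, 1] `*` `[0, 1], continuous (fun q : R * R => 1 - q.1)} by wcont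
    |move/withinP: cfs|have /withinP h : {within `[0, 1] `*` `[0, 1], continuous (fun q : R * R => q.1)} by wcont
    |move/withinP: cgs]; auto.
- by move=> s t s01 t01; apply: wA; apply: cS; [exact: in01E|exact: fS|exact: gS].
- by move=> t t01; rewrite subr0 subrr !scale1r !scale0r addr0 add0r.
- move=> s s01; rewrite -f0 -f1 -!scalerDl subrK !scale1r; by [].
Qed.

End PathTools.

Section PathAlgebra.
Variables (R : realType) (X : topologicalType) (A : set X).
Implicit Types (a b c : R -> X).

Lemma reparam_itv (M : R) (w : R -> X) (f g : R -> R) :
  {within `[0, M], continuous w} -> (forall t, t \in `[0, M] -> A (w t)) ->
  {within `[0, 1], continuous f} -> {within `[0, 1], continuous g} ->
  (forall t, t \in `[0, 1] -> f t \in `[0, M]) -> (forall t, t \in `[0, 1] -> g t \in `[0, M]) ->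
  f 0 = g 0 -> f 1 = g 1 -> phom A (w \o f) (w \o g).
Proof.
move=> cw wA cf cg fM gM f0 f1.
pose S := [set v : 'rV[R]_1 | v 0 0 \in `[0, M]].
pose W (v : 'rV[R]_1) := w (v 0 0); pose e (h : R -> R) t : 'rV[R]_1 := const_mx (h t).
have -> : w \o f = W \o e f by apply/funext => t; rewrite /W /= mxE.
have -> : w \o g = W \o e g by apply/funext => t; rewrite /W /= mxE.
have ce (h : R -> R) : {within `[0, 1], continuous h} -> {within `[0, 1], continuous (e h)}.
  move=> ch; apply: within_rV => j.
  by apply: (within_eq _ ch) => t _; rewrite mxE.
apply: (@reparam _ _ _ S).
- move=> s x y /andP[s0 s1]; rewrite /S /= !in_itv /= !mxE => /andP[x0 x1] /andP[y0 y1].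
  apply/andP; split; first by rewrite addr_ge0 // mulr_ge0 // subr_ge0.
  have h1 : (1 - s) * x 0 0 <= (1 - s) * M by rewrite ler_wpM2l // subr_ge0.
  have h2 : s * y 0 0 <= s * M by rewrite ler_wpM2l.
  by apply: le_trans (lerD h1 h2) _; rewrite -mulrDl subrK mul1r.
- by apply: (cw_comp cw) => //; apply: cw_coord; exact: cw_id.
- by move=> v Sv; exact: wA.
- exact: ce.
- exact: ce.
- by move=> t t01; rewrite /S /= mxE; exact: fM.
- by move=> t t01; rewrite /S /= mxE; exact: gM.
- by rewrite /e f0.
- by rewrite /e f1.
Qed.

Lemma cw_idR (S : set R) : {within S, continuous (fun t : R => t)}.
Proof. exact: cw_id. Qed.

Lemma glue_paths (M K : R) a b : 0 <= M -> 0 <= K ->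
  {within `[0, M], continuous a} -> {within `[0, K], continuous b} -> a M = b 0 ->
  {within `[0, M + K], continuous (fun t => if t <= M then a t else b (t - M))}.
Proof.
move=> M0 K0 ca cb ab.
apply: (@within_closed_glue _ _ _ [set s : R | s <= M] [set s : R | M <= s]).
- exact: closed_le.
- exact: closed_ge.
- by move=> s _ /=; case: (lerP s M) => [|/ltW]; [left|right].
- apply: (@within_eq _ _ _ a); first by move=> t [_ /= ->].
  by apply: continuous_subspaceW ca => t [/=]; rewrite !in_itv /= => /andP[-> _].
- apply: (@within_eq _ _ _ (fun t : R => b (t - M))).
    move=> t [h Mt]; case: (lerP t M) => // tM.
    have -> : t = M by apply/eqP; rewrite eq_le tM; exact: Mt.
    by rewrite subrr.
  apply: (cw_comp cb) => [|t [/=]].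
    by apply: cw_add; [exact: cw_idR|exact: cw_cst].
  by rewrite !in_itv /= => /andP[t0 t1] Mt; rewrite subr_ge0 Mt lerBlDl.
Qed.

Definition rev a : R -> X := fun t => a (1 - t).

Lemma rev_ends a : rev a 0 = a 1 /\ rev a 1 = a 0.
Proof. by rewrite /rev subr0 subrr. Qed.

Lemma ppath_rev a : ppath A a -> ppath A (rev a).
Proof.
move=> [ca aA]; split=> [|t t01]; last by apply: aA; exact: itv01_opp.
apply: (cw_comp ca) => [|t t01]; last exact: itv01_opp.
by apply: cw_add; [exact: cw_cst|apply: cw_opp; exact: cw_idR].
Qed.

Lemma ppath_cst x : A x -> ppath A (fun _ : R => x).
Proof. by move=> Ax; split=> //; exact: cw_cst. Qed.

(** The parametrizations of the two halves of a concatenation, continued by constants, so that each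
    is continuous on all of [0, 1]. *)
Definition lin_lo (t : R) := Num.min 1 (2 * t).
Definition lin_hi (t : R) := Num.max 0 (2 * t - 1).

Lemma lin_loE t : t <= 2^-1 -> lin_lo t = 2 * t.
Proof. by move=> t2; rewrite /lin_lo min_r //; lra. Qed.
Lemma lin_loE' t : 2^-1 <= t -> lin_lo t = 1.
Proof. by move=> t2; rewrite /lin_lo min_l //; lra. Qed.
Lemma lin_hiE t : t <= 2^-1 -> lin_hi t = 0.
Proof. by move=> t2; rewrite /lin_hi max_l //; lra. Qed.
Lemma lin_hiE' t : 2^-1 <= t -> lin_hi t = 2 * t - 1.
Proof. by move=> t2; rewrite /lin_hi max_r //; lra. Qed.

Lemma cw_lin_lo S : {within S, continuous lin_lo}.
Proof.
by apply: cw_min; [exact: cw_cst|apply: cw_mul; [exact: cw_cst|exact: cw_idR]].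
Qed.

Lemma cw_lin_hi S : {within S, continuous lin_hi}.
Proof.
apply: cw_max; [exact: cw_cst|apply: cw_add; last exact: cw_cst].
by apply: cw_mul; [exact: cw_cst|exact: cw_idR].
Qed.

Lemma lin_lo01 t : t \in `[0, 1] -> lin_lo t \in `[0, 1].
Proof.
rewrite !in_itv /= => /andP[t0 t1]; rewrite /lin_lo le_min ler01 ge_min lexx /= andbT.
by lra.
Qed.

Lemma lin_hi01 t : t \in `[0, 1] -> lin_hi t \in `[0, 1].
Proof.
rewrite !in_itv /= => /andP[t0 t1]; rewrite /lin_hi le_max lexx /= ge_max ler01 /=.
by lra.
Qed.

Lemma lin_ends : [/\ lin_lo 0 = 0, lin_lo 1 = 1, lin_hi 0 = 0 & lin_hi 1 = 1].
Proof.
split; [rewrite lin_loE|rewrite lin_loE'|rewrite lin_hiE|rewrite lin_hiE']; lra.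
Qed.

Lemma concat_lin a b t : a 1 = b 0 ->
  path_concat a b t = if t <= 2^-1 then a (lin_lo t) else b (lin_hi t).
Proof.
move=> ab; rewrite /path_concat; case: ifP => t2; first by rewrite lin_loE.
by rewrite lin_hiE' // ltW // ltNge t2.
Qed.

Lemma phom_reparam a (f g : R -> R) : ppath A a ->
  {within `[0, 1], continuous f} -> {within `[0, 1], continuous g} ->
  (forall t, t \in `[0, 1] -> f t \in `[0, 1]) -> (forall t, t \in `[0, 1] -> g t \in `[0, 1]) ->
  f 0 = g 0 -> f 1 = g 1 -> phom A (a \o f) (a \o g).
Proof. by move=> [ca aA]; exact: reparam_itv. Qed.

Lemma concat_idl a x : ppath A a -> a 0 = x -> phom A (path_concat (fun=> x) a) a.
Proof.
move=> pa a0; have [_ _ h0 h1] := lin_ends.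
have h : phom A (a \o lin_hi) (a \o id).
  apply: phom_reparam => //; [exact: cw_lin_hi|exact: cw_idR|exact: lin_hi01].
apply: (phom_trans _ h); apply: phom_sym; apply: phom_eq; first by case: h.
move=> t t01; rewrite concat_lin //=; case: ifP => // t2.
by rewrite lin_hiE.
Qed.

Lemma concat_idr a y : ppath A a -> a 1 = y -> phom A (path_concat a (fun=> y)) a.
Proof.
move=> pa a1; have [h0 h1 _ _] := lin_ends.
have h : phom A (a \o lin_lo) (a \o id).
  apply: phom_reparam => //; [exact: cw_lin_lo|exact: cw_idR|exact: lin_lo01].
apply: (phom_trans _ h); apply: phom_sym; apply: phom_eq; first by case: h.
move=> t t01; rewrite concat_lin //=; case: ifP => // /negbT; rewrite -ltNge => /ltW t2.
by rewrite lin_loE'.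
Qed.

Lemma concat_rev a : ppath A a -> phom A (path_concat a (rev a)) (fun=> a 0).
Proof.
move=> pa; have [h0 h1 h2 h3] := lin_ends.
have h : phom A (a \o (fun t => lin_lo t - lin_hi t)) (a \o (fun=> 0)).
  apply: phom_reparam => //.
  - by apply: cw_add; [exact: cw_lin_lo|apply: cw_opp; exact: cw_lin_hi].
  - exact: cw_cst.
  - move=> t; rewrite !in_itv /= => /andP[t0 t1]; have [t2|/ltW t2] := lerP t 2^-1.
      by rewrite lin_loE // lin_hiE //; apply/andP; split; lra.
    by rewrite lin_loE' // lin_hiE' //; apply/andP; split; lra.
  - by move=> t _; exact: in01_0.
  - by rewrite h0 h2 subrr.
  - by rewrite h1 h3 subrr.
apply: (phom_trans _ h); apply: phom_sym; apply: phom_eq; first by case: h.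
move=> t t01; rewrite concat_lin /rev ?subr0 //=; case: ifP => [t2|/negbT].
  by rewrite lin_hiE // subr0.
by rewrite -ltNge => /ltW t2; rewrite (lin_loE' t2).
Qed.

Lemma concat_assoc a b c : ppath A a -> ppath A b -> ppath A c -> a 1 = b 0 -> b 1 = c 0 ->
  phom A (path_concat (path_concat a b) c) (path_concat a (path_concat b c)).
Proof.
move=> [ca aA] [cb bA] [cc cA] ab bc.
pose w t := if t <= 2 then (if t <= 1 then a t else b (t - 1)) else c (t - 2).
have c2 : {within `[0, 1 + 1], continuous (fun t => if t <= 1 then a t else b (t - 1))}.
  exact: glue_paths.
have cw : {within `[0, 1 + 1 + 1], continuous w}.
  have -> : w = fun t => if t <= 1 + 1 then (if t <= 1 then a t else b (t - 1)) else c (t - (1 + 1)).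
    by apply/funext => t; rewrite /w; have -> : 1 + 1 = 2 :> R by lra.
  have h2 : 0 <= 1 + 1 :> R by rewrite addr_ge0.
  have := @glue_paths (1 + 1) 1 (fun t => if t <= 1 then a t else b (t - 1)) c h2 ler01 c2 cc.
  by apply; rewrite leNgt ltrDl ltr01 /= addrK.
have no (P : Prop) : (0 : R) < 0 -> P by rewrite ltxx.
have e3 : 1 + 1 + 1 = 3 :> R by lra.
rewrite e3 in cw.
have wA t : t \in `[0, 3] -> A (w t).
  rewrite in_itv /= /w => /andP[t0 t3]; case: (lerP t 2) => t2; last first.
    by apply: cA; rewrite in_itv /=; apply/andP; split; lra.
  case: (lerP t 1) => t1; first by apply: aA; rewrite in_itv /= t0.
  by apply: bA; rewrite in_itv /=; apply/andP; split; lra.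
(* The three paths run one after another along w on [0, 3]; f and g are the speeds that correspond
   to the two bracketings. *)
pose f t : R := Num.min (4 * t) (2 * t + 1); pose g t : R := Num.max (2 * t) (4 * t - 1).
have mulc (k : R) S : {within S, continuous (fun t : R => k * t)}.
  by apply: cw_mul; [exact: cw_cst|exact: cw_idR].
have hfg : phom A (w \o f) (w \o g).
  apply: (reparam_itv cw wA).
  - by apply: cw_min => //; apply: cw_add => //; exact: cw_cst.
  - by apply: cw_max => //; apply: cw_add => //; exact: cw_cst.
  - move=> t; rewrite !in_itv /= => /andP[t0 t1]; rewrite /f le_min ge_min.
    by apply/andP; split; [apply/andP; split; lra|apply/orP; right; lra].
  - move=> t; rewrite !in_itv /= => /andP[t0 t1]; rewrite /g le_max ge_max.
    by apply/andP; split; [apply/orP; left; lra|apply/andP; split; lra].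
  - by rewrite /f /g !mulr0 add0r sub0r min_l ?max_l //; lra.
  - by rewrite /f /g !mulr1 min_r ?max_r //; lra.
have [_ pf pg] := hfg.
apply: phom_trans (phom_trans _ hfg) _; last first.
- apply: phom_eq => // t; rewrite in_itv /= => /andP[t0 t1].
  rewrite /path_concat /w /g; case: (lerP t 2^-1) => t2.
    rewrite max_l; last by lra.
    by rewrite !ifT //; lra.
  rewrite max_r; last by lra.
  case: (lerP (2 * t - 1) 2^-1) => t3.
    have -> : 2 * (2 * t - 1) = 4 * t - 1 - 1 by lra.
    case: (lerP (4 * t - 1) 2) => t4; last by apply: no; lra.
    by case: (lerP (4 * t - 1) 1) => t5 //; apply: no; lra.
  have -> : 2 * (2 * t - 1) - 1 = 4 * t - 1 - 2 by lra.
  by case: (lerP (4 * t - 1) 2) => t4 //; apply: no; lra.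
- apply: phom_sym; apply: phom_eq => // t; rewrite in_itv /= => /andP[t0 t1].
  rewrite /path_concat /w /f; case: (lerP t 2^-1) => t2.
    rewrite min_l; last by lra.
    case: (lerP (2 * t) 2^-1) => t3.
      have -> : 2 * (2 * t) = 4 * t by lra.
      by rewrite !ifT //; lra.
    have -> : 2 * (2 * t) - 1 = 4 * t - 1 by lra.
    case: (lerP (4 * t) 2) => t4; last by apply: no; lra.
    by case: (lerP (4 * t) 1) => t5 //; apply: no; lra.
  rewrite min_r; last by lra.
  case: (lerP (2 * t + 1) 2) => t4; first by apply: no; lra.
  by congr c; lra.
Qed.

(** A homotopy class is a set of paths, and composition is defined for arbitrary sets. It is then
    associative without side conditions, and also multiplies cosets of a subgroup. *)
Definition cls a : set (R -> X) := [set c | phom A a c].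
Definition cmp (P Q : set (R -> X)) : set (R -> X) := [set c | exists a b,
  [/\ P a, Q b, ppath A a /\ ppath A b, a 1 = b 0 & phom A (path_concat a b) c]].

Lemma cls_refl a : ppath A a -> cls a a.
Proof. exact: phom_refl. Qed.

Lemma cls_eq a b : phom A a b -> cls a = cls b.
Proof.
move=> ab; apply/seteqP; split=> c; first exact: phom_trans (phom_sym ab).
exact: phom_trans ab.
Qed.

Lemma cls_inj a b : ppath A b -> cls a = cls b -> phom A a b.
Proof. by move=> pb e; have := cls_refl pb; rewrite -e. Qed.

Lemma cmp_cls a b : ppath A a -> ppath A b -> a 1 = b 0 ->
  cmp (cls a) (cls b) = cls (path_concat a b).
Proof.
move=> pa pb ab; apply/seteqP; split=> c.
  move=> [a' [b' [ha hb _ ab' h]]]; apply: phom_trans h; exact: phom_concat.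
by move=> h; exists a, b; split=> //; exact: cls_refl.
Qed.

Lemma cmpA P Q S : cmp (cmp P Q) S = cmp P (cmp Q S).
Proof.
apply/seteqP; split=> c.
  move=> [u [k [[a [b [Pa Qb [pa pb] ab hu]]] Sk [pu pk] uk hc]]].
  have [_ u1] := phom_ends hu; have [c0 c1] := path_concat_ends ab.
  have bk : b 1 = k 0 by rewrite -c1 u1.
  have [d0 d1] := path_concat_ends bk; have pbk := ppath_concat pb pk bk.
  exists a, (path_concat b k); split=> //; [|by rewrite d0|].
    by exists b, k; split=> //; exact: phom_refl.
  apply: phom_trans _ hc; apply: phom_trans (phom_sym (concat_assoc pa pb pk ab bk)) _.
  by apply: phom_concat => //; [exact: phom_refl|rewrite c1].
move=> [a [v [Pa [b [k [Qb Sk [pb pk] bk hv]]] [pa pv] av hc]]].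
have [v0 _] := phom_ends hv; have [c0 c1] := path_concat_ends bk.
have ab : a 1 = b 0 by rewrite -c0 v0.
have [d0 d1] := path_concat_ends ab; have pab := ppath_concat pa pb ab.
exists (path_concat a b), k; split=> //; [|by rewrite d1|].
  by exists a, b; split=> //; exact: phom_refl.
apply: phom_trans _ hc; apply: phom_trans (concat_assoc pa pb pk ab bk) _.
by apply: phom_concat => //; [exact: phom_refl|rewrite c0].
Qed.

Lemma cls_idl a x : ppath A a -> a 0 = x -> cmp (cls (fun=> x)) (cls a) = cls a.
Proof.
move=> pa ax; rewrite cmp_cls //.
  by apply: cls_eq; exact: concat_idl.
by apply: ppath_cst; rewrite -ax; case: pa => _; apply; exact: in01_0.
Qed.

Lemma cls_idr a x : ppath A a -> a 1 = x -> cmp (cls a) (cls (fun=> x)) = cls a.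
Proof.
move=> pa ax; rewrite cmp_cls //.
  by apply: cls_eq; exact: concat_idr.
by apply: ppath_cst; rewrite -ax; case: pa => _; apply; exact: in01_1.
Qed.

Lemma cls_revr a x : ppath A a -> a 0 = x -> cmp (cls a) (cls (rev a)) = cls (fun=> x).
Proof.
move=> pa <-; rewrite cmp_cls //; [|exact: ppath_rev|by case: (rev_ends a)].
by apply: cls_eq; exact: concat_rev.
Qed.

Lemma revK a : rev (rev a) = a.
Proof. by apply/funext => t; rewrite /rev subKr. Qed.

Lemma cls_revl a x : ppath A a -> a 1 = x -> cmp (cls (rev a)) (cls a) = cls (fun=> x).
Proof.
move=> pa ax; rewrite -{2}[a]revK; apply: cls_revr; first exact: ppath_rev.
by case: (rev_ends a) => ->.
Qed.

Definition subpath a (u v : R) : R -> X := fun t => a (u + t * (v - u)).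

Lemma subpath_ends a u v : subpath a u v 0 = a u /\ subpath a u v 1 = a v.
Proof. by rewrite /subpath mul0r mul1r addr0 addrC subrK. Qed.

Lemma in01_mix (u v t : R) : u \in `[0, 1] -> v \in `[0, 1] -> t \in `[0, 1] ->
  u + t * (v - u) \in `[0, 1].
Proof.
rewrite !in_itv /= => /andP[u0 u1] /andP[v0 v1] /andP[t0 t1].
have -> : u + t * (v - u) = (1 - t) * u + t * v by ring.
have h0 : 0 <= 1 - t by rewrite subr_ge0.
apply/andP; split; first by rewrite addr_ge0 ?mulr_ge0.
have h1 : (1 - t) * u <= (1 - t) * 1 by rewrite ler_wpM2l.
have h2 : t * v <= t * 1 by rewrite ler_wpM2l.
by apply: le_trans (lerD h1 h2) _; rewrite !mulr1 subrK.
Qed.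

Lemma cw_mix (S : set R) (u v : R) (h : R -> R) : {within S, continuous h} ->
  {within S, continuous (fun t => u + h t * (v - u))}.
Proof.
by move=> ch; apply: cw_add; [exact: cw_cst|apply: cw_mul => //; exact: cw_cst].
Qed.

Lemma ppath_sub a u v : ppath A a -> u \in `[0, 1] -> v \in `[0, 1] -> ppath A (subpath a u v).
Proof.
move=> [ca aA] u01 v01; split=> [|t t01]; last by apply: aA; exact: in01_mix.
apply: (cw_comp ca) => [|t t01]; last exact: in01_mix.
by apply: cw_mix; exact: cw_idR.
Qed.

(** Both sides reparametrize a; the three times may come in any order. *)
Lemma cls_subpath a u v w : ppath A a -> u \in `[0, 1] -> v \in `[0, 1] -> w \in `[0, 1] ->
  cmp (cls (subpath a u v)) (cls (subpath a v w)) = cls (subpath a u w).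
Proof.
move=> pa u01 v01 w01; have [s0 s1] := subpath_ends a u v; have [r0 r1] := subpath_ends a v w.
have [l0 l1 h0 h1] := lin_ends.
rewrite cmp_cls ?s1 ?r0 //; try exact: ppath_sub.
apply: cls_eq.
pose f t := (u + lin_lo t * (v - u)) + (lin_hi t * (w - v)).
have fE t : path_concat (subpath a u v) (subpath a v w) t = a (f t).
  rewrite concat_lin ?s1 ?r0 // /subpath /f; case: ifP => [t2|/negbT].
    by rewrite lin_hiE // mul0r addr0.
  rewrite -ltNge => /ltW t2; rewrite (lin_loE' t2) mul1r addrCA subrr addr0.
  by congr a; ring.
rewrite (_ : path_concat _ _ = a \o f); last by apply/funext.
apply: (phom_reparam (f := f) (g := fun t => u + t * (w - u))) => //.
- apply: cw_add; first by apply: cw_mix; exact: cw_lin_lo.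
  by apply: cw_mul; [exact: cw_lin_hi|exact: cw_cst].
- by apply: cw_mix; exact: cw_idR.
- move=> t t01; rewrite /f; have [t2|/ltW t2] := lerP t 2^-1.
    by rewrite (lin_hiE t2) mul0r addr0; apply: in01_mix => //; exact: lin_lo01.
  rewrite (lin_loE' t2) mul1r (_ : u + (v - u) = v); last by ring.
  by apply: in01_mix => //; exact: lin_hi01.
- by move=> t t01; exact: in01_mix.
- by rewrite /f l0 h0 !mul0r !addr0.
- by rewrite /f l1 h1 !mul1r; ring.
Qed.

Lemma subpath01 a : subpath a 0 1 = a.
Proof. by apply/funext => t; rewrite /subpath subr0 mulr1 add0r. Qed.

End PathAlgebra.

Section PathMaps.
Variables (R : realType) (X Y : topologicalType).

Lemma phom_map (A : set X) (B : set Y) (f : X -> Y) (a b : R -> X) : {within A, continuous f} ->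
  (forall x, A x -> B (f x)) -> phom A a b -> phom B (f \o a) (f \o b).
Proof.
move=> cf fAB [[H [cH HA h01 hst]] [ca aA] [cb bA]]; split.
- exists (f \o H); split.
  + by apply: (cw_comp cf) => // -[s t] [/= s01 t01]; exact: HA.
  + by move=> s t s01 t01; apply: fAB; exact: HA.
  + by move=> t t01; have [h0 h1] := h01 t t01; rewrite /= h0 h1.
  + by move=> s s01; have [h0 h1] := hst s s01; rewrite /= h0 h1.
- by split=> [|t t01]; [exact: (cw_comp cf ca)|exact/fAB/aA].
- by split=> [|t t01]; [exact: (cw_comp cf cb)|exact/fAB/bA].
Qed.

Lemma ppath_map (A : set X) (B : set Y) (f : X -> Y) (a : R -> X) : {within A, continuous f} ->
  (forall x, A x -> B (f x)) -> ppath A a -> ppath B (f \o a).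
Proof. by move=> cf fAB [ca aA]; split=> [|t t01]; [exact: (cw_comp cf)|exact/fAB/aA]. Qed.

Lemma ppathW (A A' : set X) (a : R -> X) : A `<=` A' -> ppath A a -> ppath A' a.
Proof. by move=> AA [ca aA]; split=> // t /aA/AA. Qed.

Lemma phomW (A A' : set X) (a b : R -> X) : A `<=` A' -> phom A a b -> phom A' a b.
Proof.
move=> AA [[H [cH HA h0 h1]] pa pb]; split; [|exact: ppathW pa|exact: ppathW pb].
by exists H; split=> // s t s01 t01; exact/AA/HA.
Qed.

Lemma map_concat (f : X -> Y) (a b : R -> X) :
  f \o path_concat a b = path_concat (f \o a) (f \o b).
Proof. by apply/funext => t; rewrite /= /path_concat; case: ifP. Qed.

End PathMaps.

(** * The Hurewicz map to a quotient of the fundamental group *)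

Section SimplexPaths.
Variables (R : realType) (X : topologicalType).
Local Notation D n := (std_simplex R n).

Definition row2 (t : R) : 'rV[R]_2 := \row_i (if i == ord0 then 1 - t else t).

Lemma row2_simplex t : t \in `[0, 1] -> D 1 (row2 t).
Proof.
rewrite in_itv /= => /andP[t0 t1]; split=> [i|]; last first.
  by rewrite !big_ord_recl big_ord0 !mxE addr0 subrK.
by rewrite mxE; case: ifP; rewrite ?subr_ge0.
Qed.

Lemma cw_row2 (S : set R) : {within S, continuous row2}.
Proof.
apply: within_rV => j; case: (j =P ord0) => [->|/eqP/negPf j0].
  apply: (@within_eq _ _ _ (fun t : R => 1 - t)); first by move=> t _; rewrite mxE eqxx.
  by apply: cw_add; [exact: cw_cst|apply: cw_opp; exact: cw_idR].
apply: (@within_eq _ _ _ (fun t : R => t)); last exact: cw_idR.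
by move=> t _; rewrite mxE j0.
Qed.

Definition simplex_path (s : D 1 -> X) : R -> X := fun t => s (ins (row2 t)).

Definition path_simplex (a : R -> X) : D 1 -> X := fun v => a ((\val v) 0 1).

Lemma simplex_row2 (v : D 1) : row2 ((\val v) 0 1) = \val v.
Proof.
have /set_mem[_ v1] := valP v; apply/rowP => j; rewrite mxE -v1 !big_ord_recl big_ord0 addr0.
have e1 : fintype.lift ord0 ord0 = 1 :> 'I_2 by exact/val_inj.
rewrite e1; case: (j =P ord0) => [->|j0]; first by rewrite addrK.
by congr (_ _ _); case: j j0 => -[|[|//]] p j0; apply/val_inj => //; case: j0; exact/val_inj.
Qed.

Lemma simplex_coord (v : D 1) : 0 <= (\val v) 0 1 <= 1.
Proof.
have /set_mem[v0 v1] := valP v; rewrite v0 /= -v1 !big_ord_recl big_ord0 addr0.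
by rewrite (_ : fintype.lift ord0 ord0 = 1) ?lerDr //; exact/val_inj.
Qed.

Lemma path_simplexK (s : D 1 -> X) : path_simplex (simplex_path s) = s.
Proof.
by apply/funext => v; rewrite /path_simplex /simplex_path simplex_row2 val_ins.
Qed.

Lemma simplex_pathK (a : R -> X) t : t \in `[0, 1] -> simplex_path (path_simplex a) t = a t.
Proof.
move=> t01; rewrite /simplex_path /path_simplex insK; last exact: row2_simplex.
by rewrite mxE.
Qed.

Lemma simplex_ppath (A : set X) (s : D 1 -> X) : continuous s -> (forall v, A (s v)) ->
  ppath A (simplex_path s).
Proof.
move=> cs sA; split=> [|t _]; last exact: sA.
apply: cw_compT cs _.
by apply: (cw_comp (@ins_within R 1)) => [|t t01]; [exact: cw_row2|exact: row2_simplex].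
Qed.

Lemma path_simplex_in (A : set X) (a : R -> X) : ppath A a ->
  (<< path_simplex a >> : chain R X 1) \in chain_in A.
Proof.
move=> [ca aA]; apply: chain_inU => [|v]; last by apply: aA; rewrite in_itv; exact: simplex_coord.
apply/cont_within; apply: (cw_comp ca) => [|v _]; last by rewrite /= in_itv; exact: simplex_coord.
by apply: cw_coord; exact/cont_within/set_val_continuous.
Qed.

Lemma bd_path_simplex (a : R -> X) :
  bd (<< path_simplex a >> : chain R X 1) = cst_simplex R 0 (a 1) - cst_simplex R 0 (a 0).
Proof.
rewrite bdU !big_ord_recl big_ord0 addr0 expr0 expr1 mulr1z mulrNz mulr1z.
have E i p : path_simplex a (@coface R 0 i p) = if i == ord0 then a 1 else a 0.
  have /set_mem[_] := valP p; rewrite big_ord1 => p1.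
  rewrite /path_simplex /= !mxE; case: unliftP => [k kE|iE].
    have -> : i = ord0.
      apply/eqP; apply: contraT => i0.
      have i1 : i = 1 by case: i {kE} i0 => -[|[|//]] q //= _; exact/val_inj.
      by move/eqP: kE; rewrite i1 (negPf (neq_lift _ _)).
    by rewrite eqxx ord1 p1.
  by rewrite -iE.
congr (<< _ >> - << _ >>); apply/funext => p; exact: E.
Qed.

Lemma coface_path (s : D 2 -> X) (i : 'I_3) (t : R) : t \in `[0, 1] ->
  simplex_path (s \o @coface R 1 i) t = (s \o @ins R 2) (row2 t *m dmx R 1 i).
Proof.
by move=> t01; rewrite /simplex_path /= coface_ins //; exact: row2_simplex.
Qed.

Lemma convex_simplexV n : convexV (D n).
Proof.
move=> t x y /andP[t0 t1] [x0 x1] [y0 y1]; split=> [i|].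
  by rewrite !mxE addr_ge0 // mulr_ge0 // subr_ge0.
under eq_bigr do rewrite mxE [X in X + _]mxE [X in _ + X]mxE.
by rewrite big_split /= -!mulr_sumr x1 y1 !mulr1 subrK.
Qed.

Lemma row2_0 : row2 0 = const_mx 1 *m dmx R 0 1.
Proof.
apply/rowP => j; rewrite !mxE big_ord1 !mxE /= mul1r subr0.
by case: j => -[|[|//]] p.
Qed.

Lemma row2_1 : row2 1 = const_mx 1 *m dmx R 0 0.
Proof.
apply/rowP => j; rewrite !mxE big_ord1 !mxE /= mul1r subrr.
by case: j => -[|[|//]] p.
Qed.

(** Both paths come from paths with the same ends in the standard triangle, which is convex: two
    edges against the third. *)
Lemma triangle_homotopy (A : set X) (s : D 2 -> X) : continuous s -> (forall v, A (s v)) ->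
  let e i := simplex_path (s \o @coface R 1 i) in
  [/\ ppath A (e 2%:R), ppath A (e 0), e 2%:R 1 = e 0 0 &
      phom A (path_concat (e 2%:R) (e 0)) (e 1)].
Proof.
move=> cs sA e; have i0 := in01_0 R; have i1 := in01_1 R.
pose W := s \o @ins R 2.
have pe i : ppath A (e i).
  apply: simplex_ppath => [|v]; last exact: sA.
  by move=> v; apply: continuous_comp; [exact: coface_continuous|exact: cs].
have eE i t : t \in `[0, 1] -> e i t = W (row2 t *m dmx R 1 i) by exact: coface_path.
have v2 : (2%:R : 'I_3) = 2%N :> nat by [].
have c21 : row2 1 *m dmx R 1 2 = row2 0 *m dmx R 1 0.
  by rewrite row2_0 row2_1 -!mulmxA; congr (_ *m _); exact: dmx_dmx.
have c20 : row2 0 *m dmx R 1 2 = row2 0 *m dmx R 1 1.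
  by rewrite row2_0 -!mulmxA; congr (_ *m _); exact: dmx_dmx.
have c01 : row2 1 *m dmx R 1 0 = row2 1 *m dmx R 1 1.
  by rewrite row2_1 -!mulmxA; congr (_ *m _); apply/esym; exact: dmx_dmx.
have e20 : e 2%:R 1 = e 0 0 by rewrite !eE // c21.
split=> //.
pose f t : 'rV[R]_3 := if t <= 2^-1 then row2 (2 * t) *m dmx R 1 2 else row2 (2 * t - 1) *m dmx R 1 0.
pose h t : 'rV[R]_3 := row2 t *m dmx R 1 1.
have ce (i : 'I_3) : ppath (D 2) (fun t => row2 t *m dmx R 1 i).
  split=> [|t t01]; first by apply: cw_mulmxr; exact: cw_row2.
  by apply: dmx_simplex; exact: row2_simplex.
have pf : ppath (D 2) f.
  exact: (ppath_concat (ce 2%:R) (ce 0) c21).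
have cW : {within D 2, continuous W} by apply: cw_compT cs _; exact: ins_within.
have WA v : A (W v) by exact: sA.
have [fc fD] := pf; have [hc hD] := ce 1.
have hfh : phom A (W \o f) (W \o h).
  apply: (reparam (@convex_simplexV 2) cW) => //.
  - by rewrite /f /h invr_ge0 ler0n mulr0 c20.
  - have [_ E] := @path_concat_ends _ _ (fun t => row2 t *m dmx R 1 2) (fun t => row2 t *m dmx R 1 0) c21.
    by rewrite /h -c01; exact: E.
have h1 : phom A (path_concat (e 2%:R) (e 0)) (W \o f).
  apply: phom_eq; first exact: ppath_concat.
  move=> t t01; rewrite /path_concat /f /=; case: ifP => t2.
    by rewrite eE //; exact: half_lo.
  by rewrite eE //; apply: half_hi => //; rewrite leNgt; apply/negP => /ltW; rewrite t2.
apply: phom_trans h1 (phom_trans hfh _).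
by apply: phom_sym; apply: phom_eq => // t t01; rewrite eE.
Qed.

End SimplexPaths.

Section Pi1Quotient.
Variables (R : realType) (X : topologicalType) (C D : set X) (b : X).
Variable g : X -> R -> X.
Hypotheses (DC : D `<=` C) (Db : D b).
Hypotheses (gC : forall x, C x -> path_in C (g x) b x)
  (gD : forall x, D x -> path_in D (g x) b x) (ab : abelian_pi1 R C).
Implicit Types (a c d : R -> X).
Local Notation cl := (cls C).
Local Notation "P ** Q" := (@cmp R X C P Q) (at level 40, left associativity).
Local Notation loop a := (path_in C a b b).

(** The image of pi_1(D, b) in pi_1(C, b), as the set of all loops whose class belongs to it. *)
Definition dloops : set (R -> X) := [set c | exists d, path_in D d b b /\ phom C d c].
Local Notation DD := dloops.

Lemma path_ppath a x y : path_in C a x y -> ppath C a.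
Proof. by case/path_inP. Qed.

Lemma dloop_loop d : path_in D d b b -> loop d.
Proof. exact: path_inW. Qed.

Lemma concat_in A a c x y z : path_in A a x y -> path_in A c y z ->
  path_in A (path_concat a c) x z.
Proof.
move=> /path_inP[pa a0 a1] /path_inP[pc c0 c1]; apply/path_inP.
have ac : a 1 = c 0 by rewrite a1 c0.
have [-> ->] := path_concat_ends ac.
by split=> //; exact: ppath_concat.
Qed.

Lemma rev_in A a x y : path_in A a x y -> path_in A (rev a) y x.
Proof.
move=> /path_inP[pa a0 a1]; apply/path_inP.
by have [-> ->] := rev_ends a; split=> //; exact: ppath_rev.
Qed.

Lemma cst_in (A : set X) x : A x -> path_in A (fun _ : R => x) x x.
Proof. by move=> Ax; apply/path_inP; split=> //; exact: ppath_cst. Qed.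

Lemma cmp_in a c x y z : path_in C a x y -> path_in C c y z ->
  cl a ** cl c = cl (path_concat a c).
Proof.
by move=> /path_inP[pa a0 a1] /path_inP[pc c0 c1]; rewrite cmp_cls // a1 c0.
Qed.

Lemma cls_comm a c : loop a -> loop c -> cl a ** cl c = cl c ** cl a.
Proof.
move=> la lc; rewrite (cmp_in la lc) (cmp_in lc la); apply: cls_eq.
have := ab la lc => h; split=> //.
  exact: path_ppath (concat_in la lc).
exact: path_ppath (concat_in lc la).
Qed.

Lemma cmp_dloops a c : loop a -> (cl a ** DD) c <->
  exists2 d, path_in D d b b & phom C (path_concat a d) c.
Proof.
move=> la; have /path_inP[pa a0 a1] := la; split.
  move=> [a' [d' [ha [d [ld hd]] _ ad h]]]; exists d => //.
  apply: phom_trans h; apply: phom_concat => //.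
  by have /path_inP[_ -> _] := ld.
move=> [d ld h]; have /path_inP[pd d0 d1] := dloop_loop ld.
exists a, d; split=> //; [exact: cls_refl| |by rewrite a1 d0].
by exists d; split=> //; exact: phom_refl.
Qed.

Lemma dloops_absorb d : path_in D d b b -> cl d ** DD = DD.
Proof.
move=> ld; have ldC := dloop_loop ld; have /path_inP[pd d0 d1] := ldC.
apply/seteqP; split=> c.
  move=> /(cmp_dloops _ ldC)[d' ld' h]; exists (path_concat d d'); split=> //.
  exact: concat_in ld ld'.
move=> [d' [ld' h]]; apply/(cmp_dloops _ ldC); exists (path_concat (rev d) d').
  exact: concat_in (rev_in ld) ld'.
apply: phom_trans h; have ldC' := dloop_loop ld'; have /path_inP[pd' d0' d1'] := ldC'.
have lrd := rev_in ldC.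
apply: cls_inj => //; rewrite -(cmp_in ldC (concat_in lrd ldC')) -(cmp_in lrd ldC') -cmpA.
by rewrite (cls_revr pd d0) cls_idl.
Qed.

Lemma dloops_cst : cl (fun _ : R => b) ** DD = DD.
Proof. by apply: dloops_absorb; exact: cst_in. Qed.

Lemma dloops_comm a : loop a -> DD ** cl a = cl a ** DD.
Proof.
move=> la; have /path_inP[pa a0 a1] := la; apply/seteqP; split=> c; last first.
  move=> /(cmp_dloops _ la)[d ld h]; have ldC := dloop_loop ld.
  exists d, a; split; [|exact: cls_refl| | |].
  - by exists d; split=> //; apply: phom_refl; exact: path_ppath ldC.
  - by split=> //; exact: path_ppath ldC.
  - by have /path_inP[_ _ ->] := ldC.
  - apply: phom_trans h; apply: cls_inj; first exact: path_ppath (concat_in la ldC).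
    by rewrite -(cmp_in la ldC) -(cmp_in ldC la) cls_comm.
move=> [d' [a' [[d [ld hd]] ha _ da h]]]; apply/(cmp_dloops _ la); exists d => //.
have ldC := dloop_loop ld.
apply: phom_trans h; apply: phom_trans (phom_concat hd ha _); last first.
  by have /path_inP[_ _ ->] := ldC.
apply: cls_inj; first exact: path_ppath (concat_in ldC la).
by rewrite -(cmp_in la ldC) -(cmp_in ldC la) cls_comm.
Qed.

Lemma dloopsM : DD ** DD = DD.
Proof.
apply/seteqP; split=> c.
  move=> [d1 [d2 [[e1 [l1 h1]] [e2 [l2 h2]] _ dd h]]]; exists (path_concat e1 e2).
  split; first exact: concat_in l1 l2.
  apply: phom_trans h; apply: phom_concat => //.
  by have /path_inP[_ _ ->] := l1; have /path_inP[_ -> _] := l2.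
rewrite -{1}dloops_cst => -[u [d [hu hd pp ud h]]]; exists u, d; split=> //.
by exists (fun _ : R => b); split=> //; exact: cst_in.
Qed.

Definition qcls a := cl a ** DD.

Lemma qclsM a c : loop a -> loop c -> qcls a ** qcls c = qcls (path_concat a c).
Proof.
move=> la lc; rewrite /qcls cmpA -[DD ** _]cmpA dloops_comm // [_ ** DD ** DD]cmpA dloopsM.
by rewrite -cmpA (cmp_in la lc).
Qed.

(** The quotient group is formed from the cosets themselves as sets of loops; its operation is the
    composition of sets. *)
Definition quot_pred : pred (set (R -> X)) :=
  fun P => `[< exists2 a, loop a & P = qcls a >].
Definition pi1quot := {P : set (R -> X) | quot_pred P}.
HB.instance Definition _ := Choice.on pi1quot.

Lemma quot_predP P : quot_pred P <-> exists2 a, loop a & P = qcls a.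
Proof. by split=> [/asboolP|h]; last exact/asboolP. Qed.

Lemma quot_add (x y : pi1quot) : quot_pred (val x ** val y).
Proof.
have /quot_predP[a la ->] := valP x; have /quot_predP[c lc ->] := valP y.
by apply/quot_predP; exists (path_concat a c); [exact: concat_in la lc|exact: qclsM].
Qed.

Lemma quot_zero : quot_pred DD.
Proof.
by apply/quot_predP; exists (fun _ : R => b); [apply: cst_in; exact: DC|rewrite /qcls dloops_cst].
Qed.

Lemma qcls_pred a : loop a -> quot_pred (qcls a).
Proof. by move=> la; apply/quot_predP; exists a. Qed.

Definition qadd (x y : pi1quot) : pi1quot := Sub _ (quot_add x y).
Definition qzero : pi1quot := Sub _ quot_zero.
Definition qrepr (x : pi1quot) : R -> X := projT1 (cid2 ((quot_predP _).1 (valP x))).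
Lemma qreprP (x : pi1quot) : loop (qrepr x) /\ val x = qcls (qrepr x).
Proof. by rewrite /qrepr; case: (cid2 _). Qed.
Definition qopp (x : pi1quot) : pi1quot := Sub _ (qcls_pred (rev_in (qreprP x).1)).

Lemma qaddA : associative qadd.
Proof. by move=> x y z; apply/val_inj; rewrite /= cmpA. Qed.

Lemma qaddC : commutative qadd.
Proof.
move=> x y; apply/val_inj => /=; have [la ->] := qreprP x; have [lc ->] := qreprP y.
by rewrite !qclsM // /qcls -(cmp_in la lc) -(cmp_in lc la) cls_comm.
Qed.

Lemma qadd0 : left_id qzero qadd.
Proof.
move=> x; apply/val_inj => /=; have [la ->] := qreprP x.
by rewrite /qcls -cmpA dloops_comm // cmpA dloopsM.
Qed.

Lemma qaddN : left_inverse qzero qopp qadd.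
Proof.
move=> x; apply/val_inj => /=; have [la ->] := qreprP x.
rewrite qclsM //; last exact: rev_in.
rewrite /qcls -(cmp_in (rev_in la) la); have /path_inP[pa a0 a1] := la.
by rewrite (cls_revl pa a1) dloops_cst.
Qed.

HB.instance Definition _ := GRing.isZmodule.Build pi1quot qaddA qaddC qadd0 qaddN.

(** The chosen paths g turn any path into a loop at b. Those that end in D run inside D, so that
    paths of D close up to loops of D and have class zero. *)
Definition closeup a := path_concat (path_concat (g (a 0)) a) (rev (g (a 1))).

Lemma closeup_loop a : ppath C a -> loop (closeup a).
Proof.
move=> pa; have [_ aC] := pa.
have h0 := gC (aC 0 (in01_0 R)); have h1 := gC (aC 1 (in01_1 R)).
apply: concat_in (rev_in h1); apply: concat_in h0 _; exact/path_inP.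
Qed.

Definition pclass a : pi1quot := insubd qzero (qcls (closeup a)).

Lemma val_pclass a : ppath C a -> val (pclass a) = qcls (closeup a).
Proof. by move=> pa; rewrite /pclass insubdK //; exact/qcls_pred/closeup_loop. Qed.

Lemma closeup_cls a : ppath C a ->
  cl (closeup a) = cl (g (a 0)) ** (cl a ** cl (rev (g (a 1)))).
Proof.
move=> pa; have [_ aC] := pa.
have h0 := gC (aC 0 (in01_0 R)); have h1 := gC (aC 1 (in01_1 R)).
have la : path_in C a (a 0) (a 1) by apply/path_inP.
by rewrite /closeup -(cmp_in (concat_in h0 la) (rev_in h1)) -(cmp_in h0 la) cmpA.
Qed.

(** The return path after a and the outgoing path before c are inverse to each other and cancel. *)
Lemma pclassD a c e : ppath C a -> ppath C c -> a 1 = c 0 -> phom C (path_concat a c) e ->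
  pclass e = pclass a + pclass c.
Proof.
move=> pa pc ac h; apply/val_inj; have [_ _ pe] := h.
have [e0 e1] := phom_ends h; have [c0 c1] := path_concat_ends ac.
have E : val (pclass a + pclass c) = val (pclass a) ** val (pclass c) by [].
rewrite E !val_pclass // qclsM; try exact: closeup_loop.
rewrite /qcls -(cmp_in (closeup_loop pa) (closeup_loop pc)) !closeup_cls //.
have [_ aC] := pa; have [_ cC] := pc.
have /path_inP[p1 g0 g1] := gC (aC 1 (in01_1 R)).
rewrite -e0 -e1 c0 c1 -(cls_eq h) -(cmp_cls pa pc ac); congr (_ ** _).
rewrite !cmpA -ac; congr (_ ** (_ ** _)).
by rewrite -[RHS]cmpA (cls_revl p1 g1) -[RHS]cmpA (cls_idl pc (esym ac)).
Qed.

Lemma pclass_D a : ppath D a -> pclass a = 0.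
Proof.
move=> pa; have [_ aD] := pa; have pC := ppathW DC pa.
apply/val_inj; rewrite val_pclass // /qcls; apply: dloops_absorb.
have h0 := gD (aD 0 (in01_0 R)); have h1 := gD (aD 1 (in01_1 R)).
apply: concat_in (rev_in h1); apply: concat_in h0 _; exact/path_inP.
Qed.

Lemma pclass_eq0 a : loop a -> pclass a = 0 -> exists d, path_in D d b b /\ phom C a d.
Proof.
move=> la; have /path_inP[pa a0 a1] := la.
have lg := gC (DC Db); have /path_inP[pg g0 g1] := lg.
move=> /(congr1 val); rewrite val_pclass //= => h.
have E : cl (closeup a) = cl a.
  rewrite closeup_cls // a0 a1 -cmpA cls_comm // cmpA (cls_revr pg g0).
  by rewrite cls_idr.
rewrite /qcls E in h; have : (cl a ** DD) a.
  apply/(cmp_dloops _ la); exists (fun _ : R => b); first exact: cst_in.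
  exact: concat_idr.
rewrite h => -[d [ld hd]]; exists d; split=> //; exact: phom_sym.
Qed.

Lemma chain_triangle (chi : {additive chain R X 1 -> pi1quot}) :
  (forall s : std_simplex R 1 -> X, chi << s >> = pclass (simplex_path s)) ->
  forall e : chain R X 2, e \in chain_in C -> chi (bd e) = 0.
Proof.
move=> chiU; apply: (fall_ind (Q := fun e : chain R X 2 => chi (bd e) = 0)) => [|e1 e2 h1 h2|s [cs sC]].
- by rewrite !raddf0.
- by rewrite 2!raddfB h1 h2 subr0.
have [p2 p0 e20 h] := triangle_homotopy cs sC.
rewrite bdU !big_ord_recl big_ord0 addr0 !expr0 !expr1 exprS expr1 mulrNN mulr1.
rewrite !mulr1z mulrNz mulr1z !raddfD raddfN /= !chiU.
have i1 : fintype.lift ord0 ord0 = 1 :> 'I_3 by exact/val_inj.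
have i2 : fintype.lift ord0 (fintype.lift ord0 ord0) = 2%:R :> 'I_3 by exact/val_inj.
have := pclassD p2 p0 e20 h; rewrite i1 i2 => ->.
by rewrite opprD [X in _ + X]addrAC addNr add0r subrr.
Qed.

Lemma pi1_functional_with : exists chi : {additive chain R X 1 -> pi1quot},
  [/\ forall e : chain R X 2, e \in chain_in C -> chi (bd e) = 0,
      forall c : chain R X 1, c \in chain_in D -> chi c = 0 &
      forall a : R -> X, path_in C a b b -> chi << path_simplex a >> = 0 ->
        exists d, path_in D d b b /\ phom C a d].
Proof.
pose f (s : std_simplex R 1 -> X) : pi1quot := pclass (simplex_path s).
exists (flift f); split.
- by apply: chain_triangle => s; rewrite /= fliftU.
- apply: (fall_ind (Q := fun c : chain R X 1 => flift f c = 0)) => [|c1 c2 h1 h2|s [cs sD]].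
  + exact: raddf0.
  + have -> : flift f (c1 - c2) = flift f c1 - flift f c2 by exact: (raddfB (flift f)).
    by rewrite h1 h2 subr0.
  + by rewrite fliftU; apply: pclass_D; exact: simplex_ppath.
- move=> a la; rewrite /= fliftU /f => h; apply: (pclass_eq0 la); rewrite -h.
  have /path_inP[pa a0 a1] := la; apply/val_inj.
have h1 : phom C a (simplex_path (path_simplex a)).
  by apply: phom_eq => // t t01; rewrite simplex_pathK.
have [_ _ pa'] := h1; have [e0 e1] := phom_ends h1.
by rewrite !val_pclass // /qcls !closeup_cls // -e0 -e1 (cls_eq h1).
Qed.

End Pi1Quotient.

(* [chi] is the composite of the Hurewicz map with pi_1(C) -> pi_1(C) / pi_1(D). *)
Lemma pi1_functional (R : realType) (X : topologicalType) (C D : set X) (b : X) :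
  D `<=` C -> D b -> abelian_pi1 R C ->
  (forall x, C x -> exists a : R -> X, path_in C a b x) ->
  (forall x, D x -> exists a : R -> X, path_in D a b x) ->
  exists (G : zmodType) (chi : {additive chain R X 1 -> G}),
  [/\ forall e : chain R X 2, e \in chain_in C -> chi (bd e) = 0,
      forall c : chain R X 1, c \in chain_in D -> chi c = 0 &
      forall a : R -> X, path_in C a b b -> chi << path_simplex a >> = 0 ->
        exists d, path_in D d b b /\ phom C a d].
Proof.
move=> DC Db ab pC pD.
have gex x : exists a : R -> X, (C x -> path_in C a b x) /\ (D x -> path_in D a b x).
  case: (pselect (D x)) => [Dx|nDx].
    by have [a ha] := pD _ Dx; exists a; split=> // _; exact: path_inW ha.
  case: (pselect (C x)) => [Cx|nCx]; last by exists (fun=> b).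
  by have [a ha] := pC _ Cx; exists a.
have [g gP] := choice gex.
have gC x : C x -> path_in C (g x) b x by have [] := gP x.
have gD x : D x -> path_in D (g x) b x by have [] := gP x.
have [chi h] := pi1_functional_with DC Db gC gD ab.
by eexists; exists chi.
Qed.

(** Local constancy makes both P and its negation open in A. *)
Lemma connected_local (T : topologicalType) (A : set T) (P : T -> Prop) x0 :
  connected A -> A x0 -> P x0 ->
  (forall x, A x -> exists2 U, open U /\ U x & forall y, A y -> U y -> P x <-> P y) ->
  forall x, A x -> P x.
Proof.
move=> cA Ax0 Px0 loc.
have h : A `&` P = A.
  apply: cA; first by exists x0.
  - exists (\bigcup_(U in [set U | open U /\ forall y, A y -> U y -> P y]) U).
      by apply: bigcup_open => U [].
    apply/seteqP; split=> x [Ax]; last by move=> [U [_ hU] Ux]; split=> //; exact: hU.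
    move=> Px; split=> //; have [U [oU Ux] hU] := loc x Ax.
    by exists U => //; split=> // y Ay Uy; apply/(hU y Ay Uy).
  - exists (~` \bigcup_(U in [set U | open U /\ forall y, A y -> U y -> ~ P y]) U).
      by apply: open_closedC; apply: bigcup_open => U [].
    apply/seteqP; split=> x [Ax]; first by move=> Px; split=> // -[U [_ hU] Ux]; exact: hU Ux Px.
    move=> nU; split=> //; apply: contrapT => nP; apply: nU.
    have [U [oU Ux] hU] := loc x Ax.
    by exists U => //; split=> // y Ay Uy; apply/(hU y Ay Uy).
by move=> x; rewrite -h => -[].
Qed.

(** * Cochains that vanish locally *)

Section Germs.
Variables (R : realType) (X : topologicalType) (C : set X) (G : zmodType).
Variable chi : {additive chain R X 1 -> G}.

(* On a good open set, [chi] is the coboundary of a 0-cochain. *)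
Definition good (O : set X) :=
  [/\ open O, (O `&` C) !=set0,
      forall p q, (O `&` C) p -> (O `&` C) q ->
        exists2 s : chain R X 1, s \in chain_in (O `&` C) &
          bd s = (cst_simplex R 0 q - cst_simplex R 0 p) &
      forall c : chain R X 1, c \in is_cycle (O `&` C) set0 -> chi c = 0].

Hypothesis chi_bd : forall e : chain R X 2, e \in chain_in C -> chi (bd e) = 0.
Hypothesis small_good : forall x W, open W -> W x -> exists2 O, good O & O x /\ O `<=` W.

Let joins O p q (s : chain R X 1) :=
  s \in chain_in (O `&` C) /\ bd s = cst_simplex R 0 q - cst_simplex R 0 p.

(** The integral of [chi] from p to q within O. It does not depend on the chain, because [chi]
    vanishes on the cycles of O off F; here C plays the role of that complement. *)
Definition val_between O p q : G := chi (xget 0 [set s | joins O p q s]).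
Local Notation v := val_between.

Lemma val_betweenE O p q s : good O -> (O `&` C) p -> (O `&` C) q -> joins O p q s ->
  v O p q = chi s.
Proof.
move=> [_ _ _ hO] Op Oq js; rewrite /v; case: xgetP => [s' _ [s'O bs']|/(_ s) []//].
have [sO bs] := js; have E : bd (s' - s) = bd s' - bd s by exact: (raddfB (@bd R X 1)).
apply/eqP; rewrite -subr_eq0 -raddfB; apply/eqP/hO.
by apply/is_cycleP; split; [exact: rpredB|rewrite E bs bs' subrr rpred0].
Qed.

Lemma val_betweenP O p q : good O -> (O `&` C) p -> (O `&` C) q ->
  exists2 s, joins O p q s & v O p q = chi s.
Proof.
move=> gO Op Oq; have [_ _ h _] := gO; have [s sO bs] := h p q Op Oq.
by exists s => //; exact: val_betweenE.
Qed.

Lemma val_betweenD O p q r : good O -> (O `&` C) p -> (O `&` C) q -> (O `&` C) r ->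
  v O p q + v O q r = v O p r.
Proof.
move=> gO Op Oq Or; have [s [sO bs] ->] := val_betweenP gO Op Oq.
have [s' [sO' bs'] ->] := val_betweenP gO Oq Or.
rewrite -raddfD; apply/esym; apply: val_betweenE => //; split; first exact: rpredD.
have -> : bd (s + s') = bd s + bd s' by exact: (raddfD (@bd R X 1)).
by rewrite bs bs' addrC subrKA.
Qed.

Lemma val_between_sub O O' p q : good O -> good O' -> O' `<=` O ->
  (O' `&` C) p -> (O' `&` C) q -> v O p q = v O' p q.
Proof.
move=> gO gO' OO Op Oq; have [s [sO bs] ->] := val_betweenP gO' Op Oq.
have h : O' `&` C `<=` O `&` C by move=> x [/OO].
by apply: val_betweenE => //; [exact: h|exact: h|split=> //; exact: chain_inW sO].
Qed.

Definition nbh x := xget setT [set O | good O /\ O x].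
Lemma nbhP x : good (nbh x) /\ nbh x x.
Proof.
rewrite /nbh; case: xgetP => [O _ //|h].
by have [O gO [Ox _]] := small_good openT (I : setT x); case: (h O).
Qed.

(** A reference point of C near x, equal to x itself if x is in C; it gives primitives a value also
    outside C. *)
Definition base x := if pselect (C x) then x else xget x (nbh x `&` C).
Lemma baseP x : (nbh x `&` C) (base x) /\ (C x -> base x = x).
Proof.
rewrite /base; case: pselect => [Cx|nCx]; first by split=> //; split=> //; have [] := nbhP x.
split=> //; case: xgetP => [y _ //|h].
by have [[_ [y hy] _ _] _] := nbhP x; case: (h y).
Qed.

Variable x0 : X.
Definition pt O := xget x0 (O `&` C).
Lemma ptP O : good O -> (O `&` C) (pt O).
Proof. by move=> [_ [y hy] _ _]; rewrite /pt; case: xgetP => [x _ //|/(_ y)]. Qed.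

Let inside O x O' := [/\ good O', O' x & O' `<=` O `&` nbh x].
Let step O x p := v O (pt O) p + v (nbh x) p (base x).

Lemma step_inside O x O' p q : good O -> inside O x O' -> (O' `&` C) p -> (O' `&` C) q ->
  step O x p = step O x q.
Proof.
move=> gO [gO' Ox sub] [Op Cp] [Oq Cq]; have [Op1 Op2] := sub _ Op; have [Oq1 Oq2] := sub _ Oq.
have [gN _] := nbhP x; have bO := ptP gO; have [bN _] := baseP x.
rewrite /step -(val_betweenD gO bO (_ : (O `&` C) p) (_ : (O `&` C) q)) //.
rewrite -(val_betweenD gN (_ : (nbh x `&` C) p) (_ : (nbh x `&` C) q) bN) // addrA.
congr (_ + _ + _); rewrite (val_between_sub gO gO') // => [|y /sub[] //].
by rewrite (val_between_sub gN gO') // => y /sub[].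
Qed.

(** The value at x of the primitive of [chi] on O that vanishes at [pt O]. As x may be outside C,
    one integrates in O up to a point of C close to x and from there, inside [nbh x], to the
    reference point [base x]. *)
Definition germ O x : G := step O x (xget x0 (xget setT (inside O x) `&` C)).

Lemma germE O x O' p : good O -> inside O x O' -> (O' `&` C) p -> germ O x = step O x p.
Proof.
move=> gO iO' O'p; rewrite /germ; have [gO' O'x sub'] := iO'.
have iO2 : inside O x (xget setT (inside O x)) by case: xgetP => [//|/(_ O')].
set O2 := xget _ _ in iO2 *; have [gO2 O2x sub2] := iO2.
have O2q : (O2 `&` C) (xget x0 (O2 `&` C)) by exact: ptP.
set q := xget _ _ in O2q *.
have [||O3 gO3 [O3x sub3]] := @small_good x (O' `&` O2).
- by apply: openI; [have [] := gO'|have [] := gO2].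
- by [].
have iO3 : inside O x O3 by split=> // y /sub3[/sub'].
have [O3r Cr] := ptP gO3; have [O'r O2r] := sub3 _ O3r.
by rewrite (step_inside gO iO2 O2q (_ : (O2 `&` C) (pt O3))) // (step_inside gO iO' O'p (_ : (O' `&` C) (pt O3))).
Qed.

Lemma inside_ex O x W : good O -> O x -> open W -> W x -> exists2 O', inside O x O' & O' `<=` W.
Proof.
move=> gO Ox oW Wx; have [gN Nx] := nbhP x.
have [||O' gO' [O'x sub]] := @small_good x (O `&` nbh x `&` W).
- by apply: openI => //; apply: openI; [have [] := gO|have [] := gN].
- by [].
by exists O' => [|y /sub[]]; first by split=> // y /sub[].
Qed.

Lemma germ_C O x : good O -> O x -> C x -> germ O x = v O (pt O) x.
Proof.
move=> gO Ox Cx; have [O' iO' _] := inside_ex gO Ox openT I.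
have [gO' O'x sub] := iO'; rewrite (germE gO iO' (_ : (O' `&` C) x)) // /step.
have [bN ->] := baseP x => //; have [gN Nx] := nbhP x.
have h := val_betweenD gN (_ : (nbh x `&` C) x) (_ : (nbh x `&` C) x) (_ : (nbh x `&` C) x).
by have /(canRL (addrK _)) -> := h (conj Nx Cx) (conj Nx Cx) (conj Nx Cx); rewrite subrr addr0.
Qed.

(** The second leg, towards [base x], is the same for both primitives and cancels in their
    difference. *)
Lemma germ_const O1 O2 O' p y : good O1 -> good O2 -> good O' -> O' `<=` O1 `&` O2 ->
  (O' `&` C) p -> O' y ->
  germ O1 y - germ O2 y = v O1 (pt O1) p - v O2 (pt O2) p.
Proof.
move=> g1 g2 g' sub [O'p Cp] O'y; have [O1y O2y] := sub _ O'y.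
have oO' : open O' by have [] := g'.
have [O3 iO3 sub3] := inside_ex g1 O1y oO' O'y.
have [g3 O3y s3] := iO3; have iO3' : inside O2 y O3.
  by split=> // z O3z; split; [have [] := sub _ (sub3 _ O3z)|have [] := s3 _ O3z].
have O3q := ptP g3; have [O'q Cq] := (sub3 _ O3q.1, O3q.2).
have [[O1p O2p] [O1q O2q]] := (sub _ O'p, sub _ O'q).
rewrite (germE g1 iO3 O3q) (germE g2 iO3' O3q) /step opprD addrACA subrr addr0.
rewrite -(val_betweenD g1 (ptP g1) (conj O1p Cp) (conj O1q Cq)).
rewrite -(val_betweenD g2 (ptP g2) (conj O2p Cp) (conj O2q Cq)).
have [s1 s2] : O' `<=` O1 /\ O' `<=` O2 by split=> z /sub[].
have [p' q'] : (O' `&` C) p /\ (O' `&` C) (pt O3) by [].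
rewrite (val_between_sub g1 g' s1 p' q') (val_between_sub g2 g' s2 p' q').
by rewrite opprD addrACA subrr addr0.
Qed.

(** The difference of the two primitives is locally constant along a, hence constant on the
    interval. *)
Lemma germ_diff O1 O2 (a : R -> X) : good O1 -> good O2 -> ppath (O1 `&` O2) a ->
  germ O1 (a 1) - germ O1 (a 0) = germ O2 (a 1) - germ O2 (a 0).
Proof.
move=> g1 g2 [ca aO]; pose d x := germ O1 x - germ O2 x.
suff h : forall t : R, `[0, 1]%classic t -> d (a t) = d (a 0).
  have /eqP := h 1 (in01_1 R); rewrite /d subr_eq => /eqP ->.
  by rewrite addrAC [germ O1 _ - _ + _]addrAC subrr add0r addrC.
apply: (@connected_local R _ (fun t => d (a t) = d (a 0)) 0) => //.
- exact: segment_connected.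
- exact: (in01_0 R).
move=> t t01; have [O1t O2t] := aO t t01.
have o12 : open (O1 `&` O2) by apply: openI; [have [] := g1|have [] := g2].
have [O' iO' sub'] := inside_ex g1 O1t o12 (conj O1t O2t).
have [gO' O't sO'] := iO'.
have oO' : open O' by have [] := gO'.
have [V oV VE] := open_within ca oO'.
have Vt : V t by have : (`[0, 1]%classic `&` a @^-1` O') t by []; rewrite VE => -[].
exists V => // y y01 Vy.
have O'y : O' (a y) by have : (`[0, 1]%classic `&` V) y by []; rewrite -VE => -[].
have E z : O' z -> d z = v O1 (pt O1) (pt O') - v O2 (pt O2) (pt O').
  exact: germ_const (ptP gO').
by rewrite (E _ O't) (E _ O'y).
Qed.

Let gsmall n := @small R X [set O | good O] n.

(** By [germ_diff] the choice of O does not matter, and for a small simplex the default [setT] is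
    not reached. *)
Definition chit1 (s : std_simplex R 1 -> X) : G :=
  let O := xget setT [set O | good O /\ forall t, O (s t)] in
  germ O (simplex_path s 1) - germ O (simplex_path s 0).

Lemma chit1E O s : continuous s -> good O -> (forall t, O (s t)) ->
  chit1 s = germ O (simplex_path s 1) - germ O (simplex_path s 0).
Proof.
move=> cs gO sO; rewrite /chit1; case: xgetP => [O' _ [gO' sO']|/(_ O) []//].
by apply: germ_diff => //; apply: simplex_ppath => // t; split.
Qed.

Lemma chit1_C s : gsmall s -> (forall t, C (s t)) -> chit1 s = chi << s >>.
Proof.
move=> [cs [O gO sO]] sC; rewrite (chit1E cs gO) //.
have [_ pO] := simplex_ppath cs sO; have [_ pC] := simplex_ppath cs sC.
have [h0 h1] := (conj (pO _ (in01_0 R)) (pC _ (in01_0 R)), conj (pO _ (in01_1 R)) (pC _ (in01_1 R))).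
rewrite !germ_C //; try tauto.
rewrite -(val_betweenD gO (ptP gO) h0 h1) addrAC subrr add0r.
apply: val_betweenE => //; split; first by apply: chain_inU.
by rewrite -[in LHS](path_simplexK s) bd_path_simplex.
Qed.

Definition chit : {additive chain R X 1 -> G} := flift chit1.

Lemma chit_bd (e : chain R X 2) : e \in fall (@gsmall 2) -> chit (bd e) = 0.
Proof.
apply: (fall_ind (Q := fun e : chain R X 2 => chit (bd e) = 0)) => [|e1 e2 h1 h2|s [cs [O gO sO]]].
- by rewrite !raddf0.
- by rewrite 2!raddfB h1 h2 subr0.
have [p2 p0 e20 h] := triangle_homotopy cs sO.
have [h0 h1] := phom_ends h; have [E0 E1] := path_concat_ends e20.
rewrite bdU !big_ord_recl big_ord0 addr0 !expr0 !expr1 exprS expr1 mulrNN mulr1.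
rewrite !mulr1z mulrNz mulr1z 2!raddfD raddfN /= !fliftU.
have ci (i : 'I_3) : continuous (s \o @coface R 1 i).
  by move=> v; apply: continuous_comp; [exact: coface_continuous|exact: cs].
rewrite !(chit1E _ gO) => //; try by move=> t; exact: sO.
have i1 : fintype.lift ord0 ord0 = 1 :> 'I_3 by exact/val_inj.
have -> : fintype.lift ord0 (fintype.lift ord0 ord0) = 2%:R :> 'I_3 by exact/val_inj.
have {h0 E0}e0 := etrans (esym h0) E0; have {h1 E1}e1 := etrans (esym h1) E1.
rewrite i1 e0 e1 -e20; move: (germ O _) (germ O _) (germ O _) => x y z.
by rewrite opprB [X in _ + X]addrC subrKA subrKA subrr.
Qed.

(* The local primitives of [chi] differ by locally constant functions, hence [chi]
   extends to small simplices of X as the difference of a primitive at their ends, and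
   vanishes on the boundary of any sufficiently subdivided 2-chain of X. *)
Theorem germ_theorem (c : chain R X 1) : c \in is_cycle C set0 -> c \in bounds setT set0 -> chi c = 0.
Proof.
move=> cc /bounds0P[e eX ce]; have /is_cycleP[cC _] := cc.
have og O : good O -> open O by case.
have cov (x : X) : [set: X] x -> exists2 O, good O & O x by move=> _; have [] := nbhP x; exists (nbh x).
have [m hm] := @iter_Sd_small R X [set O | good O] _ _ e og cov eX.
have := iter_Sd_bounds m cc => /bounds0P[f fC /(congr1 chi)].
rewrite (chi_bd fC) raddfB => /eqP; rewrite subr_eq0 => /eqP <-.
have sc : iter m (@Sd R X 1) c \in fall (@gsmall 1).
  rewrite ce -(bd_iter_Sd m (e : chain R X 2)).
  move: hm; apply: (fall_ind (Q := fun e : chain R X 2 => bd e \in fall (@gsmall 1))) => [|e1 e2 h1 h2|s [cs [O gO sO]]].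
  - by rewrite raddf0 rpred0.
  - by rewrite raddfB rpredB.
  by apply: fallW (bd_chain_in (chain_inU cs sO)) => s' [cs' s'O]; split=> //; exists O.
have sC := iter_Sd_chain_in m cC.
have -> : chi (iter m (@Sd R X 1) c) = chit (iter m (@Sd R X 1) c).
  apply: (freeg_ext_in (P := fun s => gsmall s /\ forall t, C (s t))).
  - exact: raddfB.
  - exact: raddfB.
  - move=> s [gs sC']; have -> : chit << s >> = chit1 s by exact: fliftU.
    by rewrite chit1_C.
  apply/asboolP => s sdom; move/asboolP : sc => /(_ s sdom) gs; split=> //.
  by move/asboolP : sC => /(_ s sdom)[].
by rewrite ce -(bd_iter_Sd m (e : chain R X 2)) chit_bd.
Qed.

End Germs.

(** * Meridians of a locally flat surface *)

Section OffAxis.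
Variables (R : realType) (n : nat).
Implicit Types (p q : 'rV[R]_n).

Lemma segment_path (S : set 'rV[R]_n) p q :
  (forall s, 0 <= s <= 1 -> S ((1 - s) *: p + s *: q)) ->
  path_in S (fun s : R => (1 - s) *: p + s *: q) p q.
Proof.
move=> h; apply/path_inP; rewrite subr0 subrr !scale0r !scale1r addr0 add0r; split=> //.
split=> [|t t01]; last by apply: h; exact: in01E.
apply: cw_addmx; apply: cw_scalemx; try exact: cw_cst; last exact: cw_idR.
by apply: cw_add; [exact: cw_cst|apply: cw_opp; exact: cw_idR].
Qed.

(* If the segment from [p] to [q] meets the axis, then [p] and [q] are opposite
   in the plane of the coordinates i and j, and the detour through a point
   rotated by a right angle avoids it. *)
Lemma off_axis_path (P : set 'rV[R]_n) (i j : 'I_n) p q r :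
  convexV P -> P p -> P q -> P r -> r 0 i = - p 0 j -> r 0 j = p 0 i ->
  ~ (p 0 i = 0 /\ p 0 j = 0) -> ~ (q 0 i = 0 /\ q 0 j = 0) ->
  exists a : R -> 'rV[R]_n, path_in (P `&` [set y | ~ (y 0 i = 0 /\ y 0 j = 0)]) a p q.
Proof.
move=> cP Pp Pq Pr ri rj np nq; set Q := _ `&` _.
have [h|] := pselect (forall s, 0 <= s <= 1 -> Q ((1 - s) *: p + s *: q)).
  by exists (fun s : R => (1 - s) *: p + s *: q); exact: segment_path.
move=> /existsNP[s /not_implyP[s01 nQ]].
have [zi zj] : (1 - s) * p 0 i + s * q 0 i = 0 /\ (1 - s) * p 0 j + s * q 0 j = 0.
  by apply: contrapT => h; apply: nQ; split; [exact: cP|move=> /=; rewrite !mxE].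
have sq x y : x ^+ 2 + y ^+ 2 = 0 :> R -> x = 0 /\ y = 0.
  move=> /eqP; rewrite paddr_eq0 ?sqr_ge0 // !sqrf_eq0 => /andP[/eqP -> /eqP ->]; done.
have pnz : p 0 i ^+ 2 + p 0 j ^+ 2 != 0 by apply/eqP => /sq.
have qnz : q 0 i ^+ 2 + q 0 j ^+ 2 != 0 by apply/eqP => /sq.
have s0 : s != 0.
  by apply/eqP => s0; apply: np; move: zi zj; rewrite s0 subr0 !mul1r !mul0r !addr0.
have par : p 0 i * q 0 j = p 0 j * q 0 i.
  have [ei ej] : s * q 0 i = - ((1 - s) * p 0 i) /\ s * q 0 j = - ((1 - s) * p 0 j).
    by split; apply/eqP; rewrite -addr_eq0 addrC; apply/eqP.
  by apply: (mulfI s0); rewrite mulrCA ej [RHS]mulrCA ei; ring.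
have pr : path_in Q (fun t : R => (1 - t) *: p + t *: r) p r.
  apply: segment_path => t t01; split; first exact: cP.
  rewrite /= !mxE ri rj => -[h1 h2].
  have /eqP : (1 - t) * (p 0 i ^+ 2 + p 0 j ^+ 2) = p 0 i * 0 + p 0 j * 0 by rewrite -{1}h1 -h2; ring.
  rewrite !mulr0 addr0 mulf_eq0 (negPf pnz) orbF => /eqP t1.
  have /eqP : t * (p 0 i ^+ 2 + p 0 j ^+ 2) = p 0 i * 0 - p 0 j * 0 by rewrite -{1}h2 -h1; ring.
  rewrite !mulr0 subr0 mulf_eq0 (negPf pnz) orbF => /eqP t0.
  by move: t1; rewrite t0 subr0 => /eqP; rewrite oner_eq0.
have rq : path_in Q (fun t : R => (1 - t) *: r + t *: q) r q.
  apply: segment_path => t t01; split; first exact: cP.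
  rewrite /= !mxE ri rj => -[h1 h2].
  have /eqP : (1 - t) * (p 0 i ^+ 2 + p 0 j ^+ 2) = p 0 i * 0 - p 0 j * 0.
    by rewrite -{1}h2 -h1; ring: par.
  rewrite !mulr0 subr0 mulf_eq0 (negPf pnz) orbF => /eqP t1.
  by apply: nq; move: h1 h2; rewrite t1 !mul0r !add0r (_ : t = 1) ?mul1r //; lra.
by eexists; exact: (concat_in pr rq).
Qed.

End OffAxis.

Section HomotopyChi.
Variables (R : realType) (X : topologicalType) (C : set X) (G : zmodType).
Variable chi : {additive chain R X 1 -> G}.
Hypothesis chi_bd : forall e : chain R X 2, e \in chain_in C -> chi (bd e) = 0.

Lemma chi_bounds (c : chain R X 1) : c \in bounds C set0 -> chi c = 0.
Proof. by move=> /bounds0P[e eC ->]; exact: chi_bd. Qed.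

Lemma chi_homotopy (A B : set X) (H : R * X -> X) (c : chain R X 1) :
  {within `[0, 1] `*` A, continuous H} ->
  (forall s x, 0 <= s <= 1 -> A x -> C (H (s, x))) ->
  (forall x, A x -> H (0, x) = x) -> (forall x, A x -> B (H (1, x))) ->
  c \in is_cycle A set0 ->
  exists2 c', c' \in is_cycle B set0 & chi c = chi c'.
Proof.
move=> cH HC H0 H1 /is_cycleP[cA /chain_in0 bc].
exists (push (fun x => H (1, x)) c).
  apply/is_cycleP; split; last by rewrite bd_push bc raddf0 rpred0.
  apply: push_chain_in cA => //; apply: (cw_comp cH) => [|x Ax]; last by split=> //; exact: in01_1.
  by apply: cw_pair; [exact: cw_cst|exact: cw_id].
have := @homotopy_bounds R X X 1 H A set0 C set0 c cH HC (fun s x _ _ h => h) cA.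
rewrite bc rpred0 => /(_ isT)/chi_bounds; rewrite raddfB => /eqP.
rewrite subr_eq0 => /eqP ->; congr (chi _).
by rewrite -[LHS]push_id; apply: eq_push cA => x Ax; rewrite H0.
Qed.
End HomotopyChi.

Section FlatBox.
Variables (R : realType) (N : topologicalType) (F : set N).
Implicit Types (x y : N) (O W : set N) (f : N -> 'rV[R]_4) (g : 'rV[R]_4 -> N).
Local Notation H4 := (half_space R 4).
Local Notation ball4 p r := [set z : 'rV[R]_4 | `|z - p| < r].
Local Notation C := (~` F).

Definition box x O f g (r : R) :=
  [/\ open O, O x, 0 < r & homeo O (H4 `&` ball4 (f x) r) f g].

Lemma box_ex x U f W : chart [set: N] U f -> U x -> open W -> W x ->
  exists g r O, box x O f g r /\ O `<=` U `&` W.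
Proof.
move=> [oU [V [g [oV [cf cg fK gK]]]]] Ux oW Wx; rewrite setTI in cf fK gK.
have [[_ Vx] gx] := fK x Ux.
have [V' oV' VE] := open_within cg oW.
have V'x : V' (f x).
  have : ((H4 `&` V) `&` g @^-1` W) (f x) by split; [have [] := fK x Ux|rewrite /= gx].
  by rewrite VE => -[].
have /nbhs_ballP[r /= r0 hr] := open_nbhs_nbhs (conj (openI oV oV') (conj Vx V'x)).
have hr' z : `|z - f x| < r -> V z /\ V' z.
  by move=> zr; apply: hr; rewrite -ball_normE /= distrC.
exists g, r, (U `&` f @^-1` (ball4 (f x) r)); split; last first.
  move=> z [Uz /= /hr'[Vz V'z]]; split=> //.
  have [[Hz _] gz] := fK z Uz.
  have : ((H4 `&` V) `&` V') (f z) by [].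
  by rewrite -VE /= gz => -[].
split=> //.
- by apply: open_preim => //; exact: open_ball4.
- by split=> //=; rewrite subrr normr0.
split.
- by apply: continuous_subspaceW cf => z [].
- by apply: continuous_subspaceW cg => z [Hz /hr'[]].
- by move=> z [Uz zr]; have [[Hz _] gz] := fK z Uz.
- move=> z [Hz zr]; have [Vz _] := hr' z zr.
  by have [Uz fz] := gK z (conj Hz Vz); split=> //; split=> //=; rewrite fz.
Qed.

Lemma box_convex (p : 'rV[R]_4) r : convexV (H4 `&` ball4 p r).
Proof.
move=> s x y /andP[s0 s1] [Hx xr] [Hy yr]; split.
  by move=> i i0; rewrite !mxE addr_ge0 // mulr_ge0 ?subr_ge0 //; [exact: Hx|exact: Hy].
rewrite /=; have -> : (1 - s) *: x + s *: y - p = (1 - s) *: (x - p) + s *: (y - p).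
  by rewrite !scalerBr addrACA -opprD -scalerDl subrK scale1r.
apply: le_lt_trans (ler_normD _ _) _; rewrite !normrZ !ger0_norm ?subr_ge0 //.
have [->|sn] := eqVneq s 0; first by rewrite subr0 mul1r mul0r addr0.
have sp : 0 < s by rewrite lt0r sn.
have h1 : (1 - s) * `|x - p| <= (1 - s) * r by rewrite ler_wpM2l ?subr_ge0 // ltW.
have h2 : s * `|y - p| < s * r by rewrite ltr_pM2l.
by have := ler_ltD h1 h2; rewrite -mulrDl subrK mul1r.
Qed.

Definition tame O := [/\ open O, (O `&` C) !=set0 &
  forall p q, (O `&` C) p -> (O `&` C) q -> exists a : R -> N, path_in (O `&` C) a p q].

Lemma box_center x O f g r : box x O f g r -> (H4 `&` ball4 (f x) r) (f x).
Proof. by move=> [_ Ox _ [_ _ fK _]]; have [] := fK x Ox. Qed.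

Lemma box_map_path O f g (B S T : set _) (a : R -> 'rV[R]_4) p q : homeo O B f g ->
  (forall z, B z -> S z -> T (g z)) -> O p -> O q ->
  path_in (B `&` S) a (f p) (f q) -> path_in (O `&` T) (g \o a) p q.
Proof.
move=> [_ cg fK gK] ST Op Oq /path_inP[[ca aB] a0 a1]; apply/path_inP; split=> /=.
- split; first by apply: (cw_comp cg) => // t /aB[].
  by move=> t /aB[Bt St]; split; [have [] := gK _ Bt|exact: ST].
- by rewrite a0; have [] := fK p Op.
- by rewrite a1; have [] := fK q Oq.
Qed.

Lemma box_off x O f g r : box x O f g r -> O `<=` C -> tame O.
Proof.
move=> bx OC; have [oO Ox r0 h] := bx; split=> //; first by exists x; split=> //; exact: OC.
move=> p q [Op _] [Oq _]; have [_ _ fK gK] := h.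
have pB := (fK p Op).1; have qB := (fK q Oq).1.
exists (g \o fun s : R => (1 - s) *: f p + s *: f q).
apply: (box_map_path (S := setT) h) => // [z Bz _|]; first by apply: OC; have [] := gK z Bz.
by apply: segment_path => s s01; split=> //; exact: box_convex.
Qed.

Definition flat_box x O f g r := [/\ box x O f g r, F x &
  forall y, O y -> F y <-> f y 0 (inord 2) = 0 /\ f y 0 (inord 3) = 0].

Hypothesis lF : locally_flat R 4 2 [set: N] F.

Lemma flat_box_ex x W : F x -> open W -> W x ->
  exists f g r O, flat_box x O f g r /\ O `<=` W.
Proof.
move=> Fx oW Wx; have [U [f [ch Ux fl]]] := lF.2 x Fx.
have [g [r [O [bx sub]]]] := box_ex ch Ux oW Wx.
exists f, g, r, O; split; last by move=> y /sub[].
split=> // y /sub[Uy _]; rewrite fl //; split=> [h|[h1 h2] [[|[|[|[|//]]]] p] //= _].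
- by split; apply: h; rewrite inordK.
- by rewrite (_ : Ordinal p = inord 2) //; apply/val_inj; rewrite /= inordK.
- by rewrite (_ : Ordinal p = inord 3) //; apply/val_inj; rewrite /= inordK.
Qed.

(** Removing a set of codimension two leaves the box path-connected. The box is a ball of the
    maximum norm around a point of F, so it contains the detour point, whose last two coordinates
    are those of p after a quarter turn. *)
Lemma flat_box_tame x O f g r : flat_box x O f g r -> tame O.
Proof.
move=> [bx Fx fl]; have [oO Ox r0 h] := bx; have [_ _ fK gK] := h.
have [Hx _] := box_center bx; have [x2 x3] := (fl x Ox).1 Fx.
have shift (a b : R) : `|a| < r -> `|b| < r ->
    (H4 `&` ball4 (f x) r) (row4 (f x 0 0) (f x 0 1) a b).
  move=> ar br; split.
    by apply/half_spaceP; rewrite row4E; apply/half_spaceP.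
  apply/rV_norm_lt => // -[[|[|[|[|//]]]] p]; rewrite mxE [X in _ + X]mxE.
  - by rewrite (_ : Ordinal p = 0) ?row4E ?subrr ?normr0 //; exact/val_inj.
  - by rewrite (_ : Ordinal p = 1) ?row4E ?subrr ?normr0 //; exact/val_inj.
  - by rewrite (_ : Ordinal p = inord 2) ?row4E ?x2 ?subr0 //; apply/val_inj; rewrite /= inordK.
  - by rewrite (_ : Ordinal p = inord 3) ?row4E ?x3 ?subr0 //; apply/val_inj; rewrite /= inordK.
split=> //.
  have [||Hz zr] := shift (r / 2) 0.
  - by rewrite gtr0_norm ?divr_gt0 // ltr_pdivrMr // ltr_pMr // ltr1n.
  - by rewrite normr0.
  exists (g (row4 (f x 0 0) (f x 0 1) (r / 2) 0)).
  have [Oz fz] := gK _ (conj Hz zr); split=> //= /(fl _ Oz).1; rewrite fz !row4E => -[/eqP].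
  by rewrite mulf_eq0 invr_eq0 gt_eqF //= pnatr_eq0.
move=> p q [Op Cp] [Oq Cq]; have pB := (fK p Op).1; have qB := (fK q Oq).1.
have [_ /= /rV_norm_lt pr] := pB.
have p2 := pr r0 (inord 2); have p3 := pr r0 (inord 3).
rewrite mxE [X in _ + X]mxE x2 subr0 in p2; rewrite mxE [X in _ + X]mxE x3 subr0 in p3.
have [|||||a ha] := @off_axis_path R 4 _ (inord 2) (inord 3) (f p) (f q)
  (row4 (f x 0 0) (f x 0 1) (- f p 0 (inord 3)) (f p 0 (inord 2))) (@box_convex (f x) r) pB qB.
- by apply: shift; rewrite ?normrN.
- by rewrite row4E.
- by rewrite row4E.
- by move/(fl p Op).2.
- by move/(fl q Oq).2.
exists (g \o a); apply: (box_map_path h _ Op Oq ha) => z Bz nz /=.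
by have [Oz fz] := gK z Bz; move/(fl _ Oz).1; rewrite fz.
Qed.

Hypotheses (clF : closed F) (mfd : forall x, exists U f, chart (n := 4) [set: N] U f /\ U x).

Lemma tame_ex x W : open W -> W x -> exists2 O, tame O & O x /\ O `<=` W.
Proof.
move=> oW Wx; have [Fx|nFx] := pselect (F x).
  have [f [g [r [O [fb sub]]]]] := flat_box_ex Fx oW Wx.
  by exists O; [exact: flat_box_tame fb|split=> //; case: fb => -[]].
have [U [f [ch Ux]]] := mfd x.
have [g [r [O [bx sub]]]] := box_ex ch Ux (openI oW (closed_openC clF)) (conj Wx nFx).
exists O; first by apply: box_off bx _ => y /sub[_ []].
by split=> [|y /sub[_ []]] //; case: bx.
Qed.

End FlatBox.

Section Van.
Variables (R : realType) (N : topologicalType) (F : set N) (G : zmodType).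
Local Notation C := (~` F).
Local Notation H4 := (half_space R 4).
Local Notation ball4 p r := [set z : 'rV[R]_4 | `|z - p| < r].
Variable chi : {additive chain R N 1 -> G}.
Hypothesis chi_bd : forall e : chain R N 2, e \in chain_in C -> chi (bd e) = 0.

(** Triviality of [chi] on the meridian of F at x, expressed without choosing a meridian. *)
Definition vanish x := exists O, [/\ open O, O x &
  forall c : chain R N 1, c \in is_cycle (O `&` C) set0 -> chi c = 0].

(* Contracting the box towards y moves its cycles off F into any neighbourhood of y. *)
Lemma flat_box_vanish x O (f : N -> 'rV[R]_4) g r y : flat_box F x O f g r -> F y -> O y -> vanish y ->
  forall c : chain R N 1, c \in is_cycle (O `&` C) set0 -> chi c = 0.
Proof.
move=> [bx Fx fl] Fy Oy [W [oW Wy hW]] c cc.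
have [oO Ox r0 h] := bx; have [cf cg fK gK] := h.
have [y2 y3] := (fl y Oy).1 Fy; have [yB gy] := fK y Oy.
have [V oV VE] := open_within cg oW.
have Vy : V (f y).
  have : (H4 `&` ball4 (f x) r `&` g @^-1` W) (f y) by split; rewrite //= gy.
  by rewrite VE => -[].
have /nbhs_ballP[d /= d0 hd] := open_nbhs_nbhs (conj oV Vy).
pose e := Num.min d r; have e0 : 0 < e by rewrite lt_min d0.
(* Two points of the box are less than 2r apart, so contraction by k brings the box within d of f y;
   the minimum with r in e ensures k < 1. *)
pose k := e / (2 * r); have rr : 0 < 2 * r by rewrite mulr_gt0.
have k0 : 0 < k by rewrite divr_gt0.
have k1 : k < 1.
  rewrite ltr_pdivrMr // mul1r; apply: le_lt_trans (_ : r < _); first by rewrite ge_min lexx orbT.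
  by rewrite ltr_pMl // ltr1n.
have hs s : 0 <= s <= 1 -> 0 <= s * (1 - k) <= 1 /\ s * (1 - k) < 1.
  move=> /andP[s0 s1]; have : s * (1 - k) < 1.
    apply: le_lt_trans (_ : 1 - k < 1); last by rewrite gtrBl.
    by rewrite ler_piMl // subr_ge0 ltW.
  by move=> hlt; split=> //; rewrite (ltW hlt) andbT; apply: mulr_ge0 => //; rewrite subr_ge0 ltW.
pose H (q : R * N) := g ((1 - q.1 * (1 - k)) *: f q.2 + (q.1 * (1 - k)) *: f y).
have HB s z : 0 <= s <= 1 -> O z ->
    (H4 `&` ball4 (f x) r) ((1 - s * (1 - k)) *: f z + (s * (1 - k)) *: f y).
  by move=> /hs[s01 _] Oz; apply: box_convex => //; exact: (fK z Oz).1.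
have HC s z : 0 <= s <= 1 -> (O `&` C) z -> (O `&` C) (H (s, z)).
  move=> s01 [Oz Cz]; have [OH fH] := gK _ (HB s z s01 Oz); split=> // /(fl _ OH).1.
  rewrite fH !mxE y2 y3 !mulr0 !addr0 => -[/eqP h2 /eqP h3]; apply: Cz; apply/(fl z Oz).
  have sk : (1 - s * (1 - k) == 0) = false.
    by apply/negP; rewrite subr_eq0 eq_sym => /eqP; apply/eqP; rewrite lt_eqF //; have [] := hs s s01.
  by move: h2 h3; rewrite !mulf_eq0 sk /= => /eqP -> /eqP ->.
have [|||||c' cc' ->] := @chi_homotopy R N C G chi chi_bd (O `&` C) (W `&` C) H c.
- apply: (cw_comp cg) => [|[s z] [/= s01 [Oz _]]]; last by apply: HB => //; exact: in01E.
  apply: cw_addmx; apply: cw_scalemx; try by wcont.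
  by apply: (cw_comp cf) => [|[s z] [_ []]]; first by wcont.
- by move=> s z s01 /(HC s z s01)[].
- by move=> z [Oz _]; rewrite /H /= mul0r subr0 scale1r scale0r addr0; have [] := fK z Oz.
- move=> z Oz; have [OH CH] := HC 1 z (in01E (in01_1 R)) Oz; split=> //.
  have [[Oz' _] [HH fH]] := (Oz, gK _ (HB 1 z (in01E (in01_1 R)) Oz.1)).
  have : (H4 `&` ball4 (f x) r `&` V) (f (H (1, z))).
    split; first by rewrite fH; apply: HB; rewrite ?in01E ?in01_1.
    rewrite fH; set u := (X in V X).
    have -> : u = f y + k *: (f z - f y) by apply/rowP => j; rewrite !mxE /=; ring.
    apply: hd; rewrite -ball_normE /= distrC addrAC subrr add0r normrZ gtr0_norm //.
    apply: lt_le_trans (_ : k * (2 * r) <= d).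
      rewrite ltr_pM2l // -[f z](subrK (f x)) -addrA mulr_natl mulr2n.
      have [_ /= zr] := (fK z Oz').1; have [_ /= yr] := yB.
      by apply: le_lt_trans (ler_normD _ _) _; rewrite ltrD // distrC.
    by rewrite /k divfK ?gt_eqF // ge_min lexx.
  by rewrite -VE => -[_] /=; rewrite (fK _ OH).2.
- by [].
exact: hW.
Qed.

Hypotheses (lF : locally_flat R 4 2 [set: N] F) (clF : closed F) (cF : connected F).
Hypothesis mfd : forall x, exists U (f : N -> 'rV[R]_4), chart [set: N] U f /\ U x.

(** In one flat box vanishing at one point of F passes to all others, so it spreads over the
    connected F. This replaces the conjugacy of meridians. *)
Lemma vanish_all y : F y -> vanish y -> forall x, F x -> vanish x.
Proof.
move=> Fy vy; apply: (connected_local cF Fy vy) => x Fx.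
have [f [g [r [O [fb _]]]]] := flat_box_ex lF Fx openT I.
have [[oO Ox _ _] _ _] := fb; exists O => // z Fz Oz.
suff h u w : F u -> O u -> O w -> vanish u -> vanish w by split; exact: h.
by move=> Fu Ou Ow vu; exists O; split=> //; exact: flat_box_vanish fb Fu Ou vu.
Qed.

Lemma joined_chain (A : set N) p q : (exists a : R -> N, path_in A a p q) ->
  exists2 s : chain R N 1, s \in chain_in A & bd s = (cst_simplex R 0 q - cst_simplex R 0 p).
Proof.
move=> [a /path_inP[pa <- <-]]; exists << path_simplex a >>; first exact: path_simplex_in.
exact: bd_path_simplex.
Qed.

(** At points of F a flat box has the required property by [vanish_all]; elsewhere a box off F is
    contractible. *)
Lemma good_ex y : F y -> vanish y -> forall x W, open W -> W x ->
  exists2 O, good C chi O & O x /\ O `<=` W.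
Proof.
move=> Fy vy x W oW Wx; have [Fx|nFx] := pselect (F x).
  have [O' [oO' O'x hO']] := vanish_all Fy vy Fx.
  have [f [g [r [O [fb sub]]]]] := flat_box_ex lF Fx (openI oW oO') (conj Wx O'x).
  have [oO OC hO] := flat_box_tame fb.
  exists O; last by split=> [|z /sub[]] //; case: fb => -[].
  split=> // [p q hp hq|c cc]; first exact/joined_chain/hO.
  by apply: hO'; apply: is_cycleW cc => // z [/sub[_ ?]].
have [U [f [ch Ux]]] := mfd x.
have [g [r [O [bx sub]]]] := box_ex ch Ux (openI oW (closed_openC clF)) (conj Wx nFx).
have OF : O `<=` C by move=> z /sub[_ []].
have [oO OC hO] := box_off bx OF; have [_ Ox r0 h] := bx.
exists O; last by split=> // z /sub[_ []].
split=> // [p q hp hq|c cc]; first exact/joined_chain/hO.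
apply: (chi_bounds chi_bd); apply: (@boundsW R N 1 O set0) => //.
have cO : contracts R O (g (f x)).
  apply: (homeo_contracts (homeo_sym h)); apply: star_contracts; split; first exact: box_center bx.
  by move=> s v s01 Bv; apply: box_convex => //; exact: box_center bx.
by apply: (contracts_bounds1 cO); apply: is_cycleW cc => // z [].
Qed.

(* Pushing along the collar moves the cycles near [phi 0] into the ball minus the axis. *)
Lemma collar_vanish (phi : 'rV[R]_3 -> N) : piece F phi ->
  (forall c : chain R N 1, c \in chain_in (phi @` [set w | closed_ball3 w /\ ~ axis3 w]) -> chi c = 0) ->
  F (phi 0) /\ vanish (phi 0).
Proof.
move=> pF hD; have F0 : F (phi 0) by apply/(piece_axis pF); move=> i _; rewrite mxE.
split=> //; have [e [c [c' [e0 [U [oU [cc' cc c'K cK]]] c0 cF' cB]]]] := piece_collar pF 0.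
have [d d0 hd] : exists2 d, 0 < d & forall w : 'rV[R]_3, `|w - 0| < d -> ssq w < 1.
  apply: near_ball; first by apply: cw_ssq; exact: cw_id.
  by rewrite ssqE !mxE expr0n /= !addr0.
pose O := U `&` c' @^-1` [set q : R * 'rV[R]_3 | `|q.2 - 0| < d].
have q0 : qbox 0 e (0, 0 : 'rV[R]_3) by split; rewrite /= ?subrr ?normr0 // lexx.
have [Up c'p] := cK _ q0; rewrite c0 ?subrr ?normr0 // in Up c'p.
exists O; split.
- apply: open_preim => //; apply: (@open_comp _ _ snd [set w : 'rV[R]_3 | `|w - 0| < d]).
    by move=> q _; exact: cvg_snd.
  exact: norm_lt_open.
- by split=> //=; rewrite c'p /= subrr normr0.
move=> a ca; pose H (q : R * N) := c ((1 - q.1) * (c' q.2).1, (c' q.2).2).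
have Hq s z : 0 <= s <= 1 -> U z -> qbox 0 e ((1 - s) * (c' z).1, (c' z).2).
  move=> /andP[s0 s1] Uz; have [[/andP[t0 te] we] _] := c'K z Uz; split=> //=.
  rewrite mulr_ge0 ?subr_ge0 //=; apply: le_lt_trans te; apply: ler_piMl => //.
  by rewrite gerBl.
have [||||b /is_cycleP[bD _] ->] := @chi_homotopy R N C G chi chi_bd (O `&` C)
  (phi @` [set w | closed_ball3 w /\ ~ axis3 w]) H a _ _ _ _ ca.
- apply: (cw_comp cc) => [|[s z] [/= s01 [[Uz _] _]]]; last by apply: Hq => //; exact: in01E.
  have c'2 : {within `[0, 1] `*` (O `&` C), continuous (fun q : R * N => c' q.2)}.
    by apply: (cw_comp cc') => [|[s z] [_ [[]]]]; first by wcont.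
  apply: cw_pair; last exact: cw_snd.
  by apply: cw_mul; [wcont|exact: cw_fst].
- move=> s z s01 [[Uz _] Cz] Fh; apply: Cz; have [qz cz] := c'K z Uz.
  by rewrite -cz; apply/(cF' _ qz); exact: (cF' _ (Hq s z s01 Uz)).1 Fh.
- by move=> z [[Uz _] _]; rewrite /H /= subr0 mul1r -surjective_pairing; have [] := c'K z Uz.
- move=> z [[Uz zd] Cz]; have [qz cz] := c'K z Uz; have [_ we] := qz.
  rewrite /H /= subrr mul0r c0 //; exists (c' z).2 => //; split; first exact/ltW/hd.
  by move=> ax; apply: Cz; rewrite -cz; apply/(cF' _ qz).
exact: hD.
Qed.

End Van.

Lemma path_local (R : realType) (X : topologicalType) (A : set X) (P : X -> Prop) (a : R -> X) :
  (forall x, A x -> exists2 U, open U /\ U x & forall y, U y -> P x <-> P y) ->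
  ppath A a -> P (a 0) -> P (a 1).
Proof.
move=> loc [ca aA] P0.
apply: (@connected_local R `[0, 1]%classic (fun t => P (a t)) 0 _ _ P0 _ 1).
- exact: segment_connected.
- exact: (in01_0 R).
- move=> t t01; have [U [oU Ut] hU] := loc _ (aA t t01).
  have [V oV VE] := open_within ca oU.
  have Vt : V t by have : (`[0, 1]%classic `&` a @^-1` U) t by []; rewrite VE => -[].
  exists V => // y y01 Vy; apply: hU.
  by have : (`[0, 1]%classic `&` V) y by []; rewrite -VE => -[].
- exact: (in01_1 R).
Qed.

(** * Paths and loops in the complement of one surface *)

Section Complement.
Variables (R : realType) (N : topologicalType) (F : set N).
Local Notation C := (~` F).
Hypothesis tame_small : forall x W, open W -> W x -> exists2 O, tame R F O & O x /\ O `<=` W.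

(** Along the path a of N, consider whether all nearby points off F can be reached from b within C.
    This is locally constant, since small tame sets are path-connected off F. *)
Lemma complement_joined b x (a : R -> N) : C b -> C x -> path_in [set: N] a b x ->
  exists c : R -> N, path_in C c b x.
Proof.
move=> Cb Cx /path_inP[pa a0 a1].
pose P x := exists2 O, open O /\ O x & forall y, (O `&` C) y -> exists c : R -> N, path_in C c b y.
suff [O [oO Ox] /(_ x)] : P x by apply; split.
rewrite -a1; apply: (path_local _ pa) => [y _|]; last first.
  rewrite a0; have [O [oO _ h] [Ob _]] := tame_small openT (I : setT b).
  exists O => // y hy; have [c hc] := h b y (conj Ob Cb) hy.
  by exists c; exact: path_inW hc.
have [O [oO _ h] [Oy _]] := tame_small openT (I : setT y).
exists O => // z Oz; suff hh u w : O u -> O w -> P u -> P w by split; exact: hh.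
move=> Ou Ow [W [oW Wu] hW]; exists O => // v hv.
have [O' [oO' [p [O'p Cp]] _] [O'u sub]] := tame_small (openI oO oW) (conj Ou Wu).
have [Op Wp] := sub _ O'p; have [c hc] := hW p (conj Wp Cp).
have [c' hc'] := h p v (conj Op Cp) hv.
by exists (path_concat c c'); apply: concat_in hc _; exact: path_inW hc'.
Qed.

End Complement.

Section DiskOff.
Variables (R : realType) (N : topologicalType) (F : set N) (phi : 'rV[R]_3 -> N).
Hypothesis pF : piece F phi.

Definition disk_off := phi @` [set w | closed_ball3 w /\ ~ axis3 w].

Lemma disk_off_sub : disk_off `<=` ~` F.
Proof. by move=> _ [w [_ nw] <-] /(piece_axis pF). Qed.

Lemma disk_off_joined p q : disk_off p -> disk_off q -> exists a : R -> N, path_in disk_off a p q.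
Proof.
move=> [v [v1 nv] <-] [w [w1 nw] <-].
have cB : convexV (@closed_ball3 R).
  move=> s x y /andP[s0 s1] x1 y1.
  apply: (@le_trans _ _ ((1 - s) * ssq x + s * ssq y)); last first.
    apply: (@le_trans _ _ ((1 - s) * 1 + s * 1)); last by rewrite !mulr1 subrK.
    by rewrite lerD // ler_wpM2l // subr_ge0.
  rewrite /ssq !mulr_sumr -big_split /=; apply: ler_sum => i _.
  rewrite !mxE; move: (x 0 i) (y 0 i) => a b.
  have : 0 <= s * (1 - s) * (a - b) ^+ 2 by rewrite mulr_ge0 ?sqr_ge0 // mulr_ge0 // subr_ge0.
  by clear; nra.
have [|||||a /path_inP[[ca aB] a0 a1]] := @off_axis_path R 3 _ 1 (inord 2) v w
  (row3 0 (- v 0 (inord 2)) (v 0 1)) cB v1 w1.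
- move: v1; rewrite /closed_ball3 /= -!/(ssq _) !ssqE !row3E sqrrN expr0n /= add0r => h.
  apply: le_trans h; rewrite [leLHS]addrC -[leRHS]addrA lerDr; exact: sqr_ge0.
- by rewrite row3E.
- by rewrite row3E.
- by move/axis3P.
- by move/axis3P.
exists (phi \o a); apply/path_inP; rewrite /= a0 a1; split=> //.
apply: (ppath_map _ _ (conj ca aB)) => [|y [h1 h2]]; last by exists y => //; split=> // /axis3P.
by apply: continuous_subspaceW (subsetT _) _; apply/cont_within; exact: (piece_phi pF).
Qed.

End DiskOff.

(** The null-homotopy is read as a homotopy of maps on [0, 1] relative to the ends and applied to
    the identity simplex. It makes the loop homologous to a constant simplex relative to the point
    x. *)
Lemma nullhomotopic_bounds (R : realType) (X : topologicalType) (A : set X) (a : R -> X) x :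
  path_in A a x x -> path_homotopic A a (cst x) ->
  (<< path_simplex a >> : chain R X 1) \in bounds A set0.
Proof.
move=> la [H [cH HA H01 Hs]]; have /path_inP[pa a0 a1] := la.
have [i0 i1] := (in01_0 R, in01_1 R).
pose c : chain R R 1 := << path_simplex (fun t : R => t) >>.
pose I01 : set R := `[0, 1]%classic.
have cI : c \in chain_in I01.
  by apply: path_simplex_in; split=> //; exact: cw_idR.
have bc : bd c \in chain_in [set t : R | t = 0 \/ t = 1].
  rewrite /c bd_path_simplex rpredB //; apply: cst_simplex_in; [by right|by left].
have := @homotopy_bounds R R X 1 H I01 [set t : R | t = 0 \/ t = 1] A [set x] c cH _ _ cI bc.
have E (g : R -> X) : push g c = << path_simplex g >>.
  by rewrite pushU; congr << _ >>; apply/funext => v.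
have E2 (g h : R -> X) : (forall t, t \in `[0, 1] -> g t = h t) -> path_simplex g = path_simplex h.
  by move=> gh; apply/funext => v; apply: gh; rewrite in_itv; exact: simplex_coord.
have P0 : push (fun t => H (0, t)) c = << path_simplex a >>.
  by rewrite E; congr << _ >>; apply: E2 => t t01; have [] := H01 t t01.
have P1 : push (fun t => H (1, t)) c = cst_simplex R 1 x.
  rewrite E; congr << _ >>; rewrite (E2 _ (cst x)); first exact/funext.
  by move=> t t01; have [] := H01 t t01.
rewrite P0 P1.
move=> h.
have {h} /boundsP[e eA hx] : cst_simplex R 1 x - << path_simplex a >> \in bounds A [set x].
  apply: h => [s t s01 t01|s t s01 t01]; first by apply: HA; rewrite // in_itv.
  have s01' : s \in `[0, 1] by rewrite in_itv.
  by have [Hs0 Hs1] := Hs s s01'; case=> ->; rewrite ?Hs0 ?Hs1.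
have xx : contracts R [set x] x.
  split=> //; exists (fun _ => x); split=> //; exact: cw_cst.
have Ax : A x by rewrite -a0; have [_ aA] := pa; exact: aA.
(* The remaining chain is a 1-cycle of a single point, where it bounds. *)
set u := _ - bd e in hx.
have uc : u \in is_cycle [set x] set0.
  apply/is_cycleP; split=> //.
  have E0 : bd (bd e : chain R X 1) = 0 := bd_bd e.
  have E1 : bd u = bd (cst_simplex R 1 x - << path_simplex a >>) - bd (bd e : chain R X 1).
    exact: raddfB.
  have E3 : bd (cst_simplex R 1 x - << path_simplex a >>) = bd (cst_simplex R 1 x) - bd << path_simplex a >>.
    exact: raddfB.
  by rewrite E1 E3 E0 bd_cst1 bd_path_simplex a0 a1 subrr !subr0 rpred0.
have uA : u \in bounds A set0.
  by apply: (@boundsW R X 1 [set x] set0) (contracts_bounds1 xx uc) => // y ->.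
have -> : << path_simplex a >> = cst_simplex R 1 x - u - bd e.
  have h3 (V : zmodType) (p q r : V) : q = p - (p - q - r) - r.
    by rewrite opprB opprB addrA [p + r]addrC [r + p + _]addrC [r + p]addrC subrKA addrK.
  exact: h3.
rewrite rpredB ?bounds_bd // rpredB //.
by rewrite -bd_cst2 bounds_bd // cst_simplex_in.
Qed.

Section DiskLoops.
Variables (R : realType) (N : topologicalType) (F : set N) (phi : 'rV[R]_3 -> N).
Hypotheses (mN : compact_manifold R N 4) (sN : simply_connected R [set: N]).
Hypotheses (pF : piece F phi) (lF : locally_flat R 4 2 [set: N] F).
Local Notation C := (~` F).
Local Notation D := (disk_off phi).

Lemma complement_path p q : C p -> C q -> exists a : R -> N, path_in C a p q.
Proof.
move=> Cp Cq; have [_ _ _ mfd] := mN; have [_ pc _] := sN.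
have [a ha] := pc p q I I.
exact: (complement_joined (tame_ex lF (piece_closed pF) mfd) Cp Cq ha).
Qed.

(** The class of a modulo loops of D is the value of [chi]. Since [chi] vanishes on D, it vanishes
    locally at every point of F and extends to N by [germ_theorem]; the loop a is null-homotopic in
    N, so its class is zero. *)
Lemma disk_off_loops b a : connected F -> abelian_pi1 R C -> D b -> path_in C a b b ->
  exists d : R -> N, path_in D d b b /\ phom C a d.
Proof.
move=> cF ab Db la; have [_ _ _ mfd] := mN; have [_ _ sc] := sN.
have DC := disk_off_sub pF; have Cb := DC _ Db.
have [G [chi [chi_bd chiD chi0]]] := pi1_functional DC Db ab
  (fun x Cx => complement_path Cb Cx) (fun x Dx => disk_off_joined pF Db Dx).
apply: chi0 => //.
have [F0 v0] := collar_vanish chi_bd pF chiD.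
have gd := good_ex chi_bd lF (piece_closed pF) cF mfd F0 v0.
apply: (germ_theorem chi_bd gd b).
  have /path_inP[pa a0 a1] := la.
  apply/is_cycleP; split; first exact: path_simplex_in.
  by rewrite bd_path_simplex a0 a1 subrr rpred0.
have la' : path_in [set: N] a b b by exact: path_inW la.
exact: nullhomotopic_bounds la' (sc _ _ la').
Qed.

End DiskLoops.

(** * Loops in the complement of the sum *)

Section VanKampen.
Variables (R : realType) (X : topologicalType) (C A1 A2 : set X) (b : X).
Local Notation D := (A1 `&` A2).
Local Notation cl := (cls C).
Local Notation "P ** Q" := (@cmp R X C P Q) (at level 40, left associativity).
Hypotheses (AC1 : A1 `<=` C) (AC2 : A2 `<=` C) (Db : D b).
Hypotheses (pD : forall x, D x -> exists a : R -> X, path_in D a b x)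
  (pA1 : forall x, A1 x -> exists a : R -> X, path_in A1 a b x)
  (pA2 : forall x, A2 x -> exists a : R -> X, path_in A2 a b x).
Hypothesis loop2 : forall a : R -> X, path_in A2 a b b -> exists d, path_in D d b b /\ phom A2 a d.

(* The paths [g x] are chosen inside each of A1, A2 that contains x, so that a
   piece of a loop lying in A1 or A2 closes up to a loop in the same set. *)
Lemma van_kampen_push (a : R -> X) (e : R) : 0 < e -> path_in C a b b ->
  (forall t, t \in `[0, 1] -> (forall u, u \in `[0, 1] -> `|t - u| < e -> A1 (a u)) \/
                            (forall u, u \in `[0, 1] -> `|t - u| < e -> A2 (a u))) ->
  exists d, path_in A1 d b b /\ phom C a d.
Proof.
move=> e0 /path_inP[pa a0 a1] cov.
have gex x : exists g : R -> X, [/\ A1 x -> path_in A1 g b x & A2 x -> path_in A2 g b x].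
  have [h1|n1] := pselect (A1 x); have [h2|n2] := pselect (A2 x).
  - by have [g hg] := pD (conj h1 h2); exists g; split=> _; apply: path_inW hg => ? [].
  - by have [g hg] := pA1 h1; exists g.
  - by have [g hg] := pA2 h2; exists g.
  - by exists (fun=> b).
have [g gP] := choice gex.
have gC x : A1 x \/ A2 x -> path_in C (g x) b x.
  by have [h1 h2] := gP x => -[/h1|/h2]; [exact: path_inW AC1|exact: path_inW AC2].
have [n hn] : exists n : nat, n.+1%:R^-1 < e.
  by have [m _ /(_ m (leqnn m)) hm] := near_infty_natSinv_lt (PosNum e0); exists m.
pose t (i : nat) : R := i%:R / n.+1%:R.
have t01 i : (i <= n.+1)%N -> t i \in `[0, 1].
  by move=> i1; rewrite in_itv /= divr_ge0 //= ler_pdivrMr ?ltr0n // mul1r ler_nat.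
have tS i : t i.+1 - t i = n.+1%:R^-1 by rewrite /t -mulrBl -natrB // subSnn mul1r.
have i0 := in01_0 R.
have aA i : (i <= n.+1)%N -> A1 (a (t i)) \/ A2 (a (t i)).
  by move=> /t01 ti; case: (cov _ ti) => h; [left|right]; apply: h; rewrite // subrr normr0.
(* Up to the i-th time of the partition, the path is a loop of A1 followed by the chosen path to its
   current point. *)
have H i : (i <= n.+1)%N -> exists2 d, path_in A1 d b b &
    cl (subpath a 0 (t i)) = cl d ** cl (g (a (t i))).
  elim: i => [|i IH] i1.
    have t0 : t 0%N = 0 by rewrite /t mul0r.
    have gb : path_in A1 (g b) b b by have [h _] := gP b; apply: h; case: Db.
    exists (rev (g b)); first exact: rev_in gb.
    have /path_inP[pg g0 g1] := path_inW AC1 gb.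
    rewrite t0 a0 (cls_revl pg g1); congr cl; apply/funext => s.
    by rewrite /subpath subrr mulr0 addr0 a0.
  have [|d ld hd] := IH; first exact: ltnW.
  have [ti ti1] := (t01 i (ltnW i1), t01 i.+1 i1).
  pose s := subpath a (t i) (t i.+1); have [s0 s1] : s 0 = a (t i) /\ s 1 = a (t i.+1) := subpath_ends a (t i) (t i.+1).
  have ps : ppath C s by apply: ppath_sub.
  pose c := path_concat (path_concat (g (a (t i))) s) (rev (g (a (t i.+1)))).
  have sub u : u \in `[0, 1] -> (t i + u * (t i.+1 - t i)) \in `[0, 1] /\
      `|t i - (t i + u * (t i.+1 - t i))| < e.
    move=> u01; split; first exact: in01_mix.
    rewrite opprD addrA subrr add0r normrN tS; have /andP[u0 u1] := in01E u01.
    rewrite ger0_norm ?mulr_ge0 //; apply: le_lt_trans hn; exact: ler_piMl.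
  have hs A : (forall u, u \in `[0, 1] -> `|t i - u| < e -> A (a u)) -> path_in A s (a (t i)) (a (t i.+1)).
    move=> h; apply/path_inP; rewrite s0 s1; split=> //; have [cs _] := ps; split=> // u u01.
    by have [h1 h2] := sub u u01; exact: h.
  have cE : cl (subpath a 0 (t i.+1)) = cl d ** cl c ** cl (g (a (t i.+1))).
    have gi := gC _ (aA i (ltnW i1)); have gi1 := gC _ (aA _ i1).
    have sC : path_in C s (a (t i)) (a (t i.+1)) by apply/path_inP.
    have /path_inP[pg _ g1] := gi1.
    rewrite /c -(cmp_in (concat_in gi sC) (rev_in gi1)) -(cmp_in gi sC) !cmpA.
    rewrite (cls_revl pg g1) (cls_idr ps s1) -cmpA -hd /s.
    by rewrite cls_subpath.
  have lift (f : R -> X) : path_in A1 f b b -> cl c = cl f -> exists2 d0, path_in A1 d0 b b &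
      cl (subpath a 0 (t i.+1)) = cl d0 ** cl (g (a (t i.+1))).
    move=> lf cf; exists (path_concat d f); first exact: concat_in ld lf.
    by rewrite cE cf (cmp_in (path_inW AC1 ld) (path_inW AC1 lf)).
  have close A : (forall u, u \in `[0, 1] -> `|t i - u| < e -> A (a u)) ->
      (forall x, A x -> path_in A (g x) b x) -> path_in A c b b.
    move=> h hg; have sA := hs A h; have /path_inP[[_ sA'] _ _] := sA.
    have h0 : A (a (t i)) by rewrite -s0; exact: sA'.
    have h1 : A (a (t i.+1)) by rewrite -s1; apply: sA'; exact: in01_1.
    by apply: concat_in (rev_in (hg _ h1)); exact: concat_in (hg _ h0) sA.
  case: (cov _ ti) => h.
    by apply: (lift c) => //; apply: close => // x; have [] := gP x.
  (* A piece that runs in A2 closes up to a loop of A2, which deforms into the intersection and thus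
     into A1. *)
  have /loop2[f [lf hf]] : path_in A2 c b b by apply: close => // x; have [] := gP x.
  by apply: (lift f); [apply: path_inW lf => ? []|apply: cls_eq; exact: phomW hf].
have [d ld] := H _ (leqnn _); have -> : t n.+1 = 1 by rewrite /t divff // pnatr_eq0.
rewrite subpath01 a1.
have gb : path_in A1 (g b) b b by have [h _] := gP b; apply: h; case: Db.
rewrite (cmp_in (path_inW AC1 ld) (path_inW AC1 gb)) => h.
have lc := concat_in ld gb; exists (path_concat d (g b)); split=> //.
by apply: cls_inj => //; case/path_inP: (path_inW AC1 lc).
Qed.

End VanKampen.

Section AbelianTools.
Variables (R : realType).

Lemma abelian_homeo (X Y : topologicalType) (A : set X) (B : set Y) f g :
  homeo A B f g -> abelian_pi1 R A -> abelian_pi1 R B.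
Proof.
move=> [cf cg fK gK] ab y a c la lc.
have gB z : B z -> A (g z) by case/gK.
have fA z : A z -> B (f z) by case/fK.
have gl (u : R -> Y) : path_in B u y y -> path_in A (g \o u) (g y) (g y).
  move=> /path_inP[pu u0 u1]; apply/path_inP; rewrite /= u0 u1; split=> //.
  exact: ppath_map cg gB pu.
have h : phom A (path_concat (g \o a) (g \o c)) (path_concat (g \o c) (g \o a)).
  split; first exact: ab (gl _ la) (gl _ lc).
    by case/path_inP: (concat_in (gl _ la) (gl _ lc)).
  by case/path_inP: (concat_in (gl _ lc) (gl _ la)).
have := phom_map cf fA h; rewrite -!map_concat => h'.
have E (u : R -> Y) : ppath B u -> phom B u (f \o (g \o u)).
  by move=> pu; apply: phom_eq => // t t01 /=; have [_ uB] := pu; have [_ ->] := gK _ (uB t t01).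
have pac : ppath B (path_concat a c) by case/path_inP: (concat_in la lc).
have pca : ppath B (path_concat c a) by case/path_inP: (concat_in lc la).
by have [] := phom_trans (E _ pac) (phom_trans h' (phom_sym (E _ pca))).
Qed.

(** Conjugation by a path from b moves both loops to b, where they deform into A and commute there;
    conjugating back cancels the paths. *)
Lemma abelian_retract (X : topologicalType) (C A : set X) (b : X) :
  A `<=` C -> abelian_pi1 R A ->
  (forall x, C x -> exists a : R -> X, path_in C a b x) ->
  (forall a : R -> X, path_in C a b b -> exists d, path_in A d b b /\ phom C a d) ->
  abelian_pi1 R C.
Proof.
move=> AC ab pC hA x a c la lc.
have Cx : C x by have /path_inP[[_ aC] <- _] := la; apply: aC; exact: in01_0.
have [g lg] := pC x Cx; have /path_inP[pg g0 g1] := lg.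
pose conj u := path_concat (path_concat g u) (rev g).
have lconj u : path_in C u x x -> path_in C (conj u) b b.
  by move=> lu; apply: concat_in (rev_in lg); exact: concat_in lg lu.
have [a' [la' ha]] := hA _ (lconj _ la); have [c' [lc' hc]] := hA _ (lconj _ lc).
have comm : @cmp R X C (cls C a') (cls C c') = cmp C (cls C c') (cls C a').
  rewrite (cmp_in (path_inW AC la') (path_inW AC lc')) (cmp_in (path_inW AC lc') (path_inW AC la')).
  apply: cls_eq; apply: (phomW AC); split.
  - exact: ab la' lc'.
  - by case/path_inP: (concat_in la' lc').
  - by case/path_inP: (concat_in lc' la').
have E u : path_in C u x x -> cls C u = cmp C (cmp C (cls C (rev g)) (cls C (conj u))) (cls C g).
  move=> lu; have /path_inP[pu u0 u1] := lu.
  rewrite /conj -(cmp_in (concat_in lg lu) (rev_in lg)) -(cmp_in lg lu) !cmpA.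
  by rewrite (cls_revl pg g1) (cls_idr pu u1) -cmpA (cls_revl pg g1) (cls_idl pu u0).
have M u v u' v' : path_in C u x x -> path_in C v x x -> phom C (conj u) u' -> phom C (conj v) v' ->
    cls C (path_concat u v) = cmp C (cmp C (cls C (rev g)) (cmp C (cls C u') (cls C v'))) (cls C g).
  move=> lu lv hu hv; rewrite -(cmp_in lu lv) {1}(E u lu) {1}(E v lv) -(cls_eq hu) -(cls_eq hv).
  rewrite !cmpA -[cmp C (cls C g) _]cmpA (cls_revr pg g0) -[cmp C (cls C (fun=> b)) _]cmpA.
  by have /path_inP[pv v0 v1] := lconj _ lv; rewrite (cls_idl pv v0).
have := M a c a' c' la lc ha hc; rewrite comm -(M c a c' a' lc la hc ha) => h.
have [] // : phom C (path_concat a c) (path_concat c a).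
by apply: cls_inj => //; case/path_inP: (concat_in lc la).
Qed.

End AbelianTools.

Section GluedPi1.
Variables (R : realType) (N1 N2 N : topologicalType).
Variables (F1 : set N1) (F2 : set N2) (phi1 : 'rV[R]_3 -> N1) (phi2 : 'rV[R]_3 -> N2).
Variables (e1 : N1 -> N) (e2 : N2 -> N).
Hypotheses (p1 : piece F1 phi1) (p2 : piece F2 phi2) (hN : glued phi1 phi2 e1 e2).
Hypotheses (m1 : compact_manifold R N1 4) (m2 : compact_manifold R N2 4).
Hypotheses (s1 : simply_connected R [set: N1]) (s2 : simply_connected R [set: N2]).
Hypotheses (l1 : locally_flat R 4 2 [set: N1] F1) (l2 : locally_flat R 4 2 [set: N2] F2).
Hypotheses (c2 : connected F2) (ab1 : abelian_pi1 R (~` F1)) (ab2 : abelian_pi1 R (~` F2)).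
Local Notation C := (~` gsurf F1 F2 e1 e2).
Local Notation A1 := (e1 @` (~` F1)).
Local Notation A2 := (e2 @` (~` F2)).

Lemma path_in_image (X Y : topologicalType) (f : X -> Y) (A : set X) (B : set Y) (a : R -> X) x y :
  continuous f -> (forall z, A z -> B (f z)) -> path_in A a x y -> path_in B (f \o a) (f x) (f y).
Proof.
move=> cf fAB /path_inP[pa <- <-]; apply/path_inP; split=> //.
by apply: ppath_map fAB pa; exact: continuous_subspaceT.
Qed.

Lemma gsurf_abelian : abelian_pi1 R C.
Proof.
have ce1 := glued_e1 hN; have ce2 := glued_e2 hN.
(* The base point must lie in the gluing ball and off the arc, hence in both complements. *)
pose v0 : 'rV[R]_3 := row3 0 (2^-1) 0.
have v0c : closed_ball3 v0 by rewrite /closed_ball3 /= -/(ssq _) ssqE !row3E expr0n /= add0r addr0; lra.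
have v0a : ~ axis3 v0 by move=> /axis3P[]; rewrite row3E; lra.
pose b1 := phi1 v0; pose b2 := phi2 v0; pose b := e1 b1.
have b12 : b = e2 b2 := glued_phi hN v0c.
have Db1 : disk_off phi1 b1 by exists v0.
have Db2 : disk_off phi2 b2 by exists v0.
have Cb1 := disk_off_sub p1 Db1; have Cb2 := disk_off_sub p2 Db2.
have AC1 : A1 `<=` C by move=> _ [a na <-] /(gsurf1 p1 p2 hN).
have AC2 : A2 `<=` C by move=> _ [a na <-] /(gsurf2 p1 p2 hN).
have D1 z : disk_off phi1 z -> (A1 `&` A2) (e1 z).
  move=> [v [cv nv] <-]; split; first by exists (phi1 v) => // /(piece_axis p1).
  by exists (phi2 v); [move=> /(piece_axis p2)|rewrite (glued_phi hN cv)].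
have D2 z : disk_off phi2 z -> (A1 `&` A2) (e2 z).
  by move=> [v [cv nv] <-]; rewrite -(glued_phi hN cv); apply: D1; exists v.
have DD x : (A1 `&` A2) x -> exists2 z, disk_off phi1 z & x = e1 z.
  move=> [[a na <-] [c nc /esym ac]]; exists a => //.
  have [v cv [av _]] := (gluedP hN a c).1 ac; exists v => //.
  by split=> // ax; apply: na; rewrite av; apply/(piece_axis p1).
have Db : (A1 `&` A2) b := D1 _ Db1.
have pD x : (A1 `&` A2) x -> exists a : R -> N, path_in (A1 `&` A2) a b x.
  move=> /DD[z Dz ->]; have [a ha] := disk_off_joined p1 Db1 Dz.
  by exists (e1 \o a); exact: path_in_image ce1 D1 ha.
have pA1 x : A1 x -> exists a : R -> N, path_in A1 a b x.
  move=> [z Cz <-]; have [a ha] := complement_path m1 s1 p1 l1 Cb1 Cz.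
  by exists (e1 \o a); apply: path_in_image ce1 _ ha => y Cy; exists y.
have pA2 x : A2 x -> exists a : R -> N, path_in A2 a b x.
  move=> [z Cz <-]; have [a ha] := complement_path m2 s2 p2 l2 Cb2 Cz.
  by rewrite b12; exists (e2 \o a); apply: path_in_image ce2 _ ha => y Cy; exists y.
have loop2 (a : R -> N) : path_in A2 a b b -> exists d, path_in (A1 `&` A2) d b b /\ phom A2 a d.
  move=> /path_inP[[ca aA] a0 a1].
  have [j cj jE] := e2_inverse p2 hN.
  have jC y : A2 y -> (~` F2) (j y) by move=> [z nz <-]; rewrite jE.
  have cj' : {within A2, continuous j}.
    by apply: continuous_subspaceW cj => _ [z _ <-]; exists z.
  have lj : path_in (~` F2) (j \o a) b2 b2.
    apply/path_inP; rewrite /= a0 a1 b12 jE; split=> //.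
    exact: ppath_map cj' jC (conj ca aA).
  have [d [ld hd]] := disk_off_loops m2 s2 p2 l2 c2 ab2 Db2 lj.
  exists (e2 \o d); split; first by rewrite b12; exact: path_in_image ce2 D2 ld.
  apply: phom_trans (phom_map _ _ hd); last by move=> z nz; exists z.
    apply: phom_eq => // t t01; have [z _ zE] := aA t t01; by rewrite /= -zE jE.
  exact: continuous_subspaceT.
have ab : abelian_pi1 R A1.
  have [j cj jE] := e1_inverse p1 hN.
  apply: (abelian_homeo (f := e1) (g := j)) ab1; split.
  - exact: continuous_subspaceT.
  - by apply: continuous_subspaceW cj => _ [z _ <-]; exists z.
  - by move=> z nz; split; [exists z|exact: jE].
  - by move=> _ [z nz <-]; rewrite jE.
apply: (abelian_retract AC1 ab) => [x Cx|a la].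
  have [[z xz]|[z xz]] := glued_cover hN x.
    have [|a ha] := pA1 x; last by exists a; exact: path_inW AC1 ha.
    by exists z => // Fz; apply: Cx; rewrite xz; apply/(gsurf1 p1 p2 hN).
  have [|a ha] := pA2 x; last by exists a; exact: path_inW AC2 ha.
  by exists z => // Fz; apply: Cx; rewrite xz; apply/(gsurf2 p1 p2 hN).
have [K [O [cK K0 K1 K2 [KF [oO O1 KO]]]]] := glued_collapse p1 p2 hN.
have /path_inP[[ca aC] a0 a1] := la.
(* The collapse preserves the complement of F and fixes the base point. After it, each short piece
   of the loop lies in the complement of F1 or in that of F2, although these sets need not be open
   in N. *)
pose H (q : R * R) := K (q.1, a q.2).
have cH : {within `[0, 1] `*` `[0, 1], continuous H}.
  apply: (cw_comp cK) => [|[s t] [/= s01 t01]]; last by split.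
  apply: cw_pair; first by wcont.
  by apply: (cw_comp ca) => [|[s t] []]; first by wcont.
have HC s t : s \in `[0, 1] -> t \in `[0, 1] -> C (H (s, t)).
  by move=> s01 t01 /(KF _ _ s01); exact: aC.
have i1 := in01_1 R; have i0 := in01_0 R.
pose a' t := H (1, t).
have Hb s : s \in `[0, 1] -> K (s, b) = b by move=> s01; exact: K1.
have pa' : ppath C a'.
  split=> [|t t01]; last exact: HC.
  by apply: (cw_comp cH) => [|t t01]; [apply: cw_pair; [exact: cw_cst|exact: cw_idR]|split].
have aa' : phom C a a'.
  split=> //; exists H; split=> //; first by move=> t t01; rewrite /H /= K0.
  by move=> s s01; rewrite /H /= a0 a1 Hb.
have la' : path_in C a' b b by apply/path_inP; split; rewrite // /a' /H /= ?a0 ?a1 Hb.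
have or1 : open (~` range e1) by apply: closed_openC; exact: range1_closed p1 hN.
(* The cover is taken for the loop before the collapse: pieces in O end in N1, and pieces off N1 end
   in N2. *)
have [|t t01|e e0 he] := @lebesgue_number R R^o N `[0, 1]%classic a [set U | U = O \/ U = ~` range e1]
  (@segment_compact R 0 1) ca.
- by move=> U [->|->].
- have [h|h] := pselect (range e1 (a t)); first by exists O; [left|exact: O1].
  by exists (~` range e1) => //; right.
have [|d [ld hd]] := van_kampen_push AC1 AC2 Db pD pA1 pA2 loop2 e0 la'.
  move=> t t01; have [U [->|->] hU] := he t t01; [left|right] => u u01 tu.
    have [z _ zE] := KO _ (hU u u01 tu); rewrite /a' /H /= -zE; exists z => // Fz.
    by apply: (HC 1 u i1 u01); rewrite /H /= -zE; apply/(gsurf1 p1 p2 hN).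
  have nr := hU u u01 tu; have [[z zE]|[z zE]] := glued_cover hN (a u).
    by case: nr; rewrite zE; exists z.
  have [y _ yE] := K2 1 z i1; rewrite /a' /H /= zE -yE; exists y => // Fy.
  by apply: (HC 1 u i1 u01); rewrite /H /= zE -yE; apply/(gsurf2 p1 p2 hN).
by exists d; split=> //; exact: phom_trans aa' hd.
Qed.

End GluedPi1.

(** * The simple genus *)

Section SimpleGenus.
Variables (R : realType) (N : topologicalType) (x : 'H2bd[R] N) (k : R -> N).

Lemma simple_genus_ge0 : (0 <= simple_genus x k)%E.
Proof. by apply: le_ereal_inf_tmp => _ [g _ <-]; rewrite lee_fin ler0n. Qed.

(** A nonempty set of natural numbers has a least element, and the infimum of the empty set is
    +oo. *)
Lemma simple_genus_min : simple_genus x k = +oo%E \/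
  exists (g : nat) (F : set N) phi, [/\ @simple_surface R N x k F phi, has_genus R F g &
    ((g%:R)%:E <= simple_genus x k)%E].
Proof.
pose P (g : nat) := exists F phi, @simple_surface R N x k F phi /\ has_genus R F g.
have [[g0 Pg0]|nP] := pselect (exists g, P g); last first.
  left; rewrite /simple_genus (_ : [set g : nat | P g] = set0) ?image_set0 ?ereal_inf0 //.
  by apply/seteqP; split=> g // Pg; case: nP; exists g.
right; have ex : exists g, `[< P g >] by exists g0; exact/asboolP.
case: (ex_minnP ex) => g /asboolP[F [phi [sF gF]]] gmin.
exists g, F, phi; split=> //; apply: le_ereal_inf_tmp => _ [h Ph <-].
by rewrite lee_fin ler_nat; apply: gmin; exact/asboolP.
Qed.

Lemma simple_genus_le g (F : set N) phi : @simple_surface R N x k F phi -> has_genus R F g ->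
  (simple_genus x k <= (g%:R)%:E)%E.
Proof. by move=> sF gF; apply: ereal_inf_lbound; exists g => //; exists F, phi. Qed.

End SimpleGenus.

Theorem proposition1p7 (R : realType) (N1 N2 : topologicalType)
    (mu1 : homology R 4 [set: N1] (\partial[R] N1))
    (mu2 : homology R 4 [set: N2] (\partial[R] N2))
    (hN1 : punctured_mfd4 mu1) (hN2 : punctured_mfd4 mu2)
    (x1 : 'H2bd[R] N1) (x2 : 'H2bd[R] N2) (d : nat)
    (hx1 : x1 != 0) (hx2 : x2 != 0)
    (hd1 : has_divisibility x1 d) (hd2 : has_divisibility x2 d)
    (k1 : R -> N1) (k2 : R -> N2) (hk1 : knot k1) (hk2 : knot k2)
    (* the boundary connected sum, its class x1 (+) x2 and the knot K1 # K2 *)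
    (N : topologicalType) (phi1 : 'rV[R]_3 -> N1) (phi2 : 'rV[R]_3 -> N2)
    (e1 : N1 -> N) (e2 : N2 -> N)
    (hphi1 : knot_chart k1 phi1) (hphi2 : knot_chart k2 phi2)
    (hN : glued phi1 phi2 e1 e2)
    (mu : homology R 4 [set: N] (\partial[R] N))
    (hmu : oriented_sum e1 e2 mu1 mu2 mu)
    (x : 'H2bd[R] N) (hx : class_sum e1 e2 x1 x2 x)
    (k : R -> N) (hk : knot k) (hk12 : knot_sum phi1 phi2 e1 e2 k1 k2 k)
    (* the d-fold cyclic cover of the boundary sphere branched along K1 # K2 *)
    (Sigma : topologicalType) (p : Sigma -> N) (tau : Sigma -> Sigma)
    (hSigma : cyclic_branched_cover R d (\partial[R] N) (range k) p tau)
    (hSigma1 : forall y : homology R 1 [set: Sigma] set0, y = 0) :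
  (simple_genus x k <= simple_genus x1 k1 + simple_genus x2 k2)%E.
Proof.
have [m1 sc1 _ _] := hN1; have [m2 sc2 _ _] := hN2.
(* If one genus is +oo, so is the sum, because the other is nonnegative and hence not -oo. *)
have [->|[g1 [F1 [f1 [s1 G1 le1]]]]] := simple_genus_min x1 k1.
  by rewrite addye ?leey // gt_eqF // (lt_le_trans _ (simple_genus_ge0 _ _)) ?ltNye.
have [->|[g2 [F2 [f2 [s2 G2 le2]]]]] := simple_genus_min x2 k2.
  by rewrite addey ?leey // gt_eqF // (lt_le_trans _ (simple_genus_ge0 _ _)) ?ltNye.
have [[cF1 nF1] [l1 b1] [fu1 co1] c1 ab1] := s1.
have [[cF2 nF2] [l2 b2] [fu2 co2] c2 ab2] := s2.
(* The surface in N1 is enough: the conclusion concerns half-spaces only and serves N2 and N as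
   well. *)
have binv := surface_boundary_invariant m1 hk1 l1 b1.
have p1 := piece_of_surface binv m1 hphi1 cF1 l1 b1.
have p2 := piece_of_surface binv m2 hphi2 cF2 l2 b2.
have [kr kc] := hk12.
rewrite -c1 -c2 in hx.
have [phi [fu co xE]] := gsurf_class p1 p2 hN binv m1 m2 b1 b2 kr hk1 hk2 hk fu1 co1 fu2 co2 kc hx.
apply: le_trans (_ : ((g1 + g2)%N%:R)%:E <= _)%E; last by rewrite natrD EFinD leeD.
apply: (simple_genus_le (F := gsurf F1 F2 e1 e2) (phi := phi)); last first.
  exact: gsurf_genus p1 p2 hN _ _ G1 G2.
split=> //.
- split; first exact: gsurf_compact hN cF1 cF2.
  exact: gsurf_connected p1 p2 hN nF1 nF2.
- split; first exact: gsurf_flat p1 p2 hN l1 l2.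
  exact: gsurf_bd p1 p2 hN binv m1 m2 _ _ _ b1 b2 kr.
- exact: gsurf_abelian p1 p2 hN m1 m2 sc1 sc2 l1 l2 nF2 ab1 ab2.
Qed.
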